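(* Let $P(z,w)=(p(z),q(z,w))$ be a polynomial skew-product of $\mathbb{C}^2$ satisfying the following properties: (1) $p(z)=z-z^2+O(z^3)$; (2) $P$ has two different fixed points, tangent to the identity, of the form $(0,w_1)$ and $(0,w_2)$, such that for $i=1,2$, in appropriate local coordinates centered at $(0,w_i)$, $P$ takes the form $$(z,w)\mapsto\left(z-z^2+az^3+O(z^4),\;w+w^2+b_iz^2+b_{0,3,i}w^3+b_{3,0,i}z^3+O(\|(z,w)\|^4)\right)$$ with $b_i$ real, $b_i>\frac14$, and such that $\alpha_i:=e^{2\pi/\sqrt{4b_i-1}}$ is a positive integer and $\beta_i:=(b_{0,3,i}-a)(\alpha_i-1)=0$. Then $P$ has a Fatou component $\Omega$ with historic behaviour. More precisely, for any $(z,w)\in\Omega$, the sequence of empirical measures $(e_n(z,w))_{n}$ accumulates on $$\mu_1:=\frac{\alpha_1\alpha_2-\alpha_2}{\alpha_1\alpha_2-1}\,\delta_{(0,w_1)}+\frac{\alpha_2-1}{\alpha_1\alpha_2-1}\,\delta_{(0,w_2)}$$ and on $$\mu_2:=\frac{\alpha_1-1}{\alpha_1\alpha_2-1}\,\delta_{(0,w_1)}+\frac{\alpha_1\alpha_2-\alpha_1}{\alpha_1\alpha_2-1}\,\delta_{(0,w_2)}.$$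
   Context: The Fatou set of $P$ is the largest open subset of $\mathbb{C}^2$ on which the family $(P^n)_{n\in\mathbb{N}}$ is normal; a Fatou component is a connected component of it. The empirical measures are $e_n(x):=\frac1n\sum_{k=1}^n\delta_{P^k(x)}$. A Fatou component $\Omega$ has historic behaviour if for every $x\in\Omega$ the sequence $(e_n(x))_n$ does not converge (for the weak topology on measures). ''Appropriate local coordinates'' at $(0,w_i)$ means local holomorphic coordinates preserving the vertical fibration and the $z$-coordinate: after the translation $w\mapsto w-w_i$, one conjugates by a linear automorphism of the form $(z,w)\mapsto(z,\mu w+\lambda z)$, $\mu\ne0$, and by an automorphism of the form $(z,w)\mapsto(z,e^{Az}w+Bz^2)$, with $A,B,\lambda,\mu\in\mathbb{C}$. *)

(* Defs.v *)
From HB Require Import structures.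
From mathcomp Require Import all_boot all_order all_algebra.
From mathcomp Require Import all_classical all_reals all_analysis.
From mathcomp Require Import complex.

Set Implicit Arguments.
Unset Strict Implicit.
Unset Printing Implicit Defensive.

Import Order.TTheory GRing.Theory Num.Theory.
Import numFieldNormedType.Exports.

Local Open Scope classical_set_scope.
Local Open Scope ring_scope.
Local Open Scope complex_scope.

(* Typing [R[i]] as a [numClosedFieldType] is what makes the topological and
   normed-module instances of the library apply to it; norms and radii are then
   themselves (real) elements of [Cplx R]. *)
Definition Cplx (R : realType) : numClosedFieldType := R[i].

Notation C2 R := (Cplx R * Cplx R)%type.

Definition real_Cplx (R : realType) (r : R) : Cplx R := r%:C.

Definition cexp (R : realType) (u : Cplx R) : Cplx R :=
  (expR (complex.Re u) * cos (complex.Im u))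
    +i* (expR (complex.Re u) * sin (complex.Im u)).

(* [q] is a polynomial in w whose coefficients are polynomials in z. *)
Definition skew_product (R : realType) (p : {poly Cplx R})
    (q : {poly {poly Cplx R}}) (x : C2 R) : C2 R :=
  (p.[x.1], q.[x.2%:P].[x.1]).

Section fatou.
Variable R : realType.
Implicit Types (P : C2 R -> C2 R) (U Omega : set (C2 R)).

Definition compactly_convergent U (f : nat -> C2 R -> C2 R) :=
  exists g : C2 R -> C2 R,
    forall K, compact K -> K `<=` U -> {uniform K, f @ \oo --> g}.

Definition compactly_divergent U (f : nat -> C2 R -> C2 R) :=
  forall K L : set (C2 R), compact K -> K `<=` U -> compact L ->
    \forall n \near \oo, forall x, K x -> ~ L (f n x).

(* The sequence [m] of exponents is arbitrary: it enumerates an arbitrary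
   sequence of members of the family of iterates. *)
Definition normal_iterates P U :=
  forall m : nat -> nat, exists2 s : nat -> nat,
    {homo s : i j / (i < j)%N} &
    let f := fun n => iter (m (s n)) P in
    compactly_convergent U f \/ compactly_divergent U f.

Definition fatou_set P : set (C2 R) :=
  \bigcup_(U in [set U : set (C2 R) | open U /\ normal_iterates P U]) U.

Definition fatou_component P Omega :=
  exists2 x, fatou_set P x & Omega = connected_component (fatou_set P) x.

End fatou.

Section empirical.
Variable R : realType.

Definition borelC2 := g_sigma_algebraType (@open (C2 R)).

(* At [n = 0] this is the zero measure. *)
Definition empirical (P : C2 R -> C2 R) (x : C2 R) (n : nat) :
    {measure set borelC2 -> \bar R} :=
  mscale (n%:R^-1)%:nng
    (msum (fun k => \d_(iter k.+1 P x : borelC2)) n).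

Definition weak_cvg (m : nat -> {measure set borelC2 -> \bar R})
    (mu : {measure set borelC2 -> \bar R}) :=
  forall f : C2 R -> R, continuous f -> (exists M, forall x, `|f x| <= M) ->
    (\int[m n]_(x in [set: borelC2]) (f x)%:E)%E @[n --> \oo] -->
    (\int[mu]_(x in [set: borelC2]) (f x)%:E)%E.

Definition has_weak_limit_point (m : nat -> {measure set borelC2 -> \bar R})
    (mu : {measure set borelC2 -> \bar R}) :=
  exists2 s : nat -> nat, {homo s : i j / (i < j)%N} & weak_cvg (m \o s) mu.

Definition historic_behaviour (P : C2 R -> C2 R) (Omega : set (C2 R)) :=
  forall x, Omega x -> ~ exists mu, weak_cvg (empirical P x) mu.

End empirical.

Section local_form.
Variable R : realType.
Local Notation C := (Cplx R).

(* Translation by [-w0], then (z, w) |-> (z, mu w + lambda z), then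
   (z, w) |-> (z, e^{Az} w + B z^2). *)
Definition chart (w0 mu lambda A B : C) (x : C2 R) : C2 R :=
  (x.1, cexp (A * x.1) * (mu * (x.2 - w0) + lambda * x.1) + B * x.1 ^+ 2).

Definition chart_inv (w0 mu lambda A B : C) (x : C2 R) : C2 R :=
  (x.1, (cexp (- (A * x.1)) * (x.2 - B * x.1 ^+ 2) - lambda * x.1) / mu + w0).

Lemma cexpN_mul (u : C) : cexp (- u) * cexp u = 1.
Proof.
case: u => a b; rewrite /cexp /= expRN cosN sinN; apply/eqP.
rewrite eq_complex /=; have e0 : expR a != 0 by rewrite gt_eqF ?expR_gt0.
apply/andP; split; apply/eqP; last first.
  rewrite mulrN mulNr mulrACA [X in _ - X]mulrACA.
  by rewrite [sin b * cos b]mulrC subrr.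
rewrite mulrN mulNr opprK mulrACA [X in _ + X]mulrACA mulVf // !mul1r.
by rewrite -!expr2 cos2Dsin2.
Qed.

Lemma chartK (w0 mu lambda A B : C) : mu != 0 ->
  cancel (chart w0 mu lambda A B) (chart_inv w0 mu lambda A B).
Proof.
move=> mu0 [z w]; rewrite /chart /chart_inv /= addrK mulrA cexpN_mul mul1r.
by rewrite addrK mulrC mulrA mulVf // mul1r subrK.
Qed.

Lemma chart_invK (w0 mu lambda A B : C) : mu != 0 ->
  cancel (chart_inv w0 mu lambda A B) (chart w0 mu lambda A B).
Proof.
move=> mu0 [z w]; rewrite /chart /chart_inv /= addrK mulrCA mulfV // mulr1.
by rewrite subrK mulrA [cexp _ * _]mulrC cexpN_mul mul1r subrK.
Qed.

Definition local_form (P : C2 R -> C2 R) (w0 a : C) (b : R) (b03 b30 : C) :=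
  exists mu lambda A B : C, mu != 0 /\
    let F := chart w0 mu lambda A B \o P \o chart_inv w0 mu lambda A B in
    (fun x : C2 R => (F x).1) =
      (fun x => x.1 - x.1 ^+ 2 + a * x.1 ^+ 3)
        +O_ (0 : C2 R) (fun x => x.1 ^+ 4)
    /\
    (fun x : C2 R => (F x).2) =
      (fun x => x.2 + x.2 ^+ 2 + real_Cplx b * x.1 ^+ 2
                + b03 * x.2 ^+ 3 + b30 * x.1 ^+ 3)
        +O_ (0 : C2 R) (fun x => `|x| ^+ 4).

Definition fixed_tangent_to_id (P : C2 R -> C2 R) (x0 : C2 R) :=
  P x0 = x0 /\ is_diff x0 P idfun.

End local_form.

Section limit_measures.
Variable R : realType.

Definition alpha (b : R) : R := expR (2 * pi / Num.sqrt (4 * b - 1)).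

Definition beta (a b03 : Cplx R) (b : R) : Cplx R :=
  (b03 - a) * (real_Cplx (alpha b) - 1).

Lemma alpha_ge1 (b : R) : 1 <= alpha b.
Proof.
rewrite -[X in X <= _]expR0 ler_expR divr_ge0 ?sqrtr_ge0 //.
by rewrite mulr_ge0 ?pi_ge0.
Qed.

Lemma weight_major_ge0 (s t : R) : 1 <= s -> 1 <= t ->
  0 <= (s * t - t) / (s * t - 1).
Proof.
move=> s1 t1; have t0 : 0 <= t := le_trans ler01 t1.
by rewrite divr_ge0 // subr_ge0 ?ler_peMl ?mulr_ege1.
Qed.

Lemma weight_minor_ge0 (s t : R) : 1 <= s -> 1 <= t ->
  0 <= (t - 1) / (s * t - 1).
Proof. by move=> s1 t1; rewrite divr_ge0 // subr_ge0 ?mulr_ege1. Qed.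

(* The measure mu_1; mu_2 is obtained by exchanging the indices 1 and 2. *)
Definition limit_measure (w1 w2 : Cplx R) (b1 b2 : R) :
    {measure set (borelC2 R) -> \bar R} :=
  measure_add
    (mscale (NngNum (weight_major_ge0 (alpha_ge1 b1) (alpha_ge1 b2)))
            (\d_((0, w1) : borelC2 R)))
    (mscale (NngNum (weight_minor_ge0 (alpha_ge1 b1) (alpha_ge1 b2)))
            (\d_((0, w2) : borelC2 R))).

End limit_measures.

(* Main.v *)
Require Import Defs.
From HB Require Import structures.
From mathcomp Require Import all_boot all_order all_algebra.
From mathcomp Require Import all_classical all_reals all_analysis.
From mathcomp Require Import complex ring lra zify measurable_realfun.

Import Order.TTheory GRing.Theory Num.Theory.
Import numFieldNormedType.Exports.

Set Implicit Arguments.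
Unset Strict Implicit.
Unset Printing Implicit Defensive.

Local Open Scope classical_set_scope.
Local Open Scope ring_scope.

(* Near a parabolic point (0, w_i) the ratio (w - v+ z) / (w - v- z), with v+ and v- the two
   characteristic slopes, is nearly multiplied by a rotation at each step, so that an orbit entering
   at time n leaves on the other side at time about alpha_i n; beta_i = 0 cancels the logarithmic
   drift, and in the Fatou coordinates of w |-> q(0, w) the passage from time n to time alpha_i n is an
   affine map up to o(1).  Composing the two passages along an orbit of q(0, -) that leaves the
   repelling petal of w_2 inside the basin of w_1 at a well chosen place, one obtains a limit return
   map with a critical fixed point in the basin of w_2.  Quadratic contraction there gives boxes
   visited at times N_(j+1) = alpha_1 alpha_2 N_j + m, and the lengths of the stays near w_1 and w_2
   give the two limit measures.  Both the bound on the iterates and the convergence along the blocks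
   of times propagate to the whole Fatou component by an identity principle for polynomials. *)

(* [lr h1 h2] is [lra] from [h1], [h2] and the goal only: [lra] is slow in large contexts.  The padding
   works around Elpi rejecting contexts from which section hypotheses were cleared. *)
Ltac clear_props :=
  repeat match goal with h : ?T |- _ => match type of T with Prop => clear h end end;
  do 12 (assert unit by exact tt).
Tactic Notation "lr" := clear_props; lra.
Tactic Notation "lr" ne_hyp_list(hs) := revert hs; lr.
Tactic Notation "nr" := clear_props; nra.
Tactic Notation "nr" ne_hyp_list(hs) := revert hs; nr.
Tactic Notation "via" uconstr(m) := refine (@le_trans _ _ m _ _ _ _).

(** * Moduli, completeness and polynomials *)

(** All iterates are polynomial, so the classical tools (Cauchy estimates, Montel's theorem, Fatou's
    theorem on critical points, the identity principle) are replaced by elementary statements about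
    polynomials with explicit constants. The return map must contract, and a critical point of q(0,
    -) provides this: there the Fatou coordinate of the basin of w_2 is constant to first order, so
    that a box of radius r in w tolerates errors of order r^2, including one in the phase. The phase
    s of the z-orbit is defined by 1/z_k = k - (a-1) ln k + s + o(1). Each of the two passages
    imposes one equation, and two quantities are free: s and the connecting point that leaves w_2
    and falls into the basin of w_1. Eliminating s leaves one equation, solvable because the Fatou
    coordinate of w_1 grows like a pole near preimages of w_1. Integrality of alpha_i makes alpha_i
    n a time again, and the same s then serves at every return. The logarithms of n cancel because
    beta_i = 0 gives the z- and the w-direction the same coefficient a-1. *)

Section Modulus.
Context {R : realType}.
Implicit Types (x y z : Cplx R) (r : R).

(** The norm of [Cplx R] takes its values in [Cplx R] itself; [nm] and [rc] move all estimates to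
    the ordered field [R], where linear arithmetic applies. *)
Definition nm x : R := Normc.normc (x : R[i]).
Definition rc r : Cplx R := (r%:C)%C.

Lemma rc_sum (I : Type) (s : seq I) (Q : pred I) (F : I -> R) :
 rc (\sum_(i <- s | Q i) F i) = \sum_(i <- s | Q i) rc (F i).
Proof. exact: (raddf_sum (@real_complex R)). Qed.

Lemma eq_ler (x y : R) : x = y -> x <= y. Proof. by move=> ->. Qed.

Lemma nm_ge0 x : 0<=nm x.
Proof. by case: x => a b; rewrite /nm /= sqrtr_ge0. Qed.

Lemma nm0 : nm 0 = 0.
Proof. exact: Normc.normc0. Qed.

Lemma nm1 : nm 1 = 1.
Proof. exact: Normc.normc1. Qed.

Lemma nm_eq0 x : (nm x == 0)=(x == 0).
Proof.
apply/eqP/eqP => [|->]; last exact: nm0.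
exact: Normc.eq0_normc.
Qed.

Lemma nm_gt0 x : (0<nm x)=(x!=0).
Proof. by rewrite lt0r nm_eq0 nm_ge0 andbT. Qed.

Lemma nmM x y : nm (x*y)=nm x*nm y.
Proof. exact: Normc.normcM. Qed.

Lemma nmV x : nm x^-1=(nm x)^-1.
Proof. exact: Normc.normcV. Qed.

Lemma nmf x y : nm (x/y)=nm x/nm y.
Proof. by rewrite nmM nmV. Qed.

Lemma nmN x : nm (- x)=nm x.
Proof. exact: normcN. Qed.

Lemma nmX x n : nm (x^+n)=nm x^+n.
Proof. by elim: n => [|n IH]; rewrite ?nm1 // !exprS nmM IH. Qed.

Lemma nmD x y : nm (x+y)<=nm x+nm y.
Proof. exact: le_normcD. Qed.

Lemma nmB x y : nm (x-y)<=nm x+nm y.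
Proof. by rewrite -(nmN y) nmD. Qed.

Lemma nmD_le x y r : nm x + nm y <= r -> nm (x + y) <= r.
Proof. exact: le_trans (nmD _ _). Qed.

Lemma nmB_le x y r : nm x + nm y <= r -> nm (x - y) <= r.
Proof. exact: le_trans (nmB _ _). Qed.

Lemma nmC x y : nm (x-y)=nm (y-x).
Proof. by rewrite -nmN opprB. Qed.

Lemma nm_tri z x y : nm (x-y)<=nm (x-z)+nm (z-y).
Proof. by apply: le_trans (nmD _ _); rewrite addrA subrK. Qed.

Lemma nmB_ge x y : nm x-nm y<=nm (x-y).
Proof. by rewrite lerBlDr; apply: le_trans (nmD _ _); rewrite subrK. Qed.

Lemma nmD_ge x y : nm x-nm y<=nm (x+y).
Proof. by have := nmB_ge x (- y); rewrite opprK nmN. Qed.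

Lemma rcD r s : rc (r+s)=rc r+rc s.
Proof. exact: rmorphD. Qed.
Lemma rcB r s : rc (r-s)=rc r-rc s.
Proof. exact: rmorphB. Qed.
Lemma rcM r s : rc (r*s)=rc r*rc s.
Proof. exact: rmorphM. Qed.
Lemma rcN r : rc (- r) = - rc r.
Proof. exact: rmorphN. Qed.
Lemma rcV r : rc r^-1=(rc r)^-1.
Proof. exact: fmorphV. Qed.
Lemma rc_f r s : rc (r/s)=rc r/rc s.
Proof. by rewrite rcM rcV. Qed.
Lemma rcX r n : rc (r^+n)=rc r^+n.
Proof. exact: rmorphXn. Qed.
Lemma rc_nat n : rc n%:R=n%:R.
Proof. exact: rmorph_nat. Qed.
Lemma rc0 : rc 0 = 0. Proof. by []. Qed.
Lemma rc1 : rc 1 = 1. Proof. by []. Qed.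
Lemma rc_eq0 r : (rc r == 0)=(r == 0).
Proof. exact: fmorph_eq0. Qed.
Lemma nm_rc r : nm (rc r) = `|r|.
Proof. by rewrite /nm /= expr0n addr0 sqrtr_sqr. Qed.

Lemma nm_nat n : nm n%:R=n%:R.
Proof. by rewrite -rc_nat nm_rc ger0_norm. Qed.

Definition re x : R := complex.Re (x : R[i]).
Definition im x : R := complex.Im (x : R[i]).

Lemma reD x y : re (x+y)=re x+re y.
Proof. by case: x => a b; case: y => c d. Qed.
Lemma reN x : re (- x) = - re x.
Proof. by case: x => a b. Qed.
Lemma reB x y : re (x-y)=re x-re y.
Proof. by rewrite reD reN. Qed.
Lemma imD x y : im (x+y) = im x+im y.
Proof. by case: x => a b; case: y => c d. Qed.
Lemma imN x : im (- x) = - im x.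
Proof. by case: x => a b. Qed.
Lemma imB x y : im (x-y) = im x-im y.
Proof. by rewrite imD imN. Qed.
Lemma re_rc r : re (rc r)=r. Proof. by []. Qed.
Lemma re_nat n : re n%:R=n%:R.
Proof. by rewrite -rc_nat. Qed.
Lemma re1 : re 1 = 1. Proof. by []. Qed.
Lemma re0 : re 0 = 0. Proof. by []. Qed.
Lemma re_rcM r x : re (rc r*x)=r*re x.
Proof. by case: x => a b; rewrite /re /= mul0r subr0. Qed.

Definition cx (a b : R) : Cplx R := (a +i* b)%C.
Lemma cxE x : x=cx (re x) (im x).
Proof. by case: x. Qed.
Lemma cxB a b c d : cx a b-cx c d=cx (a-c) (b-d).
Proof. by []. Qed.

Lemma nm_def x : nm x=Num.sqrt (re x^+2+im x^+2).
Proof. by case: x. Qed.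

Lemma nm_sq x : nm x^+2=re x^+2+im x^+2.
Proof. by rewrite nm_def sqr_sqrtr // addr_ge0 // sqr_ge0. Qed.

Lemma normr_re x : `|re x| <= nm x.
Proof.
by rewrite nm_def -[leLHS]sqrtr_sqr ler_wsqrtr // lerDl sqr_ge0.
Qed.

Lemma normr_im x : `|im x| <= nm x.
Proof.
by rewrite nm_def -[leLHS]sqrtr_sqr ler_wsqrtr // lerDr sqr_ge0.
Qed.

Lemma re_le x : re x<=nm x.
Proof. exact: le_trans (ler_norm _) (normr_re x). Qed.

Lemma re_geN x : - nm x<=re x.
Proof. by rewrite lerNl; apply: le_trans (normr_re x); rewrite -normrN ler_norm. Qed.

Lemma nm_le x : nm x <= `|re x| + `|im x|.
Proof.
rewrite -(@ler_pXn2r _ 2) ?nnegrE ?nm_ge0 ?addr_ge0 // nm_sq.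
rewrite -(real_normK (num_real (re x))) -(real_normK (num_real (im x))).
have := normr_ge0 (re x); have := normr_ge0 (im x); nra.
Qed.

Lemma normE x : `|x| = rc (nm x).
Proof. by []. Qed.

Lemma nm_sum (I : Type) (s : seq I) (P : pred I) (F : I -> Cplx R) :
 nm (\sum_(i <- s | P i) F i) <= \sum_(i <- s | P i) nm (F i).
Proof.
elim/big_rec2: _ => [|i y x _ IH]; first by rewrite nm0.
by apply: nmD_le; rewrite lerD2l.
Qed.

End Modulus.

Section Complete.
Context {R : realType}.

(** The limit is the supremum of the lower bounds u n - tau n, since every u m + tau m lies above
    all of them. This keeps the rate [tau] itself, which need not be monotone. *)
Lemma rcauchy_cvg (u : nat -> R) (tau : nat -> R) :
 (forall n m, (n<=m)%N -> `|u m-u n| <= tau n) ->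
 exists l, forall n, `|u n-l| <= tau n.
Proof.
move=> hu.
have key n m: u n-tau n<=u m+tau m.
 have h1 := hu n _ (leq_maxl n m); have h2 := hu m _ (leq_maxr n m).
 move: h1 h2; rewrite !ler_distl; lra.
pose S := [set x | exists n, x=u n-tau n].
have hub m: ubound S (u m+tau m) by move=> x [n ->]; exact: key.
exists (sup S) => n; rewrite ler_distl.
have h1: sup S<=u n+tau n.
 by apply: ge_sup; [exists (u n-tau n); exists n | exact: hub].
have h2: u n-tau n<=sup S.
 by apply: ub_le_sup; [exists (u n+tau n); exact: hub | exists n].
by apply/andP; split; lra.
Qed.

Lemma ccauchy_cvg (u : nat -> Cplx R) (tau : nat -> R) :
 (forall n m, (n<=m)%N -> nm (u m-u n)<=tau n) ->
 (forall e, 0<e -> exists n, tau n<=e) ->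
 exists l, forall n, nm (u n-l)<=tau n.
Proof.
move=> hu ht.
have [a ha]: exists l, forall n, `|re (u n)-l| <= tau n.
 apply: rcauchy_cvg => n m nm'; apply: le_trans (hu _ _ nm').
 by rewrite -reB normr_re.
have [b hb]: exists l, forall n, `|im (u n)-l| <= tau n.
 apply: rcauchy_cvg => n m nm'; apply: le_trans (hu _ _ nm').
 by rewrite -imB normr_im.
exists (cx a b) => n; apply/ler_addgt0Pr => e e0.
have [k0 hk0] := ht (e/4) ltac:(lra).
(* The real and imaginary parts alone would only give the rate 2 tau n; comparing with an index k of
   tiny error restores tau n. *)
have [k [nk hk]]: exists k, (n<=k)%N /\ nm (u k-cx a b)<=e.
 have [nk|kn] := leqP n k0; last first.
 exists n; split=> //; have h0 := hu _ _ (ltnW kn).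
 have ha' := ha k0; have hb' := hb k0.
 apply: le_trans (nm_tri (u k0) _ _) _.
 have := nm_le (u k0-cx a b); rewrite reB imB /= => h; lra.
 exists k0; split=> //.
 have ha' := ha k0; have hb' := hb k0.
 have := nm_le (u k0-cx a b); rewrite reB imB /= => h; lra.
have := hu _ _ nk; rewrite nmC => h.
by apply: le_trans (nm_tri (u k) _ _) _; rewrite lerD.
Qed.

(** The disc is not assumed invariant: the ratio 1/2 together with a first displacement of at most
    half the radius keeps all iterates inside. *)
Lemma cbanach (f : Cplx R -> Cplx R) (x0 : Cplx R) (r : R) :
 (forall x y, nm (x-x0)<=r -> nm (y-x0)<=r ->
 nm (f x-f y)<=2^-1*nm (x-y)) ->
 nm (f x0-x0)<=r/2 ->
 exists2 x, nm (x-x0)<=r & f x=x.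
Proof.
move=> hf h0; pose u n := iter n f x0.
have r0: 0<=r by have := nm_ge0 (f x0-x0); lra.
have hin n: nm (u n-x0)<=r.
 elim: n => [|n IH]; first by rewrite /u /= subrr nm0.
 have : nm (f (u n)-f x0)<=2^-1*nm (u n-x0).
 by apply: hf => //; rewrite subrr nm0.
 move=> h; have := nm_tri (f x0) (u n.+1) x0; rewrite -/(f (u n)); lra.
have hstep n: nm (u n.+1-u n)<=r/2*(2^-1)^+n.
 elim: n => [|n IH]; first by rewrite expr0 mulr1.
 have : nm (f (u n.+1)-f (u n))<=2^-1*nm (u n.+1-u n) by apply: hf.
 by rewrite exprS -/(u n.+2) -/(u n.+1) => h; lra.
have hc n m: (n<=m)%N -> nm (u m-u n)<=r*(2^-1)^+n.
 move=> nm'; rewrite -(subnKC nm').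
 have : forall k, nm (u (n+k)%N-u n)<=r*(2^-1)^+n*(1-(2^-1)^+k).
 elim=> [|k IH]; first by rewrite addn0 subrr nm0 expr0 subrr mulr0.
 apply: le_trans (nm_tri (u (n+k)%N) _ _) _.
 rewrite addnS; apply: le_trans (lerD (hstep _) IH) _.
 by rewrite exprD exprS; lra.
 move=> /(_ (m-n)%N) h; apply: le_trans h _.
 have h1: 0<=(2^-1 : R)^+n by [].
 have h2: 0<=(2^-1 : R)^+(m-n) by [].
 have h3: 0<=r*2^-1^+n by rewrite mulr_ge0.
 by nra.
have ht e: 0<e -> exists n, r*(2^-1)^+n<=e.
 move=> e0; have [->|rn0] := eqVneq r 0; first by exists 0%N; rewrite mul0r ltW.
 have rp: 0<r by rewrite lt0r rn0.
 have := @near_infty_natSinv_expn_lt R (PosNum (divr_gt0 e0 rp)).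
 case=> N _ /(_ N (leqnn N)) /= h; exists N.
 rewrite mulrC -ler_pdivlMr // ltW //.
 by rewrite exprVn -div1r (le_lt_trans _ h).
have [l hl] := ccauchy_cvg hc ht.
have lr: nm (l-x0)<=r.
 apply/ler_addgt0Pr => e e0; have [n hn] := ht _ e0.
 have := nm_tri (u n) l x0; rewrite (nmC l (u n)); have := hl n; have := hin n; lra.
exists l => //; apply/eqP; rewrite -subr_eq0 -nm_eq0 eq_le nm_ge0 andbT.
apply/ler_addgt0Pr => e e0; rewrite add0r.
have [n hn] := ht _ (divr_gt0 e0 (ltr0Sn _ 1)).
have h1 := hf l (u n) lr (hin n).
have h2 := nm_tri (f (u n)) (f l) l.
have h3 := hl n.+1; have h4 := hl n; rewrite nmC in h4.
rewrite exprS in h3.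
have h6: f (u n)=u n.+1 by [].
by rewrite h6 in h1 h2; lr h2 h1 h3 h4 hn e0.
Qed.

End Complete.

Section Poly.
Context {R : realType}.
Implicit Types (p h : {poly Cplx R}) (x y z w : Cplx R).

Lemma poly_bounded p (B : R) : exists2 M, 0<=M & forall x, nm x<=B -> nm p.[x]<=M.
Proof.
elim/poly_ind: p => [|p c [M M0 IH]].
 by exists 0 => // x _; rewrite horner0 nm0.
exists (M * `|B|+nm c) => [|x hx]; first by rewrite addr_ge0 ?mulr_ge0 ?nm_ge0.
rewrite hornerMXaddC; apply: nmD_le.
rewrite nmM lerD2r ler_pM ?nm_ge0 ?IH //.
exact: le_trans hx (ler_norm _).
Qed.

(** A divided difference that is polynomial in both variables: its boundedness on discs yields
    Lipschitz bounds without a mean value argument. *)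
Lemma poly_diffq p : exists g : {poly {poly Cplx R}},
 forall x y, p.[x]-p.[y]=(x-y)*g.[x%:P].[y].
Proof.
elim/poly_ind: p => [|p c [g hg]].
 by exists 0 => x y; rewrite !horner0 mulr0 subrr.
exists (g * 'X+p%:P) => x y.
rewrite !hornerMXaddC hornerD hornerM hornerC.
have ->: p.[x] = p.[y]+(x-y)*g.[x%:P].[y] by rewrite -hg addrC subrK.
ring.
Qed.

Lemma poly2_bounded (g : {poly {poly Cplx R}}) (B : R) :
 exists2 M, 0<=M & forall x y, nm x<=B -> nm y<=B -> nm g.[x%:P].[y]<=M.
Proof.
elim/poly_ind: g => [|g c [M M0 IH]].
 by exists 0 => // x y _ _; rewrite !horner0 nm0.
have [Mc Mc0 hc] := poly_bounded c B.
exists (M * `|B|+Mc) => [|x y hx hy]; first by rewrite addr_ge0 ?mulr_ge0.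
rewrite hornerMXaddC !hornerE; apply: nmD_le.
rewrite lerD ?hc // nmM ler_pM ?nm_ge0 ?IH //.
exact: le_trans hx (ler_norm _).
Qed.

Lemma poly_lip p (B : R) : exists2 M, 0<=M &
 forall x y, nm x<=B -> nm y<=B -> nm (p.[x]-p.[y])<=M*nm (x-y).
Proof.
have [g hg] := poly_diffq p; have [M M0 hM] := poly2_bounded g B.
exists M => // x y hx hy; rewrite hg nmM mulrC ler_wpM2r ?nm_ge0 ?hM //.
Qed.

Lemma poly_dvdXn p (k : nat) (M r : R) : 0<r ->
 (forall x, nm x<r -> nm p.[x]<=M*nm x^+k) -> exists h, p=h * 'X^k.
Proof.
move=> r0; elim: k p => [|k IH] p hp; first by exists p; rewrite expr0 mulr1.
have p0: p.[0] = 0.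
 apply/eqP; rewrite -nm_eq0 eq_le nm_ge0 andbT.
 by have := hp 0; rewrite nm0 expr0n mulr0; apply.
have [h eh]: exists h, p=h * 'X.
 by have /factor_theorem[h]: root p 0 by [apply/eqP]; rewrite subr0; exists h.
have [|g eg] := IH h; last by exists g; rewrite eh eg -mulrA -exprSr.
move=> x xr; have [->|x0] := eqVneq x 0; last first.
 have := hp x xr; rewrite eh hornerM hornerX nmM exprS mulrA mulrAC.
 by rewrite ler_pM2r // nm_gt0.
have [L L0 hL] := poly_lip h r.
apply/ler_addgt0Pr => e e0.
(* At x = 0 the factor |x| cannot be cancelled, so the bound for h at 0 is obtained as a limit from
   small real points t, using that h is Lipschitz. *)
pose t := Num.min (Num.min (r/2) 1) (e/2/(L + `|M|+1)).
have D0: 0<L + `|M|+1 by have := normr_ge0 M; lra.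
have t0: 0<t by rewrite !lt_min ltr01 !divr_gt0.
have tr: t<=r/2 by rewrite !ge_min lexx.
have t1: t<=1 by rewrite !ge_min lexx orbT.
have te: t*(L + `|M|+1)<=e/2 by rewrite -ler_pdivlMr // ge_min lexx orbT.
have nt: nm (rc t)=t by rewrite nm_rc gtr0_norm.
have h1: nm h.[rc t]<=M*t^+k.
 have := hp (rc t); rewrite nt => /(_ ltac:(lr tr r0)).
 by rewrite eh hornerM hornerX nmM nt exprS mulrA mulrAC ler_pM2r.
have h2: nm (h.[0]-h.[rc t])<=L*t.
 by have := hL 0 (rc t); rewrite nt nm0 sub0r nmN nt; apply; lr r0 tr.
have h3: nm h.[0]<=nm (h.[0]-h.[rc t])+nm h.[rc t].
 by have := nmD (h.[0]-h.[rc t]) h.[rc t]; rewrite subrK.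
have h5: 0<=t * `|M| by rewrite mulr_ge0 // ltW.
have h6 := ler_norm M; have h7 := normr_ge0 M.
case: k {IH hp} h1 => [|k] h1.
 by rewrite nm0 !expr0 mulr1 in h1 *; nr h1 h5 h3 h2 te e0 L0.
rewrite nm0 exprS mul0r mulr0 add0r.
have h4: M*t^+k.+1<=t * `|M|.
 have t2: t^+k.+1<=t by rewrite exprS ger_pMr // exprn_ile1 // ltW.
 have t3: 0<=t^+k.+1 by rewrite exprn_ge0 // ltW.
 by nr t3 t2 h7 h6.
by nr h4 h1 h3 h2 te t0 e0.
Qed.

End Poly.

(** * Inverse square roots, telescoping tails and logarithms *)

Section Numeric.
Context {R : realType}.

(** Error terms such as (ln k)/k^2 are relaxed to k^(-3/2) = k^-1 times [isq k], whose tails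
    telescope against [isq]. The value at k = 0 is 0. *)
Definition isq (k : nat) : R := (Num.sqrt k%:R)^-1.

Lemma sqrtn_gt0 k : (0<k)%N -> 0<Num.sqrt (k%:R : R).
Proof. by move=> k0; rewrite sqrtr_gt0 ltr0n. Qed.

Lemma sqrtn_ge1 k : (0<k)%N -> 1<=Num.sqrt (k%:R : R).
Proof. by move=> k0; rewrite -[leLHS]sqrtr1 ler_wsqrtr // ler1n. Qed.

Lemma sqrtn_sq k : Num.sqrt (k%:R : R)*Num.sqrt k%:R=k%:R.
Proof. by rewrite -expr2 sqr_sqrtr. Qed.

Lemma isq_ge0 k : 0<=isq k.
Proof. by rewrite invr_ge0 sqrtr_ge0. Qed.

Lemma isq_gt0 k : (0<k)%N -> 0<isq k.
Proof. by move=> k0; rewrite invr_gt0 sqrtn_gt0. Qed.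

Lemma isq_le j k : (0<j)%N -> (j<=k)%N -> isq k<=isq j.
Proof.
move=> j0 jk; rewrite lef_pV2 ?posrE ?sqrtn_gt0 //; last exact: leq_trans jk.
by rewrite ler_wsqrtr // ler_nat.
Qed.

Lemma isq_le1 k : isq k<=1.
Proof.
case: k => [|k]; first by rewrite /isq sqrtr0 invr0.
by rewrite invf_le1 // sqrtn_ge1.
Qed.

Lemma isq_sq k : (0<k)%N -> isq k * isq k=k%:R^-1.
Proof. by move=> k0; rewrite -invfM sqrtn_sq. Qed.

Lemma isq_sqrt k : (0<k)%N -> Num.sqrt k%:R=k%:R * isq k.
Proof.
by move=> k0; rewrite -[X in X*_]sqrtn_sq /isq mulfK // gt_eqF ?sqrtn_gt0.
Qed.

Lemma invn_le_isq k : (0<k)%N -> k%:R^-1<=isq k.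
Proof. by move=> k0; rewrite -isq_sq // ler_piMl ?isq_ge0 // isq_le1. Qed.

Lemma isq_small e : 0<e -> exists N, (0<N)%N /\ forall k, (N<=k)%N -> isq k<=e.
Proof.
move=> e0; have [N hN]: exists N : nat, e^-1^+2<N%:R.
 exists (Num.bound (e^-1^+2)).
 by apply: archi_boundP; rewrite exprn_ge0 // invr_ge0 ltW.
exists N.+1; split => // k hk.
rewrite /isq -[e]invrK lef_pV2 ?posrE ?invr_gt0 ?sqrtn_gt0 //; last exact: leq_trans hk.
have ei: 0<=e^-1 by rewrite invr_ge0 ltW.
rewrite -(ger0_norm ei) -sqrtr_sqr ler_wsqrtr //.
by rewrite (le_trans (ltW hN)) // ler_nat ltnW.
Qed.

Lemma invn_small e : 0<e -> exists N, (0<N)%N /\ forall k, (N<=k)%N -> (k%:R : R)^-1<=e.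
Proof.
move=> /isq_small[N [N0 hN]]; exists N; split => // k hk.
by apply: le_trans (hN _ hk); apply: invn_le_isq; exact: leq_trans hk.
Qed.

Lemma isq_tele k : (0<k)%N -> k%:R^-1 * isq k<=4*(isq k-isq k.+1).
Proof.
move=> k0; set s := Num.sqrt (k%:R : R); set t := Num.sqrt (k.+1%:R : R).
have s0: 0<s by exact: sqrtn_gt0.
have t0: 0<t by exact: sqrtn_gt0.
have ss: s*s=k%:R by exact: sqrtn_sq.
have tt: t*t=s*s+1 by rewrite ss /t sqrtn_sq -natr1.
have s1: 1<=s by exact: sqrtn_ge1.
have ->: isq k-isq k.+1=(t-s)/(s*t) by rewrite /isq -/s -/t; field; lra.
have ->: t-s=(t+s)^-1 by apply: (@mulfI _ (t+s)); [lra|]; rewrite mulfV; [nra|lra].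
have ->: k%:R^-1 * isq k=(s*s*s)^-1.
 by rewrite -[isq k]/(s^-1) -ss; field; lra.
rewrite -invfM.
have P0: 0<(t+s)*(s*t) by rewrite mulr_gt0 ?addr_gt0 ?mulr_gt0.
have Q0: 0<s*s*s by rewrite !mulr_gt0.
rewrite ler_pdivlMr // [leLHS]mulrC ler_pdivrMr //.
have h1: t*(t+s)<=15/4*(s*s) by nra.
nra.
Qed.

Lemma sqrt_tele k : isq k.+1<=2*(Num.sqrt (k.+1%:R)-Num.sqrt k%:R).
Proof.
set s := Num.sqrt (k%:R : R); rewrite /isq; set t := Num.sqrt (k.+1%:R : R).
have s0: 0<=s by exact: sqrtr_ge0.
have t0: 0<t by exact: sqrtn_gt0.
have ss: s*s=k%:R by exact: sqrtn_sq.
have tt: t*t=s*s+1 by rewrite ss /t sqrtn_sq -natr1.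
have ->: t-s=(t+s)^-1 by apply: (@mulfI _ (t+s)); [lra|]; rewrite mulfV; [nra|lra].
rewrite ler_pdivlMr ?ltr_wpDr // mulrC ler_pdivrMr //; nra.
Qed.

Lemma ln1D_ge (x : R) : 0<=x -> x-x^+2<=ln (1+x).
Proof.
move=> x0; have h: ln (1+x) = - ln (1-x/(1+x)).
 have ->: 1-x/(1+x)=(1+x)^-1 by field; lra.
 by rewrite lnV ?opprK // posrE; lra.
have h2: ln (1+(- (x/(1+x)))) <= - (x/(1+x)).
 by apply: le_ln1Dx; rewrite ltrN2 ltr_pdivrMr; lra.
rewrite h; have : x-x^+2<=x/(1+x).
 by rewrite ler_pdivlMr; [nra|lra].
lra.
Qed.

Lemma lnS_est k : (0<k)%N ->
 `|ln (k.+1%:R : R)-ln k%:R-k%:R^-1| <= k%:R^-1^+2.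
Proof.
move=> k0; have kp: 0<(k%:R : R) by rewrite ltr0n.
have ->: ln (k.+1%:R : R)-ln k%:R=ln (1+k%:R^-1).
 rewrite -ln_div ?posrE ?ltr0n //; congr ln; rewrite -natr1; field; lra.
have i0: 0<=(k%:R : R)^-1 by [].
have h1 := ln1D_ge i0.
have h2: ln (1+(k%:R : R)^-1)<=k%:R^-1 by apply: le_ln1Dx; lra.
by rewrite ler_norml; apply/andP; split; nra.
Qed.

Lemma nm_tele (y : nat -> Cplx R) (g : nat -> R) n m : (n<=m)%N ->
 (forall k, (n<=k<m)%N -> nm (y k.+1-y k)<=g k-g k.+1) ->
 nm (y m-y n)<=g n-g m.
Proof.
move=> nm'; rewrite -(subnKC nm'); elim: (m-n)%N => [|k IH] h.
 by rewrite addn0 !subrr nm0.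
have h1: nm (y (n+k)%N-y n)<=g n-g (n+k)%N.
 by apply: IH => i /andP[h1 h2]; apply: h; rewrite h1 addnS ltnW.
have h2: nm (y (n+k).+1-y (n+k)%N)<=g (n+k)%N-g (n+k).+1.
 by apply: h; rewrite leq_addr addnS ltnSn.
by have := nm_tri (y (n+k)%N) (y (n+k).+1) (y n); rewrite addnS; lra.
Qed.

Lemma nm_small0 (x : Cplx R) : (forall e, 0<e -> nm x<=e) -> x = 0.
Proof.
move=> h; apply/eqP; rewrite -nm_eq0 eq_le nm_ge0 andbT.
by apply/ler_addgt0Pr => e e0; rewrite add0r h.
Qed.

End Numeric.

Ltac nneg := repeat first [done | exact: nm_ge0 | exact: normr_ge0 | exact: isq_ge0 |
  apply: ltW; assumption | apply: addr_ge0 | apply: mulr_ge0 | apply: exprn_ge0 | apply: mulr_gt0 |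
  apply: exprn_gt0 | rewrite invr_ge0 | rewrite invr_gt0 ].

(** * Topology of the plane and local mapping properties of polynomials *)

Section ComplexTopology.
Context {R : realType}.
Implicit Types (x y z : Cplx R) (A : set (Cplx R)).

Lemma ltC_rc (e : Cplx R) : 0<e -> 0<re e /\ e=rc (re e).
Proof.
case: e => a b; rewrite ltcE /= => /andP[/eqP b0 a0]; split=> //.
by rewrite b0.
Qed.

Lemma ltC_rcE (r s : R) : (rc r<rc s)=(r<s).
Proof. by rewrite /rc ltcR. Qed.

Lemma ballC x (e : R) y : ball x (rc e) y <-> nm (y-x)<e.
Proof. by rewrite -ball_normE /= normE ltC_rcE nmC. Qed.

Lemma nbhsC x A : nbhs x A <-> exists2 e : R, 0<e & forall y, nm (y-x)<e -> A y.
Proof.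
split=> [/nbhs_ballP[e /ltC_rc[e0 ee] hA]|[e e0 hA]].
 by exists (re e) => // y hy; apply: hA; rewrite ee; apply/ballC.
apply/nbhs_ballP; exists (rc e); first by rewrite /= -rc0 ltC_rcE.
by move=> y /ballC; exact: hA.
Qed.

Lemma nm_continuous (f : Cplx R -> Cplx R) x (L : R) : 0<=L ->
 (forall y, nm (y-x)<1 -> nm (f y-f x)<=L*nm (y-x)) -> {for x, continuous f}.
Proof.
move=> L0 hL A /nbhsC[e e0 hA]; apply/nbhsC.
have D0: 0<L+1 by lra.
exists (Num.min 1 (e/(L+1))); first by rewrite lt_min ltr01 divr_gt0.
move=> y; rewrite lt_min ltr_pdivlMr // => /andP[y1 ye]; apply: hA.
apply: le_lt_trans (hL _ y1) _; have := nm_ge0 (y-x); nra.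
Qed.

Lemma nmr_continuous (f : Cplx R -> R) x (L : R) : 0<=L ->
 (forall y, nm (y-x)<1 -> `|f y-f x| <= L*nm (y-x)) -> {for x, continuous f}.
Proof.
move=> L0 hL; apply/(@cvgrPdist_lt R R (Cplx R) (nbhs x) (nbhs_filter x) f (f x)) => e e0.
apply/nbhsC.
have D0: 0<L+1 by lra.
exists (Num.min 1 (e/(L+1))); first by rewrite lt_min ltr01 divr_gt0.
move=> y; rewrite lt_min ltr_pdivlMr // => /andP[y1 ye]; rewrite distrC.
apply: le_lt_trans (hL _ y1) _; have := nm_ge0 (y-x); nra.
Qed.

Lemma nm_dist x y : `|nm x-nm y| <= nm (x-y).
Proof.
by rewrite ler_norml; have := nmB_ge x y; have := nmB_ge y x; rewrite (nmC y); lra.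
Qed.

Lemma poly_continuous (p : {poly Cplx R}) : continuous (horner p).
Proof.
move=> x; have [L L0 hL] := poly_lip p (nm x+1).
apply: (@nm_continuous _ x L) => // y hy; apply: hL; last lra.
by have := nmD (y-x) x; rewrite subrK; lra.
Qed.

Lemma nm_poly_continuous (p : {poly Cplx R}) : continuous (fun x => nm p.[x] : R).
Proof.
move=> x; have [L L0 hL] := poly_lip p (nm x+1).
apply: (@nmr_continuous _ x L) => // y hy; apply: le_trans (nm_dist _ _) _.
by apply: hL; last lra; have := nmD (y-x) x; rewrite subrK; lra.
Qed.

Lemma cx_continuous : continuous (fun ab : R*R => cx ab.1 ab.2 : Cplx R).
Proof.
move=> [a b] A /nbhsC[e e0 hA].
apply/nbhs_ballP; exists (e/2) => /=; first by rewrite divr_gt0.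
move=> [c d] [/=]; rewrite -!ball_normE /= => h1 h2; apply: hA; rewrite cxB.
apply: le_lt_trans (nm_le _) _; rewrite /= /re /im /= distrC [`|d-b|]distrC; lra.
Qed.

Lemma closedC_nm A : (forall x, (forall e : R, 0<e -> exists2 y, A y & nm (y-x)<e) -> A x) ->
 closed A.
Proof.
move=> h x cx'; apply: h => e e0.
have : nbhs x [set y | nm (y-x)<e] by apply/nbhsC; exists e.
by move/cx' => [y [Ay hy]]; exists y.
Qed.

Lemma compact_square (B : R) : compact [set x : Cplx R | `|re x| <= B /\ `|im x| <= B].
Proof.
have ->: [set x : Cplx R | `|re x| <= B /\ `|im x| <= B] =
 (fun ab : R*R => cx ab.1 ab.2 : Cplx R) @` (`[- B, B] `*` `[- B, B]).
 apply/seteqP; split=> [x [h1 h2]|_ [[a b] [/= h1 h2] <-]].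
 exists (re x, im x); last by rewrite /= -cxE.
 by split; rewrite /= in_itv /= -ler_norml.
 by move: h1 h2; rewrite !in_itv /= -!ler_norml.
apply: continuous_compact; last by apply: compact_setX; exact: segment_compact.
exact/continuous_subspaceT/cx_continuous.
Qed.

Lemma closed_bounded_compact A (B : R) : closed A -> (forall x, A x -> nm x<=B) -> compact A.
Proof.
move=> cA hB; apply: (subclosed_compact cA (@compact_square B)) => x /hB h.
by split; [apply: le_trans (normr_re x) h|apply: le_trans (normr_im x) h].
Qed.

Lemma closed_disc x (r : R) : closed [set y | nm (y-x)<=r].
Proof.
apply: closedC_nm => z hz /=; apply/ler_addgt0Pr => e e0.
have [y hy h] := hz e e0.
have := nm_tri y z x; rewrite (nmC z y); rewrite /= in hy; lra.
Qed.

Lemma compact_disc x (r : R) : compact [set y | nm (y-x)<=r].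
Proof.
apply: (@closed_bounded_compact _ (r+nm x)); first exact: closed_disc.
by move=> y /= h; have := nmD (y-x) x; rewrite subrK; lra.
Qed.

Lemma poly_max (p : {poly Cplx R}) A (B : R) : closed A -> (forall x, A x -> nm x<=B) ->
 A !=set0 -> exists2 c, A c & forall t, A t -> nm p.[t]<=nm p.[c].
Proof.
move=> cA hB A0.
have [|c cAA hc] := @compact_EVT_max _ _ (fun x => nm p.[x]) A A0 (closed_bounded_compact cA hB).
 exact/continuous_subspaceT/nm_poly_continuous.
exists c; first by move: cAA; rewrite inE.
by move=> t At; apply: hc; rewrite inE.
Qed.

Lemma poly_min (p : {poly Cplx R}) A (B : R) : closed A -> (forall x, A x -> nm x<=B) ->
 A !=set0 -> exists2 c, A c & forall t, A t -> nm p.[c]<=nm p.[t].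
Proof.
move=> cA hB A0.
have [|c cAA hc] := @compact_EVT_min _ _ (fun x => nm p.[x]) A A0 (closed_bounded_compact cA hB).
 exact/continuous_subspaceT/nm_poly_continuous.
exists c; first by move: cAA; rewrite inE.
by move=> t At; apply: hc; rewrite inE.
Qed.

(* Near [x0] a nonconstant polynomial behaves like [p x0 + a (x - x0)^k], so it
 moves its value in any prescribed direction [v]. *)
Lemma poly_direction (p : {poly Cplx R}) (x0 v : Cplx R) (r : R) : (1<size p)%N -> v!=0 -> 0<r ->
 exists x (t : R), [/\ nm (x-x0)<r, 0<t, t<=1 &
 nm (p.[x]-p.[x0]-rc t*v)<=t/2*nm v].
Proof.
move=> sp v0 r0.
have [k [h hh pe]] := multiplicity_XsubC (p-p.[x0]%:P) x0.
have p0: p-p.[x0]%:P!=0.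
 rewrite -size_poly_gt0 size_polyDl ?size_polyN ?size_polyC; last first.
 by case: eqP => _ //=; apply: ltn_trans sp.
 exact: ltn_trans sp.
have h0: h.[x0]!=0 by move: hh; rewrite p0.
have pE x: p.[x]-p.[x0]=h.[x]*(x-x0)^+k.
 by have := congr1 (horner^~ x) pe; rewrite !hornerE.
have k0: (0<k)%N.
 case: k pe pE => // pe pE; have := pE x0; rewrite subrr expr0 mulr1 => /esym/eqP.
 by rewrite (negbTE h0).
pose z := k.-root (v/h.[x0]).
have zE: z^+k=v/h.[x0] by rewrite /z rootCK.
have z0: z!=0.
 by apply: contraTneq v0 => e; rewrite negbK; move/eqP: zE; rewrite e expr0n (gtn_eqF k0) eq_sym mulf_eq0 invr_eq0 (negbTE h0) orbF.
have [L L0 hL] := poly_lip h (nm x0+nm z).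
have nz: 0<nm z by rewrite nm_gt0.
have nh: 0<nm h.[x0] by rewrite nm_gt0.
have D1: 0<(L+1)*nm z by rewrite mulr_gt0; lra.
pose s := Num.min 1 (Num.min (r/(2*nm z)) (nm h.[x0]/2/((L+1)*nm z))).
have s0: 0<s by rewrite !lt_min ltr01 !divr_gt0 // mulr_gt0.
have s1: s<=1 by rewrite ge_min lexx.
have sr: s*(2*nm z)<=r by rewrite -ler_pdivlMr ?mulr_gt0 // /s !ge_min lexx !orbT.
have sh: s*((L+1)*nm z)<=nm h.[x0]/2 by rewrite -ler_pdivlMr // /s !ge_min lexx !orbT.
exists (x0+rc s*z), (s^+k); split.
- rewrite addrC addKr nmM nm_rc gtr0_norm //; nra.
- by nneg.
- by rewrite exprn_ile1 // ltW.
rewrite pE [x0+_]addrC addrK exprMn zE rcX.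
have ->: h.[rc s*z+x0]*(rc s^+k*(v/h.[x0]))-rc s^+k*v =
 rc s^+k*v*((h.[rc s*z+x0]-h.[x0])/h.[x0]) by field.
have half: nm ((h.[rc s*z+x0]-h.[x0])/h.[x0])<=1/2.
 rewrite nmf ler_pdivrMr //; apply: le_trans (hL _ _ _ _) _.
 - apply: nmD_le; rewrite nmM nm_rc (gtr0_norm s0); nra.
 - lra.
 - rewrite addrK nmM nm_rc (gtr0_norm s0); nra.
rewrite nmM nmM nmX nm_rc (gtr0_norm s0).
have sv: 0<=s^+k*nm v by nneg.
have := ler_wpM2l sv half; lra.
Qed.

Lemma size_le1_const (p : {poly Cplx R}) x y : (size p<=1)%N -> p.[x] = p.[y].
Proof. by move/size1_polyC => ->; rewrite !hornerC. Qed.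

Lemma poly_no_local_max (p : {poly Cplx R}) x0 (r : R) : 0<r -> (1<size p)%N ->
 exists2 x, nm (x-x0)<r & nm p.[x0]<nm p.[x].
Proof.
move=> r0 sp; have [e|e] := eqVneq p.[x0] 0.
 have [x [t [h1 h2 _ h3]]] := poly_direction x0 sp (oner_neq0 _) r0.
 exists x => //; rewrite e nm0 nm_gt0; apply: contraTneq h2 => e2.
 move: h3; rewrite e e2 subr0 sub0r nmN mulr1 nm_rc nm1.
 by have := ler_norm t; rewrite -leNgt; lra.
have [x [t [h1 h2 t1 h3]]] := poly_direction x0 sp e r0; exists x => //.
have nv: 0<nm p.[x0] by rewrite nm_gt0.
have := nmD_ge ((1+rc t) * p.[x0]) (p.[x]-p.[x0]-rc t * p.[x0]).
have ->: (1+rc t) * p.[x0]+(p.[x]-p.[x0]-rc t * p.[x0]) = p.[x] by ring.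
rewrite nmM -rc1 -rcD nm_rc ger0_norm; nra.
Qed.

Lemma poly_no_local_min (p : {poly Cplx R}) x0 (r : R) : 0<r -> (1<size p)%N -> p.[x0]!=0 ->
 exists2 x, nm (x-x0)<r & nm p.[x]<nm p.[x0].
Proof.
move=> r0 sp e; have e': - p.[x0]!=0 by rewrite oppr_eq0.
have [x [t [h1 h2 t1 h3]]] := poly_direction x0 sp e' r0; exists x => //.
have nv: 0<nm p.[x0] by rewrite nm_gt0.
have := nmD ((1-rc t) * p.[x0]) (p.[x]-p.[x0]-rc t * - p.[x0]).
have ->: (1-rc t) * p.[x0]+(p.[x]-p.[x0]-rc t * - p.[x0]) = p.[x] by ring.
rewrite nmN in h3; rewrite nmM -rc1 -rcB nm_rc ger0_norm; nra.
Qed.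

Lemma poly_max_modulus (p : {poly Cplx R}) x0 (T B : R) : 0<T ->
 (forall x, nm (x-x0)=T -> nm p.[x]<=B) -> forall x, nm (x-x0)<=T -> nm p.[x]<=B.
Proof.
move=> T0 hB x hx.
have circ: nm (x0+rc T-x0)=T by rewrite addrC addKr nm_rc gtr0_norm.
have [sp|sp] := leqP (size p) 1.
 by rewrite (size_le1_const _ (x0+rc T) sp) hB.
have bnd y: [set y | nm (y-x0)<=T] y -> nm y<=T+nm x0.
 by move=> /= h; have := nmD (y-x0) x0; rewrite subrK; lra.
have [c hc cmax] := @poly_max p _ _ (@closed_disc x0 T) bnd ltac:(by exists x).
apply: le_trans (cmax _ hx) _; apply: hB; apply/eqP; rewrite eq_le hc leNgt /=.
apply/negP => hc'; have [|y hy1 hy2] := @poly_no_local_max p c (T-nm (c-x0)) _ sp.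
 lra.
suff : nm p.[y]<=nm p.[c] by lra.
by apply: cmax => /=; have := nm_tri c y x0; lra.
Qed.

Lemma poly_divX (p : {poly Cplx R}) : exists h, p = p.[0]%:P+h * 'X.
Proof.
have : root (p-p.[0]%:P) 0 by rewrite rootE !hornerE subrr.
by move/factor_theorem => [h]; rewrite subr0 => e; exists h; rewrite -e addrC subrK.
Qed.

(* Schwarz's lemma for the quotient [(p - p 0) / X]. *)
Lemma poly_divX_bound (p h : {poly Cplx R}) (T B : R) : 0<T -> p = p.[0]%:P+h * 'X ->
 (forall x, nm x<=T -> nm p.[x]<=B) -> forall x, nm x<=T -> nm h.[x]<=2*B/T.
Proof.
move=> T0 e hB x hx; apply: (@poly_max_modulus h 0 T) => //; last by rewrite subr0.
move=> y; rewrite subr0 => ny.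
have eh: h.[y]*y = p.[y]-p.[0] by rewrite {1}e !hornerE addrC addKr.
rewrite ler_pdivlMr // -ny -nmM eh; apply: nmB_le.
have := hB y ltac:(lra); have := hB 0; rewrite nm0 => /(_ (ltW T0)); lra.
Qed.

Lemma poly_schwarz (p : {poly Cplx R}) (T B : R) : 0<T ->
 (forall x, nm x<=T -> nm p.[x]<=B) ->
 forall x, nm x<=T -> nm (p.[x]-p.[0])<=2*B/T*nm x.
Proof.
move=> T0 hB x hx; have [h e] := poly_divX p.
have ->: p.[x]-p.[0]=h.[x]*x by rewrite {1}e !hornerE addrC addKr.
by rewrite nmM ler_wpM2r ?nm_ge0 // (poly_divX_bound T0 e hB).
Qed.

(** Cauchy's estimate with 2/T in place of 1/T: each division by the variable goes through the
    Schwarz bound and costs a factor 2, which later has to be beaten by the choice of radii. *)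
Lemma poly_coef_bound (p : {poly Cplx R}) (T B : R) k : 0<T ->
 (forall x, nm x<=T -> nm p.[x]<=B) -> nm p`_k<=B*(2/T)^+k.
Proof.
move=> T0; elim: k p B => [|k IH] p B hB.
 by rewrite expr0 mulr1 -horner_coef0 hB // nm0 ltW.
have [h e] := poly_divX p.
have ->: p`_k.+1=h`_k by rewrite e coefD coefC coefMX add0r.
rewrite exprS mulrA [B*_]mulrA [B*2]mulrC; apply: IH.
exact: (poly_divX_bound T0 e hB).
Qed.

End ComplexTopology.

(** * Trigonometric estimates and the unit circle *)

Section Cis.
Context {R : realType}.
Implicit Types (s t x y : R).

Lemma mvt0 (f df : R -> R) (K t : R) : (forall x, is_derive x 1 f (df x)) ->
 (forall x, `|x| <= `|t| -> `|df x| <= K) -> `|f t-f 0| <= K * `|t|.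
Proof.
move=> h hK; have cf (A: set R) : {within A, continuous f}.
 by apply: continuous_subspaceT => x; apply/differentiable_continuous/derivable1_diffP; have [] := h x.
have [t0|t0] := leP 0 t.
 have [x] := MVT_segment t0 (fun x _ => h x) (cf _); rewrite in_itv /= subr0 => /andP[x0 xt] ->.
 by rewrite normrM ler_wpM2r // hK // !ger0_norm.
have [x] := MVT_segment (ltW t0) (fun x _ => h x) (cf _); rewrite in_itv /= => /andP[x0 xt] e.
rewrite distrC e sub0r normrM normrN ler_wpM2r // hK // ler0_norm // ler0_norm ?lerN2 //; exact: ltW.
Qed.

Lemma sin_le_norm t : `|sin t| <= `|t|.
Proof.
have := @mvt0 sin cos 1 t (@is_derive_sin R) (fun x _ => cos_max x).
by rewrite sin0 subr0 mul1r.
Qed.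

Lemma cosB1_le t : `|cos t - 1| <= `|t|.
Proof.
have := @mvt0 cos (fun x => - sin x) 1 t (@is_derive_cos R); rewrite cos0 mul1r; apply=> x _.
by rewrite normrN sin_max.
Qed.

Lemma cosB1_le2 t : `|cos t - 1| <= t^+2.
Proof.
have := @mvt0 cos (fun x => - sin x) `|t| t (@is_derive_cos R).
rewrite cos0 -expr2 real_normK ?num_real //; apply=> x hx.
by rewrite normrN; apply: le_trans (sin_le_norm x) hx.
Qed.

Lemma sinBid_le2 t : `|sin t-t| <= t^+2.
Proof.
have := @mvt0 (sin-id) (fun x => cos x - 1) `|t| t _ _.
rewrite -expr2 real_normK ?num_real // !fctE sin0 !subr0; apply.
by move=> x hx; apply: le_trans (cosB1_le x) hx.
Qed.

Lemma sinBid_le3 t : `|sin t-t| <= `|t| ^+ 3.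
Proof.
have := @mvt0 (sin-id) (fun x => cos x - 1) (`|t| ^+ 2) t _ _.
rewrite -exprSr !fctE sin0 !subr0; apply.
move=> x hx; apply: le_trans (cosB1_le2 x) _; rewrite -(real_normK (num_real x)).
by apply: lerXn2r; rewrite ?nnegrE.
Qed.

(** Halving the angle reduces the claim to the sine: for t = 2h the expression is 2 (h - sin h)(h +
    sin h), and both factors are already estimated. *)
Lemma cos_le3 t : `|cos t - 1+t^+2/2| <= `|t| ^+ 3.
Proof.
pose h := t/2; have ->: t=h *+ 2 by rewrite -mulr_natl /h; field.
move: h => h.
have ->: cos (h *+ 2) - 1+(h *+ 2)^+2/2 = 2*((h-sin h)*(h+sin h)).
 by rewrite cos_mulr2n cos2sin2 !mulr2n; field.
have e2: `|h *+ 2| = 2 * `|h| by rewrite -mulr_natl normrM ger0_norm.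
rewrite e2 !normrM (ger0_norm (_ : 0<=2 :> R)) // distrC.
have q1 := sinBid_le2 h; have q2: `|h+sin h| <= 2 * `|h|.
 by apply: le_trans (ler_normD _ _) _; have := sin_le_norm h; lra.
have ->: (2 * `|h|)^+3 = 2*(h^+2*(2 * `|h|))+4 * `|h| ^+ 3.
 by rewrite -(real_normK (num_real h)); ring.
rewrite -[leLHS]addr0 lerD ?mulr_ge0 ?exprn_ge0 //.
by rewrite ler_wpM2l // ler_pM.
Qed.

Definition Ci : Cplx R := cx 0 1.
Definition cis t : Cplx R := rc (cos t)+Ci*rc (sin t).

Lemma cis_cx t : cis t=cx (cos t) (sin t).
Proof. by rewrite /cis /Ci /rc /cx; simpc. Qed.

Lemma Ci2 : Ci*Ci = -1.
Proof. by rewrite /Ci /cx; simpc. Qed.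

Lemma nm_Ci : nm Ci = 1.
Proof. by rewrite nm_def /Ci /= expr0n expr1n add0r sqrtr1. Qed.

Lemma Ci_rc (a b : R) : rc a+Ci*rc b=cx a b.
Proof. by rewrite /Ci /rc /cx; simpc. Qed.

Lemma nm_cx_le (a b : R) : nm (cx a b) <= `|a| + `|b|.
Proof. exact: nm_le. Qed.

Lemma cis0 : cis 0 = 1.
Proof. by rewrite /cis cos0 sin0 rc0 mulr0 addr0. Qed.

Lemma cisD s t : cis (s+t)=cis s*cis t.
Proof.
rewrite /cis cosD sinD !rcB !rcD !rcM.
transitivity (rc (cos s)*rc (cos t)+Ci*Ci*(rc (sin s)*rc (sin t))+Ci*(rc (sin s)*rc (cos t)+rc (cos s)*rc (sin t))); last by ring.
by rewrite Ci2; ring.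
Qed.

Lemma nm_cis t : nm (cis t) = 1.
Proof. by rewrite cis_cx nm_def /= cos2Dsin2 sqrtr1. Qed.

Lemma cis_neq0 t : cis t!=0.
Proof. by rewrite -nm_gt0 nm_cis. Qed.

Lemma cisB s t : cis (s-t)=cis s/cis t.
Proof. by apply: (mulIf (cis_neq0 t)); rewrite -cisD subrK divfK // cis_neq0. Qed.

Lemma cis2pi : cis (2 * pi) = 1.
Proof. by rewrite mulr_natl /cis cos2pi sin2pi rc0 mulr0 addr0. Qed.

Lemma cisB1_le t : nm (cis t - 1)<=2 * `|t|.
Proof.
have ->: cis t - 1=cx (cos t - 1) (sin t) by rewrite /cis -Ci_rc rcB rc1; ring.
apply: le_trans (nm_cx_le _ _) _.
have := cosB1_le t; have := sin_le_norm t; lra.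
Qed.

Lemma cis_lip s t : nm (cis s-cis t)<=2 * `|s-t|.
Proof.
have ->: cis s-cis t=(cis (s-t) - 1)*cis t.
 by rewrite mulrBl -cisD subrK mul1r.
by rewrite nmM nm_cis mulr1 cisB1_le.
Qed.

Lemma cis_le2 t : nm (cis t - 1-Ci*rc t)<=2*t^+2.
Proof.
have ->: cis t - 1-Ci*rc t=cx (cos t - 1) (sin t-t).
 by rewrite /cis -Ci_rc !rcB rc1; ring.
apply: le_trans (nm_cx_le _ _) _.
have := cosB1_le2 t; have := sinBid_le2 t; lra.
Qed.

Lemma cis_le3 t : nm (cis t - 1-Ci*rc t+rc (t^+2/2))<=2 * `|t| ^+ 3.
Proof.
have ->: cis t - 1-Ci*rc t+rc (t^+2/2)=cx (cos t - 1+t^+2/2) (sin t-t).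
 by rewrite /cis -Ci_rc !rcD !rcN rc1; ring.
apply: le_trans (nm_cx_le _ _) _.
have := cos_le3 t; have := sinBid_le3 t; lra.
Qed.

Lemma nm_cis2B1 t : nm (cis (2*t) - 1) = 2 * `|sin t|.
Proof.
apply/eqP; rewrite -(@eqrXn2 _ 2) ?nm_ge0 ?mulr_ge0 // nm_sq cis_cx.
have ->: re (cx (cos (2*t)) (sin (2*t)) - 1)=cos (2*t) - 1 by [].
have ->: im (cx (cos (2*t)) (sin (2*t)) - 1)=sin (2*t) - 0 by [].
rewrite subr0 mulr_natl cos_mulr2n sin_mulr2n exprMn real_normK ?num_real //.
apply/eqP; have e := sin2cos2 t; rewrite !mulr2n; have ->: (cos t^+2+cos t^+2 - 1 - 1) = - 2*sin t^+2 by rewrite e; ring.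
 transitivity (4*(sin t^+2*(sin t^+2+cos t^+2))); first by ring.
 by rewrite addrC cos2Dsin2; ring.
Qed.

Lemma sin_lb_half t : 0<=t -> t<=pi/2 -> t/8<=sin t.
Proof.
move=> t0 tpi; have [th|th] := leP t 2^-1.
 have := sinBid_le2 t; rewrite ler_norml => /andP[h _]; nra.
have h2: (pi : R)/2<=2.
 by have [/andP[_ h] _] := pihalf_02_cos_pihalf R.
have ->: t/8<=sin t=true; last by [].
apply/idP; via (1/4); first lra.
via (sin 2^-1).
 have := sinBid_le2 (2^-1 : R); rewrite ler_norml => /andP[h _]; lra.
have [->//|] := eqVneq t 2^-1 => tn.
by apply/ltW; rewrite ltr_sin // !in_itv /=; apply/andP; split; lra.
Qed.

(** The two zeros 0 and pi will correspond to the entrance and the exit of a passage; the bound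
    measures how far the rotating ratio is from 1 in between. *)
Lemma sin_lb t : 0<=t -> t<=pi -> Num.min t (pi-t)/8<=sin t.
Proof.
move=> t0 tpi; have [th|th] := leP t (pi/2).
 apply: le_trans (sin_lb_half t0 th); by rewrite ler_pM2r ?invr_gt0 // ge_min lexx.
have ->: sin t=sin (pi-t) by rewrite sinB sinpi cospi mul0r mulN1r sub0r opprK.
apply: le_trans (sin_lb_half _ _); [|lra|lra].
by rewrite ler_pM2r // ge_min lexx orbT.
Qed.

End Cis.

(* Keeps unification and [done] from unfolding complex arithmetic. *)
Opaque Cplx nm re im rc cx.

(** * Fatou coordinates of a parabolic germ *)

Section FatouCoordinate.
Context {R : realType}.

(* Both conditions are invariant under enlarging [R0]; the second one makes [F]
 nearly isometric far to the right. *)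
Definition near_translation (F : Cplx R -> Cplx R) (g : Cplx R) (M R0 : R) :=
 (forall u, R0<=re u -> nm (F u-(u+1-g/u))<=M/nm u^+2) /\
 (forall t u v, R0<=t -> t<=re u -> t<=re v ->
 nm (F u-F v-(u-v))<=M*nm (u-v)/t^+2).

Section Estimates.
Variables (F : Cplx R -> Cplx R) (g : Cplx R) (G R0 : R).
Hypotheses (gG : nm g<=G) (R01 : 1<=R0) (hF : near_translation F g G R0).

Let step_est u : R0<=re u -> nm (F u-u - 1)<=2*G/nm u.
Proof.
have hg := gG; have hR := R01; have ng := nm_ge0 g.
move=> hu; have u1: 1<=nm u by have := re_le u; lra.
have h1 := hF.1 _ hu.
have h2: G/nm u^+2<=G/nm u.
 have G0: 0<=G by lra.
 have u2: 0<nm u by lra.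
 rewrite ler_wpM2l // lef_pV2 ?posrE ?exprn_gt0 //.
 by rewrite expr2 ler_peMl; lra.
have h3: F u-u - 1=F u-(u+1-g/u)-g/u by ring.
rewrite h3; apply: nmB_le.
have h4: nm g/nm u<=G/nm u by rewrite ler_wpM2r // invr_ge0 nm_ge0.
by rewrite nmf; lra.
Qed.

Let R1 := Num.max R0 (8*G+2).

Lemma orbit_right u : R1<=re u -> forall k, re u+k%:R/2<=re (iter k F u).
Proof.
have hg := gG; have hR := R01; have ng := nm_ge0 g; have hG: 0<=G by lra.
move=> hu; elim=> [|k IH]; first by rewrite mul0r addr0.
rewrite iterS; set v := iter k F u in IH *.
have kk: 0<=(k%:R : R) by [].
have [h1 h2]: R0<=R1 /\ 8*G+2<=R1 by rewrite !le_max !lexx orbT.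
have rv: R0<=re v by lra.
have h3 := step_est rv.
have h4: 2*G/nm v<=1/2.
 have nv: 0<nm v by have := re_le v; lra.
 rewrite ler_pdivrMr //; have := re_le v; lra.
have := re_geN (F v-v - 1); rewrite !reB re1 -natr1; lra.
Qed.

Let Phi_spec u (l : Cplx R) := forall k, (0<k)%N ->
 nm (iter k F u-k%:R+g*rc (ln k%:R)-l) <=
 (16*G*(9+2*nm u+16*G)) * isq k.

Let Phi_ex u : exists l, R1<=re u -> Phi_spec u l.
Proof.
have hg := gG; have hR := R01; have ng := nm_ge0 g; have hG: 0<=G by lra.
have [hu|] := leP R1 (re u); last by exists 0.
have [hR1 hR2]: R0<=R1 /\ 8*G+2<=R1 by rewrite !le_max !lexx orbT.
pose x k := iter k F u.
have xre k: R0+k%:R/2<=re (x k).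
 by have := orbit_right hu k; rewrite -/(x k); lra.
have xnm k: (k%:R+1)/2<=nm (x k).
 by have := xre k; have := re_le (x k); lra.
have x0 k: 0<nm (x k) by have := xnm k; have : 0<=(k%:R : R) by []; lra.
have xR0 k: R0<=re (x k) by have := xre k; have : 0<=(k%:R : R) by []; lra.
(* A crude first bound: the steps differ from 1 by O(1/k), so x k - k drifts by at most O(sqrt k).
   This suffices to make the second term of the increment [e1] below of order k^(-3/2). *)
have drift k: nm (x k-k%:R-u)<=8*G*Num.sqrt k%:R.
 have h: nm ((x k-k%:R)-(x 0%N - 0%:R)) <= - (8*G)*Num.sqrt (0%:R)-(- (8*G)*Num.sqrt k%:R).
 apply: (@nm_tele R (fun k => x k-k%:R) (fun k => - (8*G)*Num.sqrt k%:R)) => // i _.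
 have ->: x i.+1-i.+1%:R-(x i-i%:R)=F (x i)-x i - 1.
 by rewrite /x iterS -natr1; ring.
 apply: le_trans (step_est (xR0 i)) _.
 have h1: 2*G/nm (x i)<=2*G*(2 * i.+1%:R^-1).
 rewrite ler_wpM2l ?mulr_ge0 // -[2]invrK -invfM lef_pV2 ?posrE ?mulr_gt0 ?invr_gt0 //.
 by have := xnm i; rewrite -natr1; lra.
 have h2 := @invn_le_isq R i.+1 isT; have h3 := @sqrt_tele R i.
 apply: le_trans h1 _.
 have := ler_wpM2l hG (le_trans h2 h3).
 by move: (_^-1) (Num.sqrt _) (Num.sqrt _) => a b c; lra.
 by rewrite sqrtr0 mulr0 subr0 /= in h; apply: le_trans h _; rewrite sub0r mulNr opprK.
pose y k := x k-k%:R+g*rc (ln k%:R).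
pose H := 4*G*(9+2*nm u+16*G).
have nu0 := nm_ge0 u.
have ystep k: (0<k)%N -> nm (y k.+1-y k)<=H*(k%:R^-1 * isq k).
 move=> k0; have kp: 0<(k%:R : R) by rewrite ltr0n.
 have x_n0: x k!=0 by rewrite -nm_gt0.
 have k_n0: (k%:R : Cplx R)!=0 by rewrite pnatr_eq0 -lt0n.
 (* Three sources of error: the map F against its model, g/x k against g/k, and ln (k+1) - ln k
    against 1/k. *)
 have e1: y k.+1-y k=(F (x k)-(x k+1-g/x k))
 + g*((x k-k%:R)/(k%:R*x k))
 + g*rc (ln k.+1%:R-ln k%:R-k%:R^-1).
 rewrite /y {1}/x iterS -/(x k) !rcB rcV rc_nat -natr1; field.
 by rewrite x_n0 k_n0.
 move: (@lnS_est R k k0) e1; move: (ln k.+1%:R-ln k%:R-k%:R^-1) => dl hdl e1.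
 have i0: 0<(k%:R : R)^-1 by nneg.
 have q1: (k%:R : R)^-1<=isq k by exact: invn_le_isq.
 have q3: Num.sqrt (k%:R : R)=k%:R * isq k by exact: isq_sqrt.
 have q4: 0<isq k :> R by exact: isq_gt0.
 have vx: (nm (x k))^-1<=2*k%:R^-1.
 rewrite -[2]invrK -invfM lef_pV2 ?posrE ?mulr_gt0 ?invr_gt0 //.
 by have := xnm k; lr.
 have vx0: 0<(nm (x k))^-1 by nneg.
 have b1: nm (F (x k)-(x k+1-g/x k))<=4*G*(k%:R^-1 * isq k).
 apply: le_trans (hF.1 _ (xR0 k)) _.
 rewrite -exprVn -mulrA [4*_]mulrC -mulrA ler_wpM2l // [_*4]mulrC.
 by nr vx0 vx q1.
 have b2: nm (g*((x k-k%:R)/(k%:R*x k))) <=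
 nm g*((2*nm u+16*G)*(k%:R^-1 * isq k)).
 rewrite nmM ler_wpM2l ?nm_ge0 // nmf nmM nm_nat invfM.
 have d1: nm (x k-k%:R)<=(nm u+8*G)*(k%:R * isq k).
 have := nmD (x k-k%:R-u) u; rewrite subrK => d.
 have := drift k; rewrite q3 => d2.
 have := @sqrtn_ge1 R k k0; rewrite q3 => d3.
 by nr d3 d2 d nu0.
 have d2: 0<=nm (x k-k%:R) by nneg.
 have d3: k%:R^-1*(nm (x k))^-1<=2*(k%:R^-1*k%:R^-1) by nr vx i0.
 have d4: 0<=k%:R^-1*(nm (x k))^-1 by nneg.
 apply: le_trans (ler_pM d2 d4 d1 d3) _.
 apply: eq_ler; field; lr kp.
 have b3: nm (g*rc dl)<=nm g*(k%:R^-1 * isq k).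
 rewrite nmM nm_rc ler_wpM2l ?nm_ge0 //; apply: le_trans hdl _.
 by rewrite expr2; nr q1 i0.
 have T0: 0<k%:R^-1 * isq k :> R by nneg.
 rewrite e1; apply: nmD_le; apply: le_trans (lerD (nmD _ _) b3) _.
 apply: le_trans (lerD (lerD b1 b2) (lexx _)) _.
 have cc: 4*G+nm g*(2*nm u+16*G)+nm g<=H by rewrite /H; nr nu0 ng hg.
 have := ler_wpM2r (ltW T0) cc; lr.
have H0: 0<=H by nneg.
have yc n m: (n<=m)%N -> nm (y m.+1-y n.+1)<=4*H * isq n.+1.
 move=> nm'; via (4*H * isq n.+1 - 4*H * isq m.+1).
 apply: (@nm_tele R y (fun k => 4*H * isq k)) => // i /andP[i0 _].
 have i1: (0<i)%N by apply: leq_ltn_trans i0.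
 apply: le_trans (ystep _ i1) _; have := @isq_tele R i i1; nr H0.
 by rewrite gerBl mulr_ge0 ?isq_ge0 // mulr_ge0.
have [|l hl] := @ccauchy_cvg R (fun k => y k.+1) (fun k => 4*H * isq k.+1) yc.
 move=> e e0; have D0: 0<4*H+1 by lr H0.
 have [N [_ hN]] := isq_small (divr_gt0 e0 D0).
 exists N; have := hN _ (leqnSn N); rewrite ler_pdivlMr // => h.
 by have := @isq_ge0 R N.+1; nr h.
exists l => _ [//|k] _; have := hl k; rewrite /y /H.
by rewrite !mulrA; congr (_<=_*_); ring.
Qed.

Let Phi_sig := choice Phi_ex.

(** [Phi] is the limit of F^k(u) - k + g ln k. Besides the functional equation the clauses keep a
    rate of convergence and the closeness of [Phi] to an isometry, because the coordinate is later
    used at finite times and in fixed point arguments. *)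
Lemma fatou_coordinate_aux : exists (Phi : Cplx R -> Cplx R) (R1 D : R),
 [/\ R0<=R1 /\ 0<=D,
 forall u, R1<=re u -> forall k, re u+k%:R/2<=re (iter k F u),
 forall u k, R1<=re u -> (0<k)%N ->
 nm (iter k F u-k%:R+g*rc (ln k%:R)-Phi u)<=D*(1+nm u) * isq k,
 forall t u v, R1<=t -> t<=re u -> t<=re v ->
 nm (Phi u-Phi v-(u-v))<=D/t*nm (u-v) &
 forall u, R1<=re u -> Phi (F u) = Phi u+1].
Proof.
have hg := gG; have hR := R01; have ng := nm_ge0 g; have hG: 0<=G by lra.
have [Phi hPhi] := Phi_sig.
have [hR1 hR2]: R0<=R1 /\ 8*G+2<=R1 by rewrite !le_max !lexx orbT.
pose D := 16*G*(9+16*G)+40*G.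
have D0: 0<=D by rewrite /D; nra.
have lim u k: R1<=re u -> (0<k)%N ->
 nm (iter k F u-k%:R+g*rc (ln k%:R)-Phi u)<=D*(1+nm u) * isq k.
 move=> hu k0; apply: le_trans (hPhi _ hu _ k0) _.
 rewrite ler_wpM2r ?isq_ge0 // /D; have := nm_ge0 u; nra.
have small u e: R1<=re u -> 0<e -> exists N, (0<N)%N /\ forall k, (N<=k)%N ->
 nm (iter k F u-k%:R+g*rc (ln k%:R)-Phi u)<=e.
 move=> hu e0.
 have D1: 0<D*(1+nm u)+1 by rewrite ltr_wpDl // mulr_ge0 // addr_ge0 ?nm_ge0.
 have [N [N0 hN]] := isq_small (divr_gt0 e0 D1).
 exists N; split => // k hk; apply: le_trans (lim _ _ hu (leq_trans N0 hk)) _.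
 have := hN _ hk; rewrite ler_pdivlMr // => h; have := @isq_ge0 R k; nr h.
exists Phi, R1, D; split=> //.
- exact: orbit_right.
- move=> t u v ht hu hv; apply/ler_addgt0Pr => e e0.
 pose d k := iter k F u-iter k F v.
 (* A potential for the Lipschitz defects: after k steps the real part is at least t + k/2, and 1/(t
    + k/2)^2 <= 2 (h k - h (k+1)), so the defects add up to O(1/t). *)
 pose h (k : nat) : R := (t+k%:R/2 - 1/2)^-1.
 have tt2: 2<=t by lr ht hR2 ng hg.
 have h_pos k: 0<h k by rewrite invr_gt0; have : 0<=(k%:R : R) by []; lr tt2.
 have iso k: nm (d k-d 0%N)<=4*G*nm (u-v)*(h 0%N-h k).
 elim: k => [|k IH]; first by rewrite !subrr nm0 mulr0.
 have kk: 0<=(k%:R : R) by [].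
 have h0t: h 0%N<=2/t.
 rewrite /h mul0r addr0 -[2]invrK -invfM lef_pV2 ?posrE; lr tt2.
 have dk: nm (d k)<=2*nm (u-v).
 have := nmD (d k-d 0%N) (d 0%N); rewrite subrK {3}/d /= => q.
 have q2: G*(h 0%N-h k)<=1/4.
 have : G*(2/t)<=1/4.
 by rewrite mulrA ler_pdivrMr; [lr ht hR2|lr tt2].
 by have := h_pos k; nr h0t hG.
 have := nm_ge0 (u-v); nr q2 q IH.
 have tk: R0<=t+k%:R/2 by lr kk ht hR1.
 have hu': t+k%:R/2<=re (iter k F u) by have := @orbit_right u ltac:(lr hu ht) k; lr hu.
 have hv': t+k%:R/2<=re (iter k F v) by have := @orbit_right v ltac:(lr hv ht) k; lr hv.
 have := hF.2 _ _ _ tk hu' hv'; rewrite -!iterS -/(d k.+1) -/(d k) => st.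
 have hh: ((t+k%:R/2)^+2)^-1<=2*(h k-h k.+1).
 have ->: h k-h k.+1=((t+k%:R/2 - 1/2)*(t+k%:R/2))^-1/2.
 rewrite /h -natr1; field; apply/andP; split; apply: lt0r_neq0; lr kk tt2.
 rewrite mulrCA divff // mulr1 lef_pV2 ?posrE; nr kk tt2.
 have h20: 0<=((t+k%:R/2)^+2)^-1 by rewrite invr_ge0 sqr_ge0.
 apply: le_trans (nm_tri (d k) _ _) _; apply: le_trans (lerD st IH) _.
 have : G*nm (d k)/(t+k%:R/2)^+2<=G*(2*nm (u-v))*(2*(h k-h k.+1)).
 by apply: ler_pM => //; rewrite ?mulr_ge0 ?nm_ge0 // ler_wpM2l.
 lr.
 have e4: 0<e/2 by lr e0.
 have [N1 [_ hN1]] := small u _ ltac:(lr hu ht) e4; have [N2 [_ hN2]] := small v _ ltac:(lr hv ht) e4.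
 have := hN1 _ (leq_maxl N1 N2); have := hN2 _ (leq_maxr N1 N2).
 set k := maxn N1 N2 => a1 a2.
 have e1: Phi u-Phi v-(u-v)=(d k-d 0%N)
 - (iter k F u-k%:R+g*rc (ln k%:R)-Phi u)
 + (iter k F v-k%:R+g*rc (ln k%:R)-Phi v) by rewrite /d /=; ring.
 rewrite e1; have q1 := nmD (d k-d 0%N-(iter k F u-k%:R+g*rc (ln k%:R)-Phi u)) (iter k F v-k%:R+g*rc (ln k%:R)-Phi v).
 have q2 := nmB (d k-d 0%N) (iter k F u-k%:R+g*rc (ln k%:R)-Phi u).
 have q3 := iso k.
 have q4: 4*G*nm (u-v)*(h 0%N-h k)<=D/t*nm (u-v).
 rewrite mulrAC ler_wpM2r ?nm_ge0 //.
 have h0t: h 0%N<=2/t.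
 rewrite /h mul0r addr0 -[2]invrK -invfM lef_pV2 ?posrE; lr tt2.
 have t0: 0<t^-1 by rewrite invr_gt0; lr tt2.
 via (8*G*t^-1); first by have := h_pos k; nr h0t hG.
 by rewrite ler_wpM2r ?(ltW t0) /D; nr hG.
 lr q4 q3 q2 q1 a2 a1.
- move=> u hu; have hFu: R1<=re (F u).
 by have := orbit_right hu 1; rewrite /=; lr hu.
 apply/eqP; rewrite -subr_eq0; apply/eqP; apply: nm_small0 => e e0.
 have e4: 0<e/(3+2*nm g) by rewrite divr_gt0 //; have := nm_ge0 g; lr.
 have [N1 [N10 hN1]] := small _ _ hu e4; have [N2 [_ hN2]] := small _ _ hFu e4.
 have [N3 [_ hN3]] := @invn_small R _ e4.
 pose k := maxn (maxn N1 N2) N3.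
 have k1: (N1<=k)%N by rewrite /k !leq_max leqnn.
 have k2: (N2<=k)%N by rewrite /k !leq_max leqnn orbT.
 have k3: (N3<=k)%N by rewrite /k !leq_max leqnn !orbT.
 have k0: (0<k)%N by exact: leq_trans k1.
 have a1 := hN1 k.+1 (leqW k1); have a2 := hN2 _ k2; have a3 := hN3 _ k3.
 have a4 := @lnS_est R k k0.
 have e1: Phi (F u)-(Phi u+1) =
 (iter k.+1 F u-k.+1%:R+g*rc (ln k.+1%:R)-Phi u)
 - (iter k F (F u)-k%:R+g*rc (ln k%:R)-Phi (F u))
 - g*rc (ln k.+1%:R-ln k%:R) by rewrite iterSr rcB -natr1; ring.
 have a5: `|ln (k.+1%:R : R)-ln k%:R| <= 2*k%:R^-1.
 have i0: 0<=(k%:R : R)^-1 by [].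
 have i1: (k%:R : R)^-1<=1 by rewrite invf_le1 ?ltr0n // ler1n.
 move: a4; rewrite !ler_norml expr2 => /andP[b1 b2]; apply/andP; split; nr b1 i1 i0 b2.
 rewrite e1; apply: nmB_le; rewrite nmM nm_rc.
 apply: le_trans (lerD (nmB _ _) (lexx _)) _.
 move: e4 a1 a2 a3; set q := e/_; have qe: q*(3+2*nm g)=e by rewrite divfK //; lr ng.
 move=> q0 a1 a2 a3; have a6 := ler_wpM2l ng (le_trans a5 (ler_wpM2l (ler0n _ 2) a3)); lr a6 a2 a1 q0 qe.
Qed.

End Estimates.

Theorem fatou_coordinate (F : Cplx R -> Cplx R) (g : Cplx R) (M R0 : R) :
 0<=M -> 1<=R0 -> near_translation F g M R0 ->
 exists (Phi : Cplx R -> Cplx R) (R1 D : R),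
 [/\ R0<=R1 /\ 0<=D,
 forall u, R1<=re u -> forall k, re u+k%:R/2<=re (iter k F u),
 forall u k, R1<=re u -> (0<k)%N ->
 nm (iter k F u-k%:R+g*rc (ln k%:R)-Phi u)<=D*(1+nm u) * isq k,
 forall t u v, R1<=t -> t<=re u -> t<=re v ->
 nm (Phi u-Phi v-(u-v))<=D/t*nm (u-v) &
 forall u, R1<=re u -> Phi (F u) = Phi u+1].
Proof.
move=> M0 R01 hF; apply: (@fatou_coordinate_aux F g (M+nm g)) => //.
 by rewrite lerDr.
have ng := nm_ge0 g.
split=> [u hu|t u v ht hu hv].
 apply: le_trans (hF.1 _ hu) _; rewrite ler_wpM2r ?invr_ge0 ?sqr_ge0 //; lra.
apply: le_trans (hF.2 _ _ _ ht hu hv) _.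
rewrite ler_wpM2r ?invr_ge0 ?sqr_ge0 // ler_wpM2r ?nm_ge0 //; lra.
Qed.

End FatouCoordinate.

(** * Parabolic germs in the coordinate at infinity *)

Section ParabolicGerm.
Context {R : realType}.

(** The estimates hold on a full neighbourhood of infinity and not only on a right half-plane: on
    the left the same map has to be inverted to reach the repelling side. *)
Definition near_translation_infty (F : Cplx R -> Cplx R) (g : Cplx R) (M R0 : R) :=
 (forall u, R0<=nm u -> nm (F u-(u+1-g/u))<=M/nm u^+2) /\
 (forall t u v, R0<=t -> t<=nm u -> t<=nm v ->
 nm (F u-F v-(u-v))<=M*nm (u-v)/t^+2).

Lemma near_translation_inftyW F g M R0 :
 near_translation_infty F g M R0 -> near_translation F g M R0.
Proof.
move=> [h1 h2]; split=> [u hu|t u v ht hu hv]; first by apply: h1; apply: le_trans (re_le u).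
by apply: h2 => //; [apply: le_trans hu _|apply: le_trans hv _]; exact: re_le.
Qed.

Definition parab (a : Cplx R) (h : {poly Cplx R}) : {poly Cplx R} :=
 'X + 'X^2+a *: 'X^3+h * 'X^4.

(* The germ in the coordinate [u = - 1 / w] at infinity. *)
Definition at_infty (f : {poly Cplx R}) (u : Cplx R) : Cplx R := - (f.[- u^-1])^-1.

(** With w = -1/u the displacement is the quotient k(w)/G(w) of two polynomials, and subtracting 1 -
    (a-1)/u leaves w^2 L(w)/G(w); this is the origin of [L]. The coefficient a-1 later produces the
    logarithm in the Fatou coordinate. *)
Lemma at_infty_near_translation a h : exists M R0 : R,
 [/\ 0<=M, 1<=R0, near_translation_infty (at_infty (parab a h)) (a - 1) M R0 &
 forall u, R0<=nm u -> (parab a h).[- u^-1]!=0 /\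
 nm (at_infty (parab a h) u-u)<=2].
Proof.
pose k : {poly Cplx R} := 1+a *: 'X+h * 'X^2.
pose G : {poly Cplx R} := 1 + 'X*k.
pose L : {poly Cplx R} := h-a%:P-h * 'X+(1-a)%:P*k.
have [Bk Bk0 hBk] := poly_bounded k 1.
have [BG BG0 hBG] := poly_bounded G 1.
have [BL BL0 hBL] := poly_bounded L 1.
have [Lk Lk0 hLk] := poly_lip k 1.
have [LG LG0 hLG] := poly_lip G 1.
pose M := 2*BL+4*(Bk*LG+BG*Lk); pose R0 := Num.max 1 (2*Bk+nm (a - 1)+2*BL+1).
have M0: 0<=M by rewrite /M; nra.
have [R01 R0k]: 1<=R0 /\ 2*Bk+nm (a - 1)+2*BL+1<=R0 by rewrite !le_max !lexx orbT.
have na0 := nm_ge0 (a - 1).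
have kE w: k.[w] = 1+a*w+h.[w]*w^+2 by rewrite !hornerE; ring.
have GE w: G.[w] = 1+w*k.[w] by rewrite !hornerE.
have fE w: (parab a h).[w]=w*G.[w].
 by rewrite GE kE /parab !hornerE /=; ring.
have LE w: L.[w]=h.[w]-a-h.[w]*w+(1-a)*k.[w] by rewrite !hornerE.
have basic u: R0<=nm u -> let w := - u^-1 in
 [/\ u!=0, nm w=(nm u)^-1, nm w<=1, 1/2<=nm G.[w] & at_infty (parab a h) u-u=k.[w]/G.[w]].
 move=> hu w; have nu: 1<=nm u by lr hu R01.
 have u0: u!=0 by rewrite -nm_gt0; lr nu.
 have nw: nm w=(nm u)^-1 by rewrite nmN nmV.
 have w1: nm w<=1 by rewrite nw invf_le1; lr nu.
 have hk := hBk _ w1.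
 have wk: nm (w*k.[w])<=1/2.
 rewrite nmM nw mulrC ler_pdivrMr; [lr hk hu na0 R0k BL0|lr nu].
 have gG: 1/2<=nm G.[w].
 by rewrite GE; have := nmD_ge 1 (w*k.[w]); rewrite nm1; lr wk.
 have g0: G.[w]!=0 by rewrite -nm_gt0; lr gG.
 have w0: w!=0 by rewrite oppr_eq0 invr_eq0.
 split=> //; rewrite /at_infty -/w fE.
 have ->: u = - w^-1 by rewrite /w invrN opprK invrK.
 rewrite GE in g0 *; field.
 by rewrite g0 w0.
exists M, R0; split=> //.
- split=> [u hu|t u v ht hu hv].
 have [u0 nw w1 gG e] := basic _ hu; set w := - u^-1 in nw w1 gG e.
 have g0: G.[w]!=0 by rewrite -nm_gt0; lr gG.
 have ->: at_infty (parab a h) u-(u+1-(a - 1)/u)=w^+2*L.[w]/G.[w].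
 have ->: at_infty (parab a h) u-(u+1-(a - 1)/u) =
 (at_infty (parab a h) u-u) - 1+(a - 1)/u by ring.
 rewrite e; have ->: (a - 1)/u = - (a - 1)*w by rewrite /w; ring.
 apply: (@mulIf _ G.[w]) => //; rewrite divfK // mulrDl mulrBl divfK //.
 by rewrite LE GE kE; ring.
 rewrite nmf nmM nmX nw exprVn.
 rewrite -mulrA mulrC ler_wpM2r ?invr_ge0 ?sqr_ge0 //.
 have := hBL _ w1; have n0 := nm_ge0 L.[w]; rewrite ler_pdivrMr; [|lr gG].
 have q1: 2*BL<=M.
 by rewrite /M; have := mulr_ge0 Bk0 LG0; have := mulr_ge0 BG0 Lk0; lr.
 by nr q1 gG BL0.
 have [u0 nw w1 gG e] := basic u ltac:(lr hu ht); set w := - u^-1 in nw w1 gG e.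
 have [v0 nw' w1' gG' e'] := basic v ltac:(lr hv ht); set w' := - v^-1 in nw' w1' gG' e'.
 have g0: G.[w]!=0 by rewrite -nm_gt0; lr gG.
 have g0': G.[w']!=0 by rewrite -nm_gt0; lr gG'.
 have ->: at_infty (parab a h) u-at_infty (parab a h) v-(u-v) =
 (k.[w]*(G.[w']-G.[w])+G.[w]*(k.[w]-k.[w']))/(G.[w]*G.[w']).
 transitivity ((at_infty (parab a h) u-u)-(at_infty (parab a h) v-v)); first by ring.
 by rewrite e e'; field; rewrite g0 g0'.
 have t0: 0<t by lr ht R01.
 have dw: nm (w-w')<=nm (u-v)/t^+2.
 have ->: w-w'=(u-v)/(u*v) by rewrite /w /w'; field; rewrite u0 v0.
 rewrite nmf nmM ler_wpM2l ?nm_ge0 // lef_pV2 ?posrE ?exprn_gt0 //; [nr t0 hv hu|].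
 by rewrite mulr_gt0 // nm_gt0.
 have n1: nm (k.[w]*(G.[w']-G.[w])+G.[w]*(k.[w]-k.[w']))<=(Bk*LG+BG*Lk)*nm (w-w').
 apply: nmD_le; rewrite !nmM [nm (G.[w']-_)]nmC.
 have := hBk _ w1; have := hBG _ w1; have := hLk _ _ w1 w1'; have := hLG _ _ w1 w1'.
 have := nm_ge0 (G.[w]-G.[w']); have := nm_ge0 (k.[w]-k.[w']).
 have := nm_ge0 k.[w]; have := nm_ge0 G.[w] => q1 q2 q3 q4 q5 q6 q7 q8.
 have := ler_pM q2 q4 q8 q5; have := ler_pM q1 q3 q7 q6; lr.
 have gg: 1/4<=nm G.[w]*nm G.[w'] by nr gG' gG.
 rewrite nmf nmM ler_pdivrMr; last by lr gg.
 apply: le_trans n1 _.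
 have C0: 0<=Bk*LG+BG*Lk by nneg.
 apply: le_trans (ler_wpM2l C0 dw) _.
 have x0: 0<=nm (u-v)/t^+2 by nneg.
 rewrite -[M*_/_]mulrA.
 move: (nm (u-v)/t^+2) (nm G.[w]*nm G.[w']) x0 gg => X Y x0 y0.
 have q1: 4*(Bk*LG+BG*Lk)<=M by rewrite /M; lr BL0.
 have q2: Bk*LG+BG*Lk<=M*Y by nr q1 y0 M0.
 by rewrite mulrAC ler_wpM2r.
- move=> u hu; have [u0 nw w1 gG e] := basic _ hu; set w := - u^-1 in nw w1 gG e *.
 have g0: G.[w]!=0 by rewrite -nm_gt0; lr gG.
 have w0: w!=0 by rewrite oppr_eq0 invr_eq0.
 split; first by rewrite fE mulf_neq0.
 have ->: at_infty (parab a h) u-u = 1-(a - 1)/u+(w^+2*L.[w]/G.[w]).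
 rewrite e; have ->: (a - 1)/u = - (a - 1)*w by rewrite /w; ring.
 apply: (@mulIf _ G.[w]) => //; rewrite divfK // mulrDl divfK //.
 by rewrite LE GE kE; ring.
 apply: nmD_le; apply: le_trans (lerD (nmB _ _) (lexx _)) _.
 rewrite nm1 nmf nmf nmM nmX nw. have nup: 0<nm u by lr hu R01.
 have := hBL _ w1 => hl; have nl := nm_ge0 L.[w]; have na := nm_ge0 (a - 1).
 have i1: (nm u)^-1<=1 by rewrite invf_le1; lr hu R01 nup.
 have i0: 0<(nm u)^-1 by nneg.
 have q1: nm L.[w]/nm G.[w]<=2*BL by rewrite ler_pdivrMr; [nr hl gG BL0|lr gG].
 have q2: (nm u)^-1^+2*nm L.[w]/nm G.[w]<=(nm u)^-1*(2*BL).
 rewrite -mulrA; apply: ler_pM => //; rewrite ?sqr_ge0 //; first by rewrite divr_ge0 ?nm_ge0.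
 by rewrite expr2; nr i0 i1.
 have q3: (nm (a - 1)+2*BL)*(nm u)^-1<=1 by rewrite ler_pdivrMr //; lr hu R0k Bk0.
 lr q3 q2.
Qed.

(** Conjugated by u -> -u, the inverse branch is again nearly the translation by 1, with coefficient
    -g, so the theory of the attracting side also yields the repelling Fatou coordinate. The
    preimage of -u near -u-1 is a fixed point of v - (F v + u), a contraction because F - id is
    almost constant. *)
Lemma inverse_branch (F : Cplx R -> Cplx R) (g : Cplx R) (M R0 : R) :
 0<=M -> 1<=R0 -> near_translation_infty F g M R0 ->
 exists (F' : Cplx R -> Cplx R) (M' R1 : R),
 [/\ 0<=M', R0<=R1, near_translation F' (- g) M' R1 &
 forall u, R1<=re u -> F (- F' u) = - u /\ nm (F' u-u - 1)<=1/2].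
Proof.
move=> M0 R01 [h1 h2]; have ng := nm_ge0 g.
pose R1 := R0+4*M+4*nm g+3.
have [r0 r1 r2]: [/\ R0<=R1, R0+3<=R1 & 4*M+4*nm g+4<=R1] by rewrite /R1; split; lra.
have key u: exists v, R1<=re u -> F (- v) = - u /\ nm (v-u - 1)<=1/2.
 have [hu|] := leP R1 (re u); last by exists 0.
 have inB v: nm (v-(- u - 1))<=1/2 -> R1<=nm v.
 move=> hv; have := re_le (- v); have := re_le (v-(- u - 1)).
 by rewrite nmN !(reB, reN) re1; lra.
 have [v hv ev]: exists2 v, nm (v-(- u - 1))<=1/2 & v-(F v+u)=v.
 apply: (@cbanach R (fun v => v-(F v+u))) => [x y hx hy|].
 have ->: x-(F x+u)-(y-(F y+u)) = - (F x-F y-(x-y)) by ring.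
 have R11: R0<=R1 by [].
 rewrite nmN; apply: le_trans (h2 _ _ _ R11 (inB _ hx) (inB _ hy)) _.
 rewrite mulrAC ler_wpM2r ?nm_ge0 // ler_pdivrMr.
 by rewrite /R1; nr ng R01 M0.
 by rewrite exprn_gt0 /R1; lr ng R01 M0.
 set v := - u - 1; have hv: R1<=nm v by apply: inB; rewrite subrr nm0; lra.
 have ->: v-(F v+u)-v = - (F v-(v+1-g/v))+g/v by rewrite {3}/v; ring.
 have R11: R0<=nm v by move: hv; rewrite /R1; lra.
 apply: nmD_le; rewrite nmN nmf.
 have nv: 0<nm v by lra.
 have e1: M/nm v^+2<=M/nm v.
 rewrite ler_wpM2l // lef_pV2 ?posrE ?exprn_gt0 //.
 by rewrite expr2 ler_peMl; lr nv hv r0 R01.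
 have e2: (M+nm g)/nm v<=1/4 by rewrite ler_pdivrMr //; move: hv; rewrite /R1; lr R01.
 by have := h1 _ R11; lr e2 e1.
 exists (- v) => _; rewrite opprK; split.
 have e1: F v=v-(v-(F v+u))-u by ring.
 by rewrite e1 ev; ring.
 by rewrite -nmN; congr (nm _<=_): hv; ring.
have [F' hF'] := choice key.
exists F', (4*M+3*nm g), R1; split=> //.
- by nneg.
- split=> [u hu|t u v ht hu hv].
 have [e n] := hF' _ hu; set v := F' u in e n *.
 have nu := re_le u.
 have R1u: R1<=nm u by lr nu hu.
 have nv: nm u/2<=nm v.
 have := nmB_ge u (- (v-u - 1) - 1).
 have ->: u-(- (v-u - 1) - 1)=v by ring.
 have := nmB (- (v-u - 1)) 1; rewrite nmN nm1; move: R1u; rewrite /R1; lr n ng R01 M0.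
 have R0v: R0<=nm v.
 have := re_le v; have := re_geN (v-u - 1); rewrite !reB re1; move: hu; rewrite /R1; lr n ng M0.
 have u0: u!=0 by rewrite -nm_gt0; lr nu hu r0 R01.
 have v0: v!=0 by rewrite -nm_gt0; lr nv nu hu r0 R01.
 have e2: v-(u+1 - - g/u)=(F (- v)-(- v+1-g/(- v)))+g*(u-v)/(u*v).
 rewrite e; field; rewrite ?oppr_eq0 u0 v0 //.
 have := h1 (- v); rewrite nmN => /(_ R0v) b1.
 have nuv: nm (u-v)<=3/2.
 have ->: u-v = - (v-u - 1) - 1 by ring.
 by apply: nmB_le; rewrite nmN nm1; lr n.
 have nup: 0<nm u by lr nu hu r0 R01.
 rewrite e2; apply: nmD_le.
 have b2: M/nm v^+2<=4*M/nm u^+2.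
 rewrite [4*M]mulrC -mulrA ler_wpM2l // -[4]invrK -invfM lef_pV2 ?posrE.
 - by rewrite [_^-1*_]mulrC ler_pdivrMr; nr nup nv.
 - by rewrite exprn_gt0; lr nv nu hu r0 R01.
 - by nneg.
 have b3: nm (g*(u-v)/(u*v))<=3*nm g/nm u^+2.
 rewrite nmf !nmM ler_pdivrMr; last by rewrite mulr_gt0 //; lr nv nu hu r0 R01.
 rewrite mulrAC ler_pdivlMr ?exprn_gt0 //.
 have : nm u^+2<=2*(nm u*nm v) by nr nup nv.
 have n0 := nm_ge0 (u-v) => q.
 have q2: nm (u-v)*nm u^+2<=3*(nm u*nm v).
 have := ler_pM n0 (sqr_ge0 _) nuv q; lr.
 have := ler_wpM2l ng q2; lr.
 by rewrite mulrDl; lr b3 b2 b1.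
 have [e n] := hF' u ltac:(lr hu ht); have [e' n'] := hF' v ltac:(lr hv ht).
 set x := F' u in e n *; set y := F' v in e' n' *.
 have tx: t<=nm (- x).
 rewrite nmN; have := re_le x; have := re_geN (x-u - 1); rewrite !reB re1; lr n hu.
 have ty: t<=nm (- y).
 rewrite nmN; have := re_le y; have := re_geN (y-v - 1); rewrite !reB re1; lr n' hv.
 have t0: 0<t by move: ht; rewrite /R1; lr ng R01 M0.
 have := h2 t (- x) (- y) ltac:(move: ht; rewrite /R1; lr ng M0) tx ty.
 rewrite e e'.
 have ->: - u - - v-(- x - - y)=x-y-(u-v) by ring.
 have ->: nm (- x - - y)=nm (x-y) by rewrite -nmN; congr nm; ring.
 have t2: 0<t^+2 by nneg.
 have tt: 2*M<=t^+2 by move: ht; rewrite /R1; nr ng R01.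
 have iM: M/t^+2<=1/2 by rewrite ler_pdivrMr //; lr tt.
 have iM0: 0<=M/t^+2 by nneg.
 rewrite ![_*_/t^+2]mulrAC => b.
 have d1 := nmB_ge (x-y) (u-v).
 have n0 := nm_ge0 (x-y).
 have d2: nm (x-y)<=2*nm (u-v) by nr n0 d1 b iM.
 apply: le_trans b _.
 have : M/t^+2*nm (x-y)<=M/t^+2*(2*nm (u-v)) by rewrite ler_wpM2l.
 have : 0<=nm g/t^+2*nm (u-v) by nneg.
 have : 0<=M/t^+2*nm (u-v) by nneg.
 rewrite ![(_+_)/_]mulrDl; lr.
Qed.

End ParabolicGerm.

(** * Critical points in parabolic basins *)

Section CriticalValues.
Context {R : realType}.
Implicit Types (x y z : Cplx R) (Q : {poly Cplx R}).

Lemma poly_taylor2 Q : exists g : {poly {poly Cplx R}},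
 forall x y, Q.[x]-Q.[y]-(x-y)*Q^`().[y]=(x-y)^+2*g.[x%:P].[y].
Proof.
elim/poly_ind: Q => [|p c [g hg]].
 by exists 0 => x y; rewrite deriv0 !horner0 !mulr0 !subrr.
exists (g * 'X+(p^`())%:P) => x y.
rewrite !hornerMXaddC derivD derivC addr0 derivM derivX mulr1 !hornerE.
have ->: p.[x] = p.[y]+(x-y) * p^`().[y]+(x-y)^+2*g.[x%:P].[y].
 by rewrite -hg; ring.
ring.
Qed.

Definition segm x y : set (Cplx R) := [set z | exists2 t : R, 0<=t<=1 & z=x+rc t*(y-x)].

Lemma segm_connected x y : connected (segm x y).
Proof.
have ->: segm x y=(fun t : R => x+rc t*(y-x)) @` `[0, 1].
 apply/seteqP; split=> z.
 by move=> [t ht ->]; exists t; rewrite ?in_itv.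
 by move=> [t /=]; rewrite in_itv /= => ht <-; exists t.
apply: connected_continuous_connected; first exact: segment_connected.
apply: continuous_subspaceT => t A /nbhsC[e e0 hA].
apply/nbhs_ballP; have D0: 0<nm (y-x)+1 by have := nm_ge0 (y-x); lra.
exists (e/(nm (y-x)+1)); first by rewrite /= divr_gt0.
move=> s; rewrite -ball_normE /= ltr_pdivlMr // distrC => hs; apply: hA.
have ->: x+rc s*(y-x)-(x+rc t*(y-x))=rc (s-t)*(y-x) by rewrite rcB; ring.
rewrite nmM nm_rc; have := normr_ge0 (s-t); lra.
Qed.

Lemma segm_start x y : segm x y x.
Proof. by exists 0; rewrite ?lexx ?ler01 // rc0 mul0r addr0. Qed.

Lemma segm_end x y : segm x y y.
Proof. by exists 1; rewrite ?lexx ?ler01 // rc1 mul1r addrC subrK. Qed.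

Lemma segm_disc c x y (r : R) : nm (x-c)<r -> nm (y-c)<r ->
 forall z, segm x y z -> nm (z-c)<r.
Proof.
move=> hx hy z [t /andP[t0 t1] ->].
have ->: x+rc t*(y-x)-c=rc (1-t)*(x-c)+rc t*(y-c).
 by rewrite rcB rc1; ring.
apply: le_lt_trans (nmD _ _) _; rewrite !nmM !nm_rc !ger0_norm; [|lra..].
pose m := Num.max (nm (x-c)) (nm (y-c)).
have m1: nm (x-c)<=m by rewrite le_max lexx.
have m2: nm (y-c)<=m by rewrite le_max lexx orbT.
have mr: m<r by rewrite gt_max hx.
nra.
Qed.

Lemma disc_component (A : set (Cplx R)) x0 c (e : R) : A x0 ->
 (forall y, nm (y-c)<e -> A y) ->
 (exists2 y, connected_component A x0 y & nm (y-c)<e) ->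
 forall y, nm (y-c)<e -> connected_component A x0 y.
Proof.
move=> A0 hA [y hy yc] z zc.
rewrite (same_connected_component hy).
apply: (@connected_component_max _ _ (segm y z)); [exact: segm_start| |exact: segm_connected|exact: segm_end].
by move=> u hu; apply: hA; exact: (segm_disc yc zc hu).
Qed.

Lemma connected_circle (A : set (Cplx R)) x0 x1 (r : R) : connected A -> A x0 -> A x1 ->
 0<r -> r<nm (x1-x0) -> exists2 x, A x & nm (x-x0)=r.
Proof.
move=> cA A0 A1 r0 r1.
have : connected ((fun x => nm (x-x0) : R) @` A).
 apply: connected_continuous_connected => //.
 apply: continuous_subspaceT => x; apply: (@nmr_continuous _ _ x 1) => // y _.
 rewrite mul1r; apply: le_trans (nm_dist _ _) _.
 by have ->: y-x0-(x-x0)=y-x by ring.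
move/connected_intervalP => iA.
have [|||x Ax <-] := iA (nm (x0-x0)) (nm (x1-x0)) _ _ r; [by exists x0|by exists x1| |by exists x].
by rewrite subrr nm0 !ltW.
Qed.

Lemma sublevel_closed Q y0 (r : R) : closed [set x | nm (Q.[x]-y0)<=r].
Proof.
apply: closedC_nm => x hx /=; apply/ler_addgt0Pr => e e0.
have [L L0 hL] := poly_lip Q (nm x+1).
have D0: 0<L+1 by lra.
have [y /= hy h] := hx (Num.min 1 (e/(L+1))) ltac:(by rewrite lt_min ltr01 divr_gt0).
move: h; rewrite lt_min ltr_pdivlMr // => /andP[h1 h2].
have := hL x y ltac:(lra) ltac:(by have := nmD (y-x) x; rewrite subrK; lra).
rewrite (nmC x y) => h3; have := nm_tri Q.[y] Q.[x] y0; have := nm_ge0 (y-x); nra.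
Qed.

Lemma sublevel_nbhs Q y0 (r : R) x : nm (Q.[x]-y0)<r ->
 exists2 e : R, 0<e & forall y, nm (y-x)<e -> nm (Q.[y]-y0)<r.
Proof.
move=> hx; have [L L0 hL] := poly_lip Q (nm x+1).
have D0: 0<L+1 by lra.
have d0: 0<r-nm (Q.[x]-y0) by lra.
exists (Num.min 1 ((r-nm (Q.[x]-y0))/(L+1))); first by rewrite lt_min ltr01 divr_gt0.
move=> y; rewrite lt_min ltr_pdivlMr // => /andP[h1 h2].
have := hL y x ltac:(by have := nmD (y-x) x; rewrite subrK; lra) ltac:(lra).
by have := nm_tri Q.[x] Q.[y] y0; have := nm_ge0 (y-x); nra.
Qed.

(* One relaxed Newton step maps a sublevel set of [Q - y0] without critical points
 continuously into a smaller one, fixing the roots, so that distinct roots are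
 never in the same connected part of it. *)
Lemma roots_disconnected Q y0 (r B : R) : 0<r ->
 (forall x, nm (Q.[x]-y0)<=r -> nm x<=B /\ Q^`().[x]!=0) ->
 forall A x0 x1, connected A -> (forall x, A x -> nm (Q.[x]-y0)<=r) ->
 A x0 -> A x1 -> Q.[x0]=y0 -> Q.[x1]=y0 -> x0=x1.
Proof.
move=> r0 hS A x0 x1 cA AS A0 A1 e0 e1; apply/eqP; apply: contraT => x01.
have [c Sc cmin]: exists2 c, [set x | nm (Q.[x]-y0)<=r] c &
 forall t, [set x | nm (Q.[x]-y0)<=r] t -> nm (Q^`()).[c]<=nm (Q^`()).[t].
 apply: (@poly_min _ _ _ B); first exact: sublevel_closed.
 by move=> x /hS[].
 by exists x0 => /=; rewrite e0 subrr nm0 ltW.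
set m := nm (Q^`()).[c] in cmin.
have m0: 0<m by rewrite nm_gt0; have [] := hS _ Sc.
have [g hg] := poly_taylor2 Q.
pose B' := B+r/m+nm (x1-x0)+1.
have [G G0 hG] := poly2_bounded g B'.
have rm0: 0<r/m by nneg.
(* A full Newton step could overshoot; with this e the quadratic Taylor remainder uses up at most
   half of the relative decrease e of the level. *)
pose e := Num.min (1/2) (m^+2/(2*(r*G+1))).
have D0: 0<2*(r*G+1) by nra.
have ep: 0<e by rewrite lt_min divr_gt0 ?divr_gt0 ?exprn_gt0.
have e2: e<=1/2 by rewrite ge_min lexx.
have eG: e*(2*(r*G+1))<=m^+2 by rewrite -ler_pdivlMr // ge_min lexx orbT.
pose N x := x-rc e*(Q.[x]-y0)/Q^`().[x].
have Nlev x: nm (Q.[x]-y0)<=r -> nm (Q.[N x]-y0)<=(1-e/2)*nm (Q.[x]-y0).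
 move=> hx; have [xB dx] := hS _ hx; have mx := cmin _ hx.
 set d := Q.[x]-y0 in hx *; set D := (Q^`()).[x] in dx mx.
 have nD: 0<nm D by rewrite nm_gt0.
 have h1: nm (rc e*d/D)<=e*nm d/m.
 rewrite nmf nmM nm_rc (gtr0_norm ep) ler_wpM2l //; last by rewrite lef_pV2 ?posrE.
 by nneg.
 have h1': e*nm d/m<=r/m by rewrite ler_wpM2r ?invr_ge0 ?(ltW m0); have := nm_ge0 d; nr hx e2.
 have NB: nm (N x)<=B' by have := nmB x (rc e*d/D); rewrite /B'; have := nm_ge0 (x1-x0); lr h1' h1 xB.
 have xB': nm x<=B' by rewrite /B'; have := nm_ge0 (x1-x0); lr xB rm0.
 have h2: N x-x = - (rc e*d/D) by rewrite /N -/d -/D; ring.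
 have h5: Q.[N x]=Q.[x]+(N x-x)*D+(N x-x)^+2*g.[(N x)%:P].[x].
 by rewrite -hg /D; ring.
 have h6: (N x-x)*D = - (rc e*d) by rewrite h2 mulNr divfK.
 have ->: Q.[N x]-y0=rc (1-e)*d+(N x-x)^+2*g.[(N x)%:P].[x].
 by rewrite h5 h6 rcB rc1 /d; ring.
 apply: nmD_le; rewrite nmM nm_rc ger0_norm; last lr e2.
 rewrite h2 nmM nmX nmN.
 have h3: nm (rc e*d/D)^+2*nm g.[(N x)%:P].[x]<=(e*nm d/m)^+2*G.
 apply: ler_pM; rewrite ?exprn_ge0 ?nm_ge0 ?hG //.
 by rewrite ler_pXn2r ?nnegrE ?nm_ge0 // divr_ge0 ?mulr_ge0 ?nm_ge0 // ltW.
 have h4: (e*nm d/m)^+2*G<=e/2*nm d.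
 have ->: (e*nm d/m)^+2*G=(e*nm d)*(e*nm d*G)/m^+2 by field; lr m0.
 rewrite ler_pdivrMr ?exprn_gt0 //.
 have nd := nm_ge0 d; have ed: 0<=e*nm d by rewrite mulr_ge0 // ltW.
 have : e*nm d*G<=m^+2/2.
 have : e*nm d*G<=e*r*G by rewrite ler_wpM2r // ler_wpM2l // ltW.
 lr eG ep.
 by move=> h; have := ler_wpM2l ed h; lr.
 lr h4 h3.
have Nfix x: Q.[x]=y0 -> N x=x by move=> ex; rewrite /N ex subrr mulr0 mul0r subr0.
have Ncont x: nm (Q.[x]-y0)<=r -> {for x, continuous N}.
 move=> hx; have [_ dx] := hS _ hx.
 apply: (@cvgB (Cplx R) (Cplx R) (Cplx R) (nbhs x) _ (fun x => x) (fun x => rc e*(Q.[x]-y0)/Q^`().[x]) x); first exact: (fun A hA => hA).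
 apply: cvgM; last by apply: cvgV => //; exact: poly_continuous.
 by apply: cvgM; [exact: cvg_cst|apply: cvgB; [exact: poly_continuous|exact: cvg_cst]].
have iterA k: exists Ak, [/\ connected Ak, Ak x0, Ak x1 &
 forall x, Ak x -> nm (Q.[x]-y0)<=(1-e/2)^+k*r].
 elim: k => [|k [Ak [cAk Ak0 Ak1 hk]]].
 by exists A; split=> // x /AS; rewrite expr0 mul1r.
 have q0: 0<=1-e/2 by lr e2.
 have hk' x: Ak x -> nm (Q.[x]-y0)<=r.
 move=> /hk h; apply: le_trans h _; rewrite ger_pMl // exprn_ile1 //; lr ep.
 exists (N @` Ak); split.
 - apply: connected_continuous_connected => //.
 apply: continuous_in_subspaceT => x; rewrite inE => /hk'; exact: Ncont.
 - by exists x0 => //; exact: Nfix.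
 - by exists x1 => //; exact: Nfix.
 - move=> _ [x Ax <-]; apply: le_trans (Nlev _ (hk' _ Ax)) _.
 by rewrite exprS -mulrA ler_wpM2l // hk.
have S0: nm (Q.[x0]-y0)<=r by rewrite e0 subrr nm0 ltW.
have [xB0 dx0] := hS _ S0; have mx0 := cmin _ S0.
have n01: 0<nm (x1-x0) by rewrite nm_gt0 subr_eq0 eq_sym.
pose s := Num.min (nm (x1-x0)/2) (m/(2*(G+1))).
have G2: 0<2*(G+1) by lr G0.
have s0: 0<s by rewrite lt_min !divr_gt0.
have s1: s<nm (x1-x0).
 by apply: (@le_lt_trans _ _ (nm (x1-x0)/2)); [rewrite ge_min lexx|lr n01].
have s2: s*(2*(G+1))<=m by rewrite -ler_pdivlMr // ge_min lexx orbT.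
(* A connected set containing both roots meets the circle of radius s around x0, on which Q - y0 is
   bounded below because its derivative at x0 does not vanish. The shrinking levels contradict
   this. *)
have low x: nm (x-x0)=s -> s*(m/2)<=nm (Q.[x]-y0).
 move=> hx; have xB': nm x<=B'.
 by have := nmD (x-x0) x0; rewrite subrK hx /B'; lr s1 xB0 rm0.
 have x0B': nm x0<=B' by rewrite /B'; lr n01 xB0 rm0.
 have ->: Q.[x]-y0=(x-x0)*(Q^`().[x0]+(x-x0)*g.[x%:P].[x0]).
 by rewrite mulrDr mulrA -expr2 -hg e0; ring.
 rewrite nmM hx ler_wpM2l ?(ltW s0) //; have := nmD_ge (Q^`().[x0]) ((x-x0)*g.[x%:P].[x0]).
 by rewrite nmM hx; have := hG _ _ xB' x0B'; nr s2 s0 mx0.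
have q1: `|1-e/2| < 1 by rewrite ltr_norml; lr e2 ep.
have t0: 0<s*(m/2)/r by nneg.
have [k hk]: exists k, (1-e/2)^+k<s*(m/2)/r.
 have /cvgrPdist_lt/(_ _ t0)[k _ hk] := cvg_expr q1.
 exists k; have := hk _ (leqnn k); rewrite /= sub0r normrN => h.
 exact: le_lt_trans (ler_norm _) h.
have [Ak [cAk Ak0 Ak1 hAk]] := iterA k.
have [x Ax hx] := connected_circle cAk Ak0 Ak1 s0 s1.
move: hk; rewrite ltr_pdivlMr // => hk.
by have := hAk _ Ax; have := low _ hx; lr hk.
Qed.

(* A weak form of Smale's mean value inequality: the minimum principle applied to
 [(Q - Q x0) / (X - x0)] on the component of the sublevel set through [x0]. *)
Lemma critical_value_near Q x0 (r B : R) : 0<r -> (1<size Q)%N ->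
 (forall x, nm (Q.[x]-Q.[x0])<=r -> nm x<=B) ->
 2*B*nm Q^`().[x0]<r ->
 exists2 x, nm (Q.[x]-Q.[x0])<=r & Q^`().[x] = 0.
Proof.
move=> r0 sQ hB hd; apply: contrapT => nocrit.
have hS x: nm (Q.[x]-Q.[x0])<=r -> nm x<=B /\ Q^`().[x]!=0.
 by move=> hx; split; [exact: hB|apply/eqP => d0; apply: nocrit; exists x].
have [h eh]: exists h, Q-Q.[x0]%:P=h*('X-x0%:P).
 by apply/factor_theorem; rewrite rootE !hornerE subrr.
have hE x: Q.[x]-Q.[x0]=h.[x]*(x-x0).
 by have := congr1 (horner^~ x) eh; rewrite !hornerE.
have hd0: h.[x0]=Q^`().[x0].
 have := congr1 (fun p => p^`().[x0]) eh.
 by rewrite derivB derivC subr0 derivM derivB derivX derivC subr0 !hornerE subrr mulr0 add0r => ->.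
have lev0: nm (Q.[x0]-Q.[x0])<=r by rewrite subrr nm0 ltW.
have [x0B dx0] := hS _ lev0.
have nh0: 0<nm h.[x0] by rewrite hd0 nm_gt0.
(* On the boundary of the sublevel set |h| is at least r/(2B), more than its value |Q'(x0)| at x0.
   The minimum of |h| over the closed component is therefore interior. *)
have far x: nm (Q.[x]-Q.[x0])=r -> nm h.[x]*(2*B) >= r.
 move=> hx; rewrite -hx hE nmM ler_wpM2l ?nm_ge0 //.
 have := hB x; rewrite hx => /(_ (lexx _)) xB; have := nmB x x0; lra.
have [sh|sh] := leqP (size h) 1.
 pose x := x0+rc (r/nm h.[x0]).
 have lx: nm (Q.[x]-Q.[x0])=r.
 rewrite hE (size_le1_const x x0 sh) /x addrC addKr nmM nm_rc gtr0_norm ?divr_gt0 //.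
 by rewrite mulrC divfK // gt_eqF.
 by have := far x lx; rewrite (size_le1_const x x0 sh) hd0; lra.
pose O := [set x | nm (Q.[x]-Q.[x0])<r].
have O0: O x0 by rewrite /O /= subrr nm0.
have Onbhs x: O x -> exists2 e : R, 0<e & forall y, nm (y-x)<e -> O y.
 exact: sublevel_nbhs.
pose U := connected_component O x0.
have US x: U x -> O x by exact: connected_component_sub.
pose K := closure U.
have KS x: K x -> nm (Q.[x]-Q.[x0])<=r.
 move=> Kx; apply: (@sublevel_closed Q Q.[x0] r).
 by apply: closure_subset Kx => y /US /ltW.
have KU x: K x -> O x -> exists2 e : R, 0<e & forall y, nm (y-x)<e -> U y.
 move=> Kx /Onbhs[e e0 he]; exists e => //.
 apply: disc_component => //.
 by have [|y [Uy hy]] := Kx [set y | nm (y-x)<e]; [apply/nbhsC; exists e|exists y].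
have [c Kc cmin]: exists2 c, K c & forall t, K t -> nm h.[c]<=nm h.[t].
 apply: (@poly_min _ _ _ B); first exact: closed_closure.
 by move=> x /KS/hB.
 by exists x0; apply: subset_closure; exact: connected_component_refl.
have K0: K x0 by apply: subset_closure; exact: connected_component_refl.
(* A zero of h in the component would be a second root of Q - Q(x0), excluded by
   [roots_disconnected], or x0 itself with Q'(x0) = 0. A nonzero interior minimum contradicts the
   minimum principle. *)
have hc0: h.[c]!=0.
 apply/eqP => hc; have Qc: Q.[c]=Q.[x0] by apply/eqP; rewrite -subr_eq0 hE hc mul0r.
 have Oc: O c by rewrite /O /= Qc subrr nm0.
 have [e e0 he] := KU _ Kc Oc.
 have Uc: U c by apply: he; rewrite subrr nm0.
 have e01: x0=c.
 apply: (@roots_disconnected Q Q.[x0] r B r0 hS U) => //; first exact: component_connected.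
 by move=> x /US/ltW.
 exact: connected_component_refl.
 by move: hc; rewrite -e01 hd0 => /eqP; rewrite (negbTE dx0).
have := KS _ Kc; rewrite le_eqVlt => /orP[/eqP lc|Oc].
 have := far _ lc; have := cmin _ K0; rewrite hd0.
 have B0: 0<=B by have := nm_ge0 x0; lr x0B.
 have := nm_ge0 h.[c]; nr B0 hd.
have [e e0 he] := KU _ Kc Oc.
have [y hy1 hy2] := poly_no_local_min e0 sh hc0.
have := cmin y (subset_closure (he _ hy1)); lr hy2.
Qed.

End CriticalValues.

(** * Iterates as polynomials and their logarithmic derivatives *)

Section Backward.
Context {R : realType}.
Implicit Types (x y z v : Cplx R) (q Q p : {poly Cplx R}).

Definition iterp q n : {poly Cplx R} := iter n (fun p => q \Po p) 'X.

Lemma iterpE q n x : (iterp q n).[x] = iter n (horner q) x.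
Proof. by elim: n => [|n IH]; rewrite /iterp /= ?hornerX // horner_comp IH. Qed.

Lemma size_iterp q n : ((size (iterp q n)).-1=(size q).-1 ^ n)%N.
Proof.
elim: n => [|n IH]; first by rewrite /iterp /= size_polyX.
by rewrite /iterp iterS size_comp_poly -/(iterp q n) IH expnS.
Qed.

Lemma deriv_iterp q n x : (iterp q n)^`().[x] = \prod_(i<n) q^`().[iter i (horner q) x].
Proof.
elim: n => [|n IH]; first by rewrite big_ord0 /iterp /= derivX hornerC.
have ->: iterp q n.+1=q \Po iterp q n by [].
by rewrite big_ord_recr /= deriv_comp hornerM horner_comp iterpE IH mulrC.
Qed.

Lemma prod_log_deriv (s : seq (Cplx R)) x : (forall z, z \in s -> x != z) ->
 (\prod_(z <- s) ('X-z%:P))^`().[x] =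
 (\prod_(z <- s) ('X-z%:P)).[x] * \sum_(z <- s) (x-z)^-1.
Proof.
elim: s => [|y s IH] h; first by rewrite !big_nil -[1]/(1%:P) derivC horner0 mulr0.
rewrite !big_cons derivM derivXsubC mul1r hornerD !hornerM IH; last first.
 by move=> z zs; apply: h; rewrite inE zs orbT.
have xy: x-y!=0 by rewrite subr_eq0 h // inE eqxx.
rewrite hornerXsubC.
set P := (\prod_(z <- s) ('X-z%:P)).[x]; set S := \sum_(z <- s) (x-z)^-1.
by rewrite mulrDr [X in _=X+_]mulrAC mulfV // mul1r mulrA.
Qed.

Lemma geom_inverse (x y : Cplx R) K : y!=0 -> x != y ->
 (x-y)^-1 = - (\sum_(k<K) x^+k*y^-1^+k.+1)+(x/y)^+K/(x-y).
Proof.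
move=> y0 xy; have d0: x-y!=0 by rewrite subr_eq0.
elim: K => [|K IH]; first by rewrite big_ord0 oppr0 add0r expr0 mul1r.
rewrite big_ord_recr /= {1}IH opprD -addrA; congr (_+_).
rewrite !exprSr !exprMn; move: (x^+K) (y^-1^+K) => X Y.
by field; rewrite y0 d0.
Qed.

Lemma sum_pow_le (X : R) K : 2<=X -> \sum_(k<K) X^+k<=X^+K.
Proof.
move=> X2; elim: K => [|K IH]; first by rewrite big_ord0 expr0 ler01.
rewrite big_ord_recr /= exprS; have : 0<=X^+K by rewrite exprn_ge0 //; lra.
nra.
Qed.

Lemma pow2_small (e : R) : 0<e -> exists K : nat, (2^-1)^+K<=e.
Proof.
move=> e0; have [K _ /(_ K (leqnn K)) h] := @near_infty_natSinv_expn_lt R (PosNum e0).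
by exists K; rewrite exprVn -div1r ltW.
Qed.

(* The power sums of the inverse roots of [Q] are the Taylor coefficients of
 [Q'/Q]; they are small because [Q'/Q] is small near [0], and they decay
 geometrically because the roots avoid the disc of radius [r]. *)
Lemma log_deriv_small (r t e : R) : 0<t -> t<=r/4 -> 0<e -> exists2 d : R, 0<d &
 forall Q, (1<size Q)%N -> (forall x, root Q x -> r<=nm x) ->
 (forall x, nm x<=t -> nm Q^`().[x]<=d*(size Q).-1%:R*nm Q.[x]) ->
 forall x, nm x<=r/4 -> nm Q^`().[x]<=e*(size Q).-1%:R*nm Q.[x].
Proof.
move=> t0 tr e0; have r0: 0<r by lra.
have [K hK] := @pow2_small (e*r/8) ltac:(by rewrite !mulr_gt0).
pose X := r/(2*t); have X2: 2<=X by rewrite /X ler_pdivlMr; lra.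
have XK: 0<X^+K by nneg.
exists (e/2/X^+K); first by rewrite !divr_gt0.
move=> Q sQ hroot hd x hx.
set D : R := (size Q).-1%:R.
have D0: 0<D by rewrite /D ltr0n; move: sQ; case: (size Q) => [|[]].
have [s es] := closed_field_poly_normal Q.
have Q0: Q!=0 by rewrite -size_poly_gt0 ltnW.
have l0: lead_coef Q!=0 by rewrite lead_coef_eq0.
have Ds: D=(size s)%:R.
 by rewrite /D es size_scale // size_prod_XsubC.
have sroot z: z \in s -> r<=nm z.
 by move=> zs; apply: hroot; rewrite es rootZ // root_prod_XsubC.
have nz z: z \in s -> z!=0 by move/sroot => h; rewrite -nm_gt0; lr h tr t0.
pose S k := \sum_(z <- s) z^-1^+k.+1.
pose p : {poly Cplx R} := \poly_(k<K) (S k).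
have logd y: nm y<=r/4 ->
 exists2 rm : Cplx R, Q^`().[y]=Q.[y]*(- p.[y]+rm) & nm rm<=D*((nm y/r)^+K*(2/r)).
 move=> hy; have yz z: z \in s -> y != z.
 by move/sroot => h; apply: contraTneq hy => ->; lr h r0.
 exists (\sum_(z <- s) (y/z)^+K/(y-z)).
 rewrite {1 2}es derivZ !hornerZ prod_log_deriv // -mulrA; congr (_*(_*_)).
 rewrite horner_poly -sumrN.
 have ->: \sum_(k<K)-(S k*y^+k) = \sum_(z <- s)-(\sum_(k<K) y^+k*z^-1^+k.+1).
 rewrite sumrN [RHS]sumrN [in RHS]exchange_big /=; congr (- _); apply: eq_bigr => k _.
 by rewrite /S mulr_suml; apply: eq_bigr => z _; rewrite mulrC.
 rewrite -big_split /=; apply: eq_big_seq => z zs.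
 by apply: geom_inverse; [exact: nz|exact: yz].
 apply: le_trans (nm_sum _ _ _) _; rewrite Ds.
 have ->: (size s)%:R*((nm y/r)^+K*(2/r)) = \sum_(z <- s) ((nm y/r)^+K*(2/r)).
 by rewrite big_const_seq count_predT iter_addr_0 mulr_natl.
 rewrite big_seq [leRHS]big_seq; apply: ler_sum => z zs.
 have hz := sroot _ zs; have nz0: 0<nm z by lr hz tr t0.
 rewrite nmf nmX nmf; apply: ler_pM.
 - by nneg.
 - by nneg.
 - apply: lerXn2r; rewrite ?nnegrE ?divr_ge0 ?nm_ge0 ?(ltW r0) //.
 by rewrite ler_wpM2l ?nm_ge0 // lef_pV2.
 - have h: r/2<=nm (y-z) by rewrite nmC; have := nmB_ge z y; lr hz hy r0.
 rewrite -[2]invrK -invfM lef_pV2 ?posrE; [lr h|lr h tr t0|].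
 by nneg.
have Qn0 y: nm y<=r/4 -> 0<nm Q.[y].
 move=> hy; rewrite nm_gt0; apply/negP => /eqP e1.
 by have := hroot y; rewrite rootE e1 eqxx => /(_ isT); lr hy r0.
pose d' := e/2/X^+K*D+D*((t/r)^+K*(2/r)).
have pt y: nm y<=t -> nm p.[y]<=d'.
 move=> hy; have hy': nm y<=r/4 by lr hy tr.
 have [rm e1 hrm] := logd y hy'.
 have := hd y hy; rewrite e1 nmM mulrC ler_pM2r ?Qn0 // => h1.
 have ->: p.[y]=rm-(- p.[y]+rm) by ring.
 apply: nmB_le; rewrite addrC /d' lerD //.
 apply: le_trans hrm _; rewrite ler_wpM2l ?(ltW D0) // ler_wpM2r ?divr_ge0 ?(ltW r0) //.
 apply: lerXn2r; rewrite ?nnegrE ?divr_ge0 ?nm_ge0 ?(ltW r0) ?(ltW t0) //.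
 by rewrite ler_wpM2r // invr_ge0 ltW.
have d'0: 0<=d' by have := pt 0; rewrite nm0 => /(_ (ltW t0)); have := nm_ge0 p.[0]; lr.
have px: nm p.[x]<=d'*X^+K.
 rewrite horner_poly; apply: le_trans (nm_sum _ _ _) _.
 apply: le_trans (_ : \sum_(k<K) d'*X^+k<=_); last first.
 by rewrite -mulr_sumr ler_wpM2l // sum_pow_le.
 apply: ler_sum => k _; rewrite nmM nmX.
 have ->: X^+k=(2/t)^+k*(r/4)^+k.
 by rewrite -exprMn; congr (_^+_); rewrite /X; field; lr t0.
 rewrite mulrA; apply: ler_pM; rewrite ?exprn_ge0 ?nm_ge0 //.
 by have := poly_coef_bound k t0 pt; rewrite coef_poly ltn_ord.
 by apply: lerXn2r; rewrite ?nnegrE ?nm_ge0 //; lr r0.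
have [rm e1 hrm] := logd x hx.
rewrite e1 nmM mulrC ler_wpM2r ?nm_ge0 //.
apply: nmD_le; rewrite nmN.
have h1: d'*X^+K=e/2*D+D*((2^-1)^+K*(2/r)).
 rewrite /d' mulrDl; congr (_+_).
 by field; rewrite gt_eqF.
 rewrite -mulrA -mulrA [2/r*_]mulrC !mulrA -[D*_*_]mulrA -exprMn; congr (_*_^+_*_/_).
 by rewrite /X; field; lr tr t0.
have h2: D*((nm x/r)^+K*(2/r))<=D*((2^-1)^+K*(2/r)).
 rewrite ler_wpM2l ?(ltW D0) // ler_wpM2r ?divr_ge0 ?(ltW r0) //.
 apply: lerXn2r; rewrite ?nnegrE ?divr_ge0 ?nm_ge0 ?(ltW r0) //.
 by rewrite ler_pdivrMr; lr hx r0.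
have h3: D*((2^-1)^+K*(2/r))<=D*(e/4).
 rewrite ler_wpM2l ?(ltW D0) // mulrA ler_pdivrMr //; lr hK.
lr h3 h2 h1 hrm px.
Qed.

(** Euler's polygon with N steps: the second-order Taylor terms are absorbed by enlarging L to L+1,
    which is possible because |Q| stays above [m] on the segment. *)
Lemma poly_gronwall Q (L m : R) : 0<=L -> 0<m ->
 (forall t : R, 0<=t<=1 -> nm Q^`().[rc t]<=L*nm Q.[rc t] /\ m<=nm Q.[rc t]) ->
 nm Q.[1]<=nm Q.[0]*expR (L+1).
Proof.
move=> L0 m0 h; have [g hg] := poly_taylor2 Q.
have [G G0 hG] := poly2_bounded g 1.
have [N [N0 hN]] := @invn_small R (m/(G+1)) ltac:(by rewrite divr_gt0 //; lra).
have {hN} := hN N (leqnn N); rewrite ler_pdivlMr; last lra.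
have Np: 0<(N%:R : R) by rewrite ltr0n.
set d := N%:R^-1 => hd; have d0: 0<d by rewrite invr_gt0.
have Nd: N%:R*d = 1 by rewrite mulfV // gt_eqF.
have step k: (k<=N)%N -> nm Q.[rc (k%:R*d)]<=nm Q.[0]*expR ((L+1)*d)^+k.
 elim: k => [|k IH] kN; first by rewrite mul0r rc0 expr0 mulr1.
 have kd: 0<=k%:R*d by nneg.
 have kd1: k.+1%:R*d<=1.
 by via (N%:R*d); [rewrite ler_pM2r // ler_nat|rewrite Nd].
 have kd2: k.+1%:R*d=k%:R*d+d by rewrite -natr1; ring.
 have [h1 h2] := h (k%:R*d) ltac:(apply/andP; split; lr kd kd1 d0).
 set x := rc (k%:R*d) in h1 h2 IH; set y := rc (k.+1%:R*d).
 have yx: y-x=rc d by rewrite /x /y kd2 rcD addrC addKr.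
 have nx: nm x<=1 by rewrite nm_rc ger0_norm; lr kd1 d0 kd.
 have ny: nm y<=1 by rewrite nm_rc ger0_norm; lr kd1 kd d0.
 have ->: Q.[y]=Q.[x]+(y-x)*Q^`().[x]+(y-x)^+2*g.[y%:P].[x] by rewrite -hg; ring.
 have := hG y x ny nx => hg'.
 via (nm Q.[x]*(1+(L+1)*d)).
 apply: nmD_le; apply: le_trans (lerD (nmD _ _) (lexx _)) _.
 rewrite yx !nmM !nm_rc (gtr0_norm d0).
 have a1: d*nm (Q^`()).[x]<=d*(L*nm Q.[x]) by rewrite ler_wpM2l // ltW.
 have a2: d*d*nm g.[y%:P].[x]<=d * m.
 rewrite -mulrA ler_wpM2l ?(ltW d0) //.
 have := ler_wpM2l (ltW d0) hg'; lr d0 hd.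
 have a3: d * m<=d*nm Q.[x] by rewrite ler_wpM2l // ltW.
 lr a3 a2 a1.
 rewrite exprSr mulrA; apply: ler_pM; [exact: nm_ge0| |by apply: IH; exact: ltnW|exact: expR_ge1Dx].
 by nneg.
have := step N (leqnn N); rewrite Nd rc1 -expRM_natl.
by have ->: N%:R*((L+1)*d)=L+1 by rewrite mulrCA Nd mulr1.
Qed.

End Backward.

(** * Preimages in discs where the iterates are not normal *)

Section PreimagesNear.
Context {R : realType}.
Implicit Types (x y z v : Cplx R) (q Q p : {poly Cplx R}).

Lemma poly_deriv_bound p y (T B : R) : 0<T ->
 (forall x, nm (x-y)<=T -> nm p.[x]<=B) -> nm p^`().[y]<=B*(2/T).
Proof.
move=> T0 hB; have h x: nm x<=T -> nm (p \Po ('X+y%:P)).[x]<=B.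
 by move=> hx; rewrite horner_comp !hornerE; apply: hB; rewrite addrK.
have := poly_coef_bound 1 T0 h; rewrite expr1.
have ->: (p \Po ('X+y%:P))`_1 = p^`().[y]; last by [].
have ->: (p \Po ('X+y%:P))`_1=(p \Po ('X+y%:P))^`().[0].
 by rewrite horner_coef0 coef_deriv mulr1n.
by rewrite deriv_comp derivD derivX derivC addr0 mulr1 horner_comp !hornerE.
Qed.

Lemma ex_natge (X : R) : exists n : nat, X<=n%:R.
Proof.
exists (Num.bound `|X|); apply: le_trans (ler_norm X) _.
by apply: ltW; apply: archi_boundP.
Qed.

(** A quantitative substitute for Montel's theorem. Were v omitted on the disc, q^n - v would have
    no zero there, and by [log_deriv_small] its logarithmic derivative would be a small multiple of
    the degree. Integrated from [xc], near which the iterates stay bounded and away from v, to [xe],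
    this contradicts the escape of [xe], which is exponential in the degree. *)
Lemma preimage_in_disc q xc xe v (r t B m k : R) (N n1 : nat) :
 (2<size q)%N -> 0<t -> 8*t<=r -> 0<m -> nm (xe-xc)<=r/4 -> 0<k ->
 (forall n x, (N<=n)%N -> nm (x-xc)<=2*t ->
 nm (iter n (horner q) x)<=B /\ m<=nm (iter n (horner q) x-v)) ->
 (forall n, 2^+((size q).-1 ^ n)<=k*nm (iter (n1+n)%N (horner q) xe)) ->
 exists n x, nm (x-xc)<r /\ iter n (horner q) x=v.
Proof.
move=> sq t0 tr m0 hxe k0 hin hout; apply: contrapT => nopre.
set d := (size q).-1 in hout *.
have d2: (2<=d)%N by rewrite /d; move: sq; case: (size q) => [|[|[]]].
have r0: 0<r by lra.
have B0: 0<=B.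
 have [h _] := hin N xc (leqnn _) ltac:(rewrite subrr nm0; lra).
 exact: le_trans (nm_ge0 _) h.
pose Bv := B+nm v+1.
have nv := nm_ge0 v.
have Bv0: 0<Bv by rewrite /Bv; lra.
pose dn1 : R := (d ^ n1)%:R.
have dn10: 0<dn1 by rewrite ltr0n expn_gt0 (leq_trans _ d2).
have l2: 0<ln (2 : R) by rewrite ln_gt0 // ltr1n.
(* g is the escape rate of [xe] per unit of degree: q^n(xe) is at least of order exp (g d^n). The
   slope e below only permits growth by exp (g d^n / 2). *)
pose g := ln 2/dn1; have g0: 0<g by rewrite divr_gt0.
pose e := g/(2*(nm (xe-xc)+1)).
have nx := nm_ge0 (xe-xc).
have e0: 0<e by rewrite divr_gt0 // mulr_gt0; lr nx.
have xe_e: nm (xe-xc)*e<=g/2.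
 rewrite /e mulrA ler_pdivrMr; last lr nx.
 have ->: g/2*(2*(nm (xe-xc)+1))=g*(nm (xe-xc)+1) by field.
 by rewrite mulrC ler_wpM2l ?(ltW g0) //; lr.
have [dl dl0 hdl] := @log_deriv_small R r t e t0 ltac:(lr tr t0) e0.
pose Q n : {poly Cplx R} := (iterp q n \Po ('X+xc%:P))-v%:P.
have QE n x: (Q n).[x] = iter n (horner q) (x+xc)-v.
 by rewrite /Q !hornerE horner_comp iterpE !hornerE.
have szQ n: (size (Q n)).-1=(d ^ n)%N.
 have h: (size (iterp q n \Po ('X+xc%:P))).-1=(d ^ n)%N.
 by rewrite size_comp_poly size_iterp size_XaddC muln1.
 have dn0: (0<d ^ n)%N by rewrite expn_gt0 (leq_trans _ d2).
 rewrite /Q size_polyDl // size_polyN size_polyC.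
 apply: (@leq_ltn_trans 1); first by case: (v!=0).
 by rewrite -ltn_predRL h.
have szQ1 n: (1<size (Q n))%N.
 have dn0: (0<d ^ n)%N by rewrite expn_gt0 (leq_trans _ d2).
 by move: (szQ n) dn0; case: (size (Q n)) => [|[|s]] //= <-.
have Qroot n x: root (Q n) x -> r<=nm x.
 rewrite rootE QE subr_eq0 => /eqP e1; rewrite leNgt; apply/negP => xr.
 by apply: nopre; exists n, (x+xc); rewrite addrK.
have big n: (N<=n)%N -> (n1<=n)%N -> 2*Bv/t<=dl*(d ^ n)%:R * m ->
 expR (g/2*(d ^ n)%:R)<=k*Bv*(1+expR 1)*expR (g/2*dn1).
 move=> Nn nN hn; set D : R := (d ^ n)%:R in hn *.
 have Qb x: nm x<=2*t -> nm (Q n).[x]<=Bv.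
 move=> hx; rewrite QE; have [h1 _] := hin n (x+xc) Nn ltac:(by rewrite addrK).
 by apply: nmB_le; rewrite /Bv; lr h1.
 have hd x: nm x<=t -> nm (Q n)^`().[x]<=dl*(size (Q n)).-1%:R*nm (Q n).[x].
 move=> hx; rewrite szQ -/D.
 apply: le_trans (_ : dl*D * m<=_); last first.
 rewrite ler_wpM2l ?mulr_ge0 ?(ltW dl0) // QE.
 by have [] := hin n (x+xc) Nn ltac:(rewrite addrK; lr hx t0).
 apply: le_trans hn; have := @poly_deriv_bound (Q n) x t Bv t0.
 move=> h; have := h ltac:(move=> y hy; apply: Qb; have := nmD (y-x) x; rewrite subrK; lr hy hx).
 lr.
 have he := hdl (Q n) (szQ1 n) (@Qroot n) hd.
 have [c /= hc cmin]: exists2 c, [set x | nm (x - 0)<=r/4] c &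
 forall x, [set x | nm (x - 0)<=r/4] x -> nm (Q n).[c]<=nm (Q n).[x].
 apply: (@poly_min _ _ _ (r/4)); first exact: closed_disc.
 by move=> x /=; rewrite subr0.
 by exists (0 : Cplx R); rewrite /mkset subrr nm0; lr r0.
 rewrite subr0 in hc.
 have mc: 0<nm (Q n).[c].
 rewrite nm_gt0; apply/negP => /eqP e1; have := @Qroot n c; rewrite rootE e1 eqxx => /(_ isT); lr hc r0.
 pose x1 := xe-xc.
 have gr := @poly_gronwall R ((Q n) \Po (x1 *: 'X)) (g/2*D) (nm (Q n).[c]) ltac:(by rewrite mulr_ge0 // divr_ge0 // ltW) mc.
 have {gr}: nm ((Q n) \Po (x1 *: 'X)).[1]<=nm ((Q n) \Po (x1 *: 'X)).[0]*expR (g/2*D+1).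
 apply: gr => s /andP[s0 s1]; rewrite deriv_comp hornerM !horner_comp derivZ derivX !hornerZ !hornerX hornerC mulr1.
 have hs: nm (x1*rc s)<=r/4.
 rewrite nmM nm_rc ger0_norm //; rewrite /x1; nr s1 nx hxe.
 split; last by apply: cmin => /=; rewrite subr0.
 rewrite nmM; have := he _ hs; rewrite szQ -/D => h.
 have q0 := nm_ge0 (Q n).[x1*rc s].
 via (e*D*nm (Q n).[x1*rc s]*nm x1); first by rewrite ler_wpM2r ?nm_ge0.
 have ->: e*D*nm (Q n).[x1*rc s]*nm x1=(nm x1*e)*(D*nm (Q n).[x1*rc s]) by ring.
 by rewrite -[g/2*D*_]mulrA ler_wpM2r // mulr_ge0.
 rewrite !horner_comp !hornerZ !hornerX mulr1 mulr0 !QE add0r subrK => h1.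
 have Q0: nm (iter n (horner q) xc-v)<=Bv.
 by have := Qb 0; rewrite QE nm0 add0r; apply; lr t0.
 have E0 := expR_gt0 (g/2*D); have E1 := expR_gt0 (1 : R).
 have F0: 1<=expR (g/2*dn1).
 by rewrite -expR0 ler_expR mulr_ge0 ?divr_ge0 // ltW.
 have h2 := hout (n-n1)%N; rewrite subnKC // in h2.
 have e2: (2 : R)^+(d ^ (n-n1))=expR (g/2*D)*expR (g/2*D).
 rewrite -expRD -{1}(@lnK R 2) ?posrE // -expRM_natl; congr expR.
 have ->: (d ^ (n-n1))%:R=D/dn1.
 by rewrite /D /dn1 -{2}(subnK nN) expnD natrM mulfK // gt_eqF.
 by rewrite /g; field; rewrite gt_eqF.
 rewrite e2 in h2.
 have h3: nm (iter n (horner q) xe)<=Bv*expR 1*expR (g/2*D)+Bv.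
 have := nmB_ge (iter n (horner q) xe) v; rewrite expRD in h1.
 have : nm (iter n (horner q) xc-v)*(expR (g/2*D)*expR 1)<=Bv*(expR (g/2*D)*expR 1).
 by rewrite ler_wpM2r // mulr_ge0.
 by rewrite /Bv; lr h1 B0.
 have E2: 1<=expR (g/2*D).
 by rewrite -expR0 ler_expR mulr_ge0 ?divr_ge0 // ltW.
 have h4: expR (g/2*D)*expR (g/2*D)<=(k*Bv*(1+expR 1))*expR (g/2*D).
 apply: le_trans h2 _; rewrite -[leRHS]mulrA -mulrA ler_wpM2l ?(ltW k0) //.
 have := ler_wpM2l (ltW Bv0) E2; lr h3.
 rewrite ler_pM2r // in h4; apply: le_trans h4 _.
 rewrite ler_peMr // mulr_ge0 ?mulr_ge0 ?(ltW k0) ?(ltW Bv0) //; lra.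
pose C := k*Bv*(1+expR 1)*expR (g/2*dn1).
pose X := 2*C/g+2*Bv/t/(dl * m)+1.
have [n0 hn0]: exists n0 : nat, X<=n0%:R.
 exact: ex_natge.
pose n := maxn N (maxn n1 n0).
have hD: X<=(d ^ n)%:R.
 apply: le_trans hn0 _; rewrite ler_nat; apply: (@leq_trans n); first by rewrite /n !leq_max leqnn !orbT.
 exact/ltnW/ltn_expl.
have D1: 2*Bv/t<=dl*(d ^ n)%:R * m.
 have : 2*Bv/t/(dl * m)<=(d ^ n)%:R.
 apply: le_trans hD; rewrite /X; have : 0<=2*C/g.
 by nneg.
 lr.
 by rewrite ler_pdivrMr ?mulr_gt0 //; lr.
have := big n (leq_maxl _ _) _ D1; rewrite -/C /n !leq_max leqnn orbT -/n => /(_ isT) h.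
have := expR_ge1Dx (g/2*(d ^ n)%:R) => h2.
have h3: 2*C/g<(d ^ n)%:R.
 apply: lt_le_trans hD; rewrite /X; have : 0<=2*Bv/t/(dl * m).
 by nneg.
 lr.
by rewrite ltr_pdivrMr // in h3; lr h3 h2 h.
Qed.

Lemma poly_escape q : (2<size q)%N -> exists2 rk : R*R, 0<rk.2 &
 forall x, rk.1<=nm x -> forall n,
 2^+((size q).-1 ^ n)<=rk.2*nm (iter n (horner q) x).
Proof.
move=> sq; set d := (size q).-1.
have d2: (2<=d)%N by rewrite /d; move: sq; case: (size q) => [|[|[]]].
have szq: size q=d.+1 by rewrite prednK // (leq_trans _ sq).
set l := lead_coef q; have l0: 0<nm l.
 by rewrite nm_gt0 lead_coef_eq0 -size_poly_gt0 (leq_trans _ sq).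
pose C := \sum_(i<d) nm q`_i.
have C0: 0<=C by apply: sumr_ge0 => i _; exact: nm_ge0.
pose k := Num.min 1 (nm l/2).
have k0: 0<k by rewrite lt_min ltr01 divr_gt0.
have k1: k<=1 by rewrite ge_min lexx.
have kl: k<=nm l/2 by rewrite ge_min lexx orbT.
pose r := 1+2*C/nm l+2/k.
have r1: 1<=r.
 by rewrite /r; have := divr_ge0 (mulr_ge0 (ler0n R 2) C0) (ltW l0); have := divr_ge0 (ler0n R 2) (ltW k0); lra.
exists (r, k) => //= x hx.
have low y: r<=nm y -> nm l/2*nm y^+d<=nm q.[y].
 move=> hy; have y1: 1<=nm y by lra.
 have ->: q.[y]=l*y^+d + \sum_(i<d) q`_i*y^+i.
 by rewrite horner_coef szq big_ord_recr /= addrC /l /lead_coef szq.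
 have h1: nm (\sum_(i<d) q`_i*y^+i)<=C*nm y^+d.-1.
 apply: le_trans (nm_sum _ _ _) _; rewrite /C mulr_suml; apply: ler_sum => i _.
 rewrite nmM nmX ler_wpM2l ?nm_ge0 //; apply: ler_weXn2l => //.
 by rewrite -ltnS (ltn_predK (ltn_ord i)).
 have h2: C*nm y^+d.-1<=nm l/2*nm y^+d.
 rewrite -{2}(@prednK d) ?(leq_trans _ d2) // exprS mulrA ler_wpM2r ?exprn_ge0 ?nm_ge0 //.
 have : 2*C/nm l<=nm y.
 by apply: le_trans hy; rewrite /r; have := divr_ge0 (ler0n R 2) (ltW k0); lra.
 by rewrite ler_pdivrMr //; lr.
 by have := nmD_ge (l*y^+d) (\sum_(i<d) q`_i*y^+i); rewrite nmM nmX; lr h2 h1.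
have kr: 2<=k*r.
 rewrite /r; have ->: k*(1+2*C/nm l+2/k)=k+k*(2*C/nm l)+2.
 by field; rewrite !gt_eqF.
 have := mulr_ge0 (ltW k0) (divr_ge0 (mulr_ge0 (ler0n R 2) C0) (ltW l0)); lra.
have step y: r<=nm y -> (k*nm y)^+d<=k*nm q.[y].
 move=> hy; have := low y hy => h.
 rewrite exprMn -{1}(@prednK d) ?(leq_trans _ d2) // exprS -mulrA ler_wpM2l ?(ltW k0) //.
 apply: le_trans h; rewrite ler_wpM2r ?exprn_ge0 ?nm_ge0 //.
 apply: le_trans kl; rewrite -[leRHS]expr1; apply: ler_wiXn2l => //; first exact: ltW.
 by rewrite -ltnS prednK (leq_trans _ d2).
suff H n : r<=nm (iter n (horner q) x) /\ 2^+(d ^ n)<=k*nm (iter n (horner q) x).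
 by move=> n; have [] := H n.
elim: n => [|n [h1 h2]].
 by rewrite /= expn0 expr1; split=> //; apply: le_trans kr _; rewrite ler_wpM2l // ltW.
have h3 := step _ h1; set y := iter n _ x in h1 h2 h3 *.
have h4: 2^+(d ^ n.+1)<=k*nm q.[y].
 apply: le_trans h3; rewrite expnSr exprM; apply: lerXn2r => //; rewrite nnegrE ?exprn_ge0 //.
 by nneg.
split; last exact: h4.
have ky: 2<=k*nm y by apply: le_trans kr _; rewrite ler_wpM2l // ltW.
have h5: k*nm y<=(k*nm y)^+d.
 by rewrite -[leLHS]expr1; apply: ler_weXn2l; [lr ky|apply: ltnW].
have : k*nm y<=k*nm q.[y] by lr h5 h3.
by rewrite ler_pM2l // /= -/y; lr h1.
Qed.

End PreimagesNear.

(** * Coordinates and dynamics at a parabolic fixed point *)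

Section ParabolicPoint.
Context {R : realType}.
Implicit Types (u v w x y : Cplx R) (q : {poly Cplx R}).

Definition fatou_clauses (F : Cplx R -> Cplx R) (g : Cplx R) (Phi : Cplx R -> Cplx R) (R1 D : R) :=
 [/\ forall u, R1<=re u -> forall k, re u+k%:R/2<=re (iter k F u),
 forall u k, R1<=re u -> (0<k)%N ->
 nm (iter k F u-k%:R+g*rc (ln k%:R)-Phi u)<=D*(1+nm u) * isq k,
 forall t u v, R1<=t -> t<=re u -> t<=re v ->
 nm (Phi u-Phi v-(u-v))<=D/t*nm (u-v) &
 forall u, R1<=re u -> Phi (F u) = Phi u+1].

Lemma fatou_clausesW F g Phi R1 R2 D : R1<=R2 ->
 fatou_clauses F g Phi R1 D -> fatou_clauses F g Phi R2 D.
Proof.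
move=> h [h1 h2 h3 h4]; split.
- by move=> u hu k; apply: h1; apply: le_trans hu.
- by move=> u k hu; apply: h2; apply: le_trans hu.
- by move=> t u v ht; apply: h3; apply: le_trans ht.
- by move=> u hu; apply: h4; apply: le_trans hu.
Qed.

(* A polynomial [q] with a parabolic fixed point [w0] which becomes
 [x + x^2 + a x^3 + ...] in the coordinate [x = mu (w - w0)]; [Phi] is the
 attracting Fatou coordinate, and [Chi] the Fatou coordinate of the inverse
 branch [G], both in the coordinate [u = -1/x] (with a sign change for [Chi]). *)
Record pdata q (w0 mu a : Cplx R) := PData {
 pd_h : {poly Cplx R};
 pd_G : Cplx R -> Cplx R;
 pd_Phi : Cplx R -> Cplx R;
 pd_Chi : Cplx R -> Cplx R;
 pd_R : R; pd_D : R; pd_M : R;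
 pd_mu : mu!=0;
 pd_conj : forall x, mu*(q.[w0+x/mu]-w0)=(parab a pd_h).[x];
 pd_R1 : 10<=pd_R;
 pd_D0 : 0<=pd_D;
 pd_M0 : 0<=pd_M;
 pd_inf : near_translation_infty (at_infty (parab a pd_h)) (a - 1) pd_M pd_R;
 pd_nz : forall u, pd_R<=nm u -> (parab a pd_h).[- u^-1]!=0 /\
 nm (at_infty (parab a pd_h) u-u)<=2;
 pd_attr : fatou_clauses (at_infty (parab a pd_h)) (a - 1) pd_Phi pd_R pd_D;
 pd_rep : fatou_clauses pd_G (- (a - 1)) pd_Chi pd_R pd_D;
 pd_inv : forall u, pd_R<=re u -> at_infty (parab a pd_h) (- pd_G u) = - u /\
 nm (pd_G u-u - 1)<=1/2 }.

Lemma pdata_exists q w0 mu a h : mu!=0 ->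
 (forall x, mu*(q.[w0+x/mu]-w0)=(parab a h).[x]) -> inhabited (pdata q w0 mu a).
Proof.
move=> mu0 hc; have [M [R0 [M0 R01 hF hnz]]] := at_infty_near_translation a h.
have [Phi [R1 [D1 [[R01' D10] a1 a2 a3 a4]]]] := fatou_coordinate M0 R01 (near_translation_inftyW hF).
have [G [M' [R2 [M'0 R02 hG hinv]]]] := inverse_branch M0 R01 hF.
have [Chi [R3 [D2 [[R23 D20] b1 b2 b3 b4]]]] := fatou_coordinate M'0 (le_trans R01 R02) hG.
pose RR := R1+R3+10.
have [r1 r3 r10]: [/\ R1<=RR, R3<=RR & 10<=RR] by rewrite /RR; split; lr R23 R02 R01 R01'.
have DD1: D1<=D1+D2 by lr D20. have DD2: D2<=D1+D2 by lr D10.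
constructor; apply: (@PData q w0 mu a h G Phi Chi RR (D1+D2) M) => //.
- by nneg.
- split=> [u hu|t u v ht hu hv]; [apply: hF.1; lr hu r1 R01'|apply: hF.2 => //; lr ht r1 R01'].
- by move=> u hu; apply: hnz; lr hu r1 R01'.
- apply: (fatou_clausesW r1); split=> // [u k hu k0|t u v ht hu hv].
 apply: le_trans (a2 _ _ hu k0) _; rewrite ler_wpM2r ?isq_ge0 // ler_wpM2r //.
 by nneg.
 apply: le_trans (a3 _ _ _ ht hu hv) _; rewrite ler_wpM2r ?nm_ge0 // ler_wpM2r // invr_ge0; lr ht R01' R01.
- apply: (fatou_clausesW r3); split=> // [u k hu k0|t u v ht hu hv].
 apply: le_trans (b2 _ _ hu k0) _; rewrite ler_wpM2r ?isq_ge0 // ler_wpM2r //.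
 by nneg.
 apply: le_trans (b3 _ _ _ ht hu hv) _; rewrite ler_wpM2r ?nm_ge0 // ler_wpM2r // invr_ge0; lr ht R23 R02 R01.
- by move=> u hu; apply: hinv; lr hu r3 R23.
Qed.

Section Theory.
Variables (q : {poly Cplx R}) (w0 mu a : Cplx R) (d : pdata q w0 mu a).

Definition uc w := - (mu*(w-w0))^-1.
Definition wc u := w0-(mu*u)^-1.
Definition pF := at_infty (parab a (pd_h d)).
Local Notation Rd := (pd_R d).

Let mu0 := pd_mu d.

Lemma nmmu : 0<nm mu. Proof. by rewrite nm_gt0 mu0. Qed.

Lemma ucK w : w != w0 -> wc (uc w)=w.
Proof.
move=> h; have h': w-w0!=0 by rewrite subr_eq0.
by rewrite /wc /uc; field; rewrite mu0 h'.
Qed.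

Lemma wcK u : u!=0 -> uc (wc u)=u.
Proof.
move=> u0; rewrite /uc /wc.
have ->: mu*(w0-(mu*u)^-1-w0) = - u^-1 by field; rewrite u0 mu0.
by rewrite invrN opprK invrK.
Qed.

Lemma wc_dist u : nm (wc u-w0)=(nm mu*nm u)^-1.
Proof. by rewrite /wc addrC addKr nmN nmV nmM. Qed.

Lemma uc_neq0 w : 0<nm (uc w) -> w != w0.
Proof.
by move=> h; apply: contraTneq h => ->; rewrite /uc subrr mulr0 invr0 oppr0 nm0 ltxx.
Qed.

Lemma wc_sub u v : u!=0 -> v!=0 -> wc u-wc v=(u-v)/(mu*(u*v)).
Proof. by move=> u0 v0; rewrite /wc; field; rewrite u0 v0 mu0. Qed.

Lemma uc_sub x y : x != w0 -> y != w0 -> uc x-uc y=(x-y)/(mu*((x-w0)*(y-w0))).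
Proof.
move=> x0 y0; have h1: x-w0!=0 by rewrite subr_eq0.
have h2: y-w0!=0 by rewrite subr_eq0.
by rewrite /uc; field; rewrite h1 h2 mu0.
Qed.

Lemma nm_uc w : nm (uc w)=(nm mu*nm (w-w0))^-1.
Proof. by rewrite /uc nmN nmV nmM. Qed.

Lemma Rd_gt0 : 0<Rd. Proof. by have := pd_R1 d; lra. Qed.

Lemma neq0_Rd u : Rd<=nm u -> u!=0.
Proof. by move=> h; rewrite -nm_gt0; have := Rd_gt0; lra. Qed.

Lemma re_Rd u : Rd<=re u -> Rd<=nm u.
Proof. by move=> h; apply: le_trans (re_le u). Qed.

Lemma q_fix : q.[w0]=w0.
Proof.
have := pd_conj d 0; rewrite mul0r addr0 /parab !hornerE /= !expr0n /= !mulr0 !addr0 => /eqP.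
by rewrite mulf_eq0 (negbTE mu0) /= subr_eq0 => /eqP.
Qed.

Lemma iter_fix k : iter k (horner q) w0=w0.
Proof. by elim: k => //= k ->; exact: q_fix. Qed.

Lemma pF_neq0 u : Rd<=nm u -> pF u!=0.
Proof. by move=> h; rewrite /pF /at_infty oppr_eq0 invr_eq0; have [] := pd_nz h. Qed.

Lemma q_wc u : Rd<=nm u -> q.[wc u]=wc (pF u).
Proof.
move=> h; have [f0 _] := pd_nz h; have u0 := neq0_Rd h.
have := pd_conj d (- u^-1); have ->: w0 + - u^-1/mu=wc u.
 by rewrite /wc; field; rewrite u0 mu0.
rewrite /wc /pF /at_infty; set f := _.[- u^-1] in f0 *.
set X := q.[_] => e; have ->: X=w0+f/mu by rewrite -e; field; exact: mu0.
by field; rewrite f0 mu0.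
Qed.

Lemma uc_q w : Rd<=nm (uc w) -> uc q.[w] = pF (uc w).
Proof.
move=> h; have w_n: w != w0 by apply: uc_neq0; have := Rd_gt0; lra.
by rewrite -{1}(ucK w_n) q_wc // wcK // pF_neq0.
Qed.

Lemma pF_step u : Rd<=nm u -> nm (pF u-u)<=2.
Proof. by move=> /pd_nz[]. Qed.

Lemma iter_pF_re u k : Rd<=re u -> re u+k%:R/2<=re (iter k pF u).
Proof. by move=> h; have [h1 _ _ _] := pd_attr d; exact: h1. Qed.

Lemma iter_pF_Rd u k : Rd<=re u -> Rd<=re (iter k pF u).
Proof. by move=> h; have := iter_pF_re k h; have : 0<=(k%:R : R) by []; lra. Qed.

Lemma iter_q_wc u k : Rd<=re u -> iter k (horner q) (wc u)=wc (iter k pF u).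
Proof.
move=> h; elim: k => //= k ->; rewrite q_wc //.
by apply: re_Rd; exact: iter_pF_Rd.
Qed.

(** Since the inverse of 0 is 0, the point w0 has coordinate 0, so neither w0 nor any of its
    preimages belongs to the basin. *)
Definition basin w := exists k, Rd<=re (uc (iter k (horner q) w)).

Lemma uc_iter w k : Rd<=re (uc w) -> uc (iter k (horner q) w) = iter k pF (uc w).
Proof.
move=> h; have w_n: w != w0 by apply: uc_neq0; have := re_Rd h; have := Rd_gt0; lra.
rewrite -{1}(ucK w_n) iter_q_wc // wcK // neq0_Rd // re_Rd //; exact: iter_pF_Rd.
Qed.

Lemma uc_iter_add w k j : Rd<=re (uc (iter k (horner q) w)) ->
 uc (iter (j+k) (horner q) w) = iter j pF (uc (iter k (horner q) w)).
Proof. by move=> h; rewrite iterD uc_iter. Qed.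

Lemma basin_iter w k : basin (iter k (horner q) w) <-> basin w.
Proof.
split=> [[j hj]|[j hj]]; first by exists (j+k)%N; rewrite iterD.
exists j; rewrite -iterD addnC uc_iter_add //; exact: iter_pF_Rd.
Qed.

Lemma basin_wc_cvg u n : Rd<=re u ->
 nm (iter n (horner q) (wc u)-w0)<=(nm mu*(Rd+n%:R/2))^-1.
Proof.
move=> h; rewrite iter_q_wc // wc_dist.
have h1 := iter_pF_re n h; have h2 := re_le (iter n pF u); have h3 := nmmu.
have h4 := Rd_gt0; have h5: 0<=(n%:R : R) by [].
by rewrite lef_pV2 ?posrE ?mulr_gt0 ?ler_pM2l //; lr h2 h1 h h5 h4.
Qed.

Lemma inv_lin_small (c b e : R) : 0<c -> 0<b -> 0<e ->
 exists N, forall n, (N<=n)%N -> (c*(b+n%:R/2))^-1<=e.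
Proof.
move=> c0 b0 e0; have ce: 0<c*e/2 by rewrite divr_gt0 // mulr_gt0.
have [N [N0 hN]] := @invn_small R _ ce.
exists N => n Nn; have n0: (0<n)%N by apply: leq_trans N0 Nn.
have np: 0<(n%:R : R) by rewrite ltr0n.
have := ler_wpM2l (ltW np) (hN _ Nn); rewrite mulfV ?gt_eqF // => h.
rewrite -[_^-1]mul1r ler_pdivrMr; last by rewrite mulr_gt0 //; lra.
have := mulr_gt0 (mulr_gt0 c0 b0) e0; lra.
Qed.

Lemma basin_cvg w : basin w -> forall e : R, 0<e ->
 exists N, forall n, (N<=n)%N -> nm (iter n (horner q) w-w0)<=e.
Proof.
move=> [k hk] e e0; have [N hN] := inv_lin_small nmmu Rd_gt0 e0.
exists (N+k)%N => n hn; rewrite -(subnK (leq_trans (leq_addl N k) hn)) iterD.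
have y_n: iter k (horner q) w != w0 by apply: uc_neq0; have := re_Rd hk; have := Rd_gt0; lra.
rewrite -(ucK y_n); apply: le_trans (basin_wc_cvg _ hk) _.
by apply: hN; rewrite leq_subRL ?(leq_trans (leq_addl N k) hn) // addnC.
Qed.

Lemma basin_neq w : basin w -> w != w0.
Proof.
move=> [k hk]; apply/eqP => e; move: hk; rewrite e iter_fix /uc subrr mulr0 invr0 oppr0 re0.
by have := Rd_gt0; lra.
Qed.

Lemma near_parabolic (T : R) : Rd<=T -> exists2 r : R, 0<r &
 forall w, w != w0 -> nm (w-w0)<r -> basin w \/ re (uc w) <= - T.
Proof.
move=> RT; pose C := nm (a - 1)+pd_M d; pose B := 14*T+4*C+4; have R0 := Rd_gt0.
have C0: 0<=C by rewrite addr_ge0 ?nm_ge0 // pd_M0.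
have B0: 0<B by rewrite /B; lra.
have T10: 10<=T by have := pd_R1 d; lra.
exists ((nm mu*B)^-1); first by rewrite invr_gt0 mulr_gt0 // nmmu.
move=> w w_n hw; have hB: B<nm (uc w).
 have x0: 0<nm (w-w0) by rewrite nm_gt0 subr_eq0.
 rewrite /uc nmN nmV nmM; move: hw.
 rewrite -[nm (w-w0)]invrK ltf_pV2 ?posrE ?invr_gt0 ?mulr_gt0 ?nmmu //.
 by rewrite invfM invrK => h; rewrite mulrC ltr_pdivlMr ?nmmu // mulrC.
have [|hre] := leP (re (uc w)) (- T); [by right|left].
have [N [N0 hN1 hN2]]: exists N : nat, [/\ (0<N)%N, N%:R >= 4*T & N%:R<=4*T+1].
 have t0: 0<=4*T by lra.
 have /andP[h1 h2] := truncn_itv t0.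
 exists (Num.truncn (4*T)).+1; split=> //; first exact: ltW.
 by rewrite -natr1; lra.
have step u: 2*C+T<=nm u -> 1/2<=re (pF u-u).
 move=> hu; have Ru: Rd<=nm u by lra.
 have h1 := (pd_inf d).1 _ Ru; rewrite -/pF in h1.
 have nu: 0<nm u by lr hu C0 R0 RT.
 have h2: pd_M d/nm u^+2<=pd_M d/nm u.
 rewrite ler_wpM2l ?pd_M0 // lef_pV2 ?posrE ?exprn_gt0 // expr2 ler_peMl //; lr nu hu T10 C0.
 have h3: C/nm u<=1/2 by rewrite ler_pdivrMr //; lr hu R0 RT.
 have := re_geN (pF u-(u+1-(a - 1)/u)); have := re_le ((a - 1)/u).
 rewrite nmf !(reB, reD) re1; rewrite mulrDl in h3; lr h3 h2 h1.
set u := uc w in hB hre.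
have key k: (k<=N)%N -> [/\ nm (iter k pF u-u)<=2*k%:R,
 re u+k%:R/2<=re (iter k pF u) & uc (iter k (horner q) w) = iter k pF u].
 elim: k => [|k IH] kN; first by rewrite /= subrr nm0 mul0r mulr0 addr0.
 have [h1 h2 h3] := IH (ltnW kN); set v := iter k pF u in h1 h2 h3 *.
 have kN': (k%:R : R)<=N%:R by rewrite ler_nat ltnW.
 have hv: 2*C+T<=nm v.
 have := nmD_ge u (v-u); have ->: u+(v-u)=v by ring.
 rewrite /B in hB; lr hB kN' h1 hN2 C0 R0 RT.
 have Rv: Rd<=nm v by lr hv C0 RT.
 have ek: (k.+1%:R : R)=k%:R+1 by rewrite -natr1.
 rewrite ek; split.
 - rewrite iterS -/v; have := nm_tri v (pF v) u; have := pF_step Rv; lr h1.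
 - have := step _ hv; rewrite iterS -/v reB; lr h2.
 - by rewrite !iterS uc_q h3.
have [_ h2 h3] := key N (leqnn N).
by exists N; rewrite h3; lr h2 hre hN1 RT.
Qed.

End Theory.
End ParabolicPoint.

(** * Escaping points, preimages and critical points near a parabolic point *)

Section ParabolicBasin.
Context {R : realType}.
Implicit Types (u v w x y : Cplx R).

Lemma poly_ext (p q : {poly Cplx R}) : (forall x, p.[x]=q.[x]) -> p=q.
Proof.
move=> h; apply/eqP; rewrite -subr_eq0; apply/eqP.
apply: (@roots_geq_poly_eq0 _ _ [seq (i%:R : Cplx R) | i <- iota 0 (size (p-q))]).
- by apply/allP => x _; rewrite rootE !hornerE h subrr.
- rewrite map_inj_uniq ?iota_uniq // => i j /eqP; rewrite eqr_nat => /eqP; exact.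
- by rewrite size_map size_iota.
Qed.

(** The growing coefficient n of X^2 is what makes the iterates unbounded near the fixed point:
    uniformly bounded iterates would have bounded coefficients. *)
Lemma iterp_parab (a : Cplx R) h n : exists k : {poly Cplx R},
 iterp (parab a h) n = 'X+n%:R *: 'X^2+k * 'X^3.
Proof.
elim: n => [|n [k IH]]; first by exists 0; rewrite scale0r addr0 mul0r addr0.
set g := iterp (parab a h) n in IH.
pose e : {poly Cplx R} := n%:R%:P + 'X*k.
exists (k+2%:R*e + 'X*e^+2+a%:P*(1 + 'X*e)^+3+(h \Po g) * 'X*(1 + 'X*e)^+4).
have ->: iterp (parab a h) n.+1 = parab a h \Po g by [].
have ->: parab a h \Po g=g+g^+2+a%:P*g^+3+(h \Po g)*g^+4.
 rewrite /parab 3!comp_polyD comp_polyZ (comp_polyM h) comp_polyX !comp_Xn_poly.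
 by rewrite -mul_polyC.
have eg: g = 'X*(1 + 'X*e) by rewrite IH /e -mul_polyC; ring.
have en: n.+1%:R=n%:R+1 :> Cplx R by rewrite -natr1.
set hg := h \Po g; rewrite eg -mul_polyC en polyCD polyC1 /e; ring.
Qed.

Variables (q : {poly Cplx R}) (w0 mu a : Cplx R) (d : pdata q w0 mu a).
Local Notation Rd := (pd_R d).
Local Notation F := (pF d).
Local Notation uc := (uc w0 mu).
Local Notation wc := (wc w0 mu).

Lemma conj_iter n x : mu*(iter n (horner q) (w0+x/mu)-w0) =
 (iterp (parab a (pd_h d)) n).[x].
Proof.
have mu0 := pd_mu d; rewrite iterpE; elim: n => [|n IH].
 by rewrite /= addrC addKr mulrCA mulfV // mulr1.
rewrite !iterS -IH -(pd_conj d); congr (mu*(q.[_]-_)).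
by rewrite mulrAC mulfV // mul1r; ring.
Qed.

Lemma size_q : (2<size q)%N.
Proof.
have mu0 := pd_mu d; rewrite ltnNge; apply/negP => sq.
pose L : {poly Cplx R} := mu^-1 *: 'X+w0%:P.
have e: parab a (pd_h d)=mu *: (q \Po L-w0%:P).
 apply: poly_ext => x; rewrite -(pd_conj d) hornerZ hornerD hornerN hornerC horner_comp.
 by rewrite /L !hornerE; congr (_*(q.[_]-_)); rewrite addrC mulrC.
have sL: (size L<=2)%N.
 by rewrite /L; apply: leq_trans (size_polyD _ _) _; rewrite geq_max (leq_trans (size_scale_leq _ _)) ?size_polyX // (leq_trans (size_polyC_leq1 _)).
have s2: (size (q \Po L)<=2)%N.
 have := size_comp_poly_leq q L => /leq_trans; apply.
 rewrite ltnS; apply: (@leq_trans (1*1)) => //.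
 by apply: leq_mul; [move: sq; case: (size q) => [|[|[]]]|move: sL; case: (size L) => [|[|[]]]].
have := congr1 (fun p : {poly Cplx R} => p`_2) e.
rewrite /parab !coefD coefX coefXn coefZ coefXn coefMXn coefZ coefB coefC /= mulr0 add0r addr0 addr0 subr0.
by rewrite [(q \Po L)`_2]nth_default // mulr0 => /eqP; rewrite oner_eq0.
Qed.

Lemma escape_near (r B : R) : 0<r -> exists x n, nm (x-w0)<r /\ B<nm (iter n (horner q) x).
Proof.
move=> r0; apply: contrapT => h; have m0 := nmmu d; have mu0 := pd_mu d.
pose T := nm mu*r/2; have T0: 0<T by rewrite divr_gt0 // mulr_gt0.
pose C := nm mu*(`|B|+nm w0).
have key n: n%:R<=C*(2/T)^+2.
 have bnd x: nm x<=T -> nm (iterp (parab a (pd_h d)) n).[x]<=C.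
 move=> hx; rewrite -conj_iter nmM /C ler_wpM2l ?nm_ge0 //.
 apply: nmB_le; rewrite lerD2r; apply: le_trans (ler_norm B).
 rewrite leNgt; apply/negP => hB; apply: h; exists (w0+x/mu), n; split=> //.
 rewrite addrC addKr nmf ltr_pdivrMr //; move: hx; rewrite /T; nra.
 have := poly_coef_bound 2 T0 bnd.
 have [k ->] := iterp_parab a (pd_h d) n.
 by rewrite !coefD coefX coefZ coefXn coefMXn /= mulr1 add0r addr0 nm_nat.
have [n hn] := ex_natge (C*(2/T)^+2+1).
have := key n; lra.
Qed.

Lemma uc_near w (U : R) x : nm (uc w)=U -> 0<U -> nm (x-w)<=(2*nm mu*U)^-1 ->
 x != w0 /\ nm (uc x-uc w)<=2*nm mu*U^+2*nm (x-w).
Proof.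
move=> eU U0 hx; have m0 := nmmu d.
have w_n: w != w0 by apply: (uc_neq0 (mu := mu)); rewrite eU.
have ew: nm (w-w0)=(nm mu*U)^-1.
 by rewrite -eU nm_uc invfM invrK mulrA mulVf ?mul1r // gt_eqF.
have mU: 0<nm mu*U by nneg.
have hxw: nm (x-w)<=(nm mu*U)^-1/2.
 by move: hx; rewrite -mulrA invfM mulrC.
have h1: (nm mu*U)^-1/2<=nm (x-w0).
 have := nmB_ge (w-w0) (w-x); rewrite (nmC w x) ew.
 by have ->: w-w0-(w-x)=x-w0; [ring|lra].
have iU: 0<(nm mu*U)^-1 by nneg.
have x_n: x != w0 by rewrite -subr_eq0 -nm_gt0; lra.
split=> //; rewrite (uc_sub d) // nmf !nmM ew ler_pdivrMr; last first.
 by rewrite mulr_gt0 // divr_gt0 // nm_gt0 subr_eq0.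
have ->: 2*nm mu*U^+2*nm (x-w)*(nm mu*(nm (x-w0)*(nm mu*U)^-1)) =
 nm (x-w)*(2*(nm mu*U)*nm (x-w0)) by field; rewrite !gt_eqF.
rewrite ler_peMr ?nm_ge0 //.
have e1: nm mu*U*((nm mu*U)^-1/2) = 1/2 by field; rewrite !gt_eqF.
have := ler_wpM2l (ltW mU) h1; lra.
Qed.

(** Escaping points and points of the attracting petal both accumulate at w0, so the contrast
    required by [preimage_in_disc] is present at every scale. *)
Lemma preimages_near v (r : R) : v != w0 -> 0<r ->
 exists x n, nm (x-w0)<r /\ iter n (horner q) x=v.
Proof.
move=> v0 r0; have m0 := nmmu d; have R0 := Rd_gt0 d.
have [[rr k] /= k0 hesc] := poly_escape size_q.
have [xe [n1 [hxe hxn]]] := @escape_near (r/20) rr ltac:(lra).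
pose T := Rd+1+20/(nm mu*r).
have i0: 0<20/(nm mu*r) by nneg.
have T1: Rd+1<=T by rewrite /T; lra.
have Tr: (nm mu*T)^-1<=r/20.
 rewrite -[_^-1]mul1r ler_pdivrMr; last by rewrite mulr_gt0 //; lra.
 have : 20/(nm mu*r)<=T by rewrite /T; lra.
 by rewrite ler_pdivrMr ?mulr_gt0; lra.
pose xc := wc (rc T); have nT: nm (rc T)=T by rewrite nm_rc gtr0_norm //; lr T1 R0.
have T_n: rc T!=0 by rewrite -nm_gt0 nT; lr T1 R0.
have uxc: uc xc=rc T by rewrite (wcK d).
have dxc: nm (xc-w0)<=r/20 by rewrite wc_dist nT.
pose t := (8*nm mu*T^+2)^-1.
have T2: 0<8*nm mu*T^+2 by rewrite !mulr_gt0 //; lr T1 R0.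
have t0: 0<t by nneg.
have mT: 0<nm mu*T by rewrite mulr_gt0 //; lr T1 R0.
have tT: t<=(nm mu*T)^-1/8.
 rewrite /t -invfM lef_pV2 ?posrE ?mulr_gt0 //; nr T2 T1 R0 mT.
have tin x: nm (x-xc)<=2*t -> Rd<=re (uc x) /\ x != w0.
 move=> hx; have nuxc: nm (uc xc)=T by rewrite uxc.
 have [|x_n hu] := uc_near nuxc ltac:(lr T1 R0) (_ : nm (x-xc)<=_).
 apply: le_trans hx _; rewrite -mulrA invfM mulrC; lr tT t0.
 split=> //; have : 2*nm mu*T^+2*nm (x-xc)<=1/2.
 have tt: 8*nm mu*T^+2*t = 1 by rewrite mulfV // gt_eqF.
 have := ler_wpM2l (ltW T2) hx; lr tt.
 have := re_geN (uc x-uc xc); rewrite reB {2}uxc re_rc; lr hu T1.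
have vw: 0<nm (v-w0) by rewrite nm_gt0 subr_eq0.
pose e := Num.min 1 (nm (v-w0)/2).
have e0: 0<e by rewrite lt_min ltr01 divr_gt0.
have e1: e<=1 by rewrite ge_min lexx.
have e2: e<=nm (v-w0)/2 by rewrite ge_min lexx orbT.
have [N hN] := inv_lin_small m0 R0 e0.
have [||||||n [x [h1 h2]]] := @preimage_in_disc R q xc xe v (r/2) t (nm w0+1) (nm (v-w0)/2) k N n1 size_q t0.
- have := Tr; lr tT r0.
- lr vw.
- by have := nm_tri w0 xe xc; rewrite (nmC w0 xc); lr dxc hxe r0.
- exact: k0.
- move=> n x Nn hx; have [h1 h2] := tin x hx.
 have h3: nm (iter n (horner q) x-w0)<=e.
 by rewrite -(ucK d h2); apply: le_trans (basin_wc_cvg _ h1) _; exact: hN.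
 split; first by have := nmD (iter n (horner q) x-w0) w0; rewrite subrK; lr h3 e1.
 have := nm_tri (iter n (horner q) x) v w0; rewrite (nmC v (iter n (horner q) x)); lr h3 e2.
- by move=> n; rewrite addnC iterD; apply: hesc; exact: ltW.
- by exists x, n; split=> //; have := nm_tri xc x w0; lr h1 dxc r0.
Qed.

(** [pd_Phi] turns iteration into translation and is nearly an isometry, so the iterates themselves
    stretch distances by a bounded factor only. *)
Lemma iso_iter (t : R) u v n : Rd<=t -> 4 * pd_D d<=t -> t<=re u -> t<=re v ->
 nm (iter n F u-iter n F v)<=2*nm (u-v).
Proof.
move=> Rt Dt hu hv; have [h1 _ h3 h4] := pd_attr d; have D0 := pd_D0 d; have R0 := Rd_gt0 d.
have shift x: Rd<=re x -> pd_Phi d (iter n F x) = pd_Phi d x+n%:R.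
 move=> hx; elim: n => [|k IH]; first by rewrite addr0.
 by rewrite iterS h4 ?IH -?addrA ?natr1 //; exact: (iter_pF_Rd k hx).
have grow x: t<=re x -> t<=re (iter n F x).
 move=> hx; have := h1 x ltac:(lr hx Rt) n; have : 0<=(n%:R : R) by []; rewrite -/F; lr hx.
have q1 := h3 t _ _ Rt (grow _ hu) (grow _ hv).
have q2 := h3 t _ _ Rt hu hv.
rewrite !shift ?(le_trans Rt) // in q1.
have e1: pd_Phi d u+n%:R-(pd_Phi d v+n%:R) = pd_Phi d u-pd_Phi d v by ring.
rewrite e1 in q1; set P := pd_Phi d u-_ in q1 q2.
have Dt4: pd_D d/t<=1/4 by rewrite ler_pdivrMr; lr Dt R0 Rt.
set y := iter n F u-_ in q1 *; have ny := nm_ge0 y; have nx := nm_ge0 (u-v).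
have p1: nm (P-y)<=1/4*nm y by apply: le_trans q1 _; rewrite ler_wpM2r.
have p2: nm (P-(u-v))<=1/4*nm (u-v) by apply: le_trans q2 _; rewrite ler_wpM2r.
have := nmB_ge y (y-P); rewrite (nmC y P); have ->: y-(y-P) = P by ring.
have := nmD (P-(u-v)) (u-v); rewrite subrK; lr p2 p1 ny.
Qed.

(** Fatou's theorem, proved without continuing an inverse of the Fatou coordinate. After n steps
    from x0 one has |u| of order n and dw is comparable to du/u^2, so q^n has derivative O(1/n^2) at
    x0, whereas q^n(x0) is the centre of a disc of radius of order 1/n inside the petal. For large n
    [critical_value_near] gives a critical point of q^n with image in that disc; by the chain rule
    its orbit contains a critical point of q. *)
Theorem critical_in_basin : exists2 c, basin d c & q^`().[c] = 0.
Proof.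
have m0 := nmmu d; have R0 := Rd_gt0 d; have R10 := pd_R1 d; have D0 := pd_D0 d.
have [[rr k] /= k0 hesc] := poly_escape size_q.
pose T := Rd+4 * pd_D d+2; have T12: 12<=T by rewrite /T; lra.
have nT: nm (rc T)=T by rewrite nm_rc gtr0_norm; lra.
pose x0 := wc (rc T).
have T_n: rc T!=0 by rewrite -nm_gt0 nT; lra.
have ux0: uc x0=rc T by rewrite (wcK d).
pose C := T+2.
pose B := Num.max 1 rr.
have B1: 1<=B by rewrite le_max lexx.
have [Na hNa] := ex_natge (k*(nm w0+2+(nm mu)^-1)).
have [Nb hNb] := ex_natge (1+2*B*(64*T^+2)*(8*nm mu*C^+2)).
pose n := (maxn 2 (maxn Na Nb)).
have n2: (2<=n)%N by rewrite leq_maxl.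
have nR: 2<=(n%:R : R) by rewrite (ler_nat R 2).
have nNa: (Na%:R : R)<=n%:R by rewrite ler_nat /n !leq_max leqnn orbT.
have nNb: (Nb%:R : R)<=n%:R by rewrite ler_nat /n !leq_max leqnn !orbT.
pose un := iter n F (rc T).
have hT: Rd<=re (rc T) by rewrite re_rc /T; lr D0.
have re_un: T+n%:R/2<=re un by have := iter_pF_re n hT; rewrite re_rc.
have nun: nm un<=C*n%:R.
 have h j: nm (iter j F (rc T))<=T+2*j%:R.
 elim: j => [|j IH]; first by rewrite mulr0 addr0 [iter _ _ _]/= nT.
 have ej: (j.+1%:R : R)=j%:R+1 by rewrite -natr1.
 have Rj: Rd<=nm (iter j F (rc T)) by apply: re_Rd; exact: iter_pF_Rd.
 have := pF_step Rj; have := nmD (F (iter j F (rc T))-iter j F (rc T)) (iter j F (rc T)).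
 by rewrite subrK iterS ej; lr IH.
 by have := h n; rewrite /C -/un; nr nR T12.
have U0: 0<nm un by have := re_le un; lr re_un nR T12.
pose Q := iterp q n.
have Qx0: Q.[x0]=wc un by rewrite iterpE (iter_q_wc (d := d)).
have un_n: un!=0 by rewrite -nm_gt0.
have uQ: uc Q.[x0]=un by rewrite Qx0 (wcK d).
pose r := n%:R/4/(2*nm mu*nm un^+2).
have U2: 0<2*nm mu*nm un^+2 by nneg.
have r0: 0<r by rewrite !divr_gt0 //; lr nR.
have r_le: r<=(2*nm mu*nm un)^-1.
 rewrite /r ler_pdivrMr // expr2 mulrA mulKf; last by rewrite gt_eqF // !mulr_gt0.
 have := re_le un; lr re_un nR T12.
have near y: nm (y-Q.[x0])<=r -> Rd<=re (uc y) /\ nm (y-w0)<=1+(nm mu)^-1.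
 move=> hy; have [|y_n hu] := uc_near (congr1 nm uQ) U0 (_ : nm (y-Q.[x0])<=_).
 exact: le_trans hy r_le.
 rewrite uQ in hu; split.
 have : 2*nm mu*nm un^+2*nm (y-Q.[x0])<=n%:R/4.
 have rr': 2*nm mu*nm un^+2*r=n%:R/4 by rewrite /r mulrC divfK // gt_eqF.
 by have := ler_wpM2l (ltW U2) hy; lr rr'.
 have := re_geN (uc y-un); rewrite reB; rewrite /T in re_un; lr re_un hu nR D0.
 have d1: nm (Q.[x0]-w0)<=(nm mu)^-1/2.
 rewrite Qx0 wc_dist invfM ler_wpM2l ?invr_ge0 ?(ltW m0) //.
 rewrite lef_pV2 ?posrE //; have := re_le un; lr re_un nR T12.
 have d2: r<=(nm mu)^-1/2.
 apply: le_trans r_le _; rewrite [2*_]mulrC -mulrA invfM ler_wpM2l ?invr_ge0 ?(ltW m0) //.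
 rewrite lef_pV2 ?posrE ?mulr_gt0 //; have := re_le un; lr re_un nR T12.
 have := nm_tri Q.[x0] y w0; lr d2 d1 hy.
have dn: (n<=(size q).-1 ^ n)%N.
 apply: ltnW; apply: ltn_expl.
 by move: size_q; case: (size q) => [|[|[]]].
(* Points beyond the escape radius are too far out after n steps to be near the petal; hence B is
   independent of n. *)
have hB y: nm (Q.[y]-Q.[x0])<=r -> nm y<=B.
 move=> /near[_ h1]; rewrite leNgt; apply/negP => h2.
 have := hesc y ltac:(by move: h2; rewrite gt_max => /andP[_ /ltW]) n.
 rewrite -iterpE -/Q => h3.
 have h4: nm Q.[y]<=nm w0+1+(nm mu)^-1.
 by have := nmD (Q.[y]-w0) w0; rewrite subrK; lr h1.
 have h5: (n%:R : R)<2^+((size q).-1 ^ n).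
 by rewrite -natrX ltr_nat; apply: leq_ltn_trans dn (ltn_expl _ _).
 have := ler_wpM2l (ltW k0) h4; lr h5 h3 nNa hNa k0.
have dQ: nm Q^`().[x0]<=64*T^+2/n%:R^+2.
 pose s := (4*nm mu*T^+2)^-1.
 have T2: 0<4*nm mu*T^+2 by rewrite !mulr_gt0 //; lr T12.
 have s0: 0<s by nneg.
 pose K := 8/(nm mu*n%:R^+2).
 have h x: nm (x-x0)<=s -> nm (Q-Q.[x0]%:P).[x]<=K.
 move=> hx; rewrite hornerD hornerN hornerC.
 have nux0: nm (uc x0)=T by rewrite ux0.
 have [||x_n hu] := uc_near nux0 _ (_ : nm (x-x0)<=_); first lr T12.
 have q1: 0<2*nm mu*T by rewrite !mulr_gt0 //; lr T12.
 apply: le_trans hx _; rewrite /s lef_pV2 ?posrE // expr2.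
 have := ler_wpM2l (ltW q1) (_ : 1<=2*T); lr T12.
 have hu1: nm (uc x-uc x0)<=1.
 apply: le_trans hu _; apply: le_trans (ler_wpM2l _ hx) _.
 by rewrite !mulr_ge0 ?nm_ge0; lr T12.
 rewrite /s ler_pdivrMr //; have := T2; lr.
 have hre: T - 1<=re (uc x).
 by have := re_geN (uc x-uc x0); rewrite reB {2}ux0 re_rc; lr hu1.
 have hRx: Rd<=re (uc x) by move: hre; rewrite /T; lr D0.
 have ->: Q.[x]=wc (iter n F (uc x)) by rewrite iterpE -{1}(ucK d x_n) (iter_q_wc (d := d)).
 rewrite Qx0.
 have re1 := iter_pF_re n hRx; set vn := iter n F (uc x) in re1 *.
 have nvn: n%:R/2<=nm vn by have := re_le vn; lr re1 hre T12.
 have nun2: n%:R/2<=nm un by have := re_le un; lr re_un T12.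
 have np: 0<(n%:R : R) by lr nR.
 have vn_n: vn!=0 by rewrite -nm_gt0; lr np nun2 nvn re1 hRx hu1 hu T2.
 rewrite (wc_sub d) // nmf !nmM.
 have iso: nm (vn-un)<=2.
 have := @iso_iter (T - 1) (uc x) (rc T) n ltac:(rewrite /T; lr D0) ltac:(rewrite /T; lr R0) hre ltac:(rewrite re_rc; lr).
 by rewrite -/vn -/un -ux0; lr hu1.
 have vu: 0<nm vn*nm un by rewrite mulr_gt0 // nm_gt0.
 rewrite /K ler_pdivrMr; last by rewrite mulr_gt0.
 have ->: 8/(nm mu*n%:R^+2)*(nm mu*(nm vn*nm un)) = 8*(nm vn*nm un)/n%:R^+2.
 by field; rewrite !gt_eqF.
 rewrite ler_pdivlMr ?exprn_gt0 //.
 have : n%:R^+2<=4*(nm vn*nm un) by nr nun2 nvn nR.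
 have := ler_wpM2r (ltW (exprn_gt0 2 np)) iso; lr.
 have := poly_deriv_bound s0 h; rewrite derivB derivC subr0 => h2; apply: le_trans h2 _.
 rewrite /K /s invrK le_eqVlt; apply/orP; left; apply/eqP; field.
 by rewrite !gt_eqF //; lr nR.
have [||x hx1 hx2] := critical_value_near r0 _ hB.
- have : (2<=(size Q).-1)%N by rewrite size_iterp; apply: leq_trans n2 dn.
 by case: (size Q) => [|[|[]]].
- have np: 0<(n%:R : R) by lr nR.
 have B0: 0<=2*B by lr B1.
 apply: le_lt_trans (ler_wpM2l B0 dQ) _.
 have h1: (8*nm mu*C^+2*n%:R)^-1<=r.
 rewrite /r -[n%:R/4]invrK -invfM lef_pV2 ?posrE; last 2 first.
 - by rewrite !mulr_gt0 // /C; lr T12.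
 - by nneg.
 rewrite invf_div mulrAC ler_pdivrMr // mulrC.
 have : nm un^+2<=(C*n%:R)^+2 by apply: lerXn2r; rewrite ?nnegrE ?mulr_ge0 //; rewrite /C; lr U0 T12.
 by have := m0; nr.
 apply: lt_le_trans h1.
 have C2: 0<8*nm mu*C^+2 by rewrite !mulr_gt0 // /C; lr T12.
 rewrite mulrA; set Y := 8*nm mu*C^+2 in C2 hNb *; set X := 2*B*_ in hNb *.
 rewrite ltr_pdivrMr ?exprn_gt0 //.
 have ->: (Y*n%:R)^-1*n%:R^+2=n%:R/Y by field; rewrite !gt_eqF.
 rewrite ltr_pdivlMr //; lr hNb nNb.
have [Rx _] := near _ hx1.
have bx: basin d x by apply/(basin_iter d x n); exists 0%N; rewrite /= -iterpE.
move: hx2; rewrite deriv_iterp => /eqP /prodf_eq0[i _ /eqP hi].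
by exists (iter i (horner q) x) => //; apply/basin_iter.
Qed.

End ParabolicBasin.

(** * Passage through a parabolic point *)

Section RiemannSums.
Context {R : realType}.

Lemma block_sum (V : zmodType) (f : nat -> V) (n N m : nat) : (n<=N)%N ->
 \sum_(n * m<=i<N * m) f i = \sum_(n<=k<N) \sum_(0<=i<m) f (k * m+i)%N.
Proof.
move=> nN; rewrite -(subnKC nN); elim: (N-n)%N => [|k IH].
 by rewrite addn0 !big_geq.
rewrite addnS big_nat_recr ?leq_addr //= -IH mulSn addnC.
rewrite (@big_cat_nat _ _ _ ((n+k) * m)) ?leq_mul2r ?leq_addr ?orbT //=.
congr (_+_); move: ((n+k) * m)%N => X.
by rewrite -{1}[X]add0n big_addn addKn; apply: eq_bigr => i _; rewrite addnC.
Qed.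

Variables (al : nat) (G : R -> Cplx R) (M L : R).
Hypotheses (al2 : (2<=al)%N) (M0 : 0<=M) (L0 : 0<=L).
Local Notation dd x := (Num.min (x - 1) (al%:R-x)).
Hypothesis G1 : forall x : R, 1<=x -> x<al%:R -> nm (G x)<=M.
Hypothesis G2 : forall x y : R, 1<x -> x<=y -> y<al%:R ->
 nm (G x-G y)<=L*(y-x)/(dd x*dd y).

Definition riemann n : Cplx R := n%:R^-1 * \sum_(n<=k<al*n) G (k%:R/n%:R).

Lemma riemann_term n m k i : (0<n)%N -> (0<m)%N -> (i<m)%N -> (n<k)%N -> (k.+1<al*n)%N ->
 nm (G ((k * m+i)%:R/(n * m)%:R)-G (k%:R/n%:R)) <=
 L*n%:R/(minn (k-n) (al*n-k.+1))%:R^+2.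
Proof.
move=> n0 m0 im nk kn; set x := k%:R/n%:R; set y := _/(n * m)%:R.
have np: 0<(n%:R : R) by rewrite ltr0n.
have mp: 0<(m%:R : R) by rewrite ltr0n.
set j := minn _ _; have j0: (0<j)%N by rewrite /j leq_min !subn_gt0 nk kn.
have jp: 0<(j%:R : R) by rewrite ltr0n.
have im': (i%:R : R)<=m%:R by rewrite ler_nat ltnW.
have xy: y-x = i%:R/(n%:R * m%:R) by rewrite /x /y natrD !natrM; field; rewrite !gt_eqF.
have y1: y-x<=n%:R^-1.
 by rewrite xy invfM mulrCA ler_piMr // ler_pdivrMr // mul1r.
have y0: 0<=y-x by rewrite xy divr_ge0 // mulr_ge0.
have j1: (j<=k-n)%N by rewrite geq_minl.
have j2: (j<=al*n-k.+1)%N by rewrite geq_minr.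
have j1': (j%:R : R)<=k%:R-n%:R by rewrite -natrB ?ler_nat // ltnW.
have j2': (j%:R : R)<=al%:R*n%:R-(k%:R+1).
 by rewrite natr1 -natrM -natrB ?ler_nat // ltnW.
have hx1: j%:R/n%:R<=x - 1.
 by rewrite -[X in _-X](@mulfV _ n%:R) ?gt_eqF // -mulrBl ler_pM2r ?invr_gt0.
have hy2: j%:R/n%:R<=al%:R-y.
 have : j%:R/n%:R<=al%:R-(x+n%:R^-1).
 rewrite /x -[al%:R](@mulfK _ n%:R) ?gt_eqF // -[X in _/_+X]mul1r -mulrDl -mulrBl.
 by rewrite ler_pM2r ?invr_gt0.
 by lr y1.
have jn: 0<j%:R/n%:R :> R by nneg.
have dx: j%:R/n%:R<=dd x by rewrite le_min hx1; lr hy2 y0.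
have dy: j%:R/n%:R<=dd y by rewrite le_min hy2 andbT; lr hx1 y0.
have := @G2 x y ltac:(lr jn hx1) ltac:(lr y0) ltac:(lr jn hy2); rewrite nmC => h; apply: le_trans h _.
have dp: 0<(j%:R/n%:R)^+2 :> R by nneg.
via (L*n%:R^-1/(j%:R/n%:R)^+2).
 apply: ler_pM; rewrite ?mulr_ge0 ?invr_ge0 ?mulr_ge0 //.
 - by apply: ltW; apply: lt_le_trans dx.
 - by apply: ltW; apply: lt_le_trans dy.
 - by rewrite ler_wpM2l.
 rewrite lef_pV2 ?posrE //; last by rewrite mulr_gt0 // (lt_le_trans jn).
 by rewrite expr2; apply: ler_pM => //; apply: ltW.
by apply: eq_ler; field; rewrite !gt_eqF.
Qed.

Lemma min_pow34 (A B t : R) : 0<=A -> 0<=B -> 0<t -> forall X : R, X<=A -> X<=B*t^+4 ->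
 X<=(A+B)*t^+3.
Proof.
move=> A0 B0 t0 X hA hB; have t3: 0<t^+3 by rewrite exprn_gt0.
have [t1|t1] := leP t 1.
 apply: (le_trans hB); rewrite exprSr mulrA; via (B*t^+3).
 by rewrite ler_piMr // mulr_ge0 // ltW.
 by rewrite ler_wpM2r ?(ltW t3) // lerDr.
apply: (le_trans hA); via (A*t^+3).
 by rewrite ler_peMr // exprn_ege1 // ltW.
by rewrite ler_wpM2r ?(ltW t3) // lerDl.
Qed.

Lemma isq_sum (n N : nat) : (0<n)%N -> \sum_(n<=k<N) (k%:R^-1 * isq k : R)<=4 * isq n.
Proof.
move=> n0; have [nN|nN] := leqP n N; last by rewrite big_geq ?(ltnW nN) // mulr_ge0 ?isq_ge0.
suff : \sum_(n<=k<N) (k%:R^-1 * isq k : R)<=4*(isq n-isq N).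
 by have := @isq_ge0 R N; lra.
rewrite -(subnKC nN); elim: (N-n)%N => [|k IH]; first by rewrite addn0 big_geq // subrr mulr0.
rewrite addnS big_nat_recr ?leq_addr //=.
by have := @isq_tele R (n+k) ltac:(by rewrite addn_gt0 n0); lra.
Qed.

Lemma sum_left (V : zmodType) (f : nat -> V) n N :
 \sum_(n<=k<N) f (k-n)%N = \sum_(0<=j<N-n) f j.
Proof.
rewrite -{1}[n]add0n big_addn; apply: eq_bigr => i _; by rewrite addnK.
Qed.

Lemma sum_right (V : zmodType) (f : nat -> V) n N :
 \sum_(n<=k<N) f (N-k.+1)%N = \sum_(0<=j<N-n) f j.
Proof.
rewrite -{1}[n]add0n big_addn big_nat_rev /=; apply: eq_big_nat => i /andP[_ iN]; congr f.
move: iN; clear; lia.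
Qed.

(** A term at j steps from the nearer endpoint is at most 2M, and at most L n/j^2 by the weighted
    Lipschitz bound. Interpolating with exponent 3/4 gives j^(-3/2) n^(3/4), summable in j; division
    by n leaves n^(-1/4), which is [Num.sqrt (isq n)]. *)
Lemma riemann_refine n m : (0<n)%N -> (0<m)%N ->
 nm (riemann (n * m)-riemann n) <=
 (4*M+8*(2*M+L))*Num.sqrt (isq n).
Proof.
move=> n0 m0; have np: 0<(n%:R : R) by rewrite ltr0n.
have mp: 0<(m%:R : R) by rewrite ltr0n.
set r := Num.sqrt (isq n); have r0: 0<r by rewrite sqrtr_gt0 isq_gt0.
have r2: r^+2 = isq n by rewrite sqr_sqrtr ?isq_ge0.
have r4: r^+4=n%:R^-1 by rewrite (exprM r 2 2) r2 expr2 isq_sq.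
have r1: r<=1 by rewrite -[leRHS]sqrtr1 ler_wsqrtr // isq_le1.
pose E k i : Cplx R := G ((k * m+i)%:R/(n * m)%:R)-G (k%:R/n%:R).
have ->: riemann (n * m)-riemann n=(n * m)%:R^-1 * \sum_(n<=k<al*n)
 \sum_(0<=i<m) E k i.
 rewrite /riemann mulnA block_sum ?leq_pmull //; last exact: ltnW.
 under [in RHS]eq_bigr => k _.
 rewrite sumrB sumr_const_nat subn0 -[G _ *+ m]mulr_natl; over.
 rewrite sumrB mulrBr -mulr_sumr; congr (_-_).
 by rewrite mulrA natrM invfM -(mulrA n%:R^-1) mulVf ?mulr1 // -(rc_nat m) rc_eq0 gt_eqF.
pose Hf j : R := if j == 0%N then 2*M else (2*M+L)/r^+3*(j%:R^-1 * isq j).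
have W0: 0<=(2*M+L)/r^+3.
 by nneg.
have Hf0 j: 0<=Hf j.
 by rewrite /Hf; case: ifP => _; [rewrite mulr_ge0|rewrite mulr_ge0 // mulr_ge0 ?isq_ge0].
have EM k i: (n<=k)%N -> (k<al*n)%N -> (i<m)%N -> nm (E k i)<=2*M.
 move=> h1 h2 im; apply: nmB_le.
 have nmp: 0<((n * m)%:R : R) by rewrite ltr0n muln_gt0 n0.
 have G3: nm (G (k%:R/n%:R))<=M.
 by apply: G1; rewrite ?ler_pdivlMr ?mul1r ?ler_nat // ltr_pdivrMr // -natrM ltr_nat.
 have : nm (G ((k * m+i)%:R/(n * m)%:R))<=M.
 apply: G1; first by rewrite ler_pdivlMr // mul1r ler_nat (leq_trans _ (leq_addr _ _)) // leq_mul2r h1 orbT.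
 rewrite ltr_pdivrMr // -natrM ltr_nat mulnA.
 by apply: (@leq_trans (k.+1 * m)); [rewrite mulSn addnC ltn_add2r|rewrite leq_mul2r h2 orbT].
 lr G3.
have EH k i: (n<=k)%N -> (k<al*n)%N -> (i<m)%N -> nm (E k i)<=Hf (k-n)%N+Hf (al*n-k.+1)%N.
 move=> h1 h2 im; have := EM _ _ h1 h2 im.
 have [->|k1] := eqVneq k n.
 by rewrite subnn {1}/Hf eqxx => h; apply: (le_trans h); rewrite lerDl.
 have [k2|k2] := eqVneq (al*n-k.+1)%N 0%N.
 by rewrite k2 {2}/Hf eqxx => h; apply: (le_trans h); rewrite lerDr.
 have h1': (n<k)%N by rewrite ltn_neqAle eq_sym k1.
 have h2': (k.+1<al*n)%N by rewrite -subn_gt0 lt0n.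
 move=> a1; have := riemann_term n0 m0 im h1' h2'; rewrite -/(E k i).
 set j := minn _ _ => a2; have j0: (0<j)%N by rewrite /j leq_min !subn_gt0 h1'.
 have t0: 0<isq j/r by rewrite divr_gt0 // isq_gt0.
 have t4: (isq j/r)^+4=n%:R/j%:R^+2.
 by rewrite expr_div_n r4 invrK mulrC (exprM _ 2 2) [isq j^+2]expr2 isq_sq // exprVn.
 have t3: (2*M+L)*(isq j/r)^+3=Hf j.
 rewrite /Hf eqn0Ngt j0 /= expr_div_n exprS [isq j^+2]expr2 isq_sq //; ring.
 have M20: 0<=2*M by have := M0; lr.
 have := min_pow34 M20 L0 t0 a1 (_ : _<=L*(isq j/r)^+4).
 rewrite t4 t3 mulrA => /(_ a2) a3; apply: le_trans a3 _.
 by rewrite /j; case: leqP => _; rewrite ?lerDl ?lerDr.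
have HS N: \sum_(0<=j<N) Hf j<=2*M+(2*M+L)/r^+3*4.
 case: N => [|N]; first by rewrite big_geq // addr_ge0 // mulr_ge0.
 rewrite big_nat_recl //= {1}/Hf eqxx lerD2l.
 have ->: \sum_(0<=i<N) Hf i.+1=(2*M+L)/r^+3 * \sum_(1<=i<N.+1) (i%:R^-1 * isq i).
 by rewrite big_add1 /= mulr_sumr; apply: eq_bigr.
 rewrite ler_wpM2l //; apply: le_trans (isq_sum _ _) _ => //.
 by rewrite /isq sqrtr1 invr1 mulr1.
rewrite nmM nmV nm_nat.
via ((n * m)%:R^-1 * \sum_(n<=k<al*n) (m%:R*(Hf (k-n)%N+Hf (al*n-k.+1)%N))).
 rewrite ler_wpM2l ?invr_ge0 //; apply: le_trans (nm_sum _ _ _) _.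
 apply: ler_sum_nat => k /andP[h1 h2]; apply: le_trans (nm_sum _ _ _) _.
 rewrite -[m in leRHS]subn0 mulr_natl -sumr_const_nat.
 by apply: ler_sum_nat => i /andP[_ im]; apply: EH.
rewrite -mulr_sumr mulrA natrM invfM -(mulrA n%:R^-1) mulVf ?mulr1 ?gt_eqF //.
rewrite big_split /= (sum_left Hf) (sum_right Hf) -r4.
have S1 := HS (al*n-n)%N; set S := \sum_(0<=j<_) _ in S1 *.
have r4p: 0<r^+4 by nneg.
via (r^+4*(2*(2*M+(2*M+L)/r^+3*4))).
 by rewrite ler_wpM2l ?(ltW r4p); lr S1.
have ->: r^+4*(2*(2*M+(2*M+L)/r^+3*4)) = 4*M*r^+4+8*(2*M+L)*r.
 by field; rewrite gt_eqF.
rewrite [leRHS]mulrDl lerD2r ler_wpM2l ?mulr_ge0 //.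
by rewrite exprSr ler_piMl ?(ltW r0) // exprn_ile1 // ltW.
Qed.

(** Two sums are compared through their common refinement, so only the limit is needed and no
    integral is introduced. *)
Lemma riemann_cvg : exists l, forall n, (0<n)%N ->
 nm (riemann n-l)<=2*(4*M+8*(2*M+L))*Num.sqrt (isq n).
Proof.
set C := 4*M+_; have C0: 0<=C by rewrite /C; have := M0; have := L0; lra.
have [|e e0|l hl] := @ccauchy_cvg _ (fun k => riemann k.+1) (fun k => 2*C*Num.sqrt (isq k.+1)).
- move=> n m nm'; apply: le_trans (nm_tri (riemann (n.+1 * m.+1)) _ _) _.
 have a1 := @riemann_refine n.+1 m.+1 isT isT.
 have := @riemann_refine m.+1 n.+1 isT isT; rewrite (mulnC m.+1) -/C nmC => a2.
 have : Num.sqrt (isq m.+1)<=Num.sqrt (isq n.+1 : R) by rewrite ler_wsqrtr // isq_le.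
 by move=> a3; have := ler_wpM2l C0 a3; move: a1 a2; rewrite -/C; lra.
- have [N [N0 hN]] := @isq_small R ((e/(2*C+1))^+2) ltac:(rewrite exprn_gt0 // divr_gt0 //; move: C0; lra).
 exists N; have C1: 0<2*C+1 by move: C0; lra.
 have : Num.sqrt (isq N.+1)<=e/(2*C+1).
 rewrite -[leRHS]ger0_norm -?sqrtr_sqr ?divr_ge0 ?(ltW e0) ?(ltW C1) // ler_wsqrtr //.
 exact: hN.
 rewrite ler_pdivlMr // => h; have := sqrtr_ge0 (isq N.+1 : R); move: h; lra.
by exists l => -[|n] // _; apply: hl.
Qed.

End RiemannSums.

(** * The reference passage and its regularized correction term *)

Section Reference.
Context {R : realType}.
Implicit Types (x y : R).
Variables (al : nat) (c : R) (g A1 A2 : Cplx R).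
Hypotheses (al2 : (2<=al)%N) (c0 : 0<c) (hc : c * ln al%:R = pi).
Local Notation dd x := (Num.min (x - 1) (al%:R-x)).

Definition I2c : Cplx R := Ci*rc (2*c).
Definition vm : Cplx R := - rc 2^-1-Ci*rc c.
(** The model ratio at time k = x n. Because c ln al = pi it turns exactly once between x = 1 and x
    = al; the ratio 1 at both ends corresponds to w/z infinite, that is, to entering and leaving. *)
Definition rho x : Cplx R := cis (2*c * ln x).
(** The slope w/z whose ratio is [rho x]; [vm] is one characteristic slope and [I2c] the difference
    of the two. *)
Definition vst x : Cplx R := vm+I2c/(1-rho x).
(** The cubic terms of the map as a function of the ratio alone; the shape comes from the partial
    fractions in [cubic_part]. *)
Definition rr (r : Cplx R) : Cplx R := (A1*(1-r)^+2+A2*(1-r))/r.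
Definition hfun x : Cplx R := rc (ln x)*g+g*vst x+(rr (rho x)-g).
(** [hfun] collects second-order terms of one step. Near the ends [x ^- 2 * hfun x] behaves like
    -g/(x-1) and like g/(al (al-x)); the two fractions cancel these poles, and the remainder is
    bounded and can be Riemann-summed. *)
Definition Gfun x : Cplx R :=
 rc (x ^- 2)*hfun x+g*rc (x - 1)^-1-g*rc ((al%:R)^-1*(al%:R-x)^-1).

Lemma nm_I2c : nm I2c = 2*c.
Proof. by rewrite nmM nm_Ci mul1r nm_rc ger0_norm // mulr_ge0 // ltW. Qed.

Lemma nm_rho x : nm (rho x) = 1. Proof. exact: nm_cis. Qed.

Lemma rho_neq0 x : rho x!=0. Proof. exact: cis_neq0. Qed.

Let alR : 2<=(al%:R : R). Proof. by rewrite (ler_nat R 2). Qed.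

Lemma rho_al x : 0<x -> rho x=cis (- (2*c * ln (al%:R/x))).
Proof.
move=> x0; rewrite ln_div ?posrE //; last by have := alR; lra.
have ->: - (2*c*(ln al%:R-ln x)) = 2*c * ln x - 2 * pi by rewrite -hc; ring.
by rewrite cisB cis2pi divr1.
Qed.

Lemma ln_le x : 1<=x -> ln x<=x - 1.
Proof. by move=> x1; have := @le_ln1Dx R (x - 1) ltac:(lra); rewrite addrCA subrr addr0. Qed.

Lemma ln_ge x : 1<=x -> (x - 1)/x<=ln x.
Proof.
move=> x1; have x0: 0<x by lra.
have := @le_ln1Dx R (x^-1 - 1) ltac:(by have : 0<x^-1; [rewrite invr_gt0|lra]).
rewrite addrCA subrr addr0 lnV ?posrE // => h.
have ->: (x - 1)/x = 1-x^-1 by field; rewrite gt_eqF.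
lra.
Qed.

Lemma ln_lip x y : 1<=x -> x<=y -> 0<=ln y-ln x<=y-x.
Proof.
move=> x1 xy; have x0: 0<x by lra.
have y0: 0<y by lra.
rewrite -ln_div ?posrE //; have yx: 1<=y/x by rewrite ler_pdivlMr // mul1r.
rewrite ln_ge0 //=; apply: le_trans (ln_le yx) _.
have ->: y/x - 1=(y-x)/x by field; rewrite gt_eqF.
by rewrite ler_pdivrMr // ler_peMr; lra.
Qed.

(** The constant in the lower bound [rho_lb] for the distance of the ratio from 1; locked so that
    arithmetic treats it as an atom. *)
Definition kap : R := locked (c/(4*al%:R)).
Lemma kap_gt0 : 0<kap.
Proof. by rewrite /kap -lock divr_gt0 // mulr_gt0; have := alR; lra. Qed.

Lemma rho_lb x : 1<=x -> x<=al%:R -> kap*dd x<=nm (1-rho x).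
Proof.
move=> x1 xa; have a2 := alR; have x0: 0<x by lra.
have l0: 0<=ln x by exact: ln_ge0.
have l1: ln x<=ln al%:R by rewrite ler_ln ?posrE; lra.
have t0: 0<=c * ln x by nneg.
have t1: c * ln x<=pi by rewrite -hc ler_wpM2l // ltW.
rewrite nmC /rho -mulrA nm_cis2B1.
have s0 := sin_ge0_pi (_ : 0<=c * ln x<=pi); rewrite t0 t1 in s0; have {}s0 := s0 isT.
rewrite ger0_norm //; have := sin_lb t0 t1.
suff : 4*kap*dd x<=Num.min (c * ln x) (pi-c * ln x) by lra.
rewrite le_min; apply/andP; split.
 via (4*kap*(x - 1)).
 by rewrite ler_wpM2l ?ge_min ?lexx // mulr_ge0 // ltW // kap_gt0.
 via (c*((x - 1)/x)); last by rewrite ler_wpM2l ?(ltW c0) // ln_ge.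
 have ->: 4*kap*(x - 1)=c*((x - 1)/al%:R) by rewrite /kap -lock; field; lra.
 by rewrite ler_wpM2l ?(ltW c0) // ler_wpM2l ?subr_ge0 // lef_pV2 ?posrE; lra.
via (4*kap*(al%:R-x)).
 by rewrite ler_wpM2l ?ge_min ?lexx ?orbT // mulr_ge0 // ltW // kap_gt0.
rewrite -hc -mulrBr -ln_div ?posrE //; last by lra.
via (c*((al%:R/x - 1)/(al%:R/x))); last first.
 by rewrite ler_wpM2l ?(ltW c0) // ln_ge // ler_pdivlMr // mul1r.
apply: eq_ler; rewrite /kap -lock; field.
by apply/andP; split; rewrite gt_eqF; lra.
Qed.

Lemma rho_lip x y : 1<=x -> x<=y -> nm (rho x-rho y)<=4*c*(y-x).
Proof.
move=> x1 xy; apply: le_trans (cis_lip _ _) _; rewrite -mulrBr normrM distrC.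
have /andP[h0 h1] := ln_lip x1 xy.
rewrite (ger0_norm h0) ger0_norm; last by rewrite mulr_ge0 // ltW.
have := ler_wpM2l (ltW c0) h1; lra.
Qed.

Lemma dd_gt0 x : 1<x -> x<al%:R -> 0<dd x.
Proof. by move=> x1 xa; rewrite lt_min; apply/andP; split; lra. Qed.

Lemma dd_le x : 1<=x -> dd x<=al%:R.
Proof. by move=> x1; rewrite ge_min; apply/orP; right; lra. Qed.

Lemma vst_bound x : 1<x -> x<al%:R -> nm (vst x)<=nm vm+2*c/kap/dd x.
Proof.
move=> x1 xa; have d0 := dd_gt0 x1 xa; have k0 := kap_gt0.
have ->: 2*c/kap/dd x = 2*c*(kap*dd x)^-1 by rewrite invfM !mulrA.
apply: nmD_le; rewrite lerD2l nmf nm_I2c ler_wpM2l ?mulr_ge0 ?(ltW c0) //.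
have h := rho_lb (ltW x1) (ltW xa).
by rewrite lef_pV2 ?posrE ?mulr_gt0 //; apply: lt_le_trans h; rewrite mulr_gt0.
Qed.

Lemma vst_lip x y : 1<x -> x<=y -> y<al%:R ->
 nm (vst x-vst y)<=8*c^+2/kap^+2*(y-x)/(dd x*dd y).
Proof.
move=> x1 xy ya; have xa: x<al%:R by lra.
have y1: 1<y by lra.
have d1 := dd_gt0 x1 xa; have d2 := dd_gt0 y1 ya; have k0 := kap_gt0.
have h1 := rho_lb (ltW x1) (ltW xa); have h2 := rho_lb (ltW y1) (ltW ya).
have p1: 0<nm (1-rho x) by apply: lt_le_trans h1; rewrite mulr_gt0.
have p2: 0<nm (1-rho y) by apply: lt_le_trans h2; rewrite mulr_gt0.
have ->: vst x-vst y=I2c*(rho x-rho y)/((1-rho x)*(1-rho y)).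
 by rewrite /vst; field; rewrite -!nm_gt0 p1 p2.
rewrite nmf (nmM I2c) nm_I2c nmM.
have ->: 8*c^+2/kap^+2*(y-x)/(dd x*dd y) = 2*c*(4*c*(y-x))/(kap*dd x*(kap*dd y)).
 by field; rewrite !gt_eqF.
apply: ler_pM.
- by nneg.
- by nneg.
- by rewrite ler_wpM2l ?mulr_ge0 ?(ltW c0) // rho_lip // ltW.
- rewrite lef_pV2 ?posrE ?mulr_gt0 //.
 by apply: ler_pM => //; apply: ltW; rewrite mulr_gt0.
Qed.

Lemma rr_bound (r : Cplx R) : 2^-1<=nm r -> nm r<=2 ->
 nm (rr r)<=2*(9*nm A1+3*nm A2).
Proof.
move=> h1 h2; have r0: 0<nm r by lra.
have h3: nm (1-r)<=3 by apply: nmB_le; rewrite nm1; lra.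
rewrite /rr nmf ler_pdivrMr //; apply: nmD_le; rewrite (nmM A1) (nmM A2) nmX.
have q1: nm A1*nm (1-r)^+2<=nm A1*9.
 rewrite ler_wpM2l ?nm_ge0 //; have := nm_ge0 (1-r); nra.
have := nm_ge0 A1; have := nm_ge0 A2; nra.
Qed.

Lemma rr_lip (r s : Cplx R) : 2^-1<=nm r -> nm r<=2 -> 2^-1<=nm s -> nm s<=2 ->
 nm (rr r-rr s)<=5*(nm A1+nm (A1+A2))*nm (r-s).
Proof.
move=> h1 h2 h3 h4; have r0: 0<nm r by lra.
have s0: 0<nm s by lra.
have ->: rr r-rr s=(r-s)*(A1-(A1+A2)/(r*s)).
 by rewrite /rr; field; rewrite -!nm_gt0 r0 s0.
rewrite nmM mulrC ler_wpM2r ?nm_ge0 //; apply: nmB_le.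
have : nm ((A1+A2)/(r*s))<=nm (A1+A2)*4.
 rewrite nmf ler_wpM2l ?nm_ge0 // nmM -[4]invrK lef_pV2 ?posrE ?mulr_gt0 //.
 have ->: 4^-1 = 2^-1*2^-1 :> R by field.
 by rewrite ler_pM.
have := nm_ge0 A1; have := nm_ge0 (A1+A2); lra.
Qed.

Definition Hh : R := al%:R*(al%:R*nm g+nm g*nm vm+2*(9*nm A1+3*nm A2)+nm g)+nm g*(2*c/kap).

Lemma h_bound x : 1<x -> x<al%:R -> nm (hfun x)<=Hh/dd x.
Proof.
move=> x1 xa; have d0 := dd_gt0 x1 xa; have k0 := kap_gt0; have g0 := nm_ge0 g.
have da := dd_le (ltW x1).
have e1: nm (rc (ln x)*g)<=al%:R*nm g.
 rewrite nmM nm_rc ler_wpM2r // ger0_norm ?ln_ge0 ?(ltW x1) //.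
 by have := ln_le (ltW x1); lra.
have e2: nm (g*vst x)<=nm g*nm vm+nm g*(2*c/kap)/dd x.
 rewrite nmM -(mulrA (nm g)) -mulrDr ler_wpM2l //; exact: vst_bound.
have e3: nm (rr (rho x))<=2*(9*nm A1+3*nm A2).
 by apply: rr_bound; rewrite nm_rho; lr.
have e4 := nmB (rr (rho x)) g.
set P := al%:R*nm g+nm g*nm vm+2*(9*nm A1+3*nm A2)+nm g.
have P0: 0<=P.
 by nneg.
have : nm (hfun x)<=P+nm g*(2*c/kap)/dd x.
 apply: nmD_le; have := nmD (rc (ln x)*g) (g*vst x); rewrite /P; lr e4 e3 e2 e1.
move=> h; apply: (le_trans h); rewrite /Hh -/P [leRHS]mulrDl lerD2r ler_pdivlMr // mulrC.
by rewrite ler_wpM2r.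
Qed.

Definition Lh : R := al%:R^+2*(nm g+5*(nm A1+nm (A1+A2))*(4*c))+nm g*(8*c^+2/kap^+2).

Lemma lip_dd (K : R) x y : 0<=K -> 1<x -> x<=y -> y<al%:R ->
 K*(y-x)<=al%:R^+2*K*(y-x)/(dd x*dd y).
Proof.
move=> K0 x1 xy ya; have xa: x<al%:R by lra.
have y1: 1<y by lra.
have d1 := dd_gt0 x1 xa; have d2 := dd_gt0 y1 ya.
rewrite ler_pdivlMr ?mulr_gt0 // -mulrA [leRHS]mulrC ler_wpM2l ?mulr_ge0 ?subr_ge0 //.
by rewrite expr2; apply: ler_pM; rewrite ?(ltW d1) ?(ltW d2) // dd_le // ltW.
Qed.

Lemma h_lip x y : 1<x -> x<=y -> y<al%:R ->
 nm (hfun x-hfun y)<=Lh*(y-x)/(dd x*dd y).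
Proof.
move=> x1 xy ya; have g0 := nm_ge0 g.
have e1: nm (rc (ln x)*g-rc (ln y)*g)<=nm g*(y-x).
 rewrite -mulrBl -rcB nmM mulrC ler_wpM2l // nm_rc distrC.
 by have /andP[h0 h1] := ln_lip (ltW x1) xy; rewrite ger0_norm.
have e2: nm (g*vst x-g*vst y)<=nm g*(8*c^+2/kap^+2)*(y-x)/(dd x*dd y).
 rewrite -mulrBr nmM; apply: le_trans (ler_wpM2l g0 (vst_lip x1 xy ya)) _.
 by rewrite !mulrA.
set Q := 5*(nm A1+nm (A1+A2)).
have Q0: 0<=Q by nneg.
have e3: nm (rr (rho x)-rr (rho y))<=Q*(4*c)*(y-x).
 apply: le_trans (rr_lip _ _ _ _) _; rewrite ?nm_rho; [lr|lr|lr|lr|].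
 by rewrite -/Q -mulrA ler_wpM2l // rho_lip // ltW.
have QQ: 0<=nm g+Q*(4*c) by nneg.
have := lip_dd QQ x1 xy ya => e4.
have ->: hfun x-hfun y=(rc (ln x)*g-rc (ln y)*g)+(g*vst x-g*vst y)+(rr (rho x)-rr (rho y)).
 by rewrite /hfun; ring.
rewrite /Lh -/Q (mulrDl _ _ (y-x)) (mulrDl _ _ (_^-1)).
have := nmD ((rc (ln x)*g-rc (ln y)*g)+(g*vst x-g*vst y)) (rr (rho x)-rr (rho y)).
have := nmD (rc (ln x)*g-rc (ln y)*g) (g*vst x-g*vst y).
lr e4 e3 e2 e1.
Qed.

Lemma G_lip : exists2 L, 0<=L & forall x y, 1<x -> x<=y -> y<al%:R ->
 nm (Gfun x-Gfun y)<=L*(y-x)/(dd x*dd y).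
Proof.
have k0 := kap_gt0; have a2 := alR; have a0: 0<=al%:R :> R by lra.
have g0 := nm_ge0 g.
have Hh0: 0<=Hh.
 by nneg.
have Lh0: 0<=Lh.
 by nneg.
exists (2*Hh*al%:R+Lh+nm g+nm g) => [|x y x1 xy ya].
 by nneg.
have xa: x<al%:R by lra.
have y1: 1<y by lra.
have d1 := dd_gt0 x1 xa; have d2 := dd_gt0 y1 ya.
have x0: 0<x by lra.
have y0: 0<y by lra.
have yx0: 0<=y-x by lra.
have e1: nm (rc (x ^- 2)*hfun x-rc (y ^- 2)*hfun y)<=(2*Hh*al%:R+Lh)*(y-x)/(dd x*dd y).
 have ->: rc (x ^- 2)*hfun x-rc (y ^- 2)*hfun y=rc (x ^- 2-y ^- 2)*hfun x+rc (y ^- 2)*(hfun x-hfun y).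
 by rewrite rcB; ring.
 apply: nmD_le; rewrite (mulrDl (2*Hh*_)) (mulrDl _ _ (_^-1)); apply: lerD; rewrite nmM nm_rc.
 have q1: `|x ^- 2-y ^- 2| <= 2*(y-x).
 have ->: x ^- 2-y ^- 2=(y-x)*((x+y)/(x^+2*y^+2)) by field; rewrite !gt_eqF.
 have xy1: 1<=x*y by rewrite mulr_ege1 // ltW.
 have q2: 0<x^+2*y^+2 by nneg.
 rewrite normrM (ger0_norm yx0) mulrC ler_wpM2r // ger0_norm ?divr_ge0 ?(ltW q2) //; last by lr xy x1.
 rewrite ler_pdivrMr // -exprMn; nr xy1 xy x1.
 apply: le_trans (ler_pM _ _ q1 (h_bound x1 xa)) _; rewrite ?nm_ge0 //.
 have ->: 2*(y-x)*(Hh/dd x) = 2*Hh*(y-x)*dd y/(dd x*dd y) by field; rewrite !gt_eqF.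
 rewrite ler_pM2r ?invr_gt0 ?mulr_gt0 // mulrAC ler_wpM2r // ler_wpM2l ?mulr_ge0 //.
 exact: dd_le (ltW y1).
 have q1: `|y ^- 2| <= 1.
 by rewrite ger0_norm ?invr_ge0 ?exprn_ge0 ?(ltW y0) // invf_le1 ?exprn_gt0 // exprn_ege1 // ltW.
 by have := ler_pM (normr_ge0 _) (nm_ge0 _) q1 (h_lip x1 xy ya); rewrite mul1r.
have e2: nm (rc (x - 1)^-1-rc (y - 1)^-1)<=(y-x)/(dd x*dd y).
 rewrite -rcB nm_rc; have ->: (x - 1)^-1-(y - 1)^-1=(y-x)/((x - 1)*(y - 1)).
 by field; apply/andP; split; rewrite gt_eqF; lr k0 y1 x1.
 rewrite normrM (ger0_norm yx0) ler_wpM2l // ger0_norm ?invr_ge0 ?mulr_ge0 //; [|lr x1|lr y1].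
 rewrite lef_pV2 ?posrE ?mulr_gt0 //; [|lr x1|lr y1].
 by rewrite ler_pM ?(ltW d1) ?(ltW d2) // ge_min lexx.
have e3: nm (rc ((al%:R)^-1*(al%:R-x)^-1)-rc ((al%:R)^-1*(al%:R-y)^-1))<=(y-x)/(dd x*dd y).
 rewrite -rcB nm_rc -mulrBr normrM distrC.
 have ->: (al%:R-y)^-1-(al%:R-x)^-1=(y-x)/((al%:R-x)*(al%:R-y)).
 by field; apply/andP; split; rewrite gt_eqF; lr k0 ya xy.
 have q1: `|(al%:R : R)^-1| <= 1 by rewrite ger0_norm // invf_le1; lr a2.
 have q2: `|(y-x)/((al%:R-x)*(al%:R-y))| <= (y-x)/(dd x*dd y).
 rewrite normrM (ger0_norm yx0) ler_wpM2l // ger0_norm ?invr_ge0 ?mulr_ge0 //; [|lr ya xy|lr ya].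
 rewrite lef_pV2 ?posrE ?mulr_gt0 //; [|lr ya xy|lr ya].
 by rewrite ler_pM ?(ltW d1) ?(ltW d2) // ge_min lexx orbT.
 by have := ler_pM (normr_ge0 _) (normr_ge0 _) q1 q2; rewrite mul1r.
have ->: Gfun x-Gfun y=(rc (x ^- 2)*hfun x-rc (y ^- 2)*hfun y)+g*(rc (x - 1)^-1-rc (y - 1)^-1)
 - g*(rc ((al%:R)^-1*(al%:R-x)^-1)-rc ((al%:R)^-1*(al%:R-y)^-1)).
 by rewrite /Gfun; ring.
apply: nmB_le; rewrite !nmM.
have := nmD (rc (x ^- 2)*hfun x-rc (y ^- 2)*hfun y) (g*(rc (x - 1)^-1-rc (y - 1)^-1)).
rewrite nmM; have := ler_wpM2l g0 e2; have := ler_wpM2l g0 e3.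
rewrite (mulrDl _ (nm g) (y-x)) (mulrDl _ (nm g) (y-x)) !(mulrDl _ _ (_^-1)) -!(mulrA (nm g)).
move: e1; rewrite !mulrDl; lr.
Qed.

(** The pole cancels because 1 - rho x = -I2c ln x + O((x-1)^2) and ln x = x - 1 + O((x-1)^2), while
    the denominator is itself of order (x-1)^2. *)
Lemma B_bound_left x : 1<x -> x<al%:R -> x - 1<=al%:R-x ->
 nm (rc (x ^- 2)*(I2c/(1-rho x))+rc (x - 1)^-1) <=
 (8*c^+2+2*c+4*c*(al%:R+1))/kap.
Proof.
move=> x1 xa hx; have k0 := kap_gt0; have d0 := dd_gt0 x1 xa.
have x0: 0<x by lra.
have y0: 0<x - 1 by lra.
have lb := rho_lb (ltW x1) (ltW xa); rewrite (min_idPl hx) in lb d0.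
have p1: 0<nm (1-rho x) by apply: lt_le_trans lb; rewrite mulr_gt0.
have p1': 1-rho x!=0 by rewrite -nm_gt0.
have ->: rc (x ^- 2)*(I2c/(1-rho x))+rc (x - 1)^-1 =
 ((1-rho x+I2c*rc (ln x))+I2c*rc (x - 1-ln x)+rc (x^+2 - 1)*(1-rho x))/(rc (x^+2*(x - 1))*(1-rho x)).
 rewrite !rcB !rcV !rcM !rcB rc1; field; rewrite p1' /=.
 by rewrite -{1}rc1 -rcB !rc_eq0 !gt_eqF.
rewrite nmf ler_pdivrMr ?nmM ?nm_rc; last first.
 by rewrite mulr_gt0 // normr_gt0 mulf_neq0 ?expf_neq0 // gt_eqF.
have l1 := ln_le (ltW x1); have l0: 0<=ln x by apply: ln_ge0; lra.
have l2: x - 1-ln x<=(x - 1)^+2.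
 by have := @ln1D_ge R (x - 1) (ltW y0); rewrite addrCA subrr addr0; lra.
have n1: nm (1-rho x+I2c*rc (ln x))<=8*c^+2*(x - 1)^+2.
 have := cis_le2 (2*c * ln x); rewrite -nmN.
 have ->: - (cis (2*c * ln x) - 1-Ci*rc (2*c * ln x)) = 1-rho x+I2c*rc (ln x).
 by rewrite /rho /I2c (rcM (2*c)); ring.
 move=> h; apply: le_trans h _; rewrite exprMn.
 have : ln x^+2<=(x - 1)^+2 by apply: lerXn2r; rewrite ?nnegrE ?(ltW y0).
 have := sqr_ge0 c; nr.
have n2: nm (I2c*rc (x - 1-ln x))<=2*c*(x - 1)^+2.
 by rewrite nmM nm_I2c nm_rc ger0_norm ?subr_ge0 // ler_wpM2l // mulr_ge0 // ltW.
have rr1: nm (1-rho x)<=4*c*(x - 1).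
 by have := rho_lip (lexx 1) (ltW x1); rewrite /rho ln1 mulr0 cis0.
have n3: nm (rc (x^+2 - 1)*(1-rho x))<=4*c*(al%:R+1)*(x - 1)^+2.
 rewrite nmM nm_rc; have ->: x^+2 - 1=(x - 1)*(x+1) by ring.
 rewrite ger0_norm ?mulr_ge0 ?(ltW y0) //; last by lr x1.
 via ((x - 1)*(al%:R+1)*(4*c*(x - 1))); last by apply: eq_ler; ring.
 apply: ler_pM; rewrite ?nm_ge0 ?mulr_ge0 ?(ltW y0) //; first by lr x1.
 by rewrite ler_wpM2l ?(ltW y0); lr xa.
have ->: `|x^+2*(x - 1)| = x^+2*(x - 1) by rewrite ger0_norm // mulr_ge0 ?exprn_ge0 ?(ltW y0) ?(ltW x0).
have N0: 0<=8*c^+2+2*c+4*c*(al%:R+1).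
 have := alR; have := c0; nr.
via ((8*c^+2+2*c+4*c*(al%:R+1))*(x - 1)^+2).
 have := nmD (1-rho x+I2c*rc (ln x)+I2c*rc (x - 1-ln x)) (rc (x^+2 - 1)*(1-rho x)).
 have := nmD (1-rho x+I2c*rc (ln x)) (I2c*rc (x - 1-ln x)); lr n3 n2 n1.
rewrite -[leRHS]mulrA ler_wpM2l // [leRHS]mulrC ler_pdivlMr //.
via ((x - 1)*(kap*(x - 1))); first by apply: eq_ler; ring.
apply: ler_pM; rewrite ?(ltW y0) ?(mulr_ge0 (ltW k0) (ltW y0)) //.
by rewrite ler_peMl ?(ltW y0) // exprn_ege1 // ltW.
Qed.

Lemma B_bound_right x : 1<x -> x<al%:R -> al%:R-x<=x - 1 ->
 nm (rc (x ^- 2)*(I2c/(1-rho x))-rc ((al%:R)^-1*(al%:R-x)^-1)) <=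
 (2*c*(1+al%:R^+2)+8*c^+2*al%:R^+2)/kap.
Proof.
move=> x1 xa hx; have k0 := kap_gt0; have d0 := dd_gt0 x1 xa; have a2 := alR.
have x0: 0<x by lra.
have a0: 0<al%:R :> R by lra.
set y := al%:R-x in hx *; have y0: 0<y by rewrite /y; lra.
have lb := rho_lb (ltW x1) (ltW xa); rewrite (min_idPr hx) -/y in lb d0.
have p1: 0<nm (1-rho x) by apply: lt_le_trans lb; rewrite mulr_gt0.
have p1': 1-rho x!=0 by rewrite -nm_gt0.
set l := ln (al%:R/x).
have ->: rc (x ^- 2)*(I2c/(1-rho x))-rc ((al%:R)^-1*y^-1) =
 (I2c*rc (al%:R*y-x^+2 * l)-rc (x^+2)*(1-rho x-I2c*rc l))/(rc (x^+2*(al%:R*y))*(1-rho x)).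
 have X0: rc x!=0 by rewrite rc_eq0 gt_eqF.
 have Y0: rc y!=0 by rewrite rc_eq0 gt_eqF.
 have A0: rc (al%:R : R)!=0 by rewrite rc_eq0 gt_eqF.
 rewrite rcB !rcM !rcV !rcM; field; by rewrite p1' X0 Y0 -(rc_nat al) A0.
have ax: 1<=al%:R/x by rewrite ler_pdivlMr // mul1r ltW.
have l1: l<=y/x.
 by have := ln_le ax; have ->: al%:R/x - 1=y/x by rewrite /y; field; rewrite gt_eqF.
have l2: y/al%:R<=l.
 have := ln_ge ax; rewrite -/l; have -> //: (al%:R/x - 1)/(al%:R/x)=y/al%:R.
 by rewrite /y; field; rewrite !gt_eqF.
have l3: y/x-l<=y^+2.
 have : y/x-y/al%:R<=y^+2.
 have ->: y/x-y/al%:R=y^+2/(x*al%:R) by rewrite /y; field; rewrite !gt_eqF.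
 rewrite ler_pdivrMr ?mulr_gt0 // ler_peMr ?sqr_ge0 //.
 by rewrite mulr_ege1; lr x1 a2.
 by lr l2.
have l0: 0<=l by apply: ln_ge0.
have l4: l<=y.
 apply: le_trans l1 _; rewrite ler_pdivrMr // ler_peMr ?(ltW y0) //; lr x1.
rewrite nmf ler_pdivrMr ?nmM ?nm_rc; last first.
 by rewrite mulr_gt0 // normr_gt0 !mulf_neq0 // gt_eqF.
have n1: nm (rc (x^+2)*(1-rho x-I2c*rc l))<=8*c^+2*al%:R^+2*y^+2.
 rewrite nmM nm_rc; have xx: `|x^+2| <= al%:R^+2.
 by rewrite ger0_norm ?exprn_ge0 ?(ltW x0) //; apply: lerXn2r; rewrite ?nnegrE // ltW.
 have hh: nm (1-rho x-I2c*rc l)<=8*c^+2*y^+2.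
 have := cis_le2 (- (2*c * l)); rewrite -rho_al // -nmN sqrrN.
 have ->: - (rho x - 1-Ci*rc (- (2*c * l))) = 1-rho x-I2c*rc l.
 by rewrite /I2c rcN (rcM (2*c)); ring.
 move=> h; apply: le_trans h _; rewrite exprMn.
 have : l^+2<=y^+2 by apply: lerXn2r; rewrite ?nnegrE ?(ltW y0).
 have := sqr_ge0 c; nr.
 apply: le_trans (ler_pM _ _ xx hh) _; rewrite ?nm_ge0 //.
 by apply: eq_ler; ring.
have n2: nm (I2c*rc (al%:R*y-x^+2 * l))<=2*c*(1+al%:R^+2)*y^+2.
 rewrite nmM nm_I2c nm_rc -[leRHS]mulrA ler_wpM2l ?mulr_ge0 ?(ltW c0) //.
 have ->: al%:R*y-x^+2 * l=y^+2+x^+2*(y/x-l) by rewrite /y; field; rewrite gt_eqF.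
 rewrite ger0_norm; last by rewrite addr_ge0 ?sqr_ge0 // mulr_ge0 ?sqr_ge0 // subr_ge0.
 rewrite [leRHS]mulrDl mul1r lerD2l; apply: ler_pM; rewrite ?sqr_ge0 ?subr_ge0 //.
 by apply: lerXn2r; rewrite ?nnegrE // ltW.
have ->: `|x^+2*(al%:R*y)| = x^+2*(al%:R*y).
 by rewrite ger0_norm // !mulr_ge0 ?(ltW y0) ?(ltW x0).
set N := 2*c*_+_; have N0: 0<=N.
 by nneg.
via (N*y^+2).
 have := nmB (I2c*rc (al%:R*y-x^+2 * l)) (rc (x^+2)*(1-rho x-I2c*rc l)); rewrite /N; lr n2 n1.
rewrite -[leRHS]mulrA ler_wpM2l // [leRHS]mulrC ler_pdivlMr //.
via (y*(kap*y)); first by apply: eq_ler; ring.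
apply: ler_pM; rewrite ?(ltW y0) ?(mulr_ge0 (ltW k0) (ltW y0)) //.
rewrite mulrA ler_peMl ?(ltW y0) // mulr_ege1 ?exprn_ege1 ?(ltW x1) //; lr a2.
Qed.

Lemma G_bounded : exists2 M, 0<=M & forall x, 1<=x -> x<al%:R -> nm (Gfun x)<=M.
Proof.
have k0 := kap_gt0; have a2 := alR; have g0 := nm_ge0 g.
have a0: 0<al%:R :> R by lra.
set Nl := (8*c^+2+2*c+4*c*(al%:R+1))/kap.
set Nr := (2*c*(1+al%:R^+2)+8*c^+2*al%:R^+2)/kap.
have Nl0: 0<=Nl by nneg.
have Nr0: 0<=Nr by nneg.
pose P := al%:R*nm g+2*(9*nm A1+3*nm A2)+nm g+nm g*nm vm.
have P0: 0<=P by nneg.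
pose M := P+nm g*(Nl+Nr+2).
have M0: 0<=M by nneg.
exists (M+nm (Gfun 1)) => [|x]; first by rewrite addr_ge0 // nm_ge0.
rewrite le_eqVlt => /orP[/eqP<- _|x1 xa]; first by rewrite lerDr.
have x0: 0<x by lra.
via M; last by rewrite lerDl nm_ge0.
have x2: nm (rc (x ^- 2))<=1.
 by rewrite nm_rc ger0_norm ?invr_ge0 ?exprn_ge0 ?(ltW x0) // invf_le1 ?exprn_gt0 // exprn_ege1 // ltW.
pose Y : Cplx R := rc (x ^- 2)*(I2c/(1-rho x))+rc (x - 1)^-1-rc ((al%:R)^-1*(al%:R-x)^-1).
pose X : Cplx R := rc (ln x)*g+(rr (rho x)-g)+g*vm.
have ->: Gfun x=rc (x ^- 2)*X+g*Y by rewrite /Gfun /hfun /vst /X /Y; ring.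
have hX: nm X<=P.
 have e1: nm (rc (ln x)*g)<=al%:R*nm g.
 rewrite nmM nm_rc ler_wpM2r // ger0_norm ?ln_ge0 ?(ltW x1) //.
 by have := ln_le (ltW x1); lr xa.
 have e3: nm (rr (rho x))<=2*(9*nm A1+3*nm A2).
 by apply: rr_bound; rewrite nm_rho; lr.
 have := nmB (rr (rho x)) g; have := nmD (rc (ln x)*g) (rr (rho x)-g).
 have := nmD (rc (ln x)*g+(rr (rho x)-g)) (g*vm); rewrite (nmM g vm) /P /X; lr e3 e1.
have hY: nm Y<=Nl+Nr+2.
 have [hx|hx] := leP (x - 1) (al%:R-x).
 have := B_bound_left x1 xa hx; rewrite -/Nl => h.
 have q: nm (rc ((al%:R)^-1*(al%:R-x)^-1))<=2.
 rewrite -invfM nm_rc ger0_norm ?invr_ge0 ?mulr_ge0 ?(ltW a0) //; last by lr xa.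
 by rewrite -[2]invrK lef_pV2 ?posrE ?mulr_gt0 //; [nr hx a2|lr xa].
 by have := nmB (rc (x ^- 2)*(I2c/(1-rho x))+rc (x - 1)^-1) (rc ((al%:R)^-1*(al%:R-x)^-1)); rewrite -/Y; lr q h Nr0.
 have := B_bound_right x1 xa (ltW hx); rewrite -/Nr => h.
 have q: nm (rc (x - 1)^-1)<=2.
 rewrite nm_rc ger0_norm ?invr_ge0; last by lr x1.
 by rewrite -[2]invrK lef_pV2 ?posrE; lr hx a2 x1.
 have ->: Y=rc (x ^- 2)*(I2c/(1-rho x))-rc ((al%:R)^-1*(al%:R-x)^-1)+rc (x - 1)^-1 by rewrite /Y; ring.
 by have := nmD (rc (x ^- 2)*(I2c/(1-rho x))-rc ((al%:R)^-1*(al%:R-x)^-1)) (rc (x - 1)^-1); lr q h Nl0.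
apply: nmD_le; rewrite !nmM /M; apply: lerD; last by rewrite ler_wpM2l.
by have := ler_pM (nm_ge0 _) (nm_ge0 _) x2 hX; rewrite mul1r.
Qed.

End Reference.

(** * The rate n^(-1/4) and harmonic sums *)

Section EpsSums.
Context {R : realType}.

(** This is n^(-1/4), the rate found for the Riemann sums. It absorbs logarithms through ln n <= 4
    n^(1/4), so one rate serves for all quantities that vanish with n. *)
Definition eps (n : nat) : R := Num.sqrt (isq n).

Lemma eps_ge0 n : 0<=eps n. Proof. exact: sqrtr_ge0. Qed.
Lemma eps_gt0 n : (0<n)%N -> 0<eps n. Proof. by move=> n0; rewrite sqrtr_gt0 isq_gt0. Qed.
Lemma eps_le1 n : eps n<=1. Proof. by rewrite -[leRHS]sqrtr1 ler_wsqrtr // isq_le1. Qed.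
Lemma eps2 n : eps n^+2 = isq n. Proof. by rewrite sqr_sqrtr ?isq_ge0. Qed.
Lemma eps4 n : (0<n)%N -> eps n^+4=n%:R^-1.
Proof. by move=> n0; rewrite (exprM _ 2 2) eps2 expr2 isq_sq. Qed.
Lemma isq_le_eps n : isq n<=eps n.
Proof. by rewrite -eps2 expr2 ler_piMl ?eps_ge0 ?eps_le1. Qed.
Lemma invn_le_eps n : (0<n)%N -> n%:R^-1<=eps n.
Proof. by move=> n0; apply: le_trans (isq_le_eps n); apply: invn_le_isq. Qed.
Lemma eps_le j k : (0<j)%N -> (j<=k)%N -> eps k<=eps j.
Proof. by move=> j0 jk; rewrite ler_wsqrtr // isq_le. Qed.

Lemma eps_small e : 0<e -> exists N, (0<N)%N /\ forall k, (N<=k)%N -> eps k<=e.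
Proof.
move=> e0; have [N [N0 hN]] := @isq_small R (e^+2) ltac:(by rewrite exprn_gt0).
exists N; split=> // k kN; rewrite -[leRHS]ger0_norm ?(ltW e0) // -sqrtr_sqr ler_wsqrtr //.
exact: hN.
Qed.

Lemma ln_le_eps n : (0<n)%N -> ln (n%:R : R)<=4/eps n.
Proof.
move=> n0; have e0 := eps_gt0 n0.
have ->: (n%:R : R)=(eps n)^-1^+4 by rewrite exprVn eps4 ?invrK.
rewrite lnXn ?invr_gt0 // -[_ *+ 4]mulr_natl ler_wpM2l //.
have e1: 1<=(eps n)^-1 by rewrite invf_ge1 ?eps_le1.
by have := ln_le e1; lra.
Qed.

Lemma ln_nat_ge0 n : 0<=ln (n%:R : R).
Proof. by case: n => [|n]; [rewrite ln0|rewrite ln_ge0 // ler1n]. Qed.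

Lemma ln_isq_le n : (0<n)%N -> ln (n%:R : R) * isq n<=4*eps n.
Proof.
move=> n0; have e0 := eps_gt0 n0; rewrite -eps2.
apply: le_trans (ler_wpM2r (sqr_ge0 _) (ln_le_eps n0)) _.
by apply: eq_ler; field; rewrite gt_eqF.
Qed.

Lemma harmonic_est p q : (0<p)%N -> (p<=q)%N ->
 `|\sum_(p<=j<q) (j%:R^-1 : R)-(ln q%:R-ln p%:R)| <= 4 * isq p.
Proof.
move=> p0 pq; via (\sum_(p<=k<q) (k%:R^-1 * isq k : R)); last exact: isq_sum.
have ->: ln q%:R-ln p%:R = \sum_(p<=k<q) (ln k.+1%:R-ln k%:R : R).
 by rewrite telescope_sumr.
rewrite -sumrB; apply: le_trans (ler_norm_sum _ _ _) _.
apply: ler_sum_nat => k /andP[pk _]; rewrite distrC.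
have k0: (0<k)%N by apply: leq_trans pk.
apply: le_trans (lnS_est k0) _; rewrite expr2 ler_wpM2l ?invr_ge0 //.
exact: invn_le_isq.
Qed.

Lemma inv_sq_sum p q : (0<p)%N -> (p<=q)%N ->
 `|\sum_(p<=k<q) (k%:R^-1^+2 : R)-(p%:R^-1-q%:R^-1)| <= (q-p)%:R * p%:R^-1^+3.
Proof.
move=> p0 pq.
have ->: p%:R^-1-q%:R^-1 = \sum_(p<=k<q) (k%:R^-1-k.+1%:R^-1 : R).
 have := telescope_sumr (fun k => - (k%:R : R)^-1) pq; rewrite opprK addrC => <-.
 by apply: eq_bigr => i _; rewrite opprK addrC.
rewrite -sumrB; apply: le_trans (ler_norm_sum _ _ _) _.
rewrite mulr_natl -sumr_const_nat; apply: ler_sum_nat => k /andP[pk _].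
have k0: (0<k)%N by apply: leq_trans pk.
have kp: 0<(k%:R : R) by rewrite ltr0n.
have ->: k%:R^-1^+2-(k%:R^-1-k.+1%:R^-1)=k%:R^-1^+2*k.+1%:R^-1 :> R.
 by rewrite -natr1; field; rewrite !gt_eqF; lra.
rewrite ger0_norm ?mulr_ge0 ?exprn_ge0 ?invr_ge0 // [leRHS]exprSr.
apply: ler_pM; rewrite ?exprn_ge0 ?invr_ge0 //.
 by apply: lerXn2r; rewrite ?nnegrE // lef_pV2 ?posrE ?ltr0n // ler_nat.
by rewrite lef_pV2 ?posrE ?ltr0n // ler_nat ltnW.
Qed.

Lemma harmonic_le N : \sum_(1<=j<N.+1) (j%:R^-1 : R)<=2*Num.sqrt N%:R.
Proof.
elim: N => [|N IH]; first by rewrite big_geq // sqrtr0 mulr0.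
rewrite big_nat_recr //=; have := @sqrt_tele R N; have := @invn_le_isq R N.+1 isT.
set x := _^-1; set y := isq _; set z := Num.sqrt N.+1%:R; set t := \sum_(_<=_<_) _ in IH *; lra.
Qed.

End EpsSums.

(** * The total drift of a passage *)

Section DriftSum.
Context {R : realType}.
Variables (al : nat) (c : R) (g A1 A2 : Cplx R).
Hypotheses (al2 : (2<=al)%N) (c0 : 0<c) (hc : c * ln al%:R = pi).
Local Notation hf := (hfun c g A1 A2).
Local Notation Gf := (Gfun al c g A1 A2).
Local Notation Hh := (Hh al c g A1 A2).

(** Up to the factor I2c, the leading relative change in one step of the quotient of the true ratio
    by the reference ratio; s is the phase of the z-orbit. *)
Definition drift (s : Cplx R) (n k : nat) : Cplx R :=
 rc (k%:R^-1^+2)*(rc (ln n%:R)*g-s+hf (k%:R/n%:R)).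

Lemma dd_nat n k : (n<=k)%N -> (k<=al*n)%N -> (0<n)%N ->
 Num.min ((k%:R : R)/n%:R - 1) (al%:R-k%:R/n%:R)=(minn (k-n) (al*n-k))%:R/n%:R.
Proof.
move=> nk kn n0; have np: 0<(n%:R : R) by rewrite ltr0n.
have ->: (k%:R : R)/n%:R - 1=(k-n)%:R/n%:R by rewrite natrB // mulrBl divff // gt_eqF.
have ->: (al%:R : R)-k%:R/n%:R=(al*n-k)%:R/n%:R.
 by rewrite natrB // natrM mulrBl mulfK // gt_eqF.
case: leqP => h.
 by apply/min_idPl; rewrite ler_pM2r ?invr_gt0 // ler_nat.
by apply/min_idPr; rewrite ler_pM2r ?invr_gt0 // ler_nat ltnW.
Qed.

Lemma kn_range n k : (0<n)%N -> (n<k)%N -> (k<al*n)%N ->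
 1<(k%:R : R)/n%:R /\ (k%:R : R)/n%:R<al%:R.
Proof.
move=> n0 nk kn; have np: 0<(n%:R : R) by rewrite ltr0n.
by rewrite ltr_pdivlMr // mul1r ltr_nat ltr_pdivrMr // -natrM ltr_nat.
Qed.

Lemma Hh_ge0 : 0<=Hh.
Proof. by rewrite /Hh; have k0 := kap_gt0 al2 c0; nneg. Qed.

Lemma drift_bound (S : R) s n k : nm s<=S -> (0<n)%N -> (n<k)%N -> (k<al*n)%N ->
 n%:R*nm (drift s n k)<=(nm g * ln n%:R+S)/n%:R+Hh/(minn (k-n) (al*n-k))%:R.
Proof.
move=> sS n0 nk kn; have np: 0<(n%:R : R) by rewrite ltr0n.
have [x1 x2] := kn_range n0 nk kn.
set j := minn _ _; have j0: (0<j)%N by rewrite /j leq_min !subn_gt0 nk kn.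
have jp: 0<(j%:R : R) by rewrite ltr0n.
have := h_bound g A1 A2 al2 c0 hc x1 x2.
rewrite dd_nat ?(ltnW nk) ?(ltnW kn) // -/j => hb.
have l0 := @ln_nat_ge0 R n.
have e1: nm (rc (ln n%:R)*g-s+hf (k%:R/n%:R))<=nm g * ln n%:R+S+Hh/(j%:R/n%:R).
 apply: nmD_le; have := nmB (rc (ln n%:R)*g) s.
 rewrite nmM nm_rc ger0_norm //; lr hb sS.
have e2: `|(k%:R^-1 : R)^+2| <= n%:R^-1^+2.
 rewrite ger0_norm ?exprn_ge0 ?invr_ge0 //; apply: lerXn2r; rewrite ?nnegrE ?invr_ge0 //.
 by rewrite lef_pV2 ?posrE ?ltr0n ?ler_nat ?(ltnW nk) // (ltn_trans n0).
rewrite /drift nmM nm_rc.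
apply: le_trans (ler_wpM2l (ltW np) (ler_pM _ _ e2 e1)) _; rewrite ?nm_ge0 //.
apply: eq_ler; field; by rewrite !gt_eqF.
Qed.

Lemma drift_split s n k : (0<n)%N -> (n<k)%N -> (k<al*n)%N ->
 n%:R*drift s n k=n%:R^-1*Gf (k%:R/n%:R)-g*rc ((k-n)%:R^-1)
 + g*rc al%:R^-1*rc ((al*n-k)%:R^-1)+(rc (ln n%:R)*g-s)*rc (n%:R*k%:R^-1^+2).
Proof.
move=> n0 nk kn; have np: 0<(n%:R : R) by rewrite ltr0n.
have kp: 0<(k%:R : R) by rewrite ltr0n (ltn_trans n0).
have ap: 0<(al%:R : R) by rewrite ltr0n ltnW.
have h1: 0<(k%:R : R)-n%:R by rewrite subr_gt0 ltr_nat.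
have h2: 0<(al%:R : R)*n%:R-k%:R by rewrite subr_gt0 -natrM ltr_nat.
have ->: ((k-n)%:R : R)^-1=n%:R^-1*((k%:R : R)/n%:R - 1)^-1.
 have ->: (k%:R : R)/n%:R - 1=(k%:R-n%:R)/n%:R by field; rewrite gt_eqF.
 by rewrite natrB ?(ltnW nk) // invf_div mulrA mulVf ?mul1r // gt_eqF.
have ->: ((al*n-k)%:R : R)^-1=n%:R^-1*((al%:R : R)-k%:R/n%:R)^-1.
 have ->: (al%:R : R)-k%:R/n%:R=(al%:R*n%:R-k%:R)/n%:R by field; rewrite gt_eqF.
 by rewrite natrB ?(ltnW kn) // natrM invf_div mulrA mulVf ?mul1r // gt_eqF.
have ->: n%:R*(k%:R : R)^-1^+2=n%:R^-1*(k%:R/n%:R) ^- 2.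
 by field; rewrite !gt_eqF.
rewrite /drift /Gfun; have ->: (k%:R : R)^-1^+2=n%:R^-1*n%:R^-1*(k%:R/n%:R) ^- 2.
 by field; rewrite !gt_eqF.
have e: (n%:R : Cplx R)^-1=rc n%:R^-1 by rewrite rcV rc_nat.
have e2: (n%:R : Cplx R)*rc n%:R^-1 = 1 by rewrite -e mulfV // -(rc_nat n) rc_eq0 gt_eqF.
rewrite e !(rcM n%:R^-1) (rcM al%:R^-1) (rcM (n%:R^-1*_)) (rcM n%:R^-1) !mulrA e2; ring.
Qed.

Lemma ln_sub_est (N K : nat) : (2*K<=N)%N -> (0<N)%N ->
 `|ln (N-K)%:R-ln (N%:R : R)| <= 2*K%:R/N%:R.
Proof.
move=> KN N0; have Np: 0<(N%:R : R) by rewrite ltr0n.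
have M0: (0<N-K)%N by rewrite subn_gt0; move: KN N0; clear; lia.
have Mp: 0<((N-K)%:R : R) by rewrite ltr0n.
have KN': (K<=N)%N by move: KN; clear; lia.
have h2: (N%:R : R)<=2*(N-K)%:R by rewrite -natrM ler_nat; move: KN; clear; lia.
have := @ln_lip R (N-K)%:R N%:R ltac:(by rewrite ler1n) ltac:(by rewrite ler_nat leq_subr).
have /andP[l0 l1]: 0<=ln (N%:R : R)-ln (N-K)%:R<=K%:R/(N-K)%:R.
 rewrite -ln_div ?posrE //; have x1: 1<=(N%:R : R)/(N-K)%:R by rewrite ler_pdivlMr // mul1r ler_nat leq_subr.
 rewrite ln_ge0 //=; apply: le_trans (ln_le x1) _.
 have ->: (N%:R : R)=(N-K)%:R+K%:R by rewrite -natrD subnK.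
 by rewrite mulrDl divff ?gt_eqF // addrAC subrr add0r.
move=> _; rewrite distrC ger0_norm //; apply: le_trans l1 _.
rewrite ler_pdivrMr // mulrAC ler_pdivlMr // mulrC [leRHS]mulrAC mulrC.
by rewrite [leRHS]mulrC ler_wpM2l.
Qed.

(** The poles give harmonic sums from K to about (al-1) n and contribute -g (1 - 1/al)(ln n + ln
    (al-1) - ln K); the term g ln n of [drift] contributes g (1 - 1/al) ln n. The logarithms of n
    cancel because both carry the same g, and this is where beta = 0 acts. The limit of the Riemann
    sums supplies the constant. *)
Theorem drift_total : exists Cinf : Cplx R, exists C : R, forall (K : nat) (S : R), (0<K)%N -> 0<=S ->
 exists D : R, forall n s, (2*K<=n)%N -> (0<n)%N -> nm s<=S ->
 nm (n%:R * \sum_(n+K<=k<al*n-K) drift s n k -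
 (- s*rc (1-al%:R^-1)+g*rc (1-al%:R^-1)*rc (ln K%:R)+Cinf))<=C * isq K+D*eps n.
Proof.
have [M M0 hM] := G_bounded g A1 A2 al2 c0 hc; have [L L0 hL] := G_lip g A1 A2 al2 c0 hc.
have [l hl] := riemann_cvg al2 M0 L0 hM hL.
set CU := 2*_ in hl; have g0 := nm_ge0 g.
have ap: 2<=(al%:R : R) by rewrite (ler_nat R 2).
have ai0: 0<(al%:R : R)^-1 by rewrite invr_gt0; lra.
have ai1: (al%:R : R)^-1<=1 by rewrite invf_le1; lra.
exists (l-g*rc (1-al%:R^-1)*rc (ln (al%:R - 1))), (10*nm g) => K S K0 S0.
exists (2*K%:R*M+CU+nm g*(2*K%:R)+nm g*(2*K%:R)+(nm g*4+S)*(2*K%:R+al%:R)).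
move=> n s Kn n0 sS.
have np: 0<(n%:R : R) by rewrite ltr0n.
have nz: (n%:R : Cplx R)!=0 by rewrite -(rc_nat n) rc_eq0 gt_eqF.
have e0 := eps_gt0 (R := R) n0.
have in_eps := @invn_le_eps R n n0.
have Kn1: (K<=n)%N by move: Kn; clear; lia.
have an2: (2*n<=al*n)%N by rewrite leq_mul2r al2 orbT.
have ord1: (n+K<=al*n-K)%N by move: Kn an2; clear; lia.
set N := (al*n-n)%N; have nN: (n<=N)%N by rewrite /N; move: an2; clear; lia.
pose X1 : Cplx R := n%:R^-1 * \sum_(n+K<=k<al*n-K) Gf (k%:R/n%:R).
pose X2 : R := \sum_(K<=j<N-K) j%:R^-1.
pose X3 : R := \sum_(K.+1<=j<(N-K).+1) j%:R^-1.
pose X4 : R := n%:R * \sum_(n+K<=k<al*n-K) k%:R^-1^+2.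
have sumE: n%:R * \sum_(n+K<=k<al*n-K) drift s n k =
 X1-g*rc X2+g*rc al%:R^-1*rc X3+(rc (ln n%:R)*g-s)*rc X4.
 rewrite mulr_sumr (eq_big_nat _ _ (F2 := fun k => n%:R^-1*Gf (k%:R/n%:R)-g*rc ((k-n)%:R^-1)
 + g*rc al%:R^-1*rc ((al*n-k)%:R^-1)+(rc (ln n%:R)*g-s)*rc (n%:R*k%:R^-1^+2))); last first.
 move=> k /andP[k1 k2]; apply: drift_split => //.
 by move: k1 K0; clear; lia.
 by move: k2; clear; lia.
 rewrite !big_split /= sumrN -!mulr_sumr; congr (_-g*_+_*_+_*_).
 - rewrite /X2 -rc_sum; congr rc.
 have ->: (al*n-K)%N=(N-K+n)%N by rewrite /N; move: ord1; clear; lia.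
 by rewrite addnC big_addn addnK; apply: eq_bigr => i _; rewrite addnK.
 - rewrite /X3 -rc_sum; congr rc.
 rewrite big_nat_rev /=.
 have ->: (al*n-K)%N=(N-K+n)%N by rewrite /N; move: ord1; clear; lia.
 rewrite [(n+K)%N]addnC big_addn addnK [in RHS]big_add1 /=.
 apply: eq_big_nat => i /andP[i1 i2]; congr (_%:R^-1).
 by move: i1 i2; rewrite /N; clear -ord1; lia.
 - rewrite /X4 mulr_sumr -rc_sum //.
have b1: nm (X1-l)<=2*K%:R*M*eps n+CU*eps n.
 have R1: nm (X1-riemann al Gf n)<=2*K%:R*M/n%:R.
 have ->: X1-riemann al Gf n = - (n%:R^-1*(\sum_(n<=k<n+K) Gf (k%:R/n%:R) + \sum_(al*n-K<=k<al*n) Gf (k%:R/n%:R))).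
 rewrite /X1 /riemann (big_cat_nat (n := (n+K)%N) (leq_addr _ _)) /=; last first.
 by apply: leq_trans ord1 (leq_subr _ _).
 rewrite (big_cat_nat (p := (al*n)%N) ord1) ?leq_subr //=; ring.
 rewrite nmN nmM nmV nm_nat mulrC ler_pM2r ?invr_gt0 //.
 apply: nmD_le.
 have hb p q: (n<=p)%N -> (q<=al*n)%N -> nm (\sum_(p<=k<q) Gf (k%:R/n%:R))<=(q-p)%:R*M.
 move=> np' qn; apply: le_trans (nm_sum _ _ _) _; rewrite mulr_natl -sumr_const_nat.
 apply: ler_sum_nat => k /andP[k1 k2]; apply: hM.
 by rewrite ler_pdivlMr // mul1r ler_nat (leq_trans np').
 by rewrite ltr_pdivrMr // -natrM ltr_nat (leq_trans k2).
 have := hb n (n+K)%N (leqnn _) ltac:(exact: leq_trans ord1 (leq_subr _ _)).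
 have := hb (al*n-K)%N (al*n)%N ltac:(move: ord1; clear; lia) (leqnn _).
 rewrite addKn subKn; last by move: Kn1 an2; clear; lia.
 lr.
 have := nm_tri (riemann al Gf n) X1 l; have := hl n n0; rewrite -/CU -/(eps n).
 have := ler_wpM2l (_ : 0<=2*K%:R*M) in_eps; rewrite !mulr_ge0 // => /(_ isT); lr R1.
have lnN: ln (N%:R : R)=ln (al%:R - 1)+ln n%:R.
 by rewrite /N natrB -?lnM ?posrE //; [congr ln; ring|lr ap|move: an2; clear; lia].
have KN: (2*K<=N)%N by apply: leq_trans nN.
have N0: (0<N)%N by apply: leq_trans nN.
have lK := @ln_sub_est N K KN N0.
have KNe: 2*K%:R/N%:R<=2*K%:R*eps n :> R.
 rewrite ler_wpM2l ?mulr_ge0 //; apply: le_trans in_eps.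
 by rewrite lef_pV2 ?posrE ?ltr0n // ler_nat.
have iK := @isq_ge0 R K.
have b2: `|X2-(ln N%:R-ln K%:R)| <= 4 * isq K+2*K%:R*eps n.
 have := @harmonic_est R K (N-K) K0 ltac:(move: KN; clear; lia); rewrite -/X2 => h.
 have ->: X2-(ln N%:R-ln K%:R)=X2-(ln (N-K)%:R-ln K%:R)+(ln (N-K)%:R-ln N%:R) by ring.
 apply: le_trans (ler_normD _ _) _; lr h KNe lK.
have b3: `|X3-(ln N%:R-ln K%:R)| <= 6 * isq K+2*K%:R*eps n.
 have KNK: (K<=N-K)%N by move: KN; clear; lia.
 have e3: K%:R^-1+X3=X2+(N-K)%:R^-1.
 rewrite /X3 /X2 -big_ltn; last by rewrite ltnS.
 by rewrite big_nat_recr.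
 have i1: (N-K)%:R^-1<=isq K :> R.
 apply: le_trans (invn_le_isq K0); rewrite lef_pV2 ?posrE ?ltr0n ?ler_nat //.
 exact: leq_trans KNK.
 have i2 := @invn_le_isq R K K0.
 have i3: 0<=(N-K)%:R^-1 :> R by [].
 have i4: 0<=K%:R^-1 :> R by [].
 move: b2; rewrite !ler_norml => /andP[h1 h2]; apply/andP; split; lr h1 i3 i2 e3 iK h2 i4 i1.
have b4: `|X4-(1-al%:R^-1)| <= (2*K%:R+al%:R)/n%:R.
 have pK: (0<n+K)%N by rewrite addn_gt0 n0.
 have := @inv_sq_sum R (n+K) (al*n-K) pK ord1.
 set Sm := \sum_(_<=k<_) _; set p := (n+K)%N in pK *; set q' := (al*n-K)%N => h.
 have pp: 0<(p%:R : R) by rewrite ltr0n.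
 have np': (n%:R : R)<=p%:R by rewrite ler_nat leq_addr.
 have nq: (n%:R : R)<=q'%:R by rewrite ler_nat; move: Kn an2; rewrite /q'; clear; lia.
 have h4: `|X4-n%:R*(p%:R^-1-q'%:R^-1)| <= al%:R/n%:R.
 rewrite /X4 -mulrBr normrM (ger0_norm (ltW np)); apply: le_trans (ler_wpM2l (ltW np) h) _.
 have u1: ((q'-p)%:R : R)<=al%:R*n%:R by rewrite -natrM ler_nat /q' /p; clear; lia.
 have u2: (p%:R : R)^-1^+3<=n%:R^-1^+3.
 by apply: lerXn2r; rewrite ?nnegrE // lef_pV2.
 apply: le_trans (ler_wpM2l (ltW np) (ler_pM _ _ u1 u2)) _; rewrite ?exprn_ge0 ?invr_ge0 //.
 by apply: eq_ler; field; rewrite gt_eqF.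
 have h5: `|n%:R/p%:R - 1| <= K%:R/n%:R :> R.
 have ->: n%:R/p%:R - 1 = - (K%:R/p%:R) :> R by rewrite /p natrD in pp *; field; rewrite gt_eqF.
 rewrite normrN ger0_norm ?divr_ge0 // ler_wpM2l // lef_pV2 ?posrE //.
 have h6: `|n%:R/q'%:R-al%:R^-1| <= K%:R/n%:R :> R.
 have qp: 0<(q'%:R : R) by apply: lt_le_trans nq.
 have eq: (q'%:R : R)=al%:R*n%:R-K%:R by rewrite /q' natrB ?natrM //; move: Kn an2; clear; lia.
 have ->: n%:R/q'%:R-al%:R^-1=al%:R^-1*(K%:R/q'%:R) :> R.
 rewrite eq in qp *; field; rewrite gt_eqF //=; lr ap.
 rewrite ger0_norm ?mulr_ge0 ?invr_ge0 //.
 rewrite -[leRHS]mul1r; apply: ler_pM; rewrite ?divr_ge0 ?(ltW ai0) // ler_wpM2l // lef_pV2 ?posrE //.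
 have ->: X4-(1-al%:R^-1)=(X4-n%:R*(p%:R^-1-q'%:R^-1))+(n%:R/p%:R - 1)-(n%:R/q'%:R-al%:R^-1) by ring.
 apply: le_trans (ler_normB _ _) _; have := ler_normD (X4-n%:R*(p%:R^-1-q'%:R^-1)) (n%:R/p%:R - 1).
 rewrite (mulrDl _ al%:R); lr h6 h5 h4.
have ->: n%:R * \sum_(n+K<=k<al*n-K) drift s n k -
 (- s*rc (1-al%:R^-1)+g*rc (1-al%:R^-1)*rc (ln K%:R)+(l-g*rc (1-al%:R^-1)*rc (ln (al%:R - 1)))) =
 (X1-l)-g*rc (X2-(ln N%:R-ln K%:R))+g*rc al%:R^-1*rc (X3-(ln N%:R-ln K%:R))
 + (rc (ln n%:R)*g-s)*rc (X4-(1-al%:R^-1)).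
 rewrite sumE lnN !rcB !rcD; ring.
have l0 := @ln_nat_ge0 R n.
have t1: nm (g*rc (X2-(ln N%:R-ln K%:R)))<=nm g*(4 * isq K+2*K%:R*eps n).
 by rewrite nmM nm_rc ler_wpM2l.
have t2: nm (g*rc al%:R^-1*rc (X3-(ln N%:R-ln K%:R)))<=nm g*(6 * isq K+2*K%:R*eps n).
 rewrite !nmM !nm_rc -mulrA ler_wpM2l // -[leRHS]mul1r; apply: ler_pM => //.
 by rewrite ger0_norm // ltW.
have t3: nm ((rc (ln n%:R)*g-s)*rc (X4-(1-al%:R^-1)))<=(nm g*4+S)*(2*K%:R+al%:R)*eps n.
 rewrite nmM nm_rc; via ((nm g * ln n%:R+S)*((2*K%:R+al%:R)/n%:R)).
 apply: ler_pM => //; rewrite ?nm_ge0 //.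
 apply: nmB_le; rewrite nmM nm_rc ger0_norm //; lr sS.
 have q1: ln (n%:R : R)/n%:R<=4*eps n.
 apply: le_trans (ln_isq_le n0); rewrite ler_wpM2l // invn_le_isq //.
 have q2: (nm g * ln n%:R+S)/n%:R<=(nm g*4+S)*eps n.
 rewrite mulrDl -mulrA; have := ler_wpM2l g0 q1; have := ler_wpM2l S0 in_eps; lr.
 have ->: (nm g * ln n%:R+S)*((2*K%:R+al%:R)/n%:R)=(nm g * ln n%:R+S)/n%:R*(2*K%:R+al%:R).
 by rewrite mulrA mulrAC.
 by rewrite [leRHS]mulrAC ler_wpM2r.
have := nmD ((X1-l)-g*rc (X2-(ln N%:R-ln K%:R))+g*rc al%:R^-1*rc (X3-(ln N%:R-ln K%:R))) ((rc (ln n%:R)*g-s)*rc (X4-(1-al%:R^-1))).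
have := nmD ((X1-l)-g*rc (X2-(ln N%:R-ln K%:R))) (g*rc al%:R^-1*rc (X3-(ln N%:R-ln K%:R))).
have := nmB (X1-l) (g*rc (X2-(ln N%:R-ln K%:R))).
move: b1 t1 t2 t3; rewrite !mulrDr !mulrDl; lr l0 b4 b3 b2 iK KNe.
Qed.

End DriftSum.

(** * One step of the map in the ratio coordinate *)

Section PassageStep.
Context {R : realType}.
Variables (c : R) (a b30 : Cplx R).
Hypothesis c0 : 0<c.
Local Notation I := (I2c c).
Local Notation vm := (vm c).

Definition vp : Cplx R := vm+I.
Definition bq : R := 1/4+c^+2.
Definition A1 : Cplx R := - (- (a*rc bq)*vm+a*rc bq+b30)/rc (4*c^+2).
Definition A2 : Cplx R := I*(a*rc bq)/rc (4*c^+2).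
Local Notation rrA := (rr A1 A2).

Lemma I2 : I*I = - rc (4*c^+2).
Proof.
rewrite /I2c; transitivity (Ci*Ci*(rc (2*c)*rc (2*c)) : Cplx R); first by ring.
by rewrite Ci2 -rcM mulN1r; congr (- rc _); ring.
Qed.

Lemma I_neq0 : I!=0.
Proof. by rewrite -nm_gt0 nm_I2c // mulr_gt0. Qed.

Lemma vmE : vm=(- 1-I)/2.
Proof. by rewrite /vm /I2c rcV rcM !rc_nat; field. Qed.

Lemma bqE : rc bq=(1-I*I)/4.
Proof.
rewrite I2 /bq; have ->: 1/4+c^+2=(1+4*c^+2)/4 by field.
by rewrite rc_f rc_nat rcD rc1 opprK.
Qed.

Lemma cubic_part z w : w-vp*z!=0 -> w-vm*z!=0 ->
 (a*w^+3-a*w*z^+2+b30*z^+3)/((w-vp*z)*(w-vm*z)) =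
 a*(w-z)+z*rrA ((w-vp*z)/(w-vm*z)).
Proof.
move=> hA hB; have i0 := I_neq0.
have e4: rc (4*c^+2) = - (I*I) by rewrite I2 opprK.
have eA: w-vp*z=w-vm*z-I*z by rewrite /vp; ring.
have ew: w=(w-vm*z)+(- 1-I)/2*z by rewrite -vmE subrK.
rewrite eA in hA *; rewrite {1 2 5}ew; move: (w-vm*z) hA hB => B hA hB.
rewrite /rr /A1 /A2 e4 bqE vmE.
move: (I) i0 hA => i i0 hA; field.
by rewrite hA hB i0.
Qed.

Lemma quad_part z w : w^+2+w*z+rc bq*z^+2=(w-vp*z)*(w-vm*z).
Proof. by rewrite bqE /vp vmE; field. Qed.

(** As vp - vm = I, the difference (w'-vp z')(w-vm z) - (w-vp z)(w'-vm z') equals I (w' z - z' w),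
    that is I z (AB + T3 + err), where the quadratic part is exactly the product AB. The ratio is
    thus multiplied by 1 + I z (1 + ...), a rotation to first order. *)
Theorem step_est (La Q : R) : 1<=La -> 0<=Q -> exists C eta : R, [/\ 0<=C, 0<eta &
 forall z w e1 e2 : Cplx R, z!=0 ->
 let m := nm z+nm w in
 let A := w-vp*z in let B := w-vm*z in
 let z' := z-z^+2+a*z^+3+e2 in
 let w' := w+w^+2+rc bq*z^+2+a*w^+3+b30*z^+3+e1 in
 m<=La*nm A -> m<=La*nm B -> m<=eta -> nm e1<=Q * m^+4 -> nm e2<=Q*nm z^+4 ->
 w'-vm*z'!=0 /\
 nm ((w'-vp*z')/(w'-vm*z')/(A/B) - 1
 - I*z*(1+(a - 1)*w+(vp-(a - 1))*z+z*rrA (A/B)))<=C*nm z * m^+2].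
Proof.
move=> La1 Q0; have v0 := nm_ge0 vm; have na := nm_ge0 a; have nb := nm_ge0 b30.
pose CT := nm a+nm b30+nm vm*nm a+Q+nm vm*Q.
pose C3 := (2*nm a+nm b30)*La^+2.
pose Cb := 1+nm vm+CT*La.
pose C4 := 2*Q*La^+2+CT*La+(1+nm vm+C3)*Cb.
have La0: 0<=La by lra.
have CT0: 0<=CT by nneg.
have C30: 0<=C3 by nneg.
have Cb1: 1<=Cb by rewrite /Cb; have := mulr_ge0 CT0 La0; lra.
have Cb0: 0<Cb by lra.
have C40: 0<=C4 by nneg.
have c2: 0<=2*c by nneg.
exists (2*c*(2*C4)), (2*Cb)^-1; split; [by nneg|by rewrite invr_gt0 mulr_gt0|].
move=> z w e1 e2 z0 m A B z' w' mA mB meta he1 he2.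
have nz: 0<nm z by rewrite nm_gt0.
have nw := nm_ge0 w.
have m0: 0<m by rewrite /m; lr nw nz.
have m1: m<=1.
 by apply: le_trans meta _; rewrite invf_le1; lr Cb1.
have zm: nm z<=m by rewrite /m; lr nw.
have wm: nm w<=m by rewrite /m; lr nz.
have A0: 0<nm A by rewrite ltNge; apply/negP => h; have := ler_wpM2l La0 h; lr m0 mA.
have B0: 0<nm B by rewrite ltNge; apply/negP => h; have := ler_wpM2l La0 h; lr m0 mB.
have An: A!=0 by rewrite -nm_gt0.
have Bn: B!=0 by rewrite -nm_gt0.
have pw k x: 0<=x -> x<=m -> x^+k<=m^+k.
 by move=> x0 xm; apply: lerXn2r; rewrite ?nnegrE // ltW.
have m3: m^+4<=m^+3 by rewrite exprS ler_piMl ?exprn_ge0 // ltW.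
have he2m: nm e2<=Q * m^+4 by apply: le_trans he2 _; rewrite ler_wpM2l // pw ?nm_ge0.
pose T := a*w^+3+b30*z^+3-vm*(a*z^+3)+(e1-vm*e2).
have hT: nm T<=CT * m^+3.
 have q1: nm (a*w^+3)<=nm a * m^+3 by rewrite nmM nmX ler_wpM2l // pw.
 have q2: nm (b30*z^+3)<=nm b30 * m^+3 by rewrite nmM nmX ler_wpM2l // pw ?nm_ge0.
 have q3: nm (vm*(a*z^+3))<=nm vm*nm a * m^+3.
 by rewrite nmM nmM nmX mulrA ler_wpM2l ?mulr_ge0 // pw ?nm_ge0.
 have q4: nm (e1-vm*e2)<=(Q+nm vm*Q) * m^+3.
 apply: nmB_le; rewrite nmM mulrDl -mulrA; apply: lerD.
 by apply: le_trans he1 _; rewrite ler_wpM2l.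
 by rewrite ler_wpM2l //; apply: le_trans he2m _; rewrite ler_wpM2l.
 apply: nmD_le; have := nmB (a*w^+3+b30*z^+3) (vm*(a*z^+3)).
 have := nmD (a*w^+3) (b30*z^+3); rewrite /CT; lr q4 q3 q2 q1.
have TB: nm (T/B)<=CT*La * m^+2.
 rewrite nmf ler_pdivrMr //; apply: (le_trans hT).
 have ->: CT*La * m^+2*nm B=CT * m^+2*(La*nm B) by ring.
 by rewrite exprSr mulrA ler_wpM2l // mulr_ge0 // exprn_ge0 // ltW.
pose beta := w+vm*z+T/B.
have wv: nm (w+vm*z)<=(1+nm vm) * m.
 apply: nmD_le; rewrite nmM mulrDl mul1r; apply: lerD => //.
 by rewrite ler_wpM2l.
have hb: nm beta<=Cb * m.
 apply: nmD_le; rewrite /Cb [leRHS]mulrDl; apply: lerD => //.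
 apply: le_trans TB _; rewrite expr2 mulrA ler_piMr //.
 by nneg.
have hb2: nm beta<=1/2.
 apply: le_trans hb _; apply: le_trans (ler_wpM2l (ltW Cb0) meta) _.
 by apply: eq_ler; field; rewrite gt_eqF.
have nb1: 1/2<=nm (1+beta) by have := nmD_ge 1 beta; rewrite nm1; lr hb2.
have bn: 1+beta!=0 by rewrite -nm_gt0; lr nb1.
have eB: w'-vm*z'=B*(1+beta).
 have ->: B*(1+beta)=B+B*(w+vm*z)+T.
 by rewrite /beta; move: (T) (B) (w+vm*z) Bn => X Y Z Yn; field.
 by rewrite /w' /z' /T /B bqE vmE; field.
have B'n: w'-vm*z'!=0 by rewrite eB mulf_neq0.
split=> //.
pose err := e1-e2*w/z.
have herr: nm err<=2*Q * m^+4.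
 have : nm (e2*w/z)<=Q * m^+4.
 rewrite nmf ler_pdivrMr // nmM; apply: le_trans (ler_wpM2r nw he2) _.
 have ->: Q*nm z^+4*nm w=Q*(nm z^+3*nm w)*nm z by ring.
 rewrite ler_wpM2r ?(ltW nz) // ler_wpM2l // [leRHS]exprSr.
 by apply: ler_pM; rewrite ?exprn_ge0 ?(ltW nz) // pw // ltW.
 by have := nmB e1 (e2*w/z); rewrite -/err; lr he1.
pose T3 := a*w^+3-a*w*z^+2+b30*z^+3.
pose AB := A*B; have AB0: 0<nm AB by rewrite nmM mulr_gt0.
have mAB: m^+2<=La^+2*nm AB.
 have ->: La^+2*nm AB=(La*nm A)*(La*nm B) by rewrite nmM; ring.
 by rewrite expr2; apply: ler_pM; rewrite ?(ltW m0).
have hT3: nm T3<=(2*nm a+nm b30) * m^+3.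
 have q1: nm (a*w^+3)<=nm a * m^+3 by rewrite nmM nmX ler_wpM2l // pw.
 have q2: nm (b30*z^+3)<=nm b30 * m^+3 by rewrite nmM nmX ler_wpM2l // pw ?nm_ge0.
 have q3: nm (a*w*z^+2)<=nm a * m^+3.
 rewrite nmM (nmM a) nmX -mulrA ler_wpM2l // [leRHS]exprS.
 by apply: ler_pM; rewrite ?exprn_ge0 ?nm_ge0 // pw ?nm_ge0.
 apply: nmD_le; have := nmB (a*w^+3) (a*w*z^+2); rewrite -/T3; lr q3 q2 q1.
have hT3N: nm (T3/AB)<=C3 * m.
 rewrite nmf ler_pdivrMr //; apply: (le_trans hT3).
 have ->: C3 * m*nm AB=(2*nm a+nm b30) * m*(La^+2*nm AB) by rewrite /C3; ring.
 by rewrite [m^+3]exprS mulrA ler_wpM2l // mulr_ge0; nneg.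
have herrN: nm (err/AB)<=2*Q*La^+2 * m^+2.
 rewrite nmf ler_pdivrMr //; apply: (le_trans herr).
 have ->: 2*Q*La^+2 * m^+2*nm AB = 2*Q * m^+2*(La^+2*nm AB) by ring.
 have ->: m^+4=m^+2 * m^+2 by ring.
 by rewrite mulrA ler_wpM2l //; rewrite !mulr_ge0 // ltW.
have T3E := @cubic_part z w An Bn; rewrite -/A -/B -/AB -/T3 in T3E.
(* What remains after multiplying through by 1 + beta: T3/AB is known exactly from [cubic_part], and
   beta equals w + vm z up to the second-order term T/B. *)
pose E := err/AB-T/B+(w+vm*z-T3/AB)*beta.
have hE: nm E<=C4 * m^+2.
 have q1: nm ((w+vm*z-T3/AB)*beta)<=(1+nm vm+C3)*Cb * m^+2.
 have ->: (1+nm vm+C3)*Cb * m^+2=((1+nm vm) * m+C3 * m)*(Cb * m) by ring.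
 rewrite nmM; apply: ler_pM; rewrite ?nm_ge0 //.
 by apply: nmB_le; apply: lerD.
 apply: nmD_le; have := nmB (err/AB) (T/B); rewrite /C4; lr q1 T3E herrN hT3N hT3 mAB AB0 herr eB nb1 hb2 hb wv TB hT he2m m3 B0 A0 wm zm m1 m0 nw nz he2 he1 meta mB mA c2 C40 Cb0 Cb1 C30 CT0 La0 nb na v0 Q0 La1 c0.
have key: (w'-vp*z')/(w'-vm*z')/(A/B) - 1
 - I*z*(1+(a - 1)*w+(vp-(a - 1))*z+z*rrA (A/B))=I*z*(E/(1+beta)).
 have ->: z*rrA (A/B)=T3/AB-a*(w-z) by rewrite T3E; ring.
 have e1': (w'-vp*z')/(w'-vm*z')/(A/B) - 1=I*z*((AB+T3+err)/(A*(B*(1+beta)))).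
 have idn: (w'-vp*z')*B-A*(w'-vm*z')=I*z*(AB+T3+err).
 rewrite /AB -quad_part /err /T3 /A /B /w' /z' bqE /vp vmE; field.
 by [].
 rewrite mulrA -idn -eB; move: (A) (B) (w'-vm*z') (w'-vp*z') An Bn B'n => X Y Z W Xn Yn Zn; field.
 by rewrite Xn Yn Zn.
 rewrite e1' /E /AB.
 have vv: vp-(a - 1) = - a-vm by rewrite /vp vmE; field.
 have eT: T/B=beta-(w+vm*z) by rewrite /beta addrC addKr.
 rewrite vv eT; move: (T3) (err) (beta) An Bn bn => X1 X2 X4 An Bn bn; field.
 by rewrite An Bn bn.
rewrite key nmM (nmM I) nm_I2c // nmf.
have ->: 2*c*(2*C4)*nm z * m^+2 = 2*c*nm z*(2*(C4 * m^+2)) by ring.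
rewrite ler_wpM2l ?mulr_ge0 ?(ltW nz) ?(ltW c0) // ler_pdivrMr; last by lr nb1.
have E0 := nm_ge0 E; nra.
Qed.

End PassageStep.

(** * Entrance, exit and the expansion of the base orbit *)

Section Asymptotics.
Context {R : realType}.
Variables (c : R).
Hypothesis c0 : 0<c.
Local Notation I := (I2c c).
Local Notation vm := (vm c).

Lemma cis_asym (t tau x : R) : 0<=x -> `|t-tau*x| <= 2*(tau^+2*x^+2) -> `|t| <= 2 * `|tau|*x ->
 nm (cis (2*c*t) - 1-I*rc (tau*x))<=(32*c^+2+4*c)*tau^+2*x^+2.
Proof.
move=> x0 h1 h2.
have ->: cis (2*c*t) - 1-I*rc (tau*x)=(cis (2*c*t) - 1-Ci*rc (2*c*t))+I*rc (t-tau*x).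
 by rewrite /I2c rcB (rcM (2*c) t); ring.
apply: nmD_le.
have q1: nm (I*rc (t-tau*x))<=2*c*(2*(tau^+2*x^+2)).
 by rewrite nmM nm_I2c // nm_rc ler_wpM2l // mulr_ge0 // ltW.
have q2: nm (cis (2*c*t) - 1-Ci*rc (2*c*t))<=32*c^+2*tau^+2*x^+2.
 apply: le_trans (cis_le2 _) _.
 have : t^+2<=(2 * `|tau|*x)^+2.
 by rewrite -(real_normK (num_real t)); apply: lerXn2r; rewrite ?nnegrE ?mulr_ge0.
 have ->: (2 * `|tau|*x)^+2 = 4*(tau^+2*x^+2) by rewrite -(real_normK (num_real tau)); ring.
 rewrite exprMn => h; have := ler_wpM2l (sqr_ge0 (2*c)) h.
 have ->: (2*c)^+2 = 4*c^+2 by ring.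
 lra.
lra.
Qed.

Lemma ln_asym_up (K n : nat) : (0<n)%N ->
 `|ln ((n+K)%:R/n%:R : R)-K%:R*n%:R^-1| <= 2*(K%:R^+2*n%:R^-1^+2) /\
 `|ln ((n+K)%:R/n%:R : R)| <= 2 * `|K%:R|*n%:R^-1.
Proof.
move=> n0; have np: 0<(n%:R : R) by rewrite ltr0n.
have ->: (n+K)%:R/n%:R = 1+K%:R*n%:R^-1 :> R by rewrite natrD; field; rewrite gt_eqF.
set y := K%:R*n%:R^-1; have y0: 0<=y by rewrite mulr_ge0 // invr_ge0.
have ->: K%:R^+2*n%:R^-1^+2=y^+2 by rewrite exprMn.
have h1 := ln1D_ge y0; have h2 := @le_ln1Dx R y ltac:(lra).
have h3: 0<=ln (1+y) by apply: ln_ge0; lra.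
rewrite (ger0_norm h3) normr_nat -mulrA -/y; split; last by lra.
by have := sqr_ge0 y; rewrite distrC ger0_norm; lra.
Qed.

Lemma ln_asym_down (K N : nat) : (2*K<=N)%N -> (0<N)%N ->
 `|- ln (N%:R/(N-K)%:R : R)-(- K%:R)*N%:R^-1| <= 2*((- K%:R)^+2*N%:R^-1^+2) /\
 `|- ln (N%:R/(N-K)%:R : R)| <= 2 * `|- K%:R|*N%:R^-1.
Proof.
move=> KN N0; have Np: 0<(N%:R : R) by rewrite ltr0n.
have KN': (K<=N)%N by move: KN; clear; lia.
set y : R := K%:R*N%:R^-1; have y0: 0<=y by rewrite mulr_ge0 // invr_ge0.
have y1: y<=1/2.
 by rewrite /y ler_pdivrMr // mulrC mul1r ler_pdivlMr // -natrM ler_nat mulnC.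
have ->: N%:R/(N-K)%:R=(1-y)^-1 :> R.
 rewrite natrB // /y; field; rewrite gt_eqF //=.
 have : (2*K%:R : R)<=N%:R by rewrite -natrM ler_nat.
 by move=> h; rewrite gt_eqF; lra.
rewrite lnV ?posrE ?opprK; last by lra.
have h1 := @le_ln1Dx R (- y) ltac:(lra).
have x1: 1<=(1-y)^-1 by rewrite invf_ge1; lra.
have h2 := ln_le x1; rewrite lnV ?posrE in h2; last by lra.
have h3: (1-y)^-1 - 1<=y+2*y^+2.
 rewrite lerBlDr -[leLHS]mul1r ler_pdivrMr; last by lra.
 have := mulr_ge0 (mulr_ge0 y0 y0) (_ : 0<=1 - 2*y); nra.
rewrite normrN normr_nat mulNr -/y -mulrA -/y sqrrN -exprMn -/y.
split; first by rewrite opprK ler_norml; apply/andP; split; [lr h3 h2|have := sqr_ge0 y; lr h1].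
rewrite ler0_norm //; nra.
Qed.

(** In u = -1/w the ratio minus 1 is I z u/(1 + vm z u). Multiplied by n it approaches I u, so at
    scale 1/n the ratio at the entrance reads off u. *)
Lemma start_asym (z u : Cplx R) (n : nat) (U E : R) : (0<n)%N -> nm (n%:R*z - 1)<=E -> E<=1 ->
 nm u<=U -> 4*(nm vm*U)<=n%:R ->
 nm (n%:R*(I*z*u/(1+vm*z*u))-I*u)<=2*c*U*(4*nm vm*U/n%:R+2*E).
Proof.
move=> n0 hE E1 hu hn; have np: 0<(n%:R : R) by rewrite ltr0n.
have v0 := nm_ge0 vm; have u0 := nm_ge0 u.
have nz: nm z<=2/n%:R.
 rewrite ler_pdivlMr // mulrC -[X in X*_]nm_nat -nmM.
 have := nmD (n%:R*z - 1) 1; rewrite subrK nm1; lra.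
set y := vm*z*u; have hy: nm y<=2*(nm vm*U)/n%:R.
 rewrite /y !nmM; via (nm vm*(2/n%:R)*U); last by apply: eq_ler; ring.
 by apply: ler_pM; rewrite ?mulr_ge0 ?nm_ge0 // ler_wpM2l.
have y2: nm y<=1/2 by apply: le_trans hy _; rewrite ler_pdivrMr; lra.
have n1: 1/2<=nm (1+y) by have := nmD_ge 1 y; rewrite nm1; lra.
have yn: 1+y!=0 by rewrite -nm_gt0; lra.
have ->: n%:R*(I*z*u/(1+y))-I*u=I*u*(((n%:R*z - 1)-y)/(1+y)) by field.
rewrite nmM nmM nm_I2c // nmf; apply: ler_pM; rewrite ?mulr_ge0 ?invr_ge0 ?nm_ge0 ?(ltW c0) //.
 by rewrite ler_wpM2l // mulr_ge0 // ltW.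
rewrite ler_pdivrMr; last by lr n1.
have := nmB (n%:R*z - 1) y.
have ->: 4*nm vm*U/n%:R = 2*(2*(nm vm*U)/n%:R) by ring.
have := nm_ge0 (n%:R*z - 1); have := nm_ge0 y; nr n1 hy hE.
Qed.

Lemma end_asym (z X : Cplx R) (N : nat) (U E : R) : (0<N)%N -> nm (N%:R*z - 1)<=E -> E<=1/2 ->
 nm X<=U -> 2*(nm vm*U)<=2*c*N%:R ->
 I-vm*(X/N%:R)!=0 /\
 nm (X/N%:R/(z*(I-vm*(X/N%:R)))-X/I)<=U/(2*c)*(4*(E+nm vm*U/(2*c)/N%:R)).
Proof.
move=> N0 hE E1 hX hN; have Np: 0<(N%:R : R) by rewrite ltr0n.
have Nn: (N%:R : Cplx R)!=0 by rewrite -nm_gt0 nm_nat.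
have v0 := nm_ge0 vm; have x0 := nm_ge0 X; have i0 := I_neq0 c0.
have c2: 0<2*c by nneg.
set y := vm*(X/N%:R)/I.
have hy: nm y<=nm vm*U/(2*c)/N%:R.
 rewrite /y nmf nmM nmf nm_nat nm_I2c //.
 have ->: nm vm*U/(2*c)/N%:R=nm vm*(U/N%:R)/(2*c) by ring.
 by rewrite ler_pM2r ?invr_gt0 // ler_wpM2l // ler_pM2r ?invr_gt0.
have y2: nm y<=1/2.
 by apply: le_trans hy _; rewrite ler_pdivrMr // ler_pdivrMr; lra.
have n1: 1/2<=nm (1-y) by have := nmB_ge 1 y; rewrite nm1; lra.
have yn: 1-y!=0 by rewrite -nm_gt0; lra.
have eI: I-vm*(X/N%:R)=I*(1-y) by rewrite /y; field; rewrite i0 Nn.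
have t1: 1/2<=nm (N%:R*z).
 by have := nmD_ge 1 (N%:R*z - 1); rewrite addrCA subrr addr0 nm1; lr E1 hE.
have tn: N%:R*z!=0 by rewrite -nm_gt0; lr t1.
have zn: z!=0 by move: tn; rewrite mulf_eq0 negb_or => /andP[].
split; first by rewrite eI mulf_neq0.
rewrite eI.
have ->: X/N%:R/(z*(I*(1-y)))-X/I=X/I*((1-(N%:R*z)*(1-y))/(N%:R*z*(1-y))).
 by field; rewrite zn yn i0 Nn.
rewrite nmM (nmf X) nm_I2c // nmf; apply: ler_pM; rewrite ?mulr_ge0 ?invr_ge0 ?nm_ge0 ?(ltW c2) //.
 by rewrite ler_pM2r ?invr_gt0.
rewrite nmM ler_pdivrMr; last by rewrite mulr_gt0 //; lr t1 n1.
have ->: 1-N%:R*z*(1-y) = - (N%:R*z - 1)*(1-y)+y by ring.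
have q1: nm (- (N%:R*z - 1)*(1-y)+y)<=E*nm (1-y)+nm y.
 by apply: nmD_le; rewrite nmM nmN lerD2r ler_wpM2r ?nm_ge0.
apply: (le_trans q1).
have E0 := le_trans (nm_ge0 _) hE.
set s := nm vm*U/(2*c)/N%:R in hy *; set p := nm (1-y) in n1 *; set t := nm (N%:R*z) in t1 *.
have s0: 0<=s := le_trans (nm_ge0 _) hy.
have h1: E * p*1<=E * p*(2*t) by rewrite ler_wpM2l ?mulr_ge0 //; lr n1 t1.
have h2: 1/4<=t * p by have := ler_pM (_ : 0<=1/2) (_ : 0<=1/2) t1 n1; lr.
have h3 := ler_wpM2l s0 h2; nr h2 h1 s0 hy E0.
Qed.

(** Inverts 1/z = k - g ln k + s + O(k^(-1/2)). As (ln k)/k is O(k^(-3/4)), its square is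
    O(k^(-3/2)), and the expansion of z to order k^-2 has an error of order k^(-5/2); hence the
    powers of [eps]. *)
Lemma Z_est (g : Cplx R) (S Cz : R) : 0<=S -> 0<=Cz -> exists C : R, exists k1 : nat, [/\ 0<=C, (0<k1)%N &
 forall k s z, (k1<=k)%N -> nm s<=S ->
 nm (z^-1-(k%:R-g*rc (ln k%:R)+s))<=Cz * isq k ->
 [/\ z!=0, nm (k%:R*z - 1)<=C*eps k^+3, nm (z-k%:R^-1)<=C*eps k^+3*k%:R^-1, nm z<=2/k%:R & 1/(2*k%:R)<=nm z /\
 nm (z-k%:R^-1-rc (k%:R^-1^+2)*(rc (ln k%:R)*g-s))<=C * isq k*k%:R^-1^+2]].
Proof.
move=> S0 Cz0; pose Cy := 4*nm g+S+Cz.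
have g0 := nm_ge0 g; have Cy0: 0<=Cy by rewrite /Cy; lra.
have [k1 [k10 hk1]] := @eps_small R (2*Cy+2)^-1 ltac:(rewrite invr_gt0; lra).
exists (2*Cy+Cz+2*Cy^+2), k1; split=> //; first by nneg.
move=> k s z kk sS; set th := z^-1-_ => hth.
have k0: (0<k)%N by apply: leq_trans kk.
have kp: 0<(k%:R : R) by rewrite ltr0n.
have kn: (k%:R : Cplx R)!=0 by rewrite -nm_gt0 nm_nat.
set e := eps k; have e0: 0<e by exact: eps_gt0.
have ek: e<=(2*Cy+2)^-1 by exact: hk1.
have e4: e^+4=k%:R^-1 by exact: eps4.
have e2: isq k=e^+2 by rewrite eps2.
have e1: e<=1 by exact: eps_le1.
pose y := (g*rc (ln k%:R)-s-th)/k%:R.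
have hy: nm y<=Cy*e^+3.
 rewrite /y nmf nm_nat -e4 !exprS expr0 !mulr1.
 have : nm (g*rc (ln k%:R)-s-th)<=Cy/e.
 have q1: nm (g*rc (ln k%:R))<=nm g*(4/e).
 rewrite nmM nm_rc ler_wpM2l // ger0_norm ?ln_nat_ge0 //; exact: ln_le_eps.
 have q2: S+Cz<=(S+Cz)/e by rewrite ler_peMr ?invf_ge1 //; lr Cz0 S0.
 have q3: Cz * isq k<=Cz by rewrite ler_piMr ?isq_le1.
 have := nmB (g*rc (ln k%:R)-s) th; have := nmB (g*rc (ln k%:R)) s.
 rewrite /Cy (_ : (4*nm g+S+Cz)/e=nm g*(4/e)+(S+Cz)/e); [lr q3 q2 q1 hth sS|ring].
 move=> h; apply: le_trans (ler_wpM2r _ h) _; first by rewrite !mulr_ge0 ?(ltW e0).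
 by apply: eq_ler; field; rewrite gt_eqF.
have e3: e^+3<=e by rewrite exprS ler_piMr ?(ltW e0) // exprn_ile1 // ltW.
have Ce: Cy*e<=1/2.
 have := ler_wpM2l (_ : 0<=2*Cy+2) ek; rewrite mulfV; [nr Cy0|by rewrite gt_eqF //; lr Cy0].
have y2: nm y<=1/2 by have := ler_wpM2l Cy0 e3; lr Ce hy.
have n1: 1/2<=nm (1-y) by have := nmB_ge 1 y; rewrite nm1; lr y2.
have yn: 1-y!=0 by rewrite -nm_gt0; lr n1.
have zi: z^-1=k%:R*(1-y).
 by rewrite mulrBr mulr1 /y mulrCA mulfV // mulr1 /th; ring.
have z0: z!=0 by rewrite -invr_eq0 zi mulf_neq0.
have ez: z=(k%:R*(1-y))^-1 by rewrite -zi invrK.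
have kz: k%:R*z - 1=y/(1-y) by rewrite ez; field; rewrite yn kn.
have hkz: nm (k%:R*z - 1)<=2*Cy*e^+3.
 rewrite kz nmf ler_pdivrMr; last by lr n1.
 have := nm_ge0 y; nr n1 hy.
have C1: 2*Cy*e^+3<=(2*Cy+Cz+2*Cy^+2)*e^+3.
 by rewrite ler_wpM2r ?exprn_ge0 ?(ltW e0); have := sqr_ge0 Cy; lr Cz0.
have nzk: nm z*k%:R=nm (k%:R*z) by rewrite nmM nm_nat mulrC.
have kz1: nm (k%:R*z - 1)<=1 by rewrite kz nmf ler_pdivrMr; lr n1 y2.
split => //; last split.
- by apply: le_trans hkz _.
- have ->: z-k%:R^-1=(k%:R*z - 1)/k%:R by field.
 by rewrite nmf nm_nat ler_pM2r ?invr_gt0 //; apply: le_trans hkz _.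
- by rewrite ler_pdivlMr // nzk; have := nmD (k%:R*z - 1) 1; rewrite subrK nm1; lr kz1.
- rewrite ler_pdivrMr ?mulr_gt0 // mulrCA nzk.
 have ->: k%:R*z=(1-y)^-1 by rewrite ez; field; rewrite yn kn.
 rewrite nmV; have : nm (1-y)<=2 by apply: nmB_le; rewrite nm1; lr y2.
 by move=> h; rewrite ler_pdivlMr; lr h n1.
have ->: z-k%:R^-1-rc (k%:R^-1^+2)*(rc (ln k%:R)*g-s)=k%:R^-1*(y^+2/(1-y))-th*k%:R^-1^+2.
 rewrite ez rcX rcV rc_nat /y; move: yn; rewrite /y; move: (th) => t yn.
 by field; rewrite kn /=; move: yn; apply: contraNneq => h; apply/eqP; apply: (mulfI kn); rewrite mulr0 mulrBr mulr1 mulrCA mulfV // mulr1 -h; ring.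
apply: nmB_le; rewrite (nmM k%:R^-1 (y^+2/(1-y))) (nmM th) nmf !nmX !nmV nm_nat.
have q1: nm th*k%:R^-1^+2<=Cz * isq k*k%:R^-1^+2.
 by rewrite ler_wpM2r // exprn_ge0 invr_ge0.
have q2: k%:R^-1*(nm y^+2/nm (1-y))<=2*Cy^+2 * isq k*k%:R^-1^+2.
 have ->: 2*Cy^+2 * isq k*k%:R^-1^+2=k%:R^-1*(2*(Cy*e^+3)^+2) :> R.
 by rewrite e2 -e4; ring.
 rewrite ler_wpM2l ?invr_ge0 // ler_pdivrMr; last by lr n1.
 have : nm y^+2<=(Cy*e^+3)^+2 by apply: lerXn2r; rewrite ?nnegrE ?nm_ge0 ?mulr_ge0 ?(ltW e0).
 have := sqr_ge0 (Cy*e^+3); nr n1.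
have q3: 0<=2*Cy * isq k*k%:R^-1^+2 by nneg.
lr q3 q2 q1.
Qed.

End Asymptotics.

(** * Comparison of one step with the reference ratio *)

Section PassageErr.
Context {R : realType}.

Lemma ln_taylor3 (x : R) : 1<=x -> `|ln x-(x - 1)+(x - 1)^+2/2| <= (x - 1)^+3.
Proof.
move=> x1.
pose f : R -> R := (@ln R)-id+(2^-1 : R) \*: ((id-cst 1)*(id-cst 1)).
have fE y: f y=ln y-y+(y - 1)^+2/2.
 rewrite /f !fctE /cst /=.
 by rewrite [_ *: _](_ : _ = 2^-1*((y - 1)*(y - 1))) //; field.
have df (y: R) : 1<=y -> is_derive y 1 f (y^-1 - 1+(y - 1)).
 move=> y1; have y0: 0<y by lra.
 have dl := is_derive1_ln y0.
 rewrite /f; apply: is_derive_eq.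
 rewrite !fctE /cst /=; have sE (p q: R) : p *: (q : R^o) = p*q by [].
 by rewrite !sE; field; rewrite gt_eqF.
have [||t] := @MVT_segment R f (fun y => y^-1 - 1+(y - 1)) 1 x x1.
- by move=> y; rewrite in_itv /= => /andP[y1 _]; apply: df; exact: ltW.
- apply: derivable_within_continuous => y; rewrite in_itv /= => /andP[y1 _].
 by have [] := df y y1.
rewrite in_itv /= => /andP[t1 tx].
rewrite !fE ln1 => e.
have ->: ln x-(x - 1)+(x - 1)^+2/2=(t^-1 - 1+(t - 1))*(x - 1).
 rewrite -e; ring.
have t0: 0<t by lra.
have ->: t^-1 - 1+(t - 1)=(t - 1)^+2/t by field; rewrite gt_eqF.
have q0: 0<=(t - 1)^+2/t by rewrite divr_ge0 ?sqr_ge0 ?(ltW t0).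
rewrite ger0_norm; last by rewrite mulr_ge0 // subr_ge0.
rewrite [leRHS]exprSr ler_wpM2r ?subr_ge0 // ler_pdivrMr //.
have : (t - 1)^+2<=(x - 1)^+2 by apply: lerXn2r; rewrite ?nnegrE; lr t1 x1 tx.
have := sqr_ge0 (x - 1); nra.
Qed.

Variables (al : nat) (c : R) (a b30 : Cplx R).
Hypotheses (al2 : (2<=al)%N) (c0 : 0<c) (hc : c * ln al%:R = pi).
Local Notation I := (I2c c).
Local Notation vm := (vm c).
Local Notation vp := (vp c).
Local Notation A1 := (A1 c a b30).
Local Notation A2 := (A2 c a).
Local Notation rr := (rr A1 A2).
Local Notation g := (a - 1).
Local Notation kap := (kap al c).
Local Notation rs n k := (rho c (k%:R/n%:R)).
Local Notation drift := (drift c g A1 A2).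
Local Notation jj n k := (minn (k-n) (al*n-k)).

(** One step of the reference ratio to second order. The coefficient is written I vp, using I vp =
    I^2/2 - I/2, since in this form it cancels against the one in [step_est]. *)
Lemma Tstar_est k : (0<k)%N ->
 nm (cis (2*c * ln (k.+1%:R/k%:R)) - 1-I*rc (k%:R^-1)-I*vp*rc (k%:R^-1^+2)) <=
 (16*c^+3+4*c^+2+2*c)*k%:R^-1^+3 /\
 nm (cis (2*c * ln (k.+1%:R/k%:R)) - 1)<=4*c*k%:R^-1.
Proof.
move=> k0; have kp: 0<(k%:R : R) by rewrite ltr0n.
set y : R := k%:R^-1; have y0: 0<y by rewrite invr_gt0.
have ->: k.+1%:R/k%:R = 1+y by rewrite -natr1 mulrDl divff ?gt_eqF // mul1r.
set t := ln (1+y).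
have h3 := @ln_taylor3 (1+y) ltac:(lra); have e1: 1+y - 1=y by ring.
rewrite e1 -/t in h3.
have t1: t<=y by apply: le_ln1Dx; lra.
have t0: 0<=t by apply: ln_ge0; lra.
have t2: y-y^+2<=t by apply: ln1D_ge; exact: ltW.
have c2: 0<=2*c by rewrite mulr_ge0 // ltW.
split; last first.
 apply: le_trans (cisB1_le _) _; rewrite ger0_norm ?mulr_ge0 ?(ltW c0) //.
 have := ler_wpM2l c2 t1; lra.
have vpE: I*vp=I*I/2-I/2 by rewrite /vp vmE; field.
have ->: cis (2*c*t) - 1-I*rc y-I*vp*rc (y^+2) =
 (cis (2*c*t) - 1-Ci*rc (2*c*t)+rc ((2*c*t)^+2/2))+I*rc (t-y+y^+2/2)+rc (2*c^+2*(y^+2-t^+2)).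
 rewrite vpE I2 /I2c !(rcB, rcD, rcM, rcX, rcV) !rc_nat; field.
 by rewrite -(rc_nat k) rc_eq0 gt_eqF.
apply: nmD_le.
have q1: nm (cis (2*c*t) - 1-Ci*rc (2*c*t)+rc ((2*c*t)^+2/2))<=16*c^+3*y^+3.
 apply: le_trans (cis_le3 _) _; rewrite ger0_norm ?mulr_ge0 ?(ltW c0) //.
 have ->: 2*(2*c*t)^+3 = 16*c^+3*t^+3 by ring.
 rewrite ler_wpM2l ?mulr_ge0 ?exprn_ge0 ?(ltW c0) //.
 by apply: lerXn2r; rewrite ?nnegrE ?(ltW y0).
have q2: nm (I*rc (t-y+y^+2/2))<=2*c*y^+3.
 by rewrite nmM nm_I2c // nm_rc ler_wpM2l.
have q3: nm (rc (2*c^+2*(y^+2-t^+2)))<=4*c^+2*y^+3.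
 have p1: 0<=y^+2-t^+2.
 by rewrite subr_ge0; apply: lerXn2r; rewrite ?nnegrE ?(ltW y0).
 have p2: y^+2-t^+2<=2*y^+3.
 have ->: y^+2-t^+2=(y-t)*(y+t) by ring.
 have ->: 2*y^+3=y^+2*(2*y) by ring.
 by apply: ler_pM; lr t1 t0 y0 t2.
 rewrite nm_rc ger0_norm; last by apply: mulr_ge0 => //; apply: mulr_ge0 => //; exact: sqr_ge0.
 have c22: 0<=2*c^+2 by apply: mulr_ge0 => //; exact: sqr_ge0.
 have := ler_wpM2l c22 p2; lr.
have := nmD (cis (2*c*t) - 1-Ci*rc (2*c*t)+rc ((2*c*t)^+2/2)) (I*rc (t-y+y^+2/2)).
lr q3 q2 q1.
Qed.

Definition La : R := 2*(1+3*(1+nm vm)/(2*c)).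
Definition Cm : R := 2*al%:R*(1+nm vm)+8*c/kap.

Lemma La_ge1 : 1<=La.
Proof.
have : 0<=3*(1+nm vm)/(2*c) by have v0 := nm_ge0 vm; nneg.
rewrite /La; lra.
Qed.

(** While the true ratio is closer to the reference than the reference is to 1, it determines w from
    z. Both factors w - vp z and w - vm z then remain comparable to |z| + |w|, and w is bounded by a
    constant over the number of steps to the nearer end. *)
Lemma geom_est n k (z w r0 : Cplx R) (th : R) : (0<n)%N -> (n<k)%N -> (k<al*n)%N ->
 z!=0 -> nm z<=2/n%:R -> nm r0 = 1 -> kap*(jj n k)%:R/n%:R<=nm (1-r0) ->
 th<=kap/2 -> th*al%:R<=1/2 -> 0<=th -> w-vm*z!=0 ->
 let r := (w-vp*z)/(w-vm*z) in
 nm (r-r0)<=th*(jj n k)%:R/n%:R ->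
 [/\ 1/2<=nm r, nm r<=2, kap*(jj n k)%:R/n%:R/2<=nm (1-r),
 w=(vm+I/(1-r))*z & [/\ nm z+nm w<=La*nm (w-vp*z), nm z+nm w<=La*nm (w-vm*z)
 & nm z+nm w<=Cm/(jj n k)%:R]].
Proof.
move=> n0 nk kn z0 hz hr0 hlb th1 th2 th0 Bn r hr.
have k0 := kap_gt0 al2 c0; have v0 := nm_ge0 vm; have np: 0<(n%:R : R) by rewrite ltr0n.
set j := jj n k in hlb hr *; have j0: (0<j)%N by rewrite /j leq_min !subn_gt0 nk kn.
have jp: 0<(j%:R : R) by rewrite ltr0n.
have jn: j%:R/n%:R<=al%:R :> R.
 rewrite ler_pdivrMr // -natrM ler_nat; apply: leq_trans (geq_minr _ _) (leq_subr _ _).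
have jn0: 0<j%:R/n%:R :> R by rewrite divr_gt0.
set x := j%:R/n%:R in jn jn0; have hx: th*j%:R/n%:R=th*x by rewrite mulrA.
have hx': kap*j%:R/n%:R=kap*x by rewrite mulrA.
rewrite hx in hr; rewrite hx' in hlb *.
have thx: th*x<=1/2 by apply: le_trans th2; rewrite ler_wpM2l.
have thx2: th*x<=kap*x/2 by have := ler_wpM2r (ltW jn0) th1; lr.
have r1: 1/2<=nm r by have := nmB_ge r0 (r0-r); rewrite (nmC r0) hr0 opprB addrCA subrr addr0; lr thx hr.
have r2: nm r<=2 by have := nmD (r-r0) r0; rewrite subrK hr0; lr thx hr.
have r3: kap*x/2<=nm (1-r).
 by have := nmB_ge (1-r0) (r-r0); have ->: 1-r0-(r-r0) = 1-r; [ring|lr thx2 hlb hr].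
have p1: 0<nm (1-r) by apply: lt_le_trans r3; rewrite divr_gt0 // mulr_gt0.
have rn: 1-r!=0 by rewrite -nm_gt0.
have eB: (1-r)*(w-vm*z)=I*z.
 by rewrite mulrBl mul1r /r divfK // /vp; ring.
have ew: w=(vm+I/(1-r))*z.
 have : w-vm*z=I/(1-r)*z by rewrite mulrAC -eB mulrAC mulfV // mul1r.
 by move/eqP; rewrite subr_eq => /eqP ->; ring.
have r4: nm (1-r)<=3 by apply: nmB_le; rewrite nm1; lr r2.
have nB: nm (1-r)*nm (w-vm*z) = 2*c*nm z by rewrite -nmM eB nmM nm_I2c.
set NB := nm (w-vm*z) in nB *.
have NB0: 0<NB by rewrite /NB nm_gt0.
have zB: nm z<=3/(2*c)*NB.
 rewrite mulrAC ler_pdivlMr ?mulr_gt0 // mulrC -nB; have := ler_wpM2r (ltW NB0) r4; lr.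
have wB: nm w<=NB+nm vm*nm z by have := nmD (w-vm*z) (vm*z); rewrite subrK nmM.
have mB: nm z+nm w<=La/2*NB.
 have e1 := ler_wpM2l v0 zB.
 have ->: La/2*NB=NB+3/(2*c)*NB+nm vm*(3/(2*c)*NB) by rewrite /La; field; rewrite gt_eqF.
 lr e1 wB zB.
have NA: nm (w-vp*z)=nm r*NB by rewrite /r nmf mulfVK // gt_eqF.
have La0 := La_ge1.
split=> //; split.
- rewrite NA; apply: (le_trans mB).
 have := ler_wpM2r (ltW NB0) r1; have := mulr_ge0 (_ : 0<=La) (ltW NB0); nra.
- apply: (le_trans mB); have : 0<=La*NB by rewrite mulr_ge0 ?(ltW NB0) //; lr La0.
 lr.
have e1: nm w<=(nm vm+4*c/(kap*x))*nm z.
 rewrite {1}ew nmM ler_wpM2r ?nm_ge0 //; apply: nmD_le; rewrite lerD2l nmf nm_I2c //.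
 rewrite ler_pdivrMr //; have kx: 0<kap*x by rewrite mulr_gt0.
 have ->: 4*c/(kap*x)*nm (1-r) = 4*c*nm (1-r)/(kap*x) by rewrite mulrAC.
 rewrite ler_pdivlMr //; have := ler_wpM2l (_ : 0<=4*c) r3; rewrite mulr_ge0 ?(ltW c0) // => /(_ isT); lr.
have e2: nm z+nm w<=(1+nm vm+4*c/(kap*x))*(2/n%:R).
 have q: 0<=1+nm vm+4*c/(kap*x) by nneg.
 by have := ler_wpM2l q hz; lr e1.
apply: (le_trans e2); rewrite /Cm ler_pdivlMr //.
have ->: (1+nm vm+4*c/(kap*x))*(2/n%:R)*j%:R = 2*x*(1+nm vm)+8*c/kap.
 by rewrite /x; field; rewrite !gt_eqF.
rewrite lerD2r ler_wpM2r //; [lr v0|by rewrite ler_wpM2l].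
Qed.

Lemma isq_al n j : (0<n)%N -> (0<j)%N -> (j<=al*n)%N -> isq n<=al%:R * isq j :> R.
Proof.
move=> n0 j0 jn; have sa := sqrtn_gt0 (R := R) (ltnW al2).
have h: isq (al*n)<=isq j :> R by apply: isq_le.
have ->: isq n=Num.sqrt al%:R * isq (al*n) :> R.
 rewrite /isq natrM sqrtrM // invfM mulrA mulfV ?mul1r // gt_eqF //.
apply: ler_pM; rewrite ?sqrtr_ge0 ?isq_ge0 //.
rewrite -[X in _<=X]sqrtn_sq ler_peMl ?sqrtr_ge0 //; apply: sqrtn_ge1; exact: ltnW.
Qed.

Lemma sqrt_isq_al n j : (0<n)%N -> (0<j)%N -> (j<=al*n)%N ->
 Num.sqrt j%:R/n%:R<=al%:R * isq n :> R.
Proof.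
move=> n0 j0 jn; have np: 0<(n%:R : R) by rewrite ltr0n.
rewrite -isq_sq // mulrA ler_wpM2r ?isq_ge0 //.
via (Num.sqrt (al*n)%:R * isq n).
 by rewrite ler_wpM2r ?isq_ge0 // ler_wsqrtr // ler_nat.
rewrite natrM sqrtrM // -mulrA /isq mulfV ?mulr1 ?gt_eqF ?sqrtn_gt0 //.
rewrite -[X in _<=X]sqrtn_sq ler_peMl ?sqrtr_ge0 //; apply: sqrtn_ge1; exact: ltnW.
Qed.

Section LocalErr.
Variables (Q S Cz : R).
Hypotheses (Q0 : 0<=Q) (S0 : 0<=S) (Cz0 : 0<=Cz).

(** With j the number of steps to the nearer end, the error is of order j^(-3/2)/n + n^(-9/4);
    summed over j >= K it is a small multiple of 1/n for large K and n. The deviation assumed at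
    time k enters linearly, through [Lam], which lets the induction in [bootstrap] close. *)
Theorem local_err : exists Ce eta : R, exists n1 : nat, [/\ 0<=Ce, 0<eta, (0<n1)%N &
 forall (n k : nat) (s z w e1 e2 : Cplx R) (Lam th : R), (n1<=n)%N -> (n<k)%N -> (k<al*n)%N -> nm s<=S ->
 nm (z^-1-(k%:R-g*rc (ln k%:R)+s))<=Cz * isq k ->
 1<=Lam -> 0<=th -> th<=kap/2 -> th*al%:R<=1/2 ->
 Cm/(jj n k)%:R<=eta ->
 nm e2<=Q*nm z^+4 -> nm e1<=Q*(nm z+nm w)^+4 -> w-vm*z!=0 ->
 let r := (w-vp*z)/(w-vm*z) in
 let z' := z-z^+2+a*z^+3+e2 in
 let w' := w+w^+2+rc (bq c)*z^+2+a*w^+3+b30*z^+3+e1 in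
 nm (r-rs n k)<=th*(jj n k)%:R/n%:R -> nm (r-rs n k)<=Lam*Num.sqrt (jj n k)%:R/n%:R ->
 w'-vm*z'!=0 /\
 nm ((w'-vp*z')/(w'-vm*z')/rs n k.+1/(r/rs n k) - 1-I*drift s n k) <=
 Ce*Lam*((jj n k)%:R^-1 * isq (jj n k)/n%:R+eps n/n%:R^+2)].
Proof.
have La1 := La_ge1.
have lr1 (x y u: R) : x<=2*u -> y<=u -> x+y<=3*u by lra.
have lr2 (x: R) : 1/2<=x -> 0<x by lra.
have lr3 (x y u v w x' y' u' v' w': R) : x<=x' -> y<=y' -> u<=u' -> v<=v' -> w<=w' -> x+y+u+v+w<=x'+y'+u'+v'+w' by lra.
have [Cst [et [Cst0 et0 hstep]]] := step_est a b30 c0 La1 Q0.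
have [CZ [k1 [CZ0 k10 hZ]]] := Z_est g S0 Cz0.
have k0 := kap_gt0 al2 c0; have v0 := nm_ge0 vm; have g0 := nm_ge0 g.
have ap: 0<(al%:R : R) by rewrite ltr0n ltnW.
have Hh0 := Hh_ge0 g A1 A2 al2 c0.
pose Crr := 2*(9*nm A1+3*nm A2).
pose Lrr := 5*(nm A1+nm (A1+A2)).
pose c1 := Cst*2*Cm^+2.
pose c2 := 2*c*CZ.
pose c3h := 2*c*nm g*(16*c/kap^+2+(al%:R*nm vm+2*c/kap)*3*CZ*al%:R).
pose c4 := 2*c*nm (vp-g)*(3*CZ).
pose c5 := 2*c*(4*Lrr*al%:R+Crr*3*CZ).
pose c6 := 16*c^+3+4*c^+2+2*c.
pose c7q := 8*c^+2*(4*nm g+S).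
pose c7h := 8*c^+2*(Hh al c g A1 A2*al%:R).
have Cm0: 0<=Cm by rewrite /Cm; nneg.
have Crr0: 0<=Crr by rewrite /Crr; nneg.
have Lrr0: 0<=Lrr by rewrite /Lrr; nneg.
have c10: 0<=c1 by rewrite /c1; nneg.
have c20: 0<=c2 by rewrite /c2; nneg.
have c30: 0<=c3h by rewrite /c3h; nneg.
have c40: 0<=c4 by rewrite /c4; nneg.
have c50: 0<=c5 by rewrite /c5; nneg.
have c60: 0<=c6 by rewrite /c6; nneg.
have c7q0: 0<=c7q by rewrite /c7q; nneg.
have c7h0: 0<=c7h by rewrite /c7h; nneg.
exists (c1+c2+c3h+c4+c5+c6+c7q+c7h), et, (maxn k1 1); split=> //.
- by nneg.
- by rewrite leq_max orbT.
move=> n k s z w e1 e2 Lam th nn nk kn sS hz Lam1 th0 th1 th2 hCm he2 he1 Bn r z' w' hr1 hr2.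
have n0: (0<n)%N by apply: leq_trans nn; rewrite leq_max orbT.
have np: 0<(n%:R : R) by rewrite ltr0n.
have k1k: (k1<=k)%N by apply: leq_trans (ltnW nk); apply: leq_trans nn; rewrite leq_max leqnn.
have kpos: (0<k)%N by apply: ltn_trans nk.
have kp: 0<(k%:R : R) by rewrite ltr0n.
have nkR: n%:R<=(k%:R : R) by rewrite ler_nat ltnW.
have [z0 _ zk zle [zge zexp]] := hZ k s z k1k sS hz.
have ik: (k%:R : R)^-1<=n%:R^-1 by rewrite lef_pV2 ?posrE.
have ik0: 0<(k%:R : R)^-1 by rewrite invr_gt0.
have in0: 0<(n%:R : R)^-1 by rewrite invr_gt0.
have zn: nm z<=2/n%:R by apply: (le_trans zle); rewrite ler_wpM2l.
have [x1 x2] := kn_range (R := R) n0 nk kn.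
have lb := rho_lb al2 c0 hc (ltW x1) (ltW x2).
have nrs: nm (rs n k) = 1 := nm_rho _ _.
set j := jj n k in hCm hr1 hr2 *; have j0: (0<j)%N by rewrite /j leq_min !subn_gt0 nk kn.
have jp: 0<(j%:R : R) by rewrite ltr0n.
have jal: (j<=al*n)%N by apply: leq_trans (geq_minr _ _) (leq_subr _ _).
rewrite dd_nat ?(ltnW nk) ?(ltnW kn) // -/j mulrA in lb.
have [r1 r2 r3 ew [mA mB mj]] := geom_est n0 nk kn z0 zn nrs lb th1 th2 th0 Bn hr1.
rewrite -/r -/j in r1 r2 r3 ew mj.
have [B'n hst] := hstep z w e1 e2 z0 mA mB (le_trans mj hCm) he1 he2.
split=> //; rewrite -/r -/z' -/w' in hst B'n *.
set T := (w'-vp*z')/(w'-vm*z') in hst *.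
have rn: r!=0 by rewrite -nm_gt0; exact: lr2.
have rsn := rho_neq0 c (k%:R/n%:R).
have rsn' := rho_neq0 c (k.+1%:R/n%:R).
set h := j%:R^-1 * isq j/n%:R; set q := eps n/n%:R^+2.
have isj0 := isq_ge0 (R := R) j; have ijp: 0<(j%:R : R)^-1 by rewrite invr_gt0.
have h0: 0<=h by rewrite /h; nneg.
have e0 := eps_gt0 (R := R) n0.
have q0: 0<=q by rewrite /q; nneg.
set D := nm (r-rs n k) in hr1 hr2 *.
have D0: 0<=D by exact: nm_ge0.
have p1: 0<nm (1-r) by apply: lt_le_trans r3; rewrite divr_gt0 // divr_gt0 // mulr_gt0.
have p2: 0<nm (1-rs n k) by apply: lt_le_trans lb; rewrite divr_gt0 // mulr_gt0.
have isqk: isq k<=isq n :> R by apply: isq_le => //; exact: ltnW.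
have isqn0 := isq_ge0 (R := R) n.
have isqe := isq_le_eps (R := R) n.
have k2n: (k%:R : R)^-1^+2<=n%:R^-1^+2 by apply: lerXn2r; rewrite ?nnegrE ?(ltW ik0) ?(ltW in0).
have k20: 0<=(k%:R : R)^-1^+2 by rewrite exprn_ge0 // ltW.
have nq: n%:R^-1^+2 * isq n<=q :> R by rewrite /q mulrC -exprVn ler_wpM2r ?exprn_ge0 ?(ltW in0).
have n2p: 0<=(n%:R : R)^-1^+2 by rewrite exprn_ge0 // ltW.
have zzk: nm (z^+2-rc (k%:R^-1^+2))<=3*CZ*(n%:R^-1^+2 * isq n).
 have ->: z^+2-rc (k%:R^-1^+2)=(z-k%:R^-1)*(z+k%:R^-1) by rewrite rcX rcV rc_nat; ring.
 rewrite nmM; have u1: nm (z-k%:R^-1)<=CZ*(n%:R^-1 * isq n).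
 apply: (le_trans zk); rewrite -mulrA ler_wpM2l // mulrC; apply: ler_pM; rewrite ?exprn_ge0 ?eps_ge0 ?(ltW ik0) //.
 apply: le_trans isqk; rewrite exprS -eps2 ler_piMl ?exprn_ge0 ?eps_ge0 ?eps_le1 //.
 have u2: nm (z+k%:R^-1)<=3*n%:R^-1.
 by apply: nmD_le; rewrite nmV nm_nat; apply: lr1.
 apply: le_trans (ler_pM _ _ u1 u2) _; rewrite ?nm_ge0 //.
 by apply: eq_ler; ring.
have nz2: nm z^+2<=4*n%:R^-1^+2.
 have : nm z^+2<=(2/n%:R)^+2 by apply: lerXn2r; rewrite ?nnegrE ?nm_ge0 ?mulr_ge0 // ltW.
 have -> //: (2/n%:R)^+2 = 4*n%:R^-1^+2 :> R by ring.
have sj: Num.sqrt j%:R*(j%:R^-1 * isq j)=j%:R^-1 :> R.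
 by rewrite mulrCA /isq mulfV ?mulr1 // gt_eqF // sqrtn_gt0.
have sjj: Num.sqrt j%:R*j%:R^-1 = isq j :> R.
 by rewrite -isq_sq // mulrA /isq mulfV ?mul1r // gt_eqF // sqrtn_gt0.

have isnj: isq n<=al%:R * isq j :> R by apply: isq_al.
have sjn: Num.sqrt j%:R/n%:R<=al%:R * isq n :> R by apply: sqrt_isq_al.
have Lam0: 0<=Lam by exact: le_trans Lam1.
have eqle (x y: R) : x=y -> x<=y by move->.
pose X := T/r - 1-I*z*(1+g*w+(vp-g)*z+z*rr r).
have bX: nm X<=c1*h.
 apply: (le_trans hst); via (Cst*(2/n%:R)*(Cm/j%:R)^+2).
 apply: ler_pM; [by rewrite mulr_ge0 ?nm_ge0|by rewrite exprn_ge0 // addr_ge0 ?nm_ge0|by rewrite ler_wpM2l|].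
 by apply: lerXn2r; rewrite ?nnegrE ?addr_ge0 ?nm_ge0 ?divr_ge0 ?(ltW jp).
 have ->: Cst*(2/n%:R)*(Cm/j%:R)^+2=c1*(j%:R^-1*j%:R^-1/n%:R) by rewrite /c1; ring.
 rewrite ler_wpM2l // /h ler_wpM2r ?(ltW in0) // ler_wpM2l ?(ltW ijp) //; exact: invn_le_isq.
pose X2 := I*(z-k%:R^-1-rc (k%:R^-1^+2)*(rc (ln k%:R)*g-s)).
have nI := nm_I2c c0.
have bX2: nm X2<=c2*q.
 rewrite nmM nI /c2 -[leRHS]mulrA; apply: ler_wpM2l; first by nneg.
 apply: (le_trans zexp); rewrite -mulrA; apply: ler_wpM2l => //.
 apply: le_trans nq; rewrite mulrC; apply: ler_pM => //; exact: isq_ge0.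
pose X3 := I*g*(z*w-rc (k%:R^-1^+2)*vst c (k%:R/n%:R)).
have bX3: nm X3<=c3h*Lam*h.
 have e3: z*w-rc (k%:R^-1^+2)*vst c (k%:R/n%:R) =
 z^+2*(I*((r-rs n k)/((1-r)*(1-rs n k))))+vst c (k%:R/n%:R)*(z^+2-rc (k%:R^-1^+2)).
 have p1n: 1-r!=0 by rewrite -nm_gt0.
 have p2n: 1-rs n k!=0 by rewrite -nm_gt0.
 rewrite ew /vst; move: (rs n k) (rc (k%:R^-1^+2)) p1n p2n => X1 X2' p1n p2n; move: (vm) (I) => V J.
 by field; rewrite p1n p2n.
 rewrite /X3 (nmM (I*g)) (nmM I g) nI.
 have ->: c3h*Lam*h = 2*c*nm g*((16*c/kap^+2+(al%:R*nm vm+2*c/kap)*3*CZ*al%:R)*(Lam*h)).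
 by rewrite /c3h; ring.
 apply: ler_wpM2l; first by nneg.
 rewrite e3 [leRHS]mulrDl; apply: nmD_le; apply: lerD.
 rewrite (nmM (z^+2)) nmX (nmM I) nI (nmf (r-rs n k)) -/D (nmM (1-r)).
 via (4*n%:R^-1^+2*(2*c*(Lam*Num.sqrt j%:R/n%:R/(kap*j%:R/n%:R/2*(kap*j%:R/n%:R))))).
 apply: ler_pM; rewrite ?exprn_ge0 ?nm_ge0 //; first by nneg.
 apply: ler_wpM2l; first by nneg.
 apply: ler_pM => //; first by rewrite invr_ge0 mulr_ge0 ?nm_ge0.
 rewrite lef_pV2 ?posrE; last 2 first.
 - by rewrite mulr_gt0.
 - by rewrite mulr_gt0 // ?divr_gt0 // ?mulr_gt0 // ?divr_gt0 // mulr_gt0.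
 by apply: ler_pM; rewrite ?divr_ge0 ?mulr_ge0 ?(ltW k0) ?(ltW jp) ?(ltW np).
 apply: eqle; rewrite /h -sjj; field; by rewrite !gt_eqF.
 rewrite nmM; have vb := vst_bound al2 c0 hc x1 x2.
 rewrite dd_nat ?(ltnW nk) ?(ltnW kn) // -/j in vb.
 have vb2: nm (vst c (k%:R/n%:R))<=(al%:R*nm vm+2*c/kap)*(n%:R/j%:R).
 apply: (le_trans vb); rewrite [leRHS]mulrDl invf_div lerD2r.
 have : 1<=al%:R*(n%:R/j%:R) :> R by rewrite mulrA ler_pdivlMr // mul1r -natrM ler_nat.
 by move=> h'; have := ler_wpM2l v0 h'; rewrite mulr1 mulrCA mulrA.
 apply: le_trans (ler_pM _ _ vb2 zzk) _; rewrite ?nm_ge0 //.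
 have ->: (al%:R*nm vm+2*c/kap)*(n%:R/j%:R)*(3*CZ*(n%:R^-1^+2 * isq n)) =
 (al%:R*nm vm+2*c/kap)*3*CZ*(j%:R^-1 * isq n/n%:R) by field; rewrite !gt_eqF.
 rewrite -[leRHS]mulrA; apply: ler_wpM2l; first by nneg.
 via (al%:R*h).
 have ->: al%:R*h=j%:R^-1*(al%:R * isq j)/n%:R by rewrite /h; ring.
 by rewrite ler_wpM2r ?(ltW in0) // ler_wpM2l ?(ltW ijp).
 by rewrite ler_wpM2l ?(ltW ap) // ler_peMl.
pose X4 := I*(vp-g)*(z^+2-rc (k%:R^-1^+2)).
have bX4: nm X4<=c4*q.
 rewrite /X4 (nmM (I*_)) (nmM I (vp-g)) nI /c4 -[leRHS]mulrA; apply: ler_wpM2l; first by nneg.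
 by apply: (le_trans zzk); apply: ler_wpM2l => //; nneg.
pose X5 := I*(z^+2*rr r-rc (k%:R^-1^+2)*rr (rs n k)).
have bX5: nm X5<=c5*Lam*q.
 have ->: X5=I*(z^+2*(rr r-rr (rs n k))+rr (rs n k)*(z^+2-rc (k%:R^-1^+2))) by rewrite /X5; ring.
 rewrite nmM nI; have ->: c5*Lam*q = 2*c*(4*Lrr*al%:R*(Lam*q)+Crr*3*CZ*(Lam*q)) by rewrite /c5; ring.
 apply: ler_wpM2l; first by nneg.
 apply: nmD_le; apply: lerD; rewrite nmM.
 have hs1: 2^-1<=nm (rs n k) by rewrite nrs invf_le1 // ler1n.
 have hs2: nm (rs n k)<=2 by rewrite nrs ler1n.
 have hr1': 2^-1<=nm r by rewrite -[2^-1]mul1r.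
 have l1: nm (rr r-rr (rs n k))<=Lrr*(Lam*(al%:R * isq n)).
 apply: le_trans (rr_lip _ _ hr1' r2 hs1 hs2) _.
 rewrite -/Lrr -/D; apply: ler_wpM2l => //; apply: (le_trans hr2); rewrite -mulrA.
 exact: ler_wpM2l.
 rewrite nmX; apply: le_trans (ler_pM _ _ nz2 l1) _; rewrite ?exprn_ge0 ?nm_ge0 //.
 have ->: 4*n%:R^-1^+2*(Lrr*(Lam*(al%:R * isq n))) = 4*Lrr*al%:R*(Lam*(n%:R^-1^+2 * isq n)) by ring.
 apply: ler_wpM2l; first by nneg.
 exact: ler_wpM2l.
 have l2: nm (rr (rs n k))<=Crr.
 by apply: rr_bound; rewrite nrs; [rewrite invf_le1 // ler1n|rewrite ler1n].
 apply: le_trans (ler_pM _ _ l2 zzk) _; rewrite ?nm_ge0 //.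
 rewrite -[leRHS]mulrA -[leRHS]mulrA; apply: ler_wpM2l => //; rewrite -mulrA; apply: ler_wpM2l => //; apply: ler_wpM2l => //.
 by apply: (le_trans nq); rewrite ler_peMl.
pose Tst := rs n k.+1/rs n k.
have Tc: Tst=cis (2*c * ln (k.+1%:R/k%:R)).
 rewrite /Tst /rho -cisB -mulrBr !ln_div ?posrE //; congr (cis (2*c*_)); ring.
have [T1 T2] := Tstar_est kpos; rewrite -Tc in T1 T2.
pose X6 := Tst - 1-I*rc k%:R^-1-I*vp*rc (k%:R^-1^+2).
have bX6: nm X6<=c6*q.
 apply: (le_trans T1); apply: ler_wpM2l => //; apply: le_trans nq.
 rewrite exprSr; apply: ler_pM; rewrite ?(ltW ik0) //.
 by apply: (le_trans ik); exact: invn_le_isq.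
set e := drift s n k.
have lnk: ln (k%:R : R)=ln n%:R+ln (k%:R/n%:R) by rewrite ln_div ?posrE //; ring.
(* In order: the step estimate, z against its expansion, the true slope against the reference slope,
   the square of z, the cubic terms, and the reference rotation. *)
have main: T/r-Tst-I*e=X+X2+X3+X4+X5-X6.
 rewrite /X /X2 /X3 /X4 /X5 /X6 /e /drift /hfun lnk rcD (rcV k%:R) rc_nat; ring.
have Tst1: nm Tst = 1 by rewrite Tc nm_cis.
have Tstn: Tst!=0 by rewrite -nm_gt0 Tst1.
have fin: T/rs n k.+1/(r/rs n k)=T/r/Tst.
 by rewrite /Tst; move: rn rsn rsn'; move: (r) (rs n k) (rs n k.+1) => X1 Y1 Z1 a1 a2' a3; field; rewrite a1 a2' a3.
have tot: T/r/Tst - 1-I*e=(X+X2+X3+X4+X5-X6)/Tst+I*e*(Tst^-1 - 1).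
 by rewrite -main; move: (T/r) (Tst) (I*e) Tstn => x1' y1' u1' yn; field.
rewrite fin tot.
pose G := Lam*(h+q).
have G0: 0<=G by rewrite /G; nneg.
have hG: h<=G by rewrite /G; via (h+q); [rewrite lerDl|rewrite ler_peMl // addr_ge0].
have qG: q<=G by rewrite /G; via (h+q); [rewrite lerDr|rewrite ler_peMl // addr_ge0].
have LhG: Lam*h<=G by rewrite /G ler_wpM2l // lerDl.
have LqG: Lam*q<=G by rewrite /G ler_wpM2l // lerDr.
have f1: nm X<=c1*G by apply: (le_trans bX); apply: ler_wpM2l.
have f2: nm X2<=c2*G by apply: (le_trans bX2); apply: ler_wpM2l.
have f3: nm X3<=c3h*G by apply: (le_trans bX3); rewrite -mulrA; apply: ler_wpM2l.
have f4: nm X4<=c4*G by apply: (le_trans bX4); apply: ler_wpM2l.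
have f5: nm X5<=c5*G by apply: (le_trans bX5); rewrite -mulrA; apply: ler_wpM2l.
have f6: nm X6<=c6*G by apply: (le_trans bX6); apply: ler_wpM2l.
have f7: nm (I*e*(Tst^-1 - 1))<=c7q*G+c7h*G.
 have ->: Tst^-1 - 1=(1-Tst)/Tst by move: (Tst) Tstn => y1' yn; field.
 rewrite nmM (nmM I) nI nmf Tst1 divr1 nmC.
 have db := drift_bound g A1 A2 al2 c0 hc sS n0 nk kn.
 rewrite -/j -/e in db.
 have db': nm e<=n%:R^-1*((4*nm g+S)*eps n+Hh al c g A1 A2/j%:R).
 rewrite -ler_pdivrMl ?invr_gt0 // invrK; apply: (le_trans db); rewrite lerD2r.
 rewrite (mulrDl (nm g * ln n%:R) S) (mulrDl (4*nm g) S); apply: lerD; last by apply: ler_wpM2l => //; exact: invn_le_eps.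
 rewrite -mulrA [4*_]mulrC -mulrA; apply: ler_wpM2l => //.
 by apply: le_trans (ln_isq_le n0); apply: ler_wpM2l; [exact: ln_nat_ge0|exact: invn_le_isq].
 via (2*c*(n%:R^-1*((4*nm g+S)*eps n+Hh al c g A1 A2/j%:R))*(4*c*n%:R^-1)).
 apply: ler_pM; rewrite ?nm_ge0 //; first by apply: mulr_ge0; [nneg|exact: nm_ge0].
 by apply: ler_wpM2l => //; nneg.
 by apply: (le_trans T2); apply: ler_wpM2l => //; nneg.
 have ->: 2*c*(n%:R^-1*((4*nm g+S)*eps n+Hh al c g A1 A2/j%:R))*(4*c*n%:R^-1) =
 c7q*q+8*c^+2*Hh al c g A1 A2*(j%:R^-1*n%:R^-1*n%:R^-1).
 by rewrite /c7q /q; field; rewrite !gt_eqF.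
 apply: lerD; first exact: ler_wpM2l.
 have ->: c7h*G = 8*c^+2*Hh al c g A1 A2*(al%:R*G) by rewrite /c7h; ring.
 apply: ler_wpM2l; first by nneg.
 via (al%:R*h); last by apply: ler_wpM2l => //; exact: ltW.
 have ->: al%:R*h=j%:R^-1*(al%:R * isq j)/n%:R by rewrite /h; ring.
 rewrite ler_wpM2r ?(ltW in0) // ler_wpM2l ?(ltW ijp) //.
 by apply: le_trans isnj; exact: invn_le_isq.
have f8: nm ((X+X2+X3+X4+X5-X6)/Tst)<=c1*G+c2*G+c3h*G+c4*G+c5*G+c6*G.
 rewrite nmf Tst1 divr1; apply: nmB_le; apply: lerD => //.
 apply: nmD_le; apply: lerD => //.
 apply: nmD_le; apply: lerD => //.
 apply: nmD_le; apply: lerD => //.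
 by apply: nmD_le; apply: lerD.
apply: nmD_le; apply: le_trans (lerD f8 f7) _.
by apply: eqle; rewrite -[RHS]mulrA -/G; ring.
Qed.

End LocalErr.
End PassageErr.

(** * Partial sums of drifts and of local errors *)

Section PassageSums.
Context {R : realType}.
Variables (al : nat) (c : R) (g A1 A2 : Cplx R).
Hypotheses (al2 : (2<=al)%N) (c0 : 0<c) (hc : c * ln al%:R = pi).
Local Notation drift := (drift c g A1 A2).
Local Notation jj n k := (minn (k-n) (al*n-k)).
Local Notation Hh := (Hh al c g A1 A2).

Lemma sum_leftK (f : nat -> R) n K q :
 \sum_(n+K<=k<q) f (k-n)%N = \sum_(0<=j<q-(n+K)) f (j+K)%N.
Proof.
rewrite -(sum_left (fun j => f (j+K)%N)); apply: eq_big_nat => k /andP[k1 _].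
by congr f; move: k1; clear; lia.
Qed.

Lemma sum_rightK (f : nat -> R) p N K : (K<=N)%N ->
 \sum_(p<=k<N-K) f (N-k)%N = \sum_(0<=j<N-K-p) f (j+K.+1)%N.
Proof.
move=> KN; rewrite -(sum_right (fun j => f (j+K.+1)%N)); apply: eq_big_nat => k /andP[k1 k2].
by congr f; move: k1 k2 KN; clear; lia.
Qed.

Lemma isq_shift_sum M K : (0<K)%N ->
 \sum_(0<=j<M) ((j+K)%:R^-1 * isq (j+K) : R)<=4 * isq K.
Proof.
move=> K0; apply: le_trans (isq_sum (M+K) K0).
rewrite le_eqVlt; apply/orP; left; apply/eqP.
have := sum_left (fun j => (j+K)%:R^-1 * isq (j+K) : R) K (M+K); rewrite addnK => <-.
by apply: eq_big_nat => k /andP[Kk _]; rewrite subnK.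
Qed.

Lemma harm_shift_sum M K : (0<K)%N ->
 \sum_(0<=j<M) ((j+K)%:R^-1 : R)<=2*Num.sqrt M%:R.
Proof.
move=> K0; apply: le_trans (harmonic_le M); rewrite big_add1 /=.
apply: ler_sum_nat => j _; rewrite lef_pV2 ?posrE ?ltr0n ?addn_gt0 ?K0 ?orbT //.
by rewrite ler_nat -addn1 leq_add2l.
Qed.

Lemma hq_sum n K : (0<K)%N -> (0<n)%N ->
 \sum_(n+K<=k<al*n-K) ((jj n k)%:R^-1 * isq (jj n k)/n%:R+eps n/n%:R^+2)
 <= n%:R^-1*(8 * isq K+al%:R*eps n) :> R.
Proof.
move=> K0 n0; have np: 0<(n%:R : R) by rewrite ltr0n.
have in0: 0<(n%:R : R)^-1 by nneg.
have e0 := eps_gt0 (R := R) n0.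
pose f j : R := j%:R^-1 * isq j.
have f0 j: 0<=f j by nneg.
via (\sum_(n+K<=k<al*n-K) (n%:R^-1*f (k-n)%N+n%:R^-1*f (al*n-k)%N+eps n/n%:R^+2)).
 apply: ler_sum_nat => k _; rewrite lerD2r -mulrDr mulrC ler_wpM2l ?(ltW in0) //.
 by rewrite -/(f _); case: leqP => _; rewrite ?lerDl ?lerDr.
rewrite !big_split /= sumr_const_nat -!mulr_sumr (sum_leftK f) [leRHS]mulrDr.
have [KN|KN] := leqP K (al*n); last first.
 have ->: (al*n-K-(n+K))%N = 0%N by move: KN; clear; lia.
 rewrite !big_geq //; [|by move: KN; clear; lia..].
 rewrite mulr0n !mulr0 !addr0 addr_ge0 // mulr_ge0 ?(ltW in0) ?mulr_ge0 ?isq_ge0 ?(ltW e0) //.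
rewrite (sum_rightK f) //.
have s1 := isq_shift_sum (al*n-K-(n+K)) K0.
have s2 := isq_shift_sum (al*n-K-(n+K)) (ltn0Sn K).
have s3: isq K.+1<=isq K :> R by apply: isq_le.
have s4: eps n/n%:R^+2 *+ (al*n-K-(n+K))<=n%:R^-1*(al%:R*eps n) :> R.
 rewrite -mulr_natl; have : ((al*n-K-(n+K))%:R : R)<=al%:R*n%:R.
 by rewrite -natrM ler_nat -subnDA leq_subr.
 move=> h; apply: le_trans (ler_wpM2r _ h) _; first by rewrite divr_ge0 ?exprn_ge0 ?(ltW e0).
 by apply: eq_ler; field; rewrite gt_eqF.
have s5: 4 * isq K.+1<=4 * isq K :> R by rewrite ler_wpM2l.
have q1 := ler_wpM2l (ltW in0) s1; have q2 := ler_wpM2l (ltW in0) (le_trans s2 s5).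
rewrite /f; lr q2 q1 s4.
Qed.

Definition Cpart (S : R) : R := al%:R*(4*nm g+S)+2*Hh.

Lemma drift_coef (S : R) n J : 0<=S -> (0<n)%N -> (0<J)%N -> (J<=al*n)%N ->
 J%:R*((nm g * ln n%:R+S)/n%:R)<=al%:R*(4*nm g+S)*Num.sqrt J%:R.
Proof.
move=> S0 n0 J0 Jn; have np: 0<(n%:R : R) by rewrite ltr0n.
have g0 := nm_ge0 g; have l0 := @ln_nat_ge0 R n.
have h1 := sqrt_isq_al (R := R) al2 n0 J0 Jn.
have h2: (nm g * ln n%:R+S) * isq n<=4*nm g+S.
 rewrite mulrDl -mulrA; apply: lerD; last by rewrite ler_piMr ?isq_le1.
 rewrite mulrC ler_wpM2r //; apply: le_trans (ln_isq_le n0) _.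
 by rewrite ler_piMr ?eps_le1.
have P0: 0<=nm g * ln n%:R+S by nneg.
have ->: J%:R*((nm g * ln n%:R+S)/n%:R)=Num.sqrt J%:R/n%:R*(nm g * ln n%:R+S)*Num.sqrt J%:R.
 by rewrite -{1}sqrtn_sq; ring.
rewrite ler_wpM2r ?sqrtr_ge0 //; apply: le_trans (ler_wpM2r P0 h1) _.
by rewrite -mulrA ler_wpM2l // mulrC.
Qed.

Lemma part_left (S : R) s n K k : nm s<=S -> 0<=S -> (0<K)%N -> (0<n)%N -> (n+K<=k)%N ->
 (k<=al*n-K)%N -> (k-n<=al*n-k)%N ->
 n%:R*nm (\sum_(n+K<=i<k) drift s n i)<=Cpart S*Num.sqrt (jj n k)%:R.
Proof.
move=> sS S0 K0 n0 nk kn hk; have np: 0<(n%:R : R) by rewrite ltr0n.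
have an: (k<al*n)%N by move: K0 nk kn; clear; lia.
rewrite (minn_idPl hk); set J := (k-n)%N.
have J0: (0<J)%N by rewrite /J; move: K0 nk; clear; lia.
have Jn: (J<=al*n)%N by rewrite /J; move: an; clear; lia.
have Hh0 := Hh_ge0 g A1 A2 al2 c0.
apply: le_trans (ler_wpM2l (ltW np) (nm_sum _ _ _)) _; rewrite mulr_sumr.
pose f j : R := j%:R^-1.
via (\sum_(n+K<=i<k) ((nm g * ln n%:R+S)/n%:R+Hh*f (i-n)%N)).
 apply: ler_sum_nat => i /andP[i1 i2].
 have := drift_bound g A1 A2 al2 c0 hc sS n0 (_ : (n<i)%N) (_ : (i<al*n)%N).
 rewrite (minn_idPl _); last by move: i2 hk; clear; lia.
 by apply; [move: i1 K0; clear; lia|apply: ltn_trans i2 an].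
rewrite big_split /= sumr_const_nat -mulr_sumr (sum_leftK f) -[_ *+ _]mulr_natl /Cpart [leRHS]mulrDl.
apply: lerD.
 have P0: 0<=(nm g * ln n%:R+S)/n%:R :> R.
 by rewrite divr_ge0 // addr_ge0 // mulr_ge0 ?nm_ge0 ?ln_nat_ge0.
 apply: le_trans (drift_coef S0 n0 J0 Jn); rewrite ler_wpM2r // ler_nat /J; clear; lia.
rewrite [2*Hh]mulrC -mulrA ler_wpM2l //; apply: le_trans (harm_shift_sum _ K0) _.
rewrite ler_wpM2l // ler_wsqrtr // ler_nat /J; clear; lia.
Qed.

Lemma part_right (S : R) s n K k : nm s<=S -> 0<=S -> (0<K)%N -> (0<n)%N -> (n+K<=k)%N ->
 (k<=al*n-K)%N -> (al*n-k<=k-n)%N ->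
 n%:R*nm (\sum_(k<=i<al*n-K) drift s n i)<=Cpart S*Num.sqrt (jj n k)%:R.
Proof.
move=> sS S0 K0 n0 nk kn hk; have np: 0<(n%:R : R) by rewrite ltr0n.
have an: (k<al*n)%N by move: K0 nk kn; clear; lia.
rewrite (minn_idPr hk); set J := (al*n-k)%N.
have J0: (0<J)%N by rewrite /J; move: an; clear; lia.
have Jn: (J<=al*n)%N by rewrite /J; move: an; clear; lia.
have Hh0 := Hh_ge0 g A1 A2 al2 c0.
apply: le_trans (ler_wpM2l (ltW np) (nm_sum _ _ _)) _; rewrite mulr_sumr.
pose f j : R := j%:R^-1.
via (\sum_(k<=i<al*n-K) ((nm g * ln n%:R+S)/n%:R+Hh*f (al*n-i)%N)).
 apply: ler_sum_nat => i /andP[i1 i2].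
 have := drift_bound g A1 A2 al2 c0 hc sS n0 (_ : (n<i)%N) (_ : (i<al*n)%N).
 rewrite (minn_idPr _); last by move: i1 hk; clear; lia.
 by apply; [move: i1 nk K0; clear; lia|apply: leq_trans i2 (leq_subr _ _)].
rewrite big_split /= sumr_const_nat -mulr_sumr (sum_rightK f); last by move: an kn nk K0; clear; lia.
rewrite -[_ *+ _]mulr_natl /Cpart [leRHS]mulrDl.
apply: lerD.
 have P0: 0<=(nm g * ln n%:R+S)/n%:R :> R.
 by rewrite divr_ge0 // addr_ge0 // mulr_ge0 ?nm_ge0 ?ln_nat_ge0.
 apply: le_trans (drift_coef S0 n0 J0 Jn); rewrite ler_wpM2r // ler_nat /J; clear; lia.
rewrite [2*Hh]mulrC -mulrA ler_wpM2l //; apply: le_trans (harm_shift_sum _ (ltn0Sn K)) _.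
rewrite ler_wpM2l // ler_wsqrtr // ler_nat /J; clear; lia.
Qed.

Lemma ln_le_sqrt K : (0<K)%N -> ln (K%:R : R)<=4*Num.sqrt K%:R.
Proof.
move=> K0; apply: le_trans (ln_le_eps K0) _; rewrite ler_wpM2l //.
rewrite -[Num.sqrt _]invrK lef_pV2 ?posrE ?invr_gt0 ?sqrtn_gt0 ?eps_gt0 //.
exact: isq_le_eps.
Qed.

(** Before the middle the terms are summed from the entrance; beyond it the sum is the total minus
    the part still to come. Absolute values summed all the way would leave a logarithm of n, which
    cancels in the total. *)
Theorem drift_partial (S : R) : 0<=S -> exists2 Cp, 0<=Cp & forall K, (0<K)%N -> exists2 n0, (0<n0)%N &
 forall n s k, (n0<=n)%N -> nm s<=S -> (n+K<=k)%N -> (k<=al*n-K)%N ->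
 n%:R*nm (\sum_(n+K<=i<k) drift s n i)<=Cp*Num.sqrt (jj n k)%:R.
Proof.
move=> S0; have [Ci [C hT]] := drift_total g A1 A2 al2 c0 hc.
have g0 := nm_ge0 g; have Hh0 := Hh_ge0 g A1 A2 al2 c0.
have CP0: 0<=Cpart S by nneg.
have ap: 1<=(al%:R : R) by rewrite ler1n ltnW.
have ai: `|1-(al%:R : R)^-1| <= 1.
 have i0: 0<(al%:R : R)^-1 by rewrite invr_gt0; lra.
 have i1: (al%:R : R)^-1<=1 by rewrite invf_le1; lra.
 rewrite ger0_norm; lra.
exists (Cpart S+(S+4*nm g+nm Ci + `|C|+1)) => [|K K0].
 by nneg.
have [D hD] := hT K S K0 S0.
have [N [N0 hN]] := @eps_small R (`|D|+1)^-1 ltac:(by rewrite invr_gt0).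
exists (maxn N (2*K)) => [|n s k nn sS nk kn]; first by rewrite leq_max N0.
have n0: (0<n)%N by apply: leq_trans nn; rewrite leq_max N0.
have nN: (N<=n)%N by apply: leq_trans nn; rewrite leq_max leqnn.
have nK: (2*K<=n)%N by apply: leq_trans nn; rewrite leq_max leqnn orbT.
have np: 0<(n%:R : R) by rewrite ltr0n.
have jK: (K<=jj n k)%N by rewrite leq_min; move: nk kn K0; clear; lia.
have sK1 := sqrtn_ge1 (R := R) K0.
have sKj: Num.sqrt K%:R<=Num.sqrt (jj n k)%:R :> R by rewrite ler_wsqrtr // ler_nat.
have [hk|hk]: (k-n<=al*n-k)%N \/ (al*n-k<=k-n)%N by apply/orP; exact: leq_total.
 apply: le_trans (part_left sS S0 K0 n0 nk kn hk) _; rewrite ler_wpM2r ?sqrtr_ge0 // lerDl.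
 by nneg.
have hr := part_right sS S0 K0 n0 nk kn hk.
have T := hD n s nK n0 sS.
have tot: n%:R*nm (\sum_(n+K<=k<al*n-K) drift s n k)<=(S+4*nm g+nm Ci + `|C|+1)*Num.sqrt K%:R.
 rewrite -[X in X*_](nm_nat n) -nmM.
 set X := n%:R*_ in T *; set Y := _+Ci in T.
 have hY: nm Y<=S+nm g*(4*Num.sqrt K%:R)+nm Ci.
 apply: nmD_le; rewrite lerD2r; apply: nmD_le; apply: lerD.
 rewrite nmM nmN nm_rc -[leRHS]mulr1; exact: ler_pM (nm_ge0 _) (normr_ge0 _) sS ai.
 rewrite nmM nmM !nm_rc; apply: ler_pM; rewrite ?mulr_ge0 ?nm_ge0 //.
 by rewrite -[leRHS]mulr1 ler_wpM2l.
 by rewrite ger0_norm ?ln_nat_ge0 // ln_le_sqrt.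
 have hC: C * isq K <= `|C|.
 by apply: le_trans (ler_norm _) _; rewrite normrM ler_piMr // ger0_norm ?isq_ge0 ?isq_le1.
 have hD1: D*eps n<=1.
 have := hN n nN; rewrite -[_^-1]mul1r ler_pdivlMr // => h.
 have := ler_norm D; have := eps_ge0 (R := R) n; nr h.
 have := nmD (X-Y) Y; rewrite subrK => h.
 have m1: S<=S*Num.sqrt K%:R by rewrite ler_peMr.
 have m2: nm Ci<=nm Ci*Num.sqrt K%:R by rewrite ler_peMr ?nm_ge0.
 have m3: `|C| <= `|C|*Num.sqrt K%:R by rewrite ler_peMr.
 lr m3 m2 m1 h hD1 hC hY T sK1.
have ->: \sum_(n+K<=i<k) drift s n i = \sum_(n+K<=i<al*n-K) drift s n i - \sum_(k<=i<al*n-K) drift s n i.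
 by rewrite (big_cat_nat nk kn) /= addrK.
apply: le_trans (ler_wpM2l (ltW np) (nmB _ _)) _; rewrite mulrDr mulrDl addrC.
apply: lerD => //; apply: (le_trans tot); rewrite ler_wpM2l // !addr_ge0 ?mulr_ge0 ?nm_ge0 //.
Qed.

Lemma drift_small (S : R) s n k : 0<=S -> nm s<=S -> (0<n)%N -> (n<k)%N -> (k<al*n)%N ->
 Num.sqrt (jj n k)%:R/n%:R*nm (drift s n k) <=
 (al%:R*(4*nm g+S)+al%:R*Hh)*((jj n k)%:R^-1 * isq (jj n k)/n%:R+eps n/n%:R^+2).
Proof.
move=> S0 sS n0 nk kn; have np: 0<(n%:R : R) by rewrite ltr0n.
set j := jj n k; have j0: (0<j)%N by rewrite /j leq_min !subn_gt0 nk kn.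
have jp: 0<(j%:R : R) by rewrite ltr0n.
have jal: (j<=al*n)%N by apply: leq_trans (geq_minr _ _) (leq_subr _ _).
have g0 := nm_ge0 g; have Hh0 := Hh_ge0 g A1 A2 al2 c0.
have db := drift_bound g A1 A2 al2 c0 hc sS n0 nk kn; rewrite -/j in db.
have sj0 := sqrtr_ge0 (j%:R : R); have a0: 0<=(al%:R : R) by [].
set h := j%:R^-1 * isq j/n%:R; set q := eps n/n%:R^+2.
have h0: 0<=h by nneg.
have q0: 0<=q by rewrite /q; have := eps_ge0 (R := R) n => ?; nneg.
have ->: Num.sqrt j%:R/n%:R*nm (drift s n k)=Num.sqrt j%:R/n%:R^+2*(n%:R*nm (drift s n k)).
 by field; rewrite gt_eqF.
have P0: 0<=Num.sqrt j%:R/n%:R^+2 :> R by [].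
apply: le_trans (ler_wpM2l P0 db) _; rewrite mulrDr.
have t1: Num.sqrt j%:R/n%:R^+2*((nm g * ln n%:R+S)/n%:R)<=al%:R*(4*nm g+S)*q.
 have h1 := sqrt_isq_al (R := R) al2 n0 j0 jal.
 have h2: (nm g * ln n%:R+S) * isq n<=(4*nm g+S)*eps n.
 rewrite mulrDl (mulrDl (4*nm g)); apply: lerD; last by rewrite ler_wpM2l ?isq_le_eps.
 by rewrite -mulrA [4*_]mulrC -mulrA ler_wpM2l // ln_isq_le.
 have L0: 0<=nm g * ln n%:R+S by rewrite addr_ge0 // mulr_ge0 ?ln_nat_ge0.
 have ->: Num.sqrt j%:R/n%:R^+2*((nm g * ln n%:R+S)/n%:R)=Num.sqrt j%:R/n%:R*(nm g * ln n%:R+S)/n%:R^+2.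
 by field; rewrite gt_eqF.
 have ->: al%:R*(4*nm g+S)*q=al%:R*((4*nm g+S)*eps n)/n%:R^+2 by rewrite /q; ring.
 rewrite ler_pM2r ?invr_gt0 ?exprn_gt0 //; apply: le_trans (ler_wpM2r L0 h1) _.
 by rewrite -mulrA ler_wpM2l // mulrC.
have t2: Num.sqrt j%:R/n%:R^+2*(Hh/j%:R)<=al%:R*Hh*h.
 have ->: Num.sqrt j%:R/n%:R^+2*(Hh/j%:R)=Hh * isq j*(n%:R^-1*n%:R^-1).
 have ->: Num.sqrt j%:R=j%:R * isq j :> R by exact: isq_sqrt.
 by field; rewrite !gt_eqF.
 have ->: al%:R*Hh*h=Hh * isq j*((al%:R/j%:R)*n%:R^-1) by rewrite /h; ring.
 rewrite ler_wpM2l ?mulr_ge0 ?isq_ge0 // ler_pM2r ?invr_gt0 //.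
 by rewrite ler_pdivlMr // mulrC ler_pdivrMr // -natrM ler_nat.
set a1 := al%:R*(4*nm g+S) in t1 *; set a2 := al%:R*Hh in t2 *.
have a10: 0<=a1 by nneg.
have a20: 0<=a2 by nneg.
apply: le_trans (lerD t1 t2) _.
have ->: (a1+a2)*(h+q)=a1*q+a2*h+(a1*h+a2*q) by ring.
by rewrite lerDl addr_ge0 // mulr_ge0.
Qed.

End PassageSums.

(** * The orbit follows the reference ratio *)

Section Passage.
Context {R : realType}.
Variables (al : nat) (c : R) (a b30 : Cplx R).
Hypotheses (al2 : (2<=al)%N) (c0 : 0<c) (hc : c * ln al%:R = pi).
Local Notation I := (I2c c).
Local Notation vm := (vm c).
Local Notation vp := (vp c).
Local Notation A1 := (A1 c a b30).
Local Notation A2 := (A2 c a).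
Local Notation rr := (rr A1 A2).
Local Notation g := (a - 1).
Local Notation kap := (kap al c).
Local Notation rs n k := (rho c (k%:R/n%:R)).
Local Notation drift := (drift c g A1 A2).
Local Notation jj n k := (minn (k-n) (al*n-k)).
Local Notation hq n k := ((jj n k)%:R^-1 * isq (jj n k)/n%:R+eps n/n%:R^+2 : R).

Definition zdata (Q Cz : R) (s : Cplx R) (z : nat -> Cplx R) (n : nat) := forall k, (n<=k)%N ->
 nm ((z k)^-1-(k%:R-g*rc (ln k%:R)+s))<=Cz * isq k /\
 nm (z k.+1-(z k-z k^+2+a*z k^+3))<=Q*nm (z k)^+4.

(** The expansion is demanded only while w is small, because the local form is known only near the
    fixed point; smallness is regained at each step of the induction. *)
Definition wdata (Q r0 : R) (z w : nat -> Cplx R) (n : nat) := forall k, (n<=k)%N -> (k<al*n)%N ->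
 nm (w k)<=r0 ->
 nm (w k.+1-(w k+w k^+2+rc (bq c)*z k^+2+a*w k^+3+b30*z k^+3)) <=
 Q*(nm (z k)+nm (w k))^+4.

Definition rk (z w : nat -> Cplx R) k := (w k-vp*z k)/(w k-vm*z k).
Definition yk (z w : nat -> Cplx R) n k := rk z w k/rs n k.

Variables (Q S Cz W0 r0 : R).
Hypotheses (Q0 : 0<=Q) (S0 : 0<=S) (Cz0 : 0<=Cz) (W00 : 0<=W0) (r00 : 0<r0).

Lemma nat_ge (x : R) : exists2 K, (0<K)%N & forall k, (K<=k)%N -> x<=k%:R.
Proof.
have [K hK] := ex_natge x; exists K.+1 => // k kK; apply: (le_trans hK).
by rewrite ler_nat; exact: ltnW.
Qed.

(** Induction on k. The deviation may grow like sqrt j / n, with j the number of steps to the nearer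
    end: this dominates the partial drift sums, and relative to j/n it gains a factor [isq K], which
    keeps the ratio away from 1 as [geom_est] demands. *)
Theorem bootstrap : exists Lam K0, [/\ 1<=Lam, (0<K0)%N & exists2 Cr : R, 0<=Cr &
 forall K, (K0<=K)%N -> exists2 n0, (0<n0)%N & forall n s z w, (n0<=n)%N -> nm s<=S ->
 zdata Q Cz s z n -> wdata Q r0 z w n -> w (n+K)%N-vm*z (n+K)%N!=0 ->
 n%:R*nm (yk z w n (n+K) - 1)<=(2*c*(4*nm g+W0+1)+1)*Num.sqrt K%:R ->
 forall k, (n+K<=k)%N -> (k<=al*n-K)%N ->
 [/\ w k-vm*z k!=0, nm (yk z w n k - 1)<=Lam*Num.sqrt (jj n k)%:R/n%:R,
 nm (yk z w n k - 1)<=Lam * isq K*(jj n k)%:R/n%:R &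
 n%:R*nm (yk z w n k-yk z w n (n+K)-I * \sum_(n+K<=i<k) drift s n i)<=Cr*(8 * isq K+al%:R*eps n)]].
Proof.
have [Ce [eta [n1 [Ce0 eta0 n10 hloc]]]] := local_err a b30 al2 c0 hc Q0 S0 Cz0.
have [CZ [k1 [CZ0 k10 hZ]]] := Z_est g S0 Cz0.
have [Cp Cp0 hpart] := drift_partial g A1 A2 al2 c0 hc S0.
have kp0 := kap_gt0 al2 c0; have g0 := nm_ge0 g; have v0 := nm_ge0 vm.
have ap: 1<=(al%:R : R) by rewrite ler1n ltnW.
have Cm0: 0<=Cm al c by nneg.
have nI := nm_I2c c0.
pose Cst := 2*c*(4*nm g+W0+1)+1.
pose Cd := al%:R*(4*nm g+S)+al%:R*Hh al c g A1 A2.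
pose Cr1 := 2*c*Cd+2*Ce.
have Cst0: 0<=Cst by nneg.
have Cd0: 0<=Cd by rewrite /Cd; nneg.
have Cr10: 0<=Cr1 by nneg.
(* Half of Lam pays for the initial deviation and the drift sums, the other half for the local
   errors, which are small for large K and n. *)
pose Lam := 2*(Cst+2*c*Cp)+1.
have Lam1: 1<=Lam by have : 0<=Cst+2*c*Cp by [nneg]; rewrite /Lam; lr.
have Lam0: 0<Lam by lr Lam1.
have half2 (u: Cplx R) : nm (u - 1)<=1/2 -> nm u<=2.
 by move=> h; have := nmD (u - 1) 1; rewrite subrK nm1; lr h.
have half3 (u: Cplx R) : nm (u - 1)<=1/2 -> 0<nm u.
 by move=> h; have := nmB_ge 1 (1-u); rewrite opprB addrCA subrr addr0 nm1 nmC; lr h.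
have c2p: 0<=2*c by nneg.
have boot_num (N Y Sh Sg y0 sK sJ E1 E2: R) : 0<=N -> Y<=Cr1*Lam*Sh+2*c*Sg+y0 ->
 N*Sg<=Cp*sJ -> Sh<=N^-1*(8*E1+al%:R*E2) -> 0<N -> N*y0<=Cst*sK ->
 sK<=sJ -> 1<=sK -> Cr1*(8*E1)<=1/4 -> Cr1*(al%:R*E2)<=1/4 -> N*Y<=Lam*sJ.
 move=> N0 h1 h2 h3 Np h4 h5 h6 h7 h8.
 have h3': N*Sh<=8*E1+al%:R*E2.
 by have := ler_wpM2l N0 h3; rewrite mulrA mulfV ?mul1r // gt_eqF.
 have q1: Cr1*Lam*(N*Sh)<=Lam/2.
 via (Lam*(Cr1*(8*E1)+Cr1*(al%:R*E2))).
 have := ler_wpM2l (mulr_ge0 Cr10 (ltW Lam0)) h3'; lr.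
 by rewrite ler_wpM2l ?(ltW Lam0); lr h8 h7.
 have q2: Lam/2<=Lam/2*sJ by rewrite ler_peMr ?divr_ge0 ?(ltW Lam0); lr h6 h5.
 have q3: Cst*sK<=Cst*sJ by rewrite ler_wpM2l.
 have q4 := ler_wpM2l c2p h2.
 have q5 := ler_wpM2l N0 h1.
 have q6: (Cst+2*c*Cp)*sJ<=Lam/2*sJ by rewrite ler_wpM2r /Lam; lr Ce0 h6 h5.
 lr q6 q5 q4 q3 q2 q1 h4.
have al0: 0<(al%:R : R) by lr ap.
pose e1 := Num.min (kap/2/Lam) (Num.min ((2*al%:R*Lam)^-1) ((32*(Cr1+1))^-1)).
have e10: 0<e1.
 by rewrite !lt_min !invr_gt0 !divr_gt0 ?mulr_gt0 //; lr Cr10.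
have [Ka [Ka0 hKa]] := isq_small e10.
have [Kb Kb0 hKb] := nat_ge (Cm al c/eta+Cm al c/r0).
exists Lam, (maxn Ka Kb); split => //; first by rewrite leq_max Ka0.
exists (Cr1*Lam) => [|K KK]; first by rewrite mulr_ge0 // ltW.
have K0: (0<K)%N by apply: leq_trans KK; rewrite leq_max Ka0.
have hK1: isq K<=e1 by apply: hKa; apply: leq_trans KK; rewrite leq_max leqnn.
have hK2: Cm al c/eta+Cm al c/r0<=K%:R by apply: hKb; apply: leq_trans KK; rewrite leq_max leqnn orbT.
have Kp: 0<(K%:R : R) by rewrite ltr0n.
have [np_ np_0 hnp] := hpart K K0.
have [nq [nq0 hnq]] := @eps_small R (8*al%:R*(Cr1+1))^-1 ltac:(rewrite invr_gt0 !mulr_gt0 //; lr Cr10).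
exists (maxn (maxn n1 k1) (maxn np_ nq)) => [|n s z w nn sS hz hw B0 hy0]; first by rewrite !leq_max n10.
move: (nn); rewrite !geq_max -!andbA => /and4P[n1n k1n npn nqn].
have n0: (0<n)%N by apply: leq_trans n1n.
have np: 0<(n%:R : R) by rewrite ltr0n.
have in0: 0<(n%:R : R)^-1 by nneg.
have heps := hnq n nqn.
pose th := Lam * isq K.
have th0: 0<=th by nneg.
have th1: th<=kap/2.
 have := le_trans hK1 (_ : e1<=kap/2/Lam); rewrite ge_min lexx => /(_ isT).
 by rewrite ler_pdivlMr // mulrC.
have th2: th*al%:R<=1/2.
 have := le_trans hK1 (_ : e1<=(2*al%:R*Lam)^-1); rewrite !ge_min lexx orbT => /(_ isT).
 rewrite -[_^-1]mul1r ler_pdivlMr ?mulr_gt0 // /th; lr.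
have th3: Cr1*(8 * isq K)<=1/4.
 have := le_trans hK1 (_ : e1<=(32*(Cr1+1))^-1); rewrite !ge_min lexx !orbT => /(_ isT).
 rewrite -[_^-1]mul1r ler_pdivlMr ?mulr_gt0 //; last by lr Cr10.
 by have := isq_ge0 (R := R) K; lr.
have th4: Cr1*(al%:R*eps n)<=1/4.
 move: heps; rewrite -[_^-1]mul1r ler_pdivlMr; last by rewrite !mulr_gt0 //; lr Cr10.
 have := mulr_ge0 (ltW al0) (eps_ge0 (R := R) n); lr.
pose y k := yk z w n k.
pose P k := [/\ w k-vm*z k!=0, nm (y k - 1)<=Lam*Num.sqrt (jj n k)%:R/n%:R &
 nm (y k-y (n+K)%N-I * \sum_(n+K<=i<k) drift s n i)<=Cr1*Lam * \sum_(n+K<=i<k) hq n i].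
have jK k: (n+K<=k)%N -> (k<=al*n-K)%N -> (K<=jj n k)%N.
 by move=> h1 h2; rewrite leq_min; move: h1 h2 K0; clear; lia.
have fine k: (n+K<=k)%N -> (k<=al*n-K)%N ->
 nm (y k - 1)<=Lam*Num.sqrt (jj n k)%:R/n%:R -> nm (y k - 1)<=th*(jj n k)%:R/n%:R.
 move=> h1 h2 h; apply: (le_trans h); rewrite ler_pM2r ?invr_gt0 // /th -mulrA ler_pM2l //.
 have j0: (0<jj n k)%N by apply: leq_trans K0 (jK k h1 h2).
 rewrite isq_sqrt // mulrC ler_wpM2r // isq_le //; exact: jK.
have hq0 i: 0<=hq n i.
 by rewrite addr_ge0 // mulr_ge0 ?invr_ge0 ?eps_ge0 // mulr_ge0 ?invr_ge0.
have sumhq k: (k<=al*n-K)%N -> \sum_(n+K<=i<k) hq n i<=n%:R^-1*(8 * isq K+al%:R*eps n).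
 move=> h2; apply: le_trans (hq_sum al K0 n0).
 have [h1|h1] := leqP (n+K) k; last by rewrite big_geq ?(ltnW h1) // sumr_ge0.
 by rewrite [leRHS](big_cat_nat h1 h2) /= lerDl sumr_ge0.
have key k: (n+K<=k)%N -> (k<=al*n-K)%N -> P k.
 move=> h1; rewrite -(subnKC h1); elim: (k-(n+K))%N => [|i IH] h2.
 rewrite addn0 in h2 *; split=> //; last first.
 by rewrite !big_geq // mulr0 !subr0 subrr nm0 mulr0.
 rewrite ler_pdivlMr // mulrC; apply: (le_trans hy0).
 apply: ler_pM; rewrite ?sqrtr_ge0 ?ler_wsqrtr ?ler_nat ?jK //.
 rewrite -/Cst /Lam; have : 0<=2*c*Cp by [nneg]; lr Cst0.
 rewrite addnS in h2 *; set k' := (n+K+i)%N in h2 IH *.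
 have h1': (n+K<=k')%N by rewrite leq_addr.
 have [Bk hyk hsk] := IH (ltnW h2).
 have nk: (n<k')%N by move: h1' K0; clear; lia.
 have kn: (k'<al*n)%N by move: h2; clear; lia.
 have jk := jK k' h1' (ltnW h2).
 have j0: (0<jj n k')%N by apply: leq_trans K0 jk.
 have jp: 0<((jj n k')%:R : R) by rewrite ltr0n.
 have hfine := fine k' h1' (ltnW h2) hyk.
 have [z1 z2] := hz k' (ltnW nk).
 have k1k: (k1<=k')%N by apply: leq_trans k1n (ltnW nk).
 have [zn _ _ zle _] := hZ k' s (z k') k1k sS z1.
 have rsn := rho_neq0 c (k'%:R/n%:R).
 have nr (x: R) : nm (y k' - 1)<=x -> nm (rk z w k'-rs n k')<=x.
 have ->: rk z w k'-rs n k'=(y k' - 1)*rs n k' by rewrite /y /yk mulrBl divfK // mul1r.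
 by rewrite nmM nm_rho mulr1.
 have zn2: nm (z k')<=2/n%:R.
 by apply: (le_trans zle); rewrite ler_wpM2l // lef_pV2 ?posrE ?ltr0n ?ler_nat ?(ltnW nk) // (leq_trans n0 (ltnW nk)).
 have [x1 x2] := kn_range (R := R) n0 nk kn.
 have lb := rho_lb al2 c0 hc (ltW x1) (ltW x2).
 rewrite dd_nat ?(ltnW nk) ?(ltnW kn) // mulrA in lb.
 have [_ _ _ _ [_ _ mj]] := geom_est al2 c0 n0 nk kn zn zn2 (nm_rho _ _) lb th1 th2 th0 Bk (nr _ hfine).
 have CK (x: R) : 0<x -> Cm al c/x<=K%:R -> Cm al c/(jj n k')%:R<=x.
 move=> x0; rewrite ler_pdivrMr // => h; rewrite ler_pdivrMr // mulrC.
 by apply: (le_trans h); rewrite ler_wpM2r ?(ltW x0) // ler_nat.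
 have Ce1: 0<=Cm al c/eta by nneg.
 have Ce2: 0<=Cm al c/r0 by nneg.
 have wr: nm (w k')<=r0.
 have : nm (w k')<=nm (z k')+nm (w k') by rewrite lerDr nm_ge0.
 move=> h; apply: (le_trans h); apply: (le_trans mj); apply: CK => //.
 by apply: le_trans hK2; rewrite lerDr.
 have wk := hw k' (ltnW nk) kn wr.
 have etaj: Cm al c/(jj n k')%:R<=eta.
 by apply: CK => //; apply: le_trans hK2; rewrite lerDl.
 have := hloc n k' s (z k') (w k') _ _ Lam th n1n nk kn sS z1 Lam1 th0 th1 th2 etaj z2 wk Bk (nr _ hfine) (nr _ hyk).
 have ez: z k'-z k'^+2+a*z k'^+3+(z k'.+1-(z k'-z k'^+2+a*z k'^+3))=z k'.+1 by ring.
 have ew: w k'+w k'^+2+rc (bq c)*z k'^+2+a*w k'^+3+b30*z k'^+3 +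
 (w k'.+1-(w k'+w k'^+2+rc (bq c)*z k'^+2+a*w k'^+3+b30*z k'^+3))=w k'.+1 by ring.
 cbv zeta; rewrite ez ew => -[B' hst].
 set e := drift s n k' in hst; set Y := y k' in hyk hsk hfine.
 have jn: (jj n k')%:R<=al%:R*n%:R :> R.
 by rewrite -natrM ler_nat; apply: leq_trans (geq_minr _ _) (leq_subr _ _).
 have hY2: nm (Y - 1)<=1/2.
 apply: (le_trans hfine); rewrite ler_pdivrMr //.
 by apply: le_trans (ler_wpM2l th0 jn) _; rewrite mulrA ler_wpM2r // ltW.
 have Yl: nm Y<=2 by apply: half2.
 have Yn: Y!=0 by rewrite -nm_gt0; apply: half3; exact: hY2.
 have stepE: y k'.+1-Y-I*e=(Y - 1)*(I*e)+Y*(y k'.+1/Y - 1-I*e).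
 by move: (y k'.+1) (Y) (I*e) Yn => p1 p2 p3 pn; field.
 have step: nm (y k'.+1-Y-I*e)<=Cr1*Lam*hq n k'.
 rewrite stepE; apply: nmD_le.
 have ds := drift_small g A1 A2 al2 c0 hc S0 sS n0 nk kn; rewrite -/e -/Cd in ds.
 have ->: Cr1*Lam*hq n k' = 2*c*(Lam*(Cd*hq n k'))+2*(Ce*Lam*hq n k') by rewrite /Cr1; ring.
 apply: lerD; last by rewrite nmM; apply: ler_pM; rewrite ?nm_ge0.
 rewrite nmM (nmM I) nI mulrCA; apply: ler_wpM2l; first by rewrite mulr_ge0 // ltW.
 apply: le_trans (ler_wpM2r (nm_ge0 _) hyk) _; rewrite -!(mulrA Lam); apply: ler_wpM2l; first exact: ltW.
 exact: ds.
 have hs': nm (y k'.+1-y (n+K)%N-I * \sum_(n+K<=i<k'.+1) drift s n i)<=Cr1*Lam * \sum_(n+K<=i<k'.+1) hq n i.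
 rewrite !big_nat_recr //= -/e mulrDr (mulrDr (Cr1*Lam)).
 have ->: y k'.+1-y (n+K)%N-(I * \sum_(n+K<=i<k') drift s n i+I*e) =
 (Y-y (n+K)%N-I * \sum_(n+K<=i<k') drift s n i)+(y k'.+1-Y-I*e) by ring.
 by apply: nmD_le; apply: lerD.
 split=> //.
 have h1'': (n+K<=k'.+1)%N by apply: leq_trans h1' _.
 have := hnp n s _ npn sS h1'' h2; have := sumhq k'.+1 h2.
 set Sg := \sum_(n+K<=i<k'.+1) drift s n i in hs' *; set Sh := \sum_(n+K<=i<k'.+1) hq n i in hs' *.
 move=> hSh hSg.
 rewrite ler_pdivlMr // mulrC.
 have tri: nm (y k'.+1 - 1)<=Cr1*Lam*Sh+2*c*nm Sg+nm (y (n+K)%N - 1).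
 have ->: y k'.+1 - 1=(y k'.+1-y (n+K)%N-I*Sg)+I*Sg+(y (n+K)%N - 1) by ring.
 by apply: nmD_le; rewrite lerD2r; apply: nmD_le; rewrite nmM nI lerD2r.
 have jk'' := jK k'.+1 h1'' h2.
 have sK1: Num.sqrt K%:R<=Num.sqrt (jj n k'.+1)%:R :> R by rewrite ler_wsqrtr // ler_nat.
 have s1: 1<=Num.sqrt K%:R :> R by exact: sqrtn_ge1.
 exact: boot_num (ltW np) tri hSg hSh np hy0 sK1 s1 th3 th4.
have hsum2 k: (k<=al*n-K)%N -> n%:R*(Cr1*Lam * \sum_(n+K<=i<k) hq n i)<=Cr1*Lam*(8 * isq K+al%:R*eps n).
 move=> h2; rewrite mulrCA ler_wpM2l //; first by rewrite mulr_ge0 // ltW.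
 by have := ler_wpM2l (ltW np) (sumhq k h2); rewrite mulrA mulfV ?mul1r // gt_eqF.
move=> k h1 h2; have [B hy hs] := key k h1 h2; split=> //.
 exact: fine.
apply: le_trans (hsum2 k h2); rewrite ler_wpM2l ?(ltW np) //.
Qed.

End Passage.

(** * The passage as an affine map of u = -1/w *)

Section PassageMain.
Context {R : realType}.
Variables (al : nat) (c : R) (a b30 : Cplx R).
Hypotheses (al2 : (2<=al)%N) (c0 : 0<c) (hc : c * ln al%:R = pi).
Local Notation I := (I2c c).
Local Notation vm := (vm c).
Local Notation vp := (vp c).
Local Notation g := (a - 1).
Local Notation rs n k := (rho c (k%:R/n%:R)).
Local Notation A1 := (A1 c a b30).
Local Notation A2 := (A2 c a).

Lemma mul_le_div1 (D e x : R) : 0<=D -> 0<=e -> e<=x/(D+1) -> D*e<=x.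
Proof.
by move=> D0 e0; rewrite ler_pdivlMr; [nra|lra].
Qed.

Lemma div1_gt0 (D x : R) : 0<=D -> 0<x -> 0<x/(D+1).
Proof. by move=> D0 x0; rewrite divr_gt0 //; lra. Qed.

Lemma mul_le_invD1 (D e : R) : 0<=D -> 0<=e -> e<=(D+1)^-1 -> D*e<=1.
Proof. by move=> D0 e0 h; apply: mul_le_div1; rewrite ?mul1r. Qed.

Lemma rk_sub (z w : Cplx R) : w-vm*z!=0 -> 1-(w-vp*z)/(w-vm*z)=I*z/(w-vm*z).
Proof. by move=> h; rewrite /vp; field. Qed.

Lemma start_piece (S Cz U : R) K : 0<=S -> 0<=Cz -> 0<=U -> exists D n0, [/\ 0<=D, (0<n0)%N &
 forall n (s z w : Cplx R), (n0<=n)%N -> nm s<=S ->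
 nm (z^-1-((n+K)%:R-g*rc (ln (n+K)%:R)+s))<=Cz * isq (n+K) ->
 w!=0 -> nm (- w^-1)<=U ->
 w-vm*z!=0 /\
 nm (n%:R*((w-vp*z)/(w-vm*z)/rs n (n+K)%N - 1)-I*(- w^-1-K%:R))<=D*eps n].
Proof.
move=> S0 Cz0 U0; have [CZ [k1 [CZ0 k10 hZ]]] := Z_est g S0 Cz0.
have v0 := nm_ge0 vm; have c2: 0<=2*c by rewrite mulr_ge0 // ltW.
pose E0 := CZ+2*K%:R; have E00: 0<=E0 by rewrite addr_ge0 // mulr_ge0.
pose Cc := (32*c^+2+4*c)*K%:R^+2.
have Cc0: 0<=Cc by rewrite /Cc; nneg.
pose D1 := 2*c*U*(4*nm vm*U+2*E0).
pose D2 := 2*c*(U+K%:R)*(2*c*K%:R+Cc).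
have D10: 0<=D1 by rewrite /D1; nneg.
have D20: 0<=D2 by rewrite /D2; nneg.
have [n1 [n10 hn1]] := @eps_small R (E0+1)^-1 ltac:(rewrite invr_gt0; lr E00).
have [n2 n20 hn2] := nat_ge (4*(nm vm*U)).
exists (D1+Cc+D2), (maxn (maxn k1 n1) n2); split; first by rewrite !addr_ge0.
 by rewrite !leq_max k10.
move=> n s z w nn sS hz w0 hu.
move: (nn); rewrite !geq_max -!andbA => /and3P[k1n n1n n2n].
have n0: (0<n)%N by apply: leq_trans n1n.
have np: 0<(n%:R : R) by rewrite ltr0n.
have e0 := eps_gt0 (R := R) n0; have e1 := eps_le1 (R := R) n.
have ie := invn_le_eps (R := R) n0.
have in0: 0<(n%:R : R)^-1 by rewrite invr_gt0.
set k := (n+K)%N in hz *; have nk: (n<=k)%N by rewrite leq_addr.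
have kp: 0<(k%:R : R) by rewrite ltr0n (leq_trans n0).
have [z0 kz _ zle _] := hZ k s z (leq_trans k1n nk) sS hz.
have hE: nm (n%:R*z - 1)<=E0*eps n.
 have ->: n%:R*z - 1=(k%:R*z - 1)-K%:R*z by rewrite /k natrD; ring.
 apply: nmB_le; rewrite /E0 mulrDl; apply: lerD.
 apply: (le_trans kz); rewrite ler_wpM2l //; apply: le_trans (eps_le n0 nk).
 by rewrite exprS ler_piMr ?eps_ge0 // exprn_ile1 ?eps_ge0 ?eps_le1.
 have ->: 2*K%:R*eps n=K%:R*(2*eps n) :> R by ring.
 rewrite nmM nm_nat ler_wpM2l //; apply: (le_trans zle); rewrite ler_wpM2l //.
 by apply: le_trans ie; rewrite lef_pV2 ?posrE // ler_nat.
have E1: E0*eps n<=1.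
 by apply: mul_le_invD1 (hn1 n n1n) => //; exact: ltW.
have hn := hn2 n n2n.
set u := - w^-1 in hu *.
have wu: w*u = -1 by rewrite /u mulrN mulfV.
have eB: w-vm*z=w*(1+vm*z*u).
 by rewrite mulrDr mulr1 mulrCA wu; ring.
have zn: nm z<=2/n%:R by apply: (le_trans zle); rewrite ler_wpM2l // lef_pV2 ?posrE // ler_nat.
have y2: nm (vm*z*u)<=1/2.
 rewrite !nmM; via (nm vm*(2/n%:R)*U).
 by apply: ler_pM; rewrite ?mulr_ge0 ?nm_ge0 // ler_wpM2l.
 have ->: nm vm*(2/n%:R)*U = 2*(nm vm*U)/n%:R by ring.
 by rewrite ler_pdivrMr //; lr hn.
have yn: 1+vm*z*u!=0.
 by rewrite -nm_gt0; have := nmD_ge 1 (vm*z*u); rewrite nm1; lr y2.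
have Bn: w-vm*z!=0 by rewrite eB mulf_neq0.
split=> //; set r := (w-vp*z)/(w-vm*z).
have er: r - 1=I*z*u/(1+vm*z*u).
 have := rk_sub Bn; rewrite -/r eB => h.
 have ->: r - 1 = - (1-r) by ring.
 have ->: I*z*u/(1+vm*z*u) = - (I*z/(w*(1+vm*z*u))).
 by move: (1+vm*z*u) yn => y0 yn0; rewrite /u; field; rewrite w0 yn0.
 by rewrite h.
have [t1 t2] := ln_asym_up (R := R) K n0.
have hrs := cis_asym c0 (ltW in0) t1 t2.
rewrite -/k in hrs.
have hrs': nm (rs n k - 1-I*rc (K%:R*n%:R^-1))<=Cc*n%:R^-1^+2 by [].
have sa := start_asym c0 n0 hE E1 hu hn.
have rsn := rho_neq0 c (k%:R/n%:R).
have nrs: nm (rs n k) = 1 := nm_rho _ _.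
have ->: n%:R*(r/rs n k - 1)-I*(u-K%:R) =
 ((n%:R*(r - 1)-I*u)-n%:R*(rs n k - 1-I*rc (K%:R*n%:R^-1)))/rs n k-I*(u-K%:R)*(rs n k - 1)/rs n k.
 rewrite rcM rcV !rc_nat; have nn0: (n%:R : Cplx R)!=0 by rewrite -nm_gt0 nm_nat.
 by move: (rs n k) rsn => q qn; field; rewrite qn nn0.
have b1: nm (n%:R*(r - 1)-I*u)<=D1*eps n.
 rewrite er; apply: (le_trans sa); rewrite /D1 -[leRHS]mulrA; apply: ler_wpM2l; first by nneg.
 rewrite [leRHS]mulrDl; apply: lerD; last by rewrite mulrA.
 by apply: ler_wpM2l => //; nneg.
have b2: nm (n%:R*(rs n k - 1-I*rc (K%:R*n%:R^-1)))<=Cc*eps n.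
 rewrite nmM nm_nat; apply: le_trans (ler_wpM2l (ltW np) hrs') _.
 have ->: n%:R*(Cc*n%:R^-1^+2)=Cc*n%:R^-1 by field; rewrite gt_eqF.
 exact: ler_wpM2l.
have b3: nm (I*(u-K%:R)*(rs n k - 1))<=D2*eps n.
 rewrite nmM (nmM I) nm_I2c //; have q1: nm (u-K%:R)<=U+K%:R.
 by apply: nmB_le; rewrite nm_nat lerD2r.
 have q2: nm (rs n k - 1)<=(2*c*K%:R+Cc)*eps n.
 have ->: rs n k - 1=(rs n k - 1-I*rc (K%:R*n%:R^-1))+I*rc (K%:R*n%:R^-1) by ring.
 apply: nmD_le; rewrite [leRHS]mulrDl addrC; apply: lerD.
 rewrite nmM nm_I2c // nm_rc ger0_norm; last by rewrite mulr_ge0 // ltW.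
 by rewrite mulrA ler_wpM2l // mulr_ge0.
 apply: (le_trans hrs'); apply: ler_wpM2l => //; apply: le_trans ie.
 by rewrite expr2 ler_piMl ?(ltW in0) // invf_le1 // ler1n.
 rewrite /D2 -[leRHS]mulrA; apply: ler_pM; rewrite ?nm_ge0 ?mulr_ge0 ?nm_ge0 ?(ltW c0) //.
 by rewrite ler_wpM2l.
apply: nmB_le; rewrite !nmf nrs !divr1; have := nmB (n%:R*(r - 1)-I*u) (n%:R*(rs n k - 1-I*rc (K%:R*n%:R^-1))).
rewrite !mulrDl; lr b3 b2 b1 nrs sa hrs' hrs t2 t1 er y2 zn eB wu hu hn E1 hE zle kz kp hz in0 ie e1 e0 np sS D20 D10 Cc0 E00 c2 v0 CZ0 U0 Cz0 S0 hc c0.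
Qed.

Lemma end_piece (S Cz U : R) K : 0<=S -> 0<=Cz -> 0<=U -> exists D n0, [/\ 0<=D, (0<n0)%N &
 forall n (s z w : Cplx R), (n0<=n)%N -> nm s<=S ->
 nm (z^-1-((al*n-K)%:R-g*rc (ln (al*n-K)%:R)+s))<=Cz * isq (al*n-K) ->
 w-vm*z!=0 -> n%:R*nm ((w-vp*z)/(w-vm*z)/rs n (al*n-K)%N - 1)<=U ->
 w!=0 /\
 nm (- w^-1+K%:R-al%:R*n%:R*((w-vp*z)/(w-vm*z)/rs n (al*n-K)%N - 1)/I)<=D*eps n].
Proof.
have l3 (x y: R) : 2*x*y<=1 -> x*y<=1/2 by lra.
move=> S0 Cz0 U0; have [CZ [k1 [CZ0 k10 hZ]]] := Z_est g S0 Cz0.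
have v0 := nm_ge0 vm; have c2: 0<=2*c by rewrite mulr_ge0 // ltW.
have c2p: 0<2*c by rewrite mulr_gt0.
have ap: 0<(al%:R : R) by rewrite ltr0n ltnW.
pose E0 := 2*CZ+2*K%:R; have E00: 0<=E0 by rewrite /E0; nneg.
pose Cc := (32*c^+2+4*c)*(- K%:R)^+2.
have Cc0: 0<=Cc by rewrite /Cc sqrrN; nneg.
pose U2 := al%:R*U+(2*c*K%:R+Cc).
have U20: 0<=U2 by rewrite /U2; nneg.
pose D1 := U2/(2*c)*(4*(E0+nm vm*U2/(2*c))).
pose D2 := (al%:R*U*(2*c*K%:R+Cc)+Cc)/(2*c).
have D10: 0<=D1 by rewrite /D1; nneg.
have D20: 0<=D2 by rewrite /D2; nneg.
have [n1 [n10 hn1]] := @eps_small R (2*E0+1)^-1 ltac:(rewrite invr_gt0; lr E00).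
have [n2 n20 hn2] := nat_ge (2*(nm vm*U2)/(2*c)).
exists (D1+D2), (maxn (maxn k1 n1) (maxn n2 (2*K))); split; first by rewrite !addr_ge0.
 by rewrite !leq_max k10.
move=> n s z w nn sS hz Bn hU.
move: (nn); rewrite !geq_max -!andbA => /and4P[k1n n1n n2n Kn].
have n0: (0<n)%N by apply: leq_trans n1n.
have np: 0<(n%:R : R) by rewrite ltr0n.
have e0 := eps_gt0 (R := R) n0; have e1 := eps_le1 (R := R) n.
have ie := invn_le_eps (R := R) n0.
have in0: 0<(n%:R : R)^-1 by rewrite invr_gt0.
set k := (al*n-K)%N in hz hU *.
have an2: (2*n<=al*n)%N by rewrite leq_mul2r al2 orbT.
have nk: (n<=k)%N by rewrite /k; move: Kn an2; clear; lia.
have kp: 0<(k%:R : R) by rewrite ltr0n (leq_trans n0).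
set N := (al*n)%N in k kp nk an2 hz hU *.
have nN: (n<=N)%N by move: an2; clear; lia.
have N0: (0<N)%N by apply: leq_trans nN.
have Np: 0<(N%:R : R) by rewrite ltr0n.
have KN: (2*K<=N)%N by apply: leq_trans nN.
have iN: N%:R^-1<=n%:R^-1 :> R by rewrite lef_pV2 ?posrE // ler_nat.
have iN0: 0<(N%:R : R)^-1 by rewrite invr_gt0.
have iNe: N%:R^-1<=eps n :> R by apply: le_trans ie.
have [z0 kz _ zle _] := hZ k s z (leq_trans k1n nk) sS hz.
have kN: (k%:R : R)=N%:R-K%:R by rewrite /k natrB //; move: KN; clear; lia.
have kNC: (k%:R : Cplx R)=N%:R-K%:R by rewrite /k natrB //; move: KN; clear; lia.
have zK: nm z<=2/n%:R by apply: (le_trans zle); rewrite ler_wpM2l // lef_pV2 ?posrE // ler_nat.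
have hE: nm (N%:R*z - 1)<=(2*CZ+2*K%:R)*eps n.
 have ->: N%:R*z - 1=(k%:R*z - 1)+K%:R*z by rewrite kNC; ring.
 apply: nmD_le; rewrite [leRHS]mulrDl; apply: lerD.
 apply: (le_trans kz); via (CZ*eps n); last first.
 by rewrite ler_wpM2r ?(ltW e0) // ler_peMl // ler1n.
 rewrite ler_wpM2l //; apply: le_trans (eps_le n0 nk).
 by rewrite exprS ler_piMr ?eps_ge0 // exprn_ile1 ?eps_ge0 ?eps_le1.
 have ->: 2*K%:R*eps n=K%:R*(2*eps n) :> R by ring.
 by rewrite nmM nm_nat ler_wpM2l //; apply: (le_trans zK); rewrite ler_wpM2l.
set y := (w-vp*z)/(w-vm*z)/rs n k in hU *.
set r := (w-vp*z)/(w-vm*z) in y hU *.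
have rsn := rho_neq0 c (k%:R/n%:R).
have nrs: nm (rs n k) = 1 := nm_rho _ _.
have ry: r=y*rs n k by rewrite /y divfK.
have [t1 t2] := ln_asym_down (R := R) KN N0.
have hrs := cis_asym c0 (ltW iN0) t1 t2.
have rsE: rs n k=cis (2*c * - ln (N%:R/(N-K)%:R)).
 rewrite (rho_al al2 hc) ?divr_gt0 // mulrN -/k; congr (cis (- (2*c * ln _))).
 by rewrite invf_div mulrA -natrM.
rewrite -rsE -/Cc in hrs.
have r1n: 1-r=I*z/(w-vm*z) by rewrite -rk_sub.
have i0 := I_neq0 c0.
have rn0: 1-r!=0 by rewrite r1n; apply: mulf_neq0; [exact: mulf_neq0|rewrite invr_eq0].
pose X := N%:R*(r - 1).
have NC: (N%:R : Cplx R)!=0 by rewrite -nm_gt0 nm_nat.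
have XN: X/N%:R=r - 1 by rewrite /X mulrC mulKf.
have hI: nm (I*rc (- K%:R*N%:R^-1)) = 2*c*K%:R*N%:R^-1.
 by rewrite nmM nm_I2c // nm_rc mulNr normrN ger0_norm ?mulrA // mulr_ge0 // ltW.
have q2: nm (rs n k - 1)<=(2*c*K%:R+Cc)*N%:R^-1.
 have ->: rs n k - 1=(rs n k - 1-I*rc (- K%:R*N%:R^-1))+I*rc (- K%:R*N%:R^-1) by ring.
 apply: nmD_le; rewrite [leRHS]mulrDl addrC; apply: lerD; first by rewrite hI.
 apply: (le_trans hrs); apply: ler_wpM2l => //.
 by rewrite expr2 ler_piMl ?(ltW iN0) // invf_le1 // ler1n.
have NE: (N%:R : R)=al%:R*n%:R by rewrite -natrM.
have NEC: (N%:R : Cplx R)=al%:R*n%:R by rewrite -natrM.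
have hX: nm X<=U2.
 have ->: X=al%:R*(n%:R*(y - 1))*rs n k+N%:R*(rs n k - 1) by rewrite /X ry NEC; ring.
 apply: nmD_le; apply: lerD.
 by rewrite !nmM !nm_nat nrs mulr1 ler_wpM2l.
 by rewrite nmM nm_nat mulrC -ler_pdivlMr.
rewrite -/E0 in hE.
have E1: E0*eps n<=1/2.
 suff : 2*E0*eps n<=1 by apply: l3.
 by apply: mul_le_invD1 (hn1 n n1n); rewrite ?(ltW e0) // mulr_ge0.
have hN: 2*(nm vm*U2)<=2*c*N%:R.
 have := hn2 n n2n; rewrite ler_pdivrMr // => h; apply: (le_trans h).
 by rewrite mulrC ler_wpM2l // ler_nat.
have [In0 hend] := end_asym c0 N0 hE E1 hX hN.
rewrite XN in In0 hend.
have ew: w=z*(I-vm*(r - 1))/(1-r).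
 rewrite r1n /r /vp; have zi: I*z!=0 by rewrite mulf_neq0.
 by field; rewrite z0 i0 Bn.
have w0: w!=0 by rewrite ew; apply: mulf_neq0; [exact: mulf_neq0|rewrite invr_eq0].
split=> //.
have eu: - w^-1=(r - 1)/(z*(I-vm*(r - 1))).
 by rewrite ew invf_div -mulNr opprB.
rewrite -eu in hend.
have ->: - w^-1+K%:R-al%:R*n%:R*(y - 1)/I =
 (- w^-1-X/I)+(al%:R*(n%:R*(y - 1))*(rs n k - 1)+N%:R*(rs n k - 1-I*rc (- K%:R*N%:R^-1)))/I.
 rewrite rcM rcV rcN !rc_nat /X ry; move: NEC; set NN := N%:R => NEC'; rewrite -/NN in NC.
 have ->: al%:R*(n%:R*(y - 1))=NN*(y - 1) by rewrite NEC'; ring.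
 have ->: al%:R*n%:R*(y - 1)/I=NN*(y - 1)/I by rewrite NEC'.
 by move: (rs n k) => q; field; rewrite i0 NC.
have b1: nm (- w^-1-X/I)<=D1*eps n.
 apply: (le_trans hend); rewrite /D1 -[leRHS]mulrA; apply: ler_wpM2l; first by nneg.
 rewrite -[leRHS]mulrA; apply: ler_wpM2l => //; rewrite [leRHS]mulrDl lerD2l.
 by apply: ler_wpM2l => //; nneg.
have b2: nm (al%:R*(n%:R*(y - 1))*(rs n k - 1))<=al%:R*U*(2*c*K%:R+Cc)*eps n.
 rewrite nmM nmM !nm_nat nmM nm_nat -[leRHS]mulrA; apply: ler_pM; rewrite ?nm_ge0 //.
 - by rewrite mulr_ge0 // mulr_ge0 ?nm_ge0.
 - by rewrite ler_wpM2l.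
 - by apply: (le_trans q2); apply: ler_wpM2l => //; nneg.
have b3: nm (N%:R*(rs n k - 1-I*rc (- K%:R*N%:R^-1)))<=Cc*eps n.
 rewrite nmM nm_nat; apply: le_trans (ler_wpM2l (ltW Np) hrs) _.
 have ->: N%:R*(Cc*N%:R^-1^+2)=Cc*N%:R^-1 by field; rewrite gt_eqF.
 exact: ler_wpM2l.
apply: nmD_le; rewrite [leRHS]mulrDl; apply: lerD => //.
rewrite nmf nm_I2c // /D2 [leRHS]mulrAC ler_pM2r ?invr_gt0 // [leRHS]mulrDl.
by apply: nmD_le; apply: lerD.
Qed.

(** With y the quotient of true and reference ratio, u is about K + n (y-1)/I at the entrance and -K
    + al n (y-1)/I at the exit; hence the factor al on W. The drift of y in between yields (1-al) s
    and [Cinf], and its term in ln K turns -al g ln K into -g ln K. [Cinf] precedes all other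
    constants because one value has to serve every orbit and every K. *)
Theorem passage : exists Cinf : Cplx R, forall Q S Cz W0 r0 : R,
 0<=Q -> 0<=S -> 0<=Cz -> 0<=W0 -> 0<r0 ->
 exists Lam K0, [/\ 0<=Lam, (0<K0)%N & forall K, (K0<=K)%N -> forall eta, 0<eta ->
 exists2 n0, (0<n0)%N & forall n s z w W, (n0<=n)%N -> nm s<=S -> nm W<=W0 ->
 zdata a Q Cz s z n -> wdata al c a b30 Q r0 z w n -> w (n+K)%N!=0 ->
 nm (- (w (n+K)%N)^-1-(K%:R-g*rc (ln K%:R)+W))<=1 ->
 [/\ forall k, (n+K<=k)%N -> (k<=al*n-K)%N -> nm (w k)<=Lam/(minn (k-n) (al*n-k))%:R,
 w (al*n-K)%N!=0 &
 nm (- (w (al*n-K)%N)^-1-(- K%:R-g*rc (ln K%:R)+al%:R*W+(1-al%:R)*s+Cinf)) <=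
 al%:R*nm (- (w (n+K)%N)^-1-(K%:R-g*rc (ln K%:R)+W))+Lam * isq K+eta]].
Proof.
have l1 (x y t: R) : t*(2*y*x)<=1 -> x*t*y<=1/2 by lra.
have [Ci [CT hT]] := drift_total g A1 A2 al2 c0 hc.
exists (al%:R*Ci) => Q S Cz W0 r0 Q0 S0 Cz0 W00 r00.
have [Lb [K0 [Lb1 K00 [Cr Cr0 hboot]]]] := bootstrap a b30 al2 c0 hc Q0 S0 Cz0 W00 r00.
have [CZ [k1 [CZ0 k10 hZ]]] := Z_est g S0 Cz0.
have g0 := nm_ge0 g; have v0 := nm_ge0 vm.
have kp0 := kap_gt0 al2 c0.
have ap: 0<(al%:R : R) by rewrite ltr0n ltnW.
have Cm0: 0<=Cm al c by rewrite /Cm; nneg.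
have c2p: 0<2*c by rewrite mulr_gt0.
have Lbp: 0<Lb by lr Lb1.
have Lb0: 0<=Lb by exact: ltW.
pose e1 := Num.min (kap al c/2/Lb) ((2*al%:R*Lb)^-1).
have e10: 0<e1 by rewrite lt_min invr_gt0 !divr_gt0 ?mulr_gt0 //; lra.
have [Ka [Ka0 hKa]] := isq_small e10.
pose LT := al%:R * `|CT|+al%:R*(Cr*8)/(2*c).
have LT0: 0<=LT by rewrite /LT; nneg.
exists (Cm al c+LT), (maxn K0 Ka); split; first by rewrite addr_ge0.
 by rewrite leq_max K00.
move=> K KK eta eta0.
have K0K: (K0<=K)%N by apply: leq_trans KK; rewrite leq_max leqnn.
have K1: (0<K)%N by apply: leq_trans K0K.
have hK1: isq K<=e1 by apply: hKa; apply: leq_trans KK; rewrite leq_max leqnn orbT.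
have Kp: 0<(K%:R : R) by rewrite ltr0n.
have lK := ln_nat_ge0 (R := R) K.
pose U := K%:R+nm g * ln K%:R+W0+1.
have U0: 0<=U by rewrite /U; nneg.
have [nb nb0 hb] := hboot K K0K.
have [Ds [ns [Ds0 ns0 hs]]] := @start_piece S Cz U K S0 Cz0 U0.
pose UE := Lb*Num.sqrt K%:R.
have UE0: 0<=UE by rewrite mulr_ge0 ?sqrtr_ge0.
have [De [ne [De0 ne0 he]]] := @end_piece S Cz UE K S0 Cz0 UE0.
have [DT hDT] := hT K S K1 S0.
pose Dtot := De+al%:R/(2*c)*(Ds+Cr*al%:R)+al%:R * `|DT|.
have Dtot0: 0<=Dtot by rewrite /Dtot; nneg.
have [nf [nf0 hnf]] := @eps_small R (Num.min (eta/(Dtot+1)) (Ds+1)^-1) ltac:(by rewrite lt_min div1_gt0 //= -[_^-1]mul1r div1_gt0).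
exists (maxn (maxn nb ns) (maxn (maxn ne nf) (maxn (2*K) k1))) => [|n s z w W nn sS WW hz hw w0 h1].
 by rewrite !leq_max nb0.
move: (nn); rewrite !geq_max -!andbA => /and5P[nbn nsn nen nfn /andP[Kn k1n]].
have n0: (0<n)%N by apply: leq_trans nbn.
have np: 0<(n%:R : R) by rewrite ltr0n.
have epsn := hnf n nfn; rewrite le_min in epsn; move/andP: epsn => [epsn1 epsn2].
have en0 := eps_ge0 (R := R) n.
have an2: (2*n<=al*n)%N by rewrite leq_mul2r al2 orbT.
have ord1: (n+K<=al*n-K)%N by move: Kn an2; clear; lia.
set u0 := - (w (n+K)%N)^-1 in h1 *.
have nu0: nm u0<=U.
 have ->: u0=(u0-(K%:R-g*rc (ln K%:R)+W))+(K%:R-g*rc (ln K%:R)+W) by ring.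
 apply: nmD_le; rewrite /U addrC; apply: lerD => //.
 apply: nmD_le; apply: lerD => //; apply: nmB_le.
 by rewrite nm_nat nmM nm_rc ger0_norm.
have [B0 hs1] := hs n s _ _ nsn sS (hz (n+K)%N (leq_addr _ _)).1 w0 nu0.
rewrite -/(rk c z w (n+K)) -/(yk c z w n (n+K)) -/u0 in hs1.
set y0 := yk c z w n (n+K) in hs1.
have nI := nm_I2c c0; have i0 := I_neq0 c0.
have hy0: n%:R*nm (y0 - 1)<=(2*c*(4*nm g+W0+1)+1)*Num.sqrt K%:R.
 rewrite -[X in X*_]nm_nat -nmM.
 have sK1 := sqrtn_ge1 (R := R) K1.
 have q1: nm (u0-K%:R)<=(4*nm g+W0+1)*Num.sqrt K%:R.
 have ->: u0-K%:R=(u0-(K%:R-g*rc (ln K%:R)+W))+(W-g*rc (ln K%:R)) by ring.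
 apply: nmD_le; have := nmB W (g*rc (ln K%:R)).
 rewrite nmM nm_rc ger0_norm // => q2; have := ler_wpM2l g0 (ln_le_sqrt (R := R) K1).
 have : 1<=1*Num.sqrt K%:R :> R by rewrite mul1r.
 have : W0<=W0*Num.sqrt K%:R by rewrite ler_peMr.
 lr q2 h1 WW.
 have q2: Ds*eps n<=1.
 exact: mul_le_invD1 epsn2.
 have ->: n%:R*(y0 - 1)=(n%:R*(y0 - 1)-I*(u0-K%:R))+I*(u0-K%:R) by ring.
 apply: nmD_le; rewrite (nmM I) nI [leRHS]mulrDl mul1r addrC; apply: lerD.
 by rewrite -[leRHS]mulrA ler_wpM2l // ltW.
 by apply: (le_trans hs1); apply: (le_trans q2).
have hbk := hb n s z w nbn sS hz hw B0 hy0.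
have [Be ye1 ye2 ye3] := hbk (al*n-K)%N ord1 (leqnn _).
set ye := yk c z w n (al*n-K) in ye1 ye2 ye3.
have jKe: (minn (al*n-K-n) (al*n-(al*n-K))<=K)%N.
 by apply: leq_trans (geq_minr _ _) _; rewrite subKn //; move: Kn an2; clear; lia.
have hUE: n%:R*nm (ye - 1)<=UE.
 have := ye1; rewrite ler_pdivlMr // mulrC => h; apply: (le_trans h).
 by rewrite ler_wpM2l // ler_wsqrtr // ler_nat.
have [we0 he1] := he n s _ _ nen sS (hz _ (leq_trans (leq_addr _ _) ord1)).1 Be hUE.
rewrite -/(rk c z w _) -/(yk c z w n _) -/ye in he1.
split=> //.
 move=> k h2 h3; have [Bk _ hfine _] := hbk k h2 h3.
 have nk: (n<k)%N by move: h2 K1; clear; lia.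
 have kn: (k<al*n)%N by move: h3 K1 ord1; clear; lia.
 have [z1 _] := hz k (ltnW nk).
 have [zn _ _ zle _] := hZ k s (z k) (leq_trans k1n (ltnW nk)) sS z1.
 have zn2: nm (z k)<=2/n%:R.
 by apply: (le_trans zle); rewrite ler_wpM2l // lef_pV2 ?posrE ?ltr0n ?ler_nat ?(ltnW nk) // (leq_trans n0 (ltnW nk)).
 have [x1 x2] := kn_range (R := R) n0 nk kn.
 have lb := rho_lb al2 c0 hc (ltW x1) (ltW x2).
 rewrite dd_nat ?(ltnW nk) ?(ltnW kn) // mulrA in lb.
 have th0: 0<=Lb * isq K by rewrite mulr_ge0 ?isq_ge0.
 have th1: Lb * isq K<=kap al c/2.
 have := le_trans hK1 (_ : e1<=kap al c/2/Lb); rewrite ge_min lexx => /(_ isT).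
 by rewrite ler_pdivlMr // mulrC.
 have th2: Lb * isq K*al%:R<=1/2.
 have := le_trans hK1 (_ : e1<=(2*al%:R*Lb)^-1); rewrite !ge_min lexx orbT => /(_ isT).
 rewrite -[_^-1]mul1r ler_pdivlMr ?mulr_gt0 // => h; exact: (l1 _ _ _ h).
 have rsn := rho_neq0 c (k%:R/n%:R).
 have hr: nm (rk c z w k-rs n k)<=Lb * isq K*(minn (k-n) (al*n-k))%:R/n%:R.
 have ->: rk c z w k-rs n k=(yk c z w n k - 1)*rs n k by rewrite /yk mulrBl divfK // mul1r.
 by rewrite nmM nm_rho mulr1.
 have [_ _ _ _ [_ _ mj]] := geom_est al2 c0 n0 nk kn zn zn2 (nm_rho _ _) lb th1 th2 th0 Bk hr.
 have wm: nm (w k)<=nm (z k)+nm (w k) by rewrite lerDr nm_ge0.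
 apply: (le_trans wm); apply: (le_trans mj); rewrite ler_wpM2r ?invr_ge0 //.
 by rewrite lerDl.
have hDn := hDT n s Kn n0 sS.
set Sg := \sum_(n+K<=i<al*n-K) _ in ye3 hDn.
set ue := - (w (al*n-K)%N)^-1 in he1 *.
set Tg := _+Ci in hDn.
have acn: (al%:R : Cplx R)!=0 by rewrite -nm_gt0 nm_nat.
have eTg: al%:R*Tg=(1-al%:R)*s+(al%:R - 1)*g*rc (ln K%:R)+al%:R*Ci.
 by rewrite /Tg rcB rcV rc1 rc_nat; field; exact: acn.
have ->: ue-(- K%:R-g*rc (ln K%:R)+al%:R*W+(1-al%:R)*s+al%:R*Ci) =
 (ue+K%:R-al%:R*n%:R*(ye - 1)/I)+al%:R/I*(n%:R*(ye-y0-I*Sg))+al%:R/I*(n%:R*(y0 - 1)-I*(u0-K%:R))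
 + al%:R*(n%:R*Sg-Tg)+al%:R*(u0-(K%:R-g*rc (ln K%:R)+W)).
 rewrite [al%:R*(n%:R*Sg-Tg)]mulrBr eTg.
 by field.
have f1: nm (al%:R/I*(n%:R*(ye-y0-I*Sg)))<=al%:R/(2*c)*(Cr*(8 * isq K+al%:R*eps n)).
 by rewrite nmM nmf nm_nat nI nmM nm_nat ler_wpM2l // divr_ge0 // ltW.
have f2: nm (al%:R/I*(n%:R*(y0 - 1)-I*(u0-K%:R)))<=al%:R/(2*c)*(Ds*eps n).
 by rewrite nmM nmf nm_nat nI ler_wpM2l // divr_ge0 // ltW.
have f3: nm (al%:R*(n%:R*Sg-Tg))<=al%:R*(`|CT| * isq K + `|DT|*eps n).
 rewrite nmM nm_nat ler_wpM2l // ?(ltW ap) //; apply: (le_trans hDn).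
 by apply: lerD; rewrite ler_wpM2r ?isq_ge0 // ler_norm.
have f4: nm (al%:R*(u0-(K%:R-g*rc (ln K%:R)+W)))<=al%:R*nm (u0-(K%:R-g*rc (ln K%:R)+W)).
 by rewrite nmM nm_nat.
have Deps: Dtot*eps n<=eta.
 by apply: mul_le_div1 epsn1.
have tri (p1 p2 p3 p4 p5: Cplx R) (q1 q2 q3 q4 q5 : R) : nm p1<=q1 -> nm p2<=q2 -> nm p3<=q3 -> nm p4<=q4 -> nm p5<=q5 ->
 nm (p1+p2+p3+p4+p5)<=q1+q2+q3+q4+q5.
 move=> j1 j2 j3 j4 j5; apply: nmD_le; apply: lerD => //.
 apply: nmD_le; apply: lerD => //; apply: nmD_le; apply: lerD => //.
 by apply: nmD_le; apply: lerD.
apply: le_trans (tri _ _ _ _ _ _ _ _ _ _ he1 f1 f2 f3 f4) _.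
have CmK: 0<=Cm al c * isq K by rewrite mulr_ge0 ?isq_ge0.
via (al%:R*nm (u0-(K%:R-g*rc (ln K%:R)+W))+LT * isq K+Dtot*eps n).
 by apply: eq_ler; rewrite /LT /Dtot; ring.
by apply: lerD => //; rewrite lerD2l [leRHS]mulrDl lerDr.
Qed.

End PassageMain.

(** * Connections and the return map *)

Section FatouOnBasin.
Context {R : realType}.
Implicit Types (u v w x y : Cplx R).
Variables (q : {poly Cplx R}) (w0 mu a : Cplx R) (d : pdata q w0 mu a).
Local Notation Rd := (pd_R d).
Local Notation F := (pF d).
Local Notation uc := (uc w0 mu).
Local Notation wc := (wc w0 mu).
Local Notation g := (a - 1).

Lemma Phi_shift u k : Rd<=re u -> pd_Phi d (iter k F u) = pd_Phi d u+k%:R.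
Proof.
move=> hu; have [_ _ _ h4] := pd_attr d; elim: k => [|k IH]; first by rewrite addr0.
by rewrite iterS h4 ?IH -?addrA ?natr1 //; exact: (iter_pF_Rd k hu).
Qed.

Definition btime w := xget 0%N [set k | Rd<=re (uc (iter k (horner q) w))].
(** The functional equation extends [pd_Phi] to the basin; by [phiE] every entry time gives the same
    value, so the choice in [btime] does not matter. *)
Definition phi w := pd_Phi d (uc (iter (btime w) (horner q) w))-(btime w)%:R.

Lemma phiE w k : Rd<=re (uc (iter k (horner q) w)) ->
 phi w = pd_Phi d (uc (iter k (horner q) w))-k%:R.
Proof.
have key j i: Rd<=re (uc (iter i (horner q) w)) ->
 pd_Phi d (uc (iter (j+i) (horner q) w)) = pd_Phi d (uc (iter i (horner q) w))+j%:R.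
 by move=> h; rewrite (uc_iter_add j h) Phi_shift.
move=> h; rewrite /phi; have hb: Rd<=re (uc (iter (btime w) (horner q) w)).
 by rewrite /btime; case: xgetP => [j _ //|/(_ k)].
move: (btime w) hb => b hb; have e1 := key k b hb; have := key b k h.
rewrite addnC e1; move: (pd_Phi d _) (pd_Phi d _) => A B e2.
by have ->: B=A+b%:R-k%:R; [rewrite -e2 addrK|ring].
Qed.

Lemma phi_iter w k : basin d w -> phi (iter k (horner q) w) = phi w+k%:R.
Proof.
move=> [j hj]; have hjk: Rd<=re (uc (iter j (horner q) (iter k (horner q) w))).
 by rewrite -iterD addnC (uc_iter_add (d := d) _ hj); exact: iter_pF_Rd.
by rewrite (phiE hjk) (phiE hj) -iterD addnC (uc_iter_add (d := d) _ hj) Phi_shift //; ring.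
Qed.

Lemma uc_sub_nm x y : x != w0 -> y != w0 -> nm (uc x-uc y)=nm mu*nm (x-y)*(nm (uc x)*nm (uc y)).
Proof.
move=> x0 y0; rewrite -!nmM; congr nm; have h1: x-w0!=0 by rewrite subr_eq0.
have h2: y-w0!=0 by rewrite subr_eq0.
by rewrite /uc; field; rewrite h1 h2 (pd_mu d).
Qed.

Lemma basin_time w T : basin d w -> exists2 k, (0<k)%N & T<=re (uc (iter k (horner q) w)).
Proof.
move=> [k hk]; have [j hj] := ex_natge (2*T).
exists (j.+1+k)%N => //; rewrite (uc_iter_add (d := d) _ hk); have := iter_pF_re j.+1 hk.
have := Rd_gt0 d; have : (j%:R : R)<=j.+1%:R by rewrite ler_nat.
lra.
Qed.

Lemma basin_chart w T : basin d w -> Rd<=T -> exists r k B, [/\ 0<r, (0<k)%N, 0<=B &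
 forall x, nm (x-w)<=r -> T<=re (uc (iter k (horner q) x)) /\ nm (uc (iter k (horner q) x))<=B].
Proof.
move=> bw RT; have R0 := Rd_gt0 d; have m0 := nmmu d.
have [k k0 hk] := basin_time (T+1) bw.
set y := iter k (horner q) w in hk; set U := nm (uc y).
have U0: 0<U by have := re_le (uc y); rewrite -/U; lra.
have [M M0 hM] := poly_lip (iterp q k) (nm w+1).
pose A := 2*nm mu*U; pose E := 2*nm mu*U^+2.
have A0: 0<A by rewrite /A !mulr_gt0.
have E0: 0<E by rewrite /E !mulr_gt0 // exprn_gt0.
pose r := Num.min 1 ((M+1)^-1*Num.min A^-1 E^-1).
have M1: 0<M+1 by lra.
have r0: 0<r by rewrite lt_min ltr01 mulr_gt0 // ?invr_gt0 // lt_min !invr_gt0 A0.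
exists r, k, (U+1); split=> //; first by lr U0.
move=> x hx; have hx1: nm (x-w)<=1 by apply: (le_trans hx); rewrite ge_min lexx.
have b1: nm x<=nm w+1 by have := nmD (x-w) w; rewrite subrK; lr hx1.
have b2: nm w<=nm w+1 by lr.
have := hM _ _ b1 b2; rewrite !iterpE -/y => h1.
have h2: nm (iter k (horner q) x-y)<=Num.min A^-1 E^-1.
 apply: (le_trans h1); via ((M+1)*nm (x-w)).
 by rewrite ler_wpM2r ?nm_ge0 //; lr.
 by rewrite mulrC -ler_pdivlMr // mulrC; apply: (le_trans hx); rewrite ge_min lexx orbT.
move: h2; rewrite le_min => /andP[h2 h3].
have [xn h4] := uc_near d (erefl U) U0 h2.
have h5: nm (uc (iter k (horner q) x)-uc y)<=1.
 by apply: (le_trans h4); rewrite mulrC -ler_pdivlMr // mul1r.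
split.
 have := re_geN (uc (iter k (horner q) x)-uc y); rewrite reB; lr h5 hk.
by have := nmD (uc (iter k (horner q) x)-uc y) (uc y); rewrite subrK -/U; lr h5.
Qed.

Lemma re_gt0_neq x : 0<re (uc x) -> x != w0.
Proof. by move=> h; apply: (uc_neq0 (mu := mu)); have := re_le (uc x); lra. Qed.

Lemma Phi_lip u v : Rd<=re u -> Rd<=re v -> nm (pd_Phi d u-pd_Phi d v)<=(1+pd_D d)*nm (u-v).
Proof.
move=> hu hv; have R10 := pd_R1 d; have D0 := pd_D0 d.
have [_ _ h3 _] := pd_attr d; have h := h3 Rd u v (lexx _) hu hv.
have := nmD (pd_Phi d u-pd_Phi d v-(u-v)) (u-v); rewrite subrK.
have : pd_D d/Rd*nm (u-v)<=pd_D d*nm (u-v).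
 by rewrite ler_wpM2r ?nm_ge0 // ler_pdivrMr; nra.
lra.
Qed.

(** The asymptotics u = K - g ln K + phi x after K steps, with constants uniform on a disc. At a
    fixed time K they are matched with the entrance condition of [passage]. *)
Lemma basin_coord w : basin d w -> exists r L D K0, [/\ 0<r, 0<=L, 0<=D, (0<K0)%N &
 forall x, nm (x-w)<=r -> [/\ basin d x, nm (phi x)<=L,
 forall y, nm (y-w)<=r -> nm (phi x-phi y)<=L*nm (x-y) &
 forall K, (K0<=K)%N -> nm (uc (iter K (horner q) x)-(K%:R-g*rc (ln K%:R)+phi x))<=D * isq K]].
Proof.
move=> bw; have R0 := Rd_gt0 d; have m0 := nmmu d; have R10 := pd_R1 d; have D0 := pd_D0 d.
have [r [k [B [r0 k0 B0 hB]]]] := basin_chart bw (lexx _).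
have [M M0 hM] := poly_lip (iterp q k) (nm w+r).
have hb x: nm (x-w)<=r -> nm x<=nm w+r.
 by move=> h; have := nmD (x-w) w; rewrite subrK; lra.
pose L1 := (1+pd_D d)*(nm mu*M*(B*B)).
have L10: 0<=L1 by rewrite /L1 !mulr_ge0 ?nm_ge0 //; lra.
pose P0 := nm (phi w)+L1*r.
have lip x y: nm (x-w)<=r -> nm (y-w)<=r -> nm (phi x-phi y)<=L1*nm (x-y).
 move=> hx hy; have [x1 x2] := hB x hx; have [y1 y2] := hB y hy.
 rewrite (phiE x1) (phiE y1); set X := uc _ in x1 x2 *; set Y := uc _ in y1 y2 *.
 have ->: pd_Phi d X-k%:R-(pd_Phi d Y-k%:R) = pd_Phi d X-pd_Phi d Y by ring.
 apply: (le_trans (Phi_lip x1 y1)); rewrite /L1 -[leRHS]mulrA ler_wpM2l //; first by lr D0.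
 rewrite /X /Y uc_sub_nm; [|apply: re_gt0_neq; lr x1 R0|apply: re_gt0_neq; lr y1 R0].
 have := hM x y (hb x hx) (hb y hy); rewrite !iterpE => h.
 have ->: nm mu*M*(B*B)*nm (x-y)=nm mu*(M*nm (x-y))*(B*B) by ring.
 apply: ler_pM; rewrite ?mulr_ge0 ?nm_ge0 //; first by rewrite ler_wpM2l // ltW.
 by apply: ler_pM; rewrite ?nm_ge0.
pose Dk := pd_D d*(1+B)*2+2*k%:R*nm g.
have Dk0: 0<=Dk by rewrite addr_ge0 // !mulr_ge0 ?nm_ge0 //; lr B0.
exists r, (L1+P0), Dk, (2*k)%N; split=> //.
- by rewrite addr_ge0 // addr_ge0 ?nm_ge0 // mulr_ge0 // ltW.
- by rewrite muln_gt0.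
move=> x hx; have [x1 x2] := hB x hx; split.
- by exists k.
- have := nmD (phi x-phi w) (phi w); rewrite subrK => h; apply: (le_trans h).
 have := lip x w hx ltac:(by rewrite subrr nm0 ltW) => h2.
 have : L1*nm (x-w)<=L1*r by rewrite ler_wpM2l.
 by rewrite /P0; lr h2 L10.
- move=> y hy; apply: (le_trans (lip x y hx hy)); rewrite ler_wpM2r ?nm_ge0 // lerDl.
 by rewrite addr_ge0 ?nm_ge0 // mulr_ge0 // ltW.
move=> K kK; have kK1: (k<K)%N by move: k0 kK; clear; lia.
have K0: (0<K)%N by move: k0 kK; clear; lia.
have Kk0: (0<K-k)%N by rewrite subn_gt0.
rewrite (phiE x1) -{1}(subnK (ltnW kK1)) (uc_iter_add (d := d) _ x1).
set u := uc _ in x1 x2 *; have [_ h2 _ _] := pd_attr d.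
have := h2 u (K-k)%N x1 Kk0; rewrite -/F => h.
have ->: iter (K-k) F u-(K%:R-g*rc (ln K%:R)+(pd_Phi d u-k%:R)) =
 (iter (K-k) F u-(K-k)%:R+g*rc (ln (K-k)%:R)-pd_Phi d u)-g*rc (ln (K-k)%:R-ln K%:R).
 by rewrite natrB ?(ltnW kK1) // rcB; ring.
apply: nmB_le; rewrite /Dk [leRHS]mulrDl; apply: lerD.
 apply: (le_trans h); rewrite -[leRHS]mulrA -/(isq K); apply: ler_pM.
 - by rewrite mulr_ge0 // addr_ge0 ?nm_ge0.
 - exact: isq_ge0.
 - by rewrite ler_wpM2l // lerD2l.
 - have i1: 0<isq (K-k) :> R := isq_gt0 Kk0.
 have i2: 0<isq K :> R := isq_gt0 K0.
 rewrite -(@ler_pXn2r _ 2) ?nnegrE ?mulr_ge0 ?isq_ge0 // exprMn !expr2 !isq_sq //.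
 rewrite ler_pdivlMr ?ltr0n // mulrC ler_pdivrMr ?ltr0n //.
 by rewrite -!natrM ler_nat; move: kK; clear; lia.
rewrite nmM nm_rc mulrC [leRHS]mulrAC; apply: ler_wpM2r; first exact: nm_ge0.
apply: le_trans (ln_sub_est kK K0) _; rewrite -mulrA -[leRHS]mulrA ler_wpM2l // ler_wpM2l //.
exact: invn_le_isq.
Qed.

(** A critical point of q is critical for all its positive iterates, and [phi] factors through one
    of them. This is the source of the super-attraction of the return map. *)
Lemma phi_crit c : basin d c -> q^`().[c] = 0 -> exists r L, [/\ 0<r, 0<=L &
 forall x, nm (x-c)<=r -> nm (phi x-phi c)<=L*nm (x-c)^+2].
Proof.
move=> bc qc; have R0 := Rd_gt0 d; have m0 := nmmu d; have D0 := pd_D0 d.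
have [r [k [B [r0 k0 B0 hB]]]] := basin_chart bc (lexx _).
have [h hh]: exists h : {poly Cplx R}, forall x, (iterp q k).[x]-(iterp q k).[c]=(x-c)^+2*h.[x].
 have : root (iterp q k-(iterp q k).[c]%:P) c by rewrite rootE !hornerE subrr.
 move/factor_theorem => [s es].
 have : root s c.
 have : (iterp q k-(iterp q k).[c]%:P)^`().[c] = 0.
 rewrite derivB derivC subr0 deriv_iterp; case: k k0 {hB es} => // k _.
 by rewrite big_ord_recl /= qc mul0r.
 by rewrite es derivM derivXsubC mulr1 !hornerE subrr mulr0 add0r rootE => ->.
 move/factor_theorem => [t et]; exists t => x.
 have := congr1 (horner^~ x) es; rewrite et !hornerE => ->; ring.
have [M M0 hM] := poly_bounded h (nm c+r).
exists r, ((1+pd_D d)*(nm mu*M*(B*B))); split=> //.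
 by rewrite !mulr_ge0 ?nm_ge0 //; lra.
move=> x hx; have [x1 x2] := hB x hx; have [y1 y2] := hB c ltac:(by rewrite subrr nm0 ltW).
rewrite (phiE x1) (phiE y1); set X := uc _ in x1 x2 *; set Y := uc _ in y1 y2 *.
have ->: pd_Phi d X-k%:R-(pd_Phi d Y-k%:R) = pd_Phi d X-pd_Phi d Y by ring.
apply: (le_trans (Phi_lip x1 y1)); rewrite -[leRHS]mulrA ler_wpM2l //; first by lr D0.
rewrite /X /Y uc_sub_nm; [|apply: re_gt0_neq; lr x1 R0|apply: re_gt0_neq; lr y1 R0].
have ->: nm mu*M*(B*B)*nm (x-c)^+2=nm mu*(nm (x-c)^+2*M)*(B*B) by ring.
apply: ler_pM; rewrite ?mulr_ge0 ?nm_ge0 //; last by apply: ler_pM; rewrite ?nm_ge0.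
rewrite ler_wpM2l ?(ltW m0) //; have := hh x; rewrite !iterpE => ->.
rewrite nmM nmX ler_wpM2l ?exprn_ge0 ?nm_ge0 // hM //.
by have := nmD (x-c) c; rewrite subrK; lr hx.
Qed.

Definition Td := Rd+8 * pd_M d+2.

(** The forward orbit retraces a backward orbit. A step stretches distances by at most 1 + M/t^2,
    where t grows linearly along the backward orbit, and the product of these factors is bounded;
    [Bi] is a telescoping majorant of it with values between 1 and 2. *)
Lemma rep_forward v K x E : Td<=re v -> 0<=E -> E<=1 -> nm (- uc x-iter K (pd_G d) v)<=E ->
 forall j, (j<=K)%N -> nm (- uc (iter j (horner q) x)-iter (K-j) (pd_G d) v)<=2*E.
Proof.
move=> hv E0 E1 hx; have R0 := Rd_gt0 d; have M0 := pd_M0 d; have M1: 0<=8 * pd_M d by lra.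
have [g1 _ _ _] := pd_rep d; have [_ inf2] := pd_inf d.
have hvR: Rd<=re v by move: hv; rewrite /Td; lra.
have gre i: Rd+8 * pd_M d+2+i%:R/2<=re (iter i (pd_G d) v).
 by have := g1 v hvR i; move: hv; rewrite /Td; lra.
pose T := Rd+8 * pd_M d.
pose Bi (i : nat) := 1+8 * pd_M d/(T+i%:R/2).
have T0: 0<T by rewrite /T; lra.
have ti (i: nat) : T<=T+i%:R/2 by rewrite lerDl divr_ge0.
have Bi1 i: 1<=Bi i by rewrite lerDl divr_ge0 //; have := ti i; lr T0.
have Bi2 i: Bi i<=2.
 have h := ti i; have : 8 * pd_M d/(T+i%:R/2)<=1.
 by rewrite ler_pdivrMr ?mul1r; [move: (h); rewrite /T|]; lr R0 h T0.
 by rewrite /Bi; lr.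
have step i: Bi i.+1*(1+pd_M d/(T+i.+1%:R/2)^+2)<=Bi i.
 have h := ti i; have e: T+i.+1%:R/2=T+i%:R/2+1/2 by rewrite -natr1; lr.
 have := Bi2 i.+1; rewrite /Bi e; move: (T+i%:R/2) h => t h.
 have tp: 0<t by lr h T0.
 have tp': 0<t+1/2 by lr tp.
 have mt: 0<=pd_M d/(t+1/2)^+2 by rewrite divr_ge0 // exprn_ge0 // ltW.
 have e2: 8 * pd_M d/t - 8 * pd_M d/(t+1/2) = 4*(pd_M d/(t*(t+1/2))).
 by field; rewrite !gt_eqF //; lr tp.
 have m2: pd_M d/(t+1/2)^+2<=pd_M d/(t*(t+1/2)).
 rewrite ler_wpM2l // lef_pV2 ?posrE ?exprn_gt0 ?mulr_gt0 // expr2 ler_pM2r //; lr.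
 have m3: 0<=pd_M d/(t*(t+1/2)) by apply: le_trans mt m2.
 move=> b2; set X := 8 * pd_M d/(t+1/2) in b2 e2 *; set Y := 8 * pd_M d/t in e2 *.
 move: (pd_M d/(t+1/2)^+2) mt m2 => y mt m2; move: (pd_M d/(t*_)) e2 m2 m3 => s e2 m2 m3.
 have : (1+X)*y<=2*y by rewrite ler_wpM2r.
 by rewrite mulrDr mulr1; lr m2 e2 mt.
suff key j : (j<=K)%N -> nm (- uc (iter j (horner q) x)-iter (K-j) (pd_G d) v)<=Bi (K-j)%N*E.
 by move=> j jK; apply: (le_trans (key j jK)); rewrite ler_wpM2r.
elim: j => [|j IH] jK; first by rewrite subn0 /=; apply: (le_trans hx); rewrite ler_peMl.
have := IH (ltnW jK); have ->: (K-j=(K-j.+1).+1)%N by move: jK; clear; lia.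
set i := (K-j.+1)%N; set y := iter j (horner q) x; rewrite !iterS -/y.
set G0 := iter i (pd_G d) v => h.
have hG0: Rd<=re G0 by have := gre i; have : 0<=(i%:R : R) by []; rewrite -/G0; lr M0.
have [hF _] := pd_inv hG0; rewrite -/F in hF.
have h1: re (pd_G d G0) >= T+2+i.+1%:R/2 by have := gre i.+1; rewrite iterS -/G0 /T; lr.
have h2: Bi i.+1*E<=2.
 by rewrite -[leRHS]mulr1; apply: ler_pM => //; have := Bi1 i.+1; lr.
have h3: T+i.+1%:R/2<=nm (uc y).
 have := re_geN (- uc y-pd_G d G0); have := re_le (- uc y); rewrite reB nmN; lr h2 h1 h.
have h4: T+i.+1%:R/2<=nm (- pd_G d G0).
 by rewrite nmN; have := re_le (pd_G d G0); lr h1.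
have hR: Rd<=T+i.+1%:R/2 by have := ti i.+1; rewrite /T; lr M0.
have := inf2 _ _ _ hR h3 h4; rewrite -/F hF => h5.
rewrite (uc_q (d := d)); last by apply: le_trans h3.
set Y := nm (uc y - - pd_G d G0) in h5.
have eY: Y=nm (- uc y-pd_G d G0) by rewrite /Y -nmN; congr nm; ring.
have ->: nm (- F (uc y)-G0)=nm (F (uc y) - - G0) by rewrite -nmN; congr nm; ring.
have : nm (F (uc y) - - G0)<=Y*(1+pd_M d/(T+i.+1%:R/2)^+2).
 have := nmD (F (uc y) - - G0-(uc y - - pd_G d G0)) (uc y - - pd_G d G0).
 rewrite subrK -/Y => h6; apply: (le_trans h6); rewrite mulrDr mulr1 addrC lerD2l.
 by apply: (le_trans h5); rewrite mulrA [Y*_]mulrC.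
move=> h6; apply: (le_trans h6); rewrite eY.
have p1: 0<=1+pd_M d/(T+i.+1%:R/2)^+2 by rewrite addr_ge0 // divr_ge0 // exprn_ge0 //; lr hR R0.
apply: le_trans (ler_wpM2r p1 h) _; rewrite mulrAC ler_wpM2r //.
Qed.

Lemma rep_asym v K : Rd<=re v -> (0<K)%N ->
 nm (- iter K (pd_G d) v-(- K%:R-g*rc (ln K%:R)-pd_Chi d v))<=pd_D d*(1+nm v) * isq K.
Proof.
move=> hv K0; have [_ h _ _] := pd_rep d; have := h v K hv K0; rewrite -nmN => h2.
by apply: le_trans h2; apply: eq_ler; congr nm; ring.
Qed.

Lemma rep_land v K x E : Td<=re v -> 0<=E -> E<=1 -> nm (- uc x-iter K (pd_G d) v)<=E ->
 nm (iter K (horner q) x-wc (- v))<=2/nm mu*E /\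
 forall j, (j<=K)%N -> nm (iter j (horner q) x-w0)<=(nm mu)^-1.
Proof.
move=> hv E0 E1 hx; have h := rep_forward hv E0 E1 hx; have R0 := Rd_gt0 d; have R10 := pd_R1 d.
have M0 := pd_M0 d; have m0 := nmmu d; have mm := pd_mu d.
have hvR: Rd+2<=re v by move: hv; rewrite /Td; lra.
have [g1 _ _ _] := pd_rep d.
have low j: (j<=K)%N -> 1<=nm (uc (iter j (horner q) x)).
 move=> jK; have := h j jK; have := g1 v ltac:(lra) (K-j)%N.
 have : 0<=((K-j)%:R : R) by [].
 have := re_geN (- uc (iter j (horner q) x)-iter (K-j) (pd_G d) v).
 have := re_le (- uc (iter j (horner q) x)); rewrite reB nmN; lr hvR R10 E1.
split; last first.
 move=> j jK; have := low j jK; rewrite nm_uc => l.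
 have xn: 0<nm mu*nm (iter j (horner q) x-w0) by rewrite -invr_gt0; lr l.
 rewrite -[leRHS]mul1r ler_pdivlMr // mulrC -[leLHS]invrK -[leRHS]invr1 lef_pV2 ?posrE //.
 by rewrite invr_gt0.
have := h K (leqnn K); rewrite subnn /= => h1; have lK := low K (leqnn K).
set y := iter K (horner q) x in h1 lK *.
have yn: y != w0 by apply: (uc_neq0 (mu := mu)); lr lK.
have uy0: uc y!=0 by rewrite -nm_gt0; lr lK.
have v0: - v!=0 by rewrite oppr_eq0 -nm_gt0; have := re_le v; lr hvR R0.
rewrite -{1}(ucK d yn) (wc_sub d uy0 v0) nmf !nmM nmN.
have e1: nm (uc y - - v)=nm (- uc y-v) by rewrite -nmN; congr nm; ring.
rewrite e1; have nv1: 1<=nm v by have := re_le v; lr hvR R0.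
have p0: 0<nm (uc y)*nm v by rewrite mulr_gt0 //; lr lK nv1.
have p1: 1<=nm (uc y)*nm v by rewrite -[leLHS]mul1r ler_pM.
rewrite ler_pdivrMr ?(mulr_gt0 m0 p0) //; apply: (le_trans h1).
have ->: 2/nm mu*E*(nm mu*(nm (uc y)*nm v)) = 2*E*(nm (uc y)*nm v) by field; rewrite gt_eqF.
by rewrite ler_peMr // mulr_ge0.
Qed.

End FatouOnBasin.

(** One number dominates eight constants and 1, so that a single condition on n meets all smallness
    requirements of [passage_near]. *)
Lemma sum8_ge (R : realType) (x1 x2 x3 x4 x5 x6 x7 x8 : R) : 0<=x1 -> 0<=x2 -> 0<=x3 -> 0<=x4 ->
 0<=x5 -> 0<=x6 -> 0<=x7 -> 0<=x8 -> let S := x1+x2+x3+x4+x5+x6+x7+x8+1 in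
 [/\ x1<=S, x2<=S, x3<=S & x4<=S] /\ [/\ x5<=S, x6<=S, x7<=S, x8<=S & 1<=S].
Proof. by move=> ? ? ? ? ? ? ? ? S; rewrite /S; split; split; lra. Qed.

(** * The passage for orbits of the skew product *)

Section PassageOrig.
Context {R : realType}.
Implicit Types (u v w x y : Cplx R).

(* A parabolic point [(0, w0)] of the skew product [(z, w) |-> (p z, f z w)] together
 with its normalizing chart [w |-> psi z w]; [al] is the time-dilation factor. *)
Record transit (p : Cplx R -> Cplx R) (f : Cplx R -> Cplx R -> Cplx R) (q : {poly Cplx R})
 (w0 a : Cplx R) (al : nat) := Transit {
 t_mu : Cplx R; t_b30 : Cplx R; t_c : R; t_psi : Cplx R -> Cplx R -> Cplx R;
 t_Q : R; t_r : R; t_C : R;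
 t_d : pdata q w0 t_mu a;
 t_al : (2<=al)%N;
 t_c0 : 0<t_c;
 t_hc : t_c * ln al%:R = pi;
 t_Q0 : 0<=t_Q;
 t_r0 : 0<t_r;
 t_C0 : 0<=t_C;
 t_f : forall B : R, exists2 M, 0<=M & forall z w w', nm z<=1 -> nm w<=B -> nm w'<=B ->
 nm (f z w-q.[w'])<=M*(nm z+nm (w-w'));
 t_psi1 : forall B : R, exists2 M, 0<=M & forall z w, nm z<=1 -> nm w<=B ->
 nm (t_psi z w-t_mu*(w-w0))<=M*nm z;
 t_psi2 : forall z w, nm z<=t_r -> nm (w-w0)<=t_C*(nm z+nm (t_psi z w));
 t_est : forall z w, nm z<=t_r -> nm (t_psi z w)<=t_r ->
 let o := t_psi z w in
 nm (t_psi (p z) (f z w)-(o+o^+2+rc (bq t_c)*z^+2+a * o^+3+t_b30*z^+3))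
 <= t_Q*(nm z+nm o)^+4 }.

Variables (p : Cplx R -> Cplx R) (f : Cplx R -> Cplx R -> Cplx R) (q : {poly Cplx R}).
Variables (w0 a : Cplx R) (al : nat) (T : transit p f q w0 a al).
Local Notation d := (t_d T).
Local Notation mu := (t_mu T).
Local Notation psi := (t_psi T).
Local Notation c := (t_c T).
Local Notation g := (a - 1).
Local Notation uc := (uc w0 mu).
Local Notation wc := (wc w0 mu).

(** The fibre map differs from q by O(z), so for a fixed number K of steps the orbit follows that of
    q, the error being multiplied by a constant at each step. *)
Lemma shadow B K : exists2 M, 1<=M & forall (z w : nat -> Cplx R) x e n, 0<=e -> M*e<=1 ->
 (forall j, (j<K)%N -> nm (z (n+j)%N)<=e) ->
 (forall j, (j<K)%N -> w (n+j).+1=f (z (n+j)%N) (w (n+j)%N)) -> nm (w n-x)<=e ->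
 (forall j, (j<=K)%N -> nm (iter j (horner q) x)+1<=B) ->
 forall j, (j<=K)%N -> nm (w (n+j)%N-iter j (horner q) x)<=M*e.
Proof.
have [M0 M00 hM] := t_f T B; pose M := 2*(M0+1).
have M1: 1<=M by rewrite /M; lra.
exists (M^+K) => [|z w x e n e0 Me hz hw hx hB]; first exact: exprn_ege1.
have hp j: (j<=K)%N -> M^+j*e<=M^+K*e by move=> jK; rewrite ler_wpM2r // ler_weXn2l.
have e1: e<=1 by have := hp 0%N isT; rewrite expr0 mul1r; lra.
suff key j : (j<=K)%N -> nm (w (n+j)%N-iter j (horner q) x)<=M^+j*e.
 by move=> j jK; apply: (le_trans (key j jK)); exact: hp.
elim: j => [|j IH] jK; first by rewrite addn0 expr0 mul1r.
have h := IH (ltnW jK); rewrite addnS hw // iterS.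
have b1 := hB j (ltnW jK).
have b2: nm (iter j (horner q) x)<=B by lra.
have b3: nm (w (n+j)%N)<=B.
 have := nmD (w (n+j)%N-iter j (horner q) x) (iter j (horner q) x); rewrite subrK.
 have := hp j (ltnW jK); lr b1 h Me.
have z1 := hz j jK.
have := hM _ _ _ (le_trans z1 e1) b3 b2 => h2; apply: (le_trans h2).
have p1: 1<=M^+j by exact: exprn_ege1.
have p2: e<=M^+j*e by rewrite ler_peMl.
have p3: M0*(nm (z (n+j)%N)+nm (w (n+j)%N-iter j (horner q) x))<=M0*(2*(M^+j*e)).
 by rewrite ler_wpM2l //; lr p2 z1 h.
apply: (le_trans p3); rewrite exprS -[leRHS]mulrA [leLHS]mulrA ler_wpM2r //; [lr p2 e0|rewrite /M; lr].
Qed.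

Lemma orbit_bounded K (B : R) : exists B', forall x j, nm x<=B -> (j<=K)%N -> nm (iter j (horner q) x)<=B'.
Proof.
elim: K => [|K [B1 IH]]; first by exists B => x [|j].
have [M M0 hM] := poly_bounded (iterp q K.+1) B.
exists (Num.max B1 M) => x j hx; rewrite leq_eqVlt => /orP[/eqP->|jK].
 by rewrite -iterpE le_max hM ?orbT.
by rewrite le_max IH.
Qed.

Lemma inv_close (o o' : Cplx R) (U : R) : o'!=0 -> nm o'^-1<=U -> nm (o-o')*U<=1/2 ->
 o!=0 /\ nm (o^-1-o'^-1)<=2*U^+2*nm (o-o').
Proof.
move=> o0 hU h; have i0: 0<nm o'^-1 by rewrite nm_gt0 invr_eq0.
have U0: 0<U by lra.
have n0: 0<nm o' by rewrite nm_gt0.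
have h1: U^-1<=nm o' by rewrite -[nm o']invrK lef_pV2 ?posrE ?invr_gt0 // -nmV.
have h2: nm (o-o')<=U^-1/2 by rewrite -ler_pdivlMr // in h; apply: (le_trans h); rewrite div1r mulrC.
have h3: U^-1/2<=nm o.
 by have := nmD_ge o' (o-o'); have ->: o'+(o-o') = o by [ring]; lra.
have Ui: 0<U^-1 by rewrite invr_gt0.
have on: o!=0 by rewrite -nm_gt0; lra.
split=> //; have ->: o^-1-o'^-1 = - (o-o')*(o^-1 * o'^-1) by field; rewrite on o0.
rewrite nmM nmN mulrC nmM; apply: ler_wpM2r; first exact: nm_ge0.
have ->: 2*U^+2=(2*U)*U by ring.
apply: ler_pM; rewrite ?nm_ge0 // nmV.
have ->: 2*U=(U^-1/2)^-1 by field; rewrite gt_eqF.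
by rewrite lef_pV2 ?posrE ?divr_gt0 //; lra.
Qed.

Lemma zdataW Q Q' Cz s (z : nat -> Cplx R) n : Q<=Q' -> zdata a Q Cz s z n -> zdata a Q' Cz s z n.
Proof.
move=> QQ h k nk; have [h1 h2] := h k nk; split=> //; apply: (le_trans h2).
by rewrite ler_wpM2r // exprn_ge0 // nm_ge0.
Qed.

(** Three stretches are glued: K steps shadowing q into the attracting petal, the passage in the
    normalizing chart, and K steps shadowing q out of the repelling petal. The equation for [pd_Chi]
    says that the exit predicted from w1 and s0 is the point with coordinate -v. The constants r and
    L precede the error [eps], so that the return map can later be made to contract. *)
Theorem passage_near : exists Cinf : Cplx R, forall w1 v s0 Q Cz, basin d w1 -> Td d<=re v ->
 0<=Q -> 0<=Cz -> - pd_Chi d v=al%:R * phi d w1+(1-al%:R)*s0+Cinf ->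
 exists r L : R, [/\ 0<r, 0<=L & forall eps, 0<eps -> exists K n0 B, (0<n0)%N /\
 forall n s (z w : nat -> Cplx R), (n0<=n)%N -> nm (s-s0)<=r -> zdata a Q Cz s z n ->
 (forall k, (n<=k)%N -> z k.+1 = p (z k)) -> (forall k, (n<=k)%N -> w k.+1=f (z k) (w k)) ->
 nm (w n-w1)<=r ->
 [/\ nm (w (al*n)%N-wc (- v))<=L*(nm (phi d (w n)-phi d w1)+nm (s-s0))+eps,
 forall k, (n<=k<=al*n)%N -> nm (w k)<=B &
 forall k, (n+K<=k)%N -> (k+K<=al*n)%N -> nm (w k-w0)<=eps]].
Proof.
have m0 := nmmu d; have mm := pd_mu d; have al2 := t_al T; have c0 := t_c0 T.
have [Ci hp] := passage a (t_b30 T) al2 c0 (t_hc T).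
exists Ci => w1 v s0 Q Cz bw hv Q0 Cz0 hY.
have [rb [Lb [Db [Kb [rb0 Lb0 Db0 Kb0 hb]]]]] := basin_coord bw.
have tr0 := t_r0 T; have tC0 := t_C0 T; have tQ0 := t_Q0 T; have D0 := pd_D0 d; have nv := nm_ge0 v; have g0 := nm_ge0 g.
have ap: 1<=(al%:R : R) by rewrite ler1n ltnW.
pose S := nm s0+1; have S0: 0<=S by rewrite addr_ge0 ?nm_ge0.
pose Q' := Q+t_Q T; have Q'0: 0<=Q' by rewrite addr_ge0.
have [Lam [K0 [Lam0 K00 hpass]]] := hp Q' S Cz Lb (t_r T) Q'0 S0 Cz0 Lb0 tr0.
have [CZ [k1 [CZ0 k10 hZ]]] := Z_est g S0 Cz0.
have Lr0: 0<4*al%:R*(Lb+1) by rewrite !mulr_gt0 // ?(lt_le_trans ltr01) // lerDr.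
pose r := Num.min (Num.min rb 1) (4*al%:R*(Lb+1))^-1.
have r0: 0<r by rewrite !lt_min rb0 ltr01 invr_gt0.
exists r, (2/nm mu*al%:R); split=> // [|eps eps0].
 by rewrite !mulr_ge0 ?invr_ge0 //; lr m0.
pose Ctot := al%:R*Db+Lam+pd_D d*(1+nm v).
have Ctot0: 0<=Ctot by rewrite /Ctot; nneg; lra.
(* e1 bounds the errors that depend on K, and e2 below those that vanish with n once K is fixed. *)
pose e1 := Num.min (1/4) (eps*nm mu/8).
have e10: 0<e1 by rewrite lt_min !divr_gt0 // mulr_gt0.
have [Ka [Ka0 hKa]] := isq_small (div1_gt0 (addr_ge0 Ctot0 Db0) e10).
have [Kc Kc0 hKc] := nat_ge (2*t_C T*Lam/eps).
pose K := maxn (maxn K0 Kb) (maxn Ka Kc).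
have [K0K KbK KaK KcK]: [/\ (K0<=K)%N, (Kb<=K)%N, (Ka<=K)%N & (Kc<=K)%N].
 by rewrite /K !leq_max !leqnn !orbT.
have K1: (0<K)%N by apply: leq_trans K0K.
have Kp: 0<(K%:R : R) by rewrite ltr0n.
have iK: (Ctot+Db) * isq K<=e1 by apply: (mul_le_div1 _ (isq_ge0 _) (hKa K KaK)); rewrite addr_ge0.
have iK0 := isq_ge0 (R := R) K.
have iK1: Ctot * isq K<=e1 by move: iK; rewrite mulrDl; have := mulr_ge0 Db0 iK0; lr.
have iK2: Db * isq K<=e1 by move: iK; rewrite mulrDl; have := mulr_ge0 Ctot0 iK0; lr.
have LK: t_C T*(Lam/K%:R)<=eps/2.
 have := hKc K KcK; rewrite ler_pdivrMr // mulrA ler_pdivrMr //; lr.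
have [B1 hB1] := orbit_bounded K (nm w1+1).
have B10: 0<=B1 by apply: le_trans (nm_ge0 0) (hB1 0 0%N _ isT); rewrite nm0 addr_ge0 ?nm_ge0.
have [M1 M11 hM1] := shadow (B1+1) K.
have [P1 P10 hP1] := t_psi1 T (B1+1).
pose B3 := nm w0+(nm mu)^-1.
have [M3 M31 hM3] := shadow (B3+1) K.
pose B2 := nm w0+t_C T*(1+Lam).
have [P2 P20 hP2] := t_psi1 T B2.
have lK := ln_nat_ge0 (R := R) K.
pose U1 := K%:R+nm g * ln K%:R+Lb+1.
have U10: 0<=U1 by rewrite /U1; nneg.
pose U2 := K%:R+nm g * ln K%:R+al%:R*Lb+(1+al%:R)*S+nm Ci+(al%:R+Lam+1).
have U20: 0<=U2 by rewrite /U2; nneg; rewrite ?nm_ge0; lra.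
have i0: 0<(nm mu)^-1 by rewrite invr_gt0.
pose e2 := Num.min (Num.min (1/8) (e1/(8*al%:R))) (eps/4).
have e20: 0<e2 by rewrite !lt_min !divr_gt0 // mulr_gt0 // (lt_le_trans ltr01).
pose V1 := P1+nm mu*M1.
have V10: 0<=V1 by rewrite addr_ge0 // mulr_ge0 ?nm_ge0 // (le_trans ler01).
pose Sg := M1+M3+V1*U1+2*U1^+2*V1+P2*U2+2*U2^+2*P2+t_C T+(t_r T)^-1+1.
have ti0: 0<(t_r T)^-1 by rewrite invr_gt0.
have q1: 0<=V1*U1 by rewrite mulr_ge0.
have q2: 0<=2*U1^+2*V1 by rewrite mulr_ge0 // mulr_ge0 // exprn_ge0.
have q3: 0<=P2*U2 by rewrite mulr_ge0.
have q4: 0<=2*U2^+2*P2 by rewrite mulr_ge0 // mulr_ge0 // exprn_ge0.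
have M10: 0<=M1 := le_trans ler01 M11.
have M30: 0<=M3 := le_trans ler01 M31.
have [[s1 s2 s3 s4] [s5 s6 s7 s8 s9]] := sum8_ge M10 M30 q1 q2 q3 q4 tC0 (ltW ti0).
rewrite -/Sg in s1 s2 s3 s4 s5 s6 s7 s8 s9.
have e2a: e2<=1/8 by rewrite !ge_min lexx.
have e2b: e2<=e1/(8*al%:R) by rewrite !ge_min lexx orbT.
have e2c: e2<=eps/4 by rewrite !ge_min lexx orbT.
have e1a: e1<=1/4 by rewrite ge_min lexx.
have e1b: e1<=eps*nm mu/8 by rewrite ge_min lexx orbT.
have e2le: e2<=1 by lr e2a.
have ae2: al%:R*e2<=e1/8.
 by move: e2b; rewrite ler_pdivlMr ?mulr_gt0 ?(lt_le_trans ltr01) //; lr.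
have r1: r<=1 by rewrite !ge_min lexx orbT.
have rrb: r<=rb by rewrite !ge_min lexx.
have rL: 4*al%:R*(Lb+1)*r<=1.
 by rewrite mulrC -ler_pdivlMr // div1r ge_min lexx orbT.
have [n1 n10 hn1] := nat_ge (2*Sg/e2).
have [n2 n20 hpass2] := hpass K K0K e2 e20.
have B30: 0<=B3 by rewrite addr_ge0 ?nm_ge0 // ltW.
have B20: 0<=B2 by rewrite addr_ge0 ?nm_ge0 // mulr_ge0 // addr_ge0.
exists K, (maxn (maxn n1 n2) (maxn k1 (2*K))), (B1+1+B2+(B3+1)); split; first by rewrite !leq_max n10.
move=> n s z w nn hs hz hzp hwf hw.
have [n1n n2n k1n Kn]: [/\ (n1<=n)%N, (n2<=n)%N, (k1<=n)%N & (2*K<=n)%N].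
 by move: nn; rewrite !geq_max => /andP[/andP[-> ->] /andP[-> ->]].
have n0: (0<n)%N by apply: leq_trans n1n.
have np: 0<(n%:R : R) by rewrite ltr0n.
pose t : R := 2/n%:R; have t0: 0<t by rewrite divr_gt0.
have St: Sg*t<=e2.
 have := hn1 n n1n; by rewrite ler_pdivrMr // /t mulrA ler_pdivrMr // [_*e2]mulrC [_*2]mulrC.
have part (x: R) : 0<=x -> x<=Sg -> x*t<=e2.
 by move=> x0 xS; apply: le_trans St; rewrite ler_wpM2r // ltW.
have M1t := part _ M10 s1.
have M3t := part _ M30 s2.
have t1: t<=e2 by rewrite -[t]mul1r; exact: part.
have tr: t<=t_r T.
 have := part _ (ltW ti0) s8; rewrite mulrC ler_pdivrMr // => h; apply: (le_trans h).
 by rewrite ler_piMl // ltW.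
have Ct := part _ tC0 s7.
have hz': zdata a Q' Cz s z n by apply: zdataW hz; rewrite lerDl.
have sS: nm s<=S.
 rewrite /S; have := nmD (s-s0) s0; rewrite subrK => h; apply: (le_trans h).
 by rewrite addrC lerD2l (le_trans hs).
have t1': t<=1 := le_trans t1 e2le.
have zk k: (n<=k)%N -> z k!=0 /\ nm (z k)<=t.
 move=> nk; have [z1 _ _ z2 _] := hZ k s (z k) (leq_trans k1n nk) sS (hz k nk).1.
 split=> //; apply: (le_trans z2); rewrite ler_wpM2l // lef_pV2 ?posrE ?ltr0n ?ler_nat //.
 exact: leq_trans nk.
have an2: (2*n<=al*n)%N by rewrite leq_mul2r al2 orbT.
have hwb: nm (w n-w1)<=rb := le_trans hw rrb.
have [bwn pwn lipw asyw] := hb _ hwb.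
set W := phi d (w n) in pwn lipw asyw *.
have dW: nm (W-phi d w1)<=Lb*r.
 have h := lipw w1; rewrite subrr nm0 in h; apply: le_trans (h _) _; first exact: ltW.
 by rewrite ler_wpM2l.
have nwn: nm (w n)<=nm w1+1 by have := nmD (w n-w1) w1; rewrite subrK; lr hw r1.
have M1t': M1*t<=1 := le_trans M1t e2le.
have sh1: forall j, (j<=K)%N -> nm (w (n+j)%N-iter j (horner q) (w n))<=M1*t.
 apply: (hM1 z w (w n) t n (ltW t0) M1t').
 - by move=> j _; apply: (zk _ (leq_addr _ _)).2.
 - by move=> j _; apply: hwf; exact: leq_addr.
 - by rewrite subrr nm0 ltW.
 - by move=> j jK; rewrite lerD2r; apply: hB1.
have bd1 j: (j<=K)%N -> nm (w (n+j)%N)<=B1+1.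
 move=> jK; have h := sh1 j jK; have := hB1 (w n) j nwn jK.
 have := nmD (w (n+j)%N-iter j (horner q) (w n)) (iter j (horner q) (w n)); rewrite subrK; lr h M1t'.
pose om k := psi (z k) (w k).
have zK := zk _ (leq_addr K n).
set X := iter K (horner q) (w n) in sh1.
have hX := asyw K KbK; rewrite -/X in hX.
have nX: nm (uc X)<=U1.
 have := nmD (uc X-(K%:R-g*rc (ln K%:R)+W)) (K%:R-g*rc (ln K%:R)+W); rewrite subrK.
 have := nmD (K%:R-g*rc (ln K%:R)) W; have := nmB K%:R (g*rc (ln K%:R)).
 rewrite nm_nat nmM nm_rc ger0_norm // /U1; lr hX iK2 e1a pwn.
have [X0 hX0]: X != w0 /\ 0<nm (uc X).
 have bX: basin d X by apply/basin_iter.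
 have Xn := basin_neq bX; split=> //.
 by rewrite nm_uc invr_gt0 mulr_gt0 // nm_gt0 subr_eq0.
have muX: mu*(X-w0)!=0 by rewrite mulf_neq0 // subr_eq0.
have cl1: nm (om (n+K)%N-mu*(X-w0))<=V1*t.
 have h1 := hP1 _ _ (le_trans zK.2 t1') (bd1 K (leqnn _)).
 have ->: om (n+K)%N-mu*(X-w0)=(om (n+K)%N-mu*(w (n+K)%N-w0))+mu*(w (n+K)%N-X) by ring.
 apply: nmD_le; rewrite /V1 mulrDl; apply: lerD.
 by apply: (le_trans h1); rewrite ler_wpM2l // zK.2.
 by rewrite nmM -mulrA ler_wpM2l ?sh1 // ltW.
have Vt1: V1*t*U1<=1/2.
 by rewrite mulrAC; apply: le_trans (part _ q1 s3) _; lr e2a.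
have [om0 hu0]: om (n+K)%N!=0 /\ nm ((om (n+K)%N)^-1-(mu*(X-w0))^-1)<=e2.
 have h1: nm (mu*(X-w0))^-1<=U1 by rewrite -nmN.
 have h2: nm (om (n+K)%N-mu*(X-w0))*U1<=1/2 by apply: le_trans Vt1; rewrite ler_wpM2r.
 have [oa ob] := inv_close muX h1 h2; split=> //; apply: (le_trans ob).
 via (2*U1^+2*V1*t); last exact: part.
 by rewrite -[leRHS]mulrA ler_wpM2l // mulr_ge0 // exprn_ge0.
have st: nm (- (om (n+K)%N)^-1-(K%:R-g*rc (ln K%:R)+W))<=Db * isq K+e2.
 have ->: - (om (n+K)%N)^-1-(K%:R-g*rc (ln K%:R)+W) =
 (uc X-(K%:R-g*rc (ln K%:R)+W))-((om (n+K)%N)^-1-(mu*(X-w0))^-1) by rewrite /uc; ring.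
 by apply: nmB_le; exact: lerD.
have st1: nm (- (om (n+K)%N)^-1-(K%:R-g*rc (ln K%:R)+W))<=1 by lr st iK2 e1a e2a.
have hwd: wdata al c a (t_b30 T) Q' (t_r T) z om n.
 move=> k nk _ ok; rewrite {1}/om hzp // hwf //.
 have := t_est (le_trans (zk k nk).2 tr) ok => h; apply: (le_trans h).
 by rewrite ler_wpM2r ?lerDr // exprn_ge0 // addr_ge0 ?nm_ge0.
have [tra oe0 hend] := hpass2 n s z om W n2n sS pwn hz' hwd om0 st1.
have kmin k: (n+K<=k)%N -> (k+K<=al*n)%N -> nm (om k)<=Lam/K%:R.
 move=> h1 h2; have h3: (k<=al*n-K)%N by move: h2; clear; lia.
 apply: (le_trans (tra k h1 h3)); apply: ler_wpM2l => //.
 have h4: (K<=minn (k-n) (al*n-k))%N by rewrite leq_min; move: h1 h2; clear; lia.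
 by rewrite lef_pV2 ?posrE ?ltr0n ?ler_nat // (leq_trans K1).
have trans k: (n+K<=k)%N -> (k+K<=al*n)%N -> nm (w k-w0)<=t_C T*(t+Lam/K%:R).
 move=> h1 h2; have nk: (n<=k)%N by apply: leq_trans h1; exact: leq_addr.
 have := t_psi2 (w k) (le_trans (zk k nk).2 tr) => h; apply: (le_trans h).
 by rewrite ler_wpM2l // lerD ?(zk k nk).2 // kmin.
have eKl: (n+K<=al*n-K)%N by move: Kn an2; clear; lia.
have eKr: (al*n-K+K=al*n)%N by move: Kn an2; clear; lia.
have LK1: Lam/K%:R<=Lam by rewrite ler_pdivrMr // ler_peMr // ler1n.
have trB k: (n+K<=k)%N -> (k+K<=al*n)%N -> nm (w k)<=B2.
 move=> h1 h2; have := trans k h1 h2; have := nmD (w k-w0) w0; rewrite subrK.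
 have : t_C T*(t+Lam/K%:R)<=t_C T*(1+Lam) by rewrite ler_wpM2l // lerD.
 rewrite /B2; lr.
set E := (al*n-K)%N in eKl eKr oe0 hend.
have nE: (n<=E)%N by apply: leq_trans eKl; exact: leq_addr.
have hEE: (E+K<=al*n)%N by rewrite eKr.
set Y := - K%:R-g*rc (ln K%:R)+al%:R*W+(1-al%:R)*s+Ci in hend.
have hend2: nm (- (om E)^-1-Y)<=al%:R*(Db * isq K+e2)+Lam * isq K+e2.
 apply: (le_trans hend); rewrite 2!lerD2r ler_wpM2l ?ler0n //.
have nal: nm (al%:R : Cplx R)=al%:R := nm_nat _.
have nal1: nm (1-al%:R : Cplx R)<=1+al%:R by have := nmB 1 (al%:R : Cplx R); rewrite nm1 nal.
have nY: nm (- (om E)^-1)<=U2.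
 have y1: nm Y<=K%:R+nm g * ln K%:R+al%:R*Lb+(1+al%:R)*S+nm Ci.
 rewrite /Y; apply: nmD_le; rewrite lerD2r; apply: nmD_le; apply: lerD.
 apply: nmD_le; apply: lerD; last by rewrite nmM nal ler_wpM2l // (le_trans ler01).
 by apply: nmB_le; rewrite nmN nm_nat nmM nm_rc ger0_norm.
 by rewrite nmM; apply: ler_pM; rewrite ?nm_ge0.
 have := nmD (- (om E)^-1-Y) Y; rewrite subrK.
 have : al%:R*(Db * isq K)<=al%:R*1 by rewrite ler_wpM2l ?(le_trans ler01) //; lr iK2 e1a.
 have : Lam * isq K<=Lam*1 by rewrite ler_wpM2l // isq_le1.
 move: hend2 y1 ae2 e1a e2a; rewrite mulrDr /U2; lr.
have hxe: nm (mu*(w E-w0)-om E)<=P2*t.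
 rewrite nmC; have h1 := hP2 (z E) (w E) (le_trans (zk _ nE).2 t1') (trB _ eKl hEE).
 by apply: (le_trans h1); rewrite ler_wpM2l // (zk _ nE).2.
have [xe0 hxe2]: mu*(w E-w0)!=0 /\ nm ((mu*(w E-w0))^-1-(om E)^-1)<=e2.
 rewrite nmN in nY; have h2: nm (mu*(w E-w0)-om E)*U2<=1/2.
 via (P2*t*U2); first by rewrite ler_wpM2r.
 by rewrite mulrAC; apply: le_trans (part _ q3 s5) _; lr e2a.
 have [oa ob] := inv_close oe0 nY h2; split=> //; apply: (le_trans ob).
 via (2*U2^+2*P2*t); last exact: part.
 by rewrite -[leRHS]mulrA ler_wpM2l // mulr_ge0 // exprn_ge0.
pose D1 := nm (W-phi d w1)+nm (s-s0).
have D10: 0<=D1 by rewrite addr_ge0 ?nm_ge0.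
have D1r: al%:R*D1<=1/4.
 via (al%:R*((Lb+1)*r)).
 by rewrite ler_wpM2l ?(le_trans ler01) // mulrDl mul1r; exact: lerD.
 by move: rL; rewrite mulrA; lr.
have hvR: pd_R d<=re v by move: hv; rewrite /Td; have := pd_M0 d; lr.
have hrep := rep_asym hvR K1.
have bigE: nm (- uc (w E)-iter K (pd_G d) v)<=al%:R*D1+2*e1.
 have ->: - uc (w E)-iter K (pd_G d) v =
 ((mu*(w E-w0))^-1-(om E)^-1)-(- (om E)^-1-Y)-(al%:R*(W-phi d w1)+(1-al%:R)*(s-s0))
 + (- iter K (pd_G d) v-(- K%:R-g*rc (ln K%:R)-pd_Chi d v)).
 by rewrite /uc opprK /Y hY; ring.
 have n4: nm (al%:R*(W-phi d w1)+(1-al%:R)*(s-s0))<=al%:R*D1.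
 apply: nmD_le; rewrite !nmM nal /D1 mulrDr lerD2l ler_wpM2r ?nm_ge0 //.
 have ->: 1-al%:R = - rc (al%:R - 1) :> Cplx R by rewrite rcB rc_nat rc1; ring.
 by rewrite nmN nm_rc ger0_norm; lr ap.
 apply: nmD_le; via (e2+(al%:R*(Db * isq K+e2)+Lam * isq K+e2)+al%:R*D1+pd_D d*(1+nm v) * isq K).
 apply: lerD => //; apply: nmB_le; apply: lerD => //.
 by apply: nmB_le; exact: lerD.
 have e28: e2<=e1/8 by apply: le_trans ae2; rewrite ler_peMl // ltW.
 have e5: al%:R*(Db * isq K+e2)=al%:R*Db * isq K+al%:R*e2 by rewrite mulrDr mulrA.
 by rewrite e5; move: iK1 ae2 e28 e10; rewrite /Ctot !mulrDl; lr.
have E0: 0<=al%:R*D1+2*e1 by rewrite addr_ge0 // mulr_ge0 // ?(ltW e10) // (le_trans ler01).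
have E1: al%:R*D1+2*e1<=1 by lr D1r e1a.
have [land bnd] := rep_land hv E0 E1 bigE.
have M3t': M3*t<=1 := le_trans M3t e2le.
have sh3: forall j, (j<=K)%N -> nm (w (E+j)%N-iter j (horner q) (w E))<=M3*t.
 apply: (hM3 z w (w E) t E (ltW t0) M3t').
 - by move=> j _; apply: (zk _ (leq_trans nE (leq_addr _ _))).2.
 - by move=> j _; apply: hwf; apply: leq_trans (leq_addr _ _).
 - by rewrite subrr nm0 ltW.
 - move=> j jK; have := bnd j jK; have := nmD (iter j (horner q) (w E)-w0) w0; rewrite subrK /B3; lr.
split.
- have := sh3 K (leqnn K); rewrite eKr => h.
 have := nm_tri (iter K (horner q) (w E)) (w (al*n)%N) (wc (- v)).
 have : 2/nm mu*(2*e1)<=eps/2.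
 by rewrite mulrAC ler_pdivrMr //; lr e1b.
 move: land h M3t e2c eps0; rewrite mulrDr mulrA -/D1 -/W; lr.
- move=> k /andP[nk kn].
 have [kK|kK] := leqP k (n+K).
 have ->: k=(n+(k-n))%N by rewrite subnKC.
 apply: le_trans (bd1 _ _) _; first by move: kK; clear; lia.
 by lr B20 B30.
 have [kE|kE] := leqP (k+K) (al*n).
 by apply: le_trans (trB k (ltnW kK) kE) _; lr B10 B30.
 have Ek: (E<=k)%N by move: kE eKr; clear; lia.
 have ->: k=(E+(k-E))%N by rewrite subnKC.
 have jK: (k-E<=K)%N by move: kn eKr Ek; clear; lia.
 have := sh3 _ jK; have := bnd _ jK; have := nmD (w (E+(k-E))%N-iter (k-E) (horner q) (w E)) (iter (k-E) (horner q) (w E)).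
 have := nmD (iter (k-E) (horner q) (w E)-w0) w0; rewrite !subrK /B3; lr M3t' B10 B20.
- move=> k h1 h2; apply: (le_trans (trans k h1 h2)); rewrite mulrDr; lr Ct LK e2c eps0.
Qed.

End PassageOrig.

(** * Solving t^e + E(t) = 1 near t = 1 *)

Section SolveRoot.
Context {R : realType}.
Implicit Types (u v w x y t : Cplx R).

Lemma poly_crit (P : {poly Cplx R}) c : P^`().[c] = 0 ->
 exists h : {poly Cplx R}, forall x, P.[x]-P.[c]=(x-c)^+2*h.[x].
Proof.
move=> hc; have : root (P-P.[c]%:P) c by rewrite rootE !hornerE subrr.
move/factor_theorem => [s es].
have : root s c.
 have : (P-P.[c]%:P)^`().[c] = 0 by rewrite derivB derivC subr0.
 by rewrite es derivM derivXsubC mulr1 !hornerE subrr mulr0 add0r rootE => ->.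
move/factor_theorem => [h eh]; exists h => x.
have := congr1 (horner^~ x) es; rewrite eh !hornerE => ->; ring.
Qed.

Lemma poly_crit_lip (P : {poly Cplx R}) c (e : R) : P^`().[c] = 0 -> 0<e -> exists2 r : R, 0<r &
 forall x y, nm (x-c)<=r -> nm (y-c)<=r -> nm (P.[x]-P.[y])<=e*nm (x-y).
Proof.
move=> /poly_crit[h hh] e0; have [M M0 hM] := poly_bounded h (nm c+1).
have [L L0 hL] := poly_lip h (nm c+1).
pose r := Num.min 1 (e/(2*M+L+1)).
have S0: 0<2*M+L+1 by lra.
have r0: 0<r by rewrite lt_min ltr01 divr_gt0.
have r1: r<=1 by rewrite ge_min lexx.
have r2: (2*M+L)*r<=e.
 have : (2*M+L+1)*r<=e by rewrite mulrC -ler_pdivlMr // ge_min lexx orbT.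
 by lr r0.
exists r => // x y hx hy.
have bd z: nm (z-c)<=r -> nm z<=nm c+1.
 by move=> hz; have := nmD (z-c) c; rewrite subrK; lra.
have ->: P.[x]-P.[y]=(x-y)*((x-c)+(y-c))*h.[x]+(y-c)^+2*(h.[x]-h.[y]).
 have ->: P.[x]-P.[y]=(P.[x]-P.[c])-(P.[y]-P.[c]) by ring.
 by rewrite !hh; ring.
apply: nmD_le; rewrite !nmM.
have nxy := nm_ge0 (x-y).
have h1: nm (x-c+(y-c))<=2*r by apply: nmD_le; lra.
have h2: nm (x-y)*nm (x-c+(y-c))*nm h.[x]<=nm (x-y)*(2*r)*M.
 by rewrite ler_pM ?mulr_ge0 ?nm_ge0 ?ler_wpM2l ?hM ?bd.
have h3: nm (y-c)*nm (y-c)*nm (h.[x]-h.[y])<=(r*1)*(L*nm (x-y)).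
 rewrite ler_pM ?mulr_ge0 ?nm_ge0 ?hL ?bd // ler_pM ?nm_ge0 //; lr hy r1.
have : nm (x-y)*((2*M+L)*r)<=nm (x-y)*e by rewrite ler_wpM2l.
lr h3 h2.
Qed.

(** Newton's method with the derivative frozen at e. Its main part t - t^e/e has a critical point at
    1, hence contracts strongly nearby and leaves room for a perturbation of Lipschitz constant
    1/4. *)
Lemma solve_root (e : nat) : (0<e)%N -> exists M tau : R, [/\ 0<=M, 0<tau, tau<=1/2 &
 forall t, nm (t - 1)<=tau -> nm (t^+e - 1)<=1/4] /\
 (forall t t', nm (t - 1)<=tau -> nm (t' - 1)<=tau -> nm (t^+e-t'^+e)<=M*nm (t-t')) /\
 forall E : Cplx R -> Cplx R,
 (forall t t', nm (t - 1)<=tau -> nm (t' - 1)<=tau -> nm (E t-E t')<=1/4*nm (t-t')) ->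
 nm (E 1)<=tau/4 -> exists2 t, nm (t - 1)<=tau & t^+e+E t = 1.
Proof.
move=> e0; pose P : {poly Cplx R} := 'X-e%:R^-1 *: 'X^e.
have en: (e%:R : Cplx R)!=0 by rewrite pnatr_eq0 -lt0n.
have [M M0 hM] := poly_lip ('X^e : {poly Cplx R}) 2.
have P1: P^`().[1] = 0.
 rewrite derivB derivX derivZ derivXn !(hornerE, hornerMn, hornerXn) expr1n.
 by rewrite mulVf // subrr.
have [r r0 hr] := @poly_crit_lip P 1 (1/8) P1 ltac:(lra).
pose tau := Num.min (Num.min r (1/2)) (4*M+1)^-1.
have M1: 0<4*M+1 by lra.
have t0: 0<tau by rewrite !lt_min r0 invr_gt0 M1 divr_gt0.
have t2: tau<=1/2 by rewrite !ge_min lexx orbT.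
have tr: tau<=r by rewrite !ge_min lexx.
have tM: M*tau<=1/4.
 have : tau<=(4*M+1)^-1 by rewrite ge_min lexx orbT.
 by rewrite -[_^-1]mul1r ler_pdivlMr // => h; lr h t0.
have bd t: nm (t - 1)<=tau -> nm t<=2.
 by move=> ht; have := nmD (t - 1) 1; rewrite subrK nm1; lra.
have lip t t': nm (t - 1)<=tau -> nm (t' - 1)<=tau -> nm (t^+e-t'^+e)<=M*nm (t-t').
 by move=> ht ht'; have := hM _ _ (bd t ht) (bd t' ht'); rewrite !hornerE.
have t11: nm (1 - 1 : Cplx R)<=tau by rewrite subrr nm0 ltW.
exists M, tau; split.
 split=> // t ht; have := lip t 1 ht t11; rewrite expr1n => h.
 by apply: (le_trans h); apply: le_trans tM; rewrite ler_wpM2l.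
split=> // E hE E1; have e1: 1<=(e%:R : R) by rewrite ler1n.
have ein: nm (e%:R^-1 : Cplx R)<=1 by rewrite nmV nm_nat invf_le1 // (lt_le_trans ltr01).
have [|| t ht ft] := @cbanach R (fun t => t-(t^+e+E t - 1)/e%:R) 1 tau.
- move=> x y hx hy.
 have ->: x-(x^+e+E x - 1)/e%:R-(y-(y^+e+E y - 1)/e%:R) =
 (P.[x]-P.[y])-e%:R^-1*(E x-E y) by rewrite /P !hornerE; ring.
 apply: nmB_le; rewrite nmM.
 have h1 := hr x y (le_trans hx tr) (le_trans hy tr); have h2 := hE x y hx hy.
 have h3: nm (e%:R^-1 : Cplx R)*nm (E x-E y)<=1*(1/4*nm (x-y)).
 by rewrite ler_pM ?nm_ge0.
 have := nm_ge0 (x-y); lr h1 h3.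
- have ->: 1-(1^+e+E 1 - 1)/e%:R - 1 = - (e%:R^-1*E 1) by rewrite expr1n; ring.
 rewrite nmN nmM; have : nm (e%:R^-1 : Cplx R)*nm (E 1)<=1*(tau/4) by rewrite ler_pM ?nm_ge0.
 by lr t0.
exists t => //; apply/eqP; rewrite -subr_eq0; apply/eqP.
have : (t^+e+E t - 1)/e%:R = 0.
 by move: ft; set A := _/_ => ft; have ->: A=t-(t-A) by [ring]; rewrite ft subrr.
by move/eqP; rewrite mulf_eq0 invr_eq0 (negbTE en) orbF => /eqP.
Qed.

End SolveRoot.

(** * Orbits connecting one parabolic point to the basin of the other *)

Section Connection.
Context {R : realType}.
Implicit Types (u v w x y t : Cplx R).
Variables (q : {poly Cplx R}) (w1 w2 mu1 mu2 a : Cplx R) (d1 : pdata q w1 mu1 a) (d2 : pdata q w2 mu2 a).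
Hypothesis w12 : w1 != w2.
Local Notation uc1 := (uc w1 mu1).
Local Notation uc2 := (uc w2 mu2).

Lemma Chi_lip u v : pd_R d2<=re u -> pd_R d2<=re v -> nm (pd_Chi d2 u-pd_Chi d2 v)<=(1+pd_D d2)*nm (u-v).
Proof.
move=> hu hv; have R10 := pd_R1 d2; have D0 := pd_D0 d2.
have [_ _ h3 _] := pd_rep d2; have h := h3 (pd_R d2) u v (lexx _) hu hv.
have := nmD (pd_Chi d2 u-pd_Chi d2 v-(u-v)) (u-v); rewrite subrK.
have : pd_D d2/pd_R d2*nm (u-v)<=pd_D d2*nm (u-v).
 by rewrite ler_wpM2r ?nm_ge0 // ler_pdivrMr; nra.
lra.
Qed.

Lemma Chi_near u : pd_R d2+1<=re (- uc2 u) -> exists r L B, [/\ 0<r, 0<=L, 0<=B &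
 forall x, nm (x-u)<=r -> [/\ x != w2, re (- uc2 u) - 1<=re (- uc2 x), nm (pd_Chi d2 (- uc2 x))<=B &
 forall y, nm (y-u)<=r -> nm (pd_Chi d2 (- uc2 x)-pd_Chi d2 (- uc2 y))<=L*nm (x-y)]].
Proof.
move=> hu; have R0 := Rd_gt0 d2; have m0 := nmmu d2; have D0 := pd_D0 d2.
set U := nm (uc2 u); have U0: 0<U by have := re_le (- uc2 u); rewrite nmN -/U; lra.
pose A := 2*nm mu2*U; pose E := 2*nm mu2*U^+2.
have A0: 0<A by rewrite /A !mulr_gt0.
have E0: 0<E by rewrite /E !mulr_gt0 // exprn_gt0.
pose r := Num.min A^-1 E^-1; have r0: 0<r by rewrite lt_min !invr_gt0 A0.
have near x: nm (x-u)<=r -> x != w2 /\ nm (uc2 x-uc2 u)<=1.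
 rewrite le_min => /andP[h1 h2]; have [xn h3] := uc_near d2 (erefl U) U0 h1.
 by split=> //; apply: (le_trans h3); rewrite mulrC -ler_pdivlMr // mul1r.
have reb x: nm (x-u)<=r -> re (- uc2 u) - 1<=re (- uc2 x).
 move=> /near[_ h]; have := re_geN (- (uc2 x-uc2 u)); rewrite nmN.
 have ->: re (- uc2 x)=re (- uc2 u)+re (- (uc2 x-uc2 u)) by rewrite -reD; congr re; ring.
 by lra.
pose L := (1+pd_D d2)*(nm mu2*((U+1)*(U+1))).
have L0: 0<=L by rewrite /L !mulr_ge0 ?nm_ge0 //; lr D0 U0.
have lip x y: nm (x-u)<=r -> nm (y-u)<=r ->
 nm (pd_Chi d2 (- uc2 x)-pd_Chi d2 (- uc2 y))<=L*nm (x-y).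
 move=> hx hy; have := reb x hx; have := reb y hy => h1 h2.
 apply: (le_trans (Chi_lip _ _)); [lr h2 hu|lr h1 hu|]; rewrite /L -mulrA; apply: ler_wpM2l; first by lr D0.
 have [xn hx1] := near x hx; have [yn hy1] := near y hy.
 have ->: - uc2 x - - uc2 y = - (uc2 x-uc2 y) by ring.
 rewrite nmN (uc_sub_nm d2 xn yn) mulrAC; apply: ler_wpM2r; first exact: nm_ge0.
 rewrite ler_wpM2l ?nm_ge0 // ler_pM ?nm_ge0 //.
 by have := nmD (uc2 x-uc2 u) (uc2 u); rewrite subrK -/U; lr hx1.
 by have := nmD (uc2 y-uc2 u) (uc2 u); rewrite subrK -/U; lr hy1.
have uu: nm (u-u)<=r by rewrite subrr nm0 ltW.
exists r, L, (nm (pd_Chi d2 (- uc2 u))+L*r); split=> //.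
 by rewrite addr_ge0 ?nm_ge0 // mulr_ge0 // ltW.
move=> x hx; split=> [|||y]; [by have [] := near x hx|exact: reb| |exact: lip].
have := nmD (pd_Chi d2 (- uc2 x)-pd_Chi d2 (- uc2 u)) (pd_Chi d2 (- uc2 u)); rewrite subrK.
have := lip x u hx uu; have : L*nm (x-u)<=L*r by rewrite ler_wpM2l.
lra.
Qed.

Lemma basin_fix_neq u k : basin d2 u -> iter k (horner q) u != w1.
Proof.
move=> bu; apply/eqP => e; have n12: 0<nm (w1-w2) by rewrite nm_gt0 subr_eq0.
have [N hN] := basin_cvg bu (ltac:(rewrite divr_gt0 //) : 0<nm (w1-w2)/2).
have := hN (N+k)%N (leq_addr _ _); rewrite iterD e (iter_fix d1); lra.
Qed.

(** Preimages of w1 close to w2 cannot lie in the basin of w2, so [near_parabolic] puts them on the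
    repelling side. *)
Lemma connection_preimage (T : R) : pd_R d2<=T -> exists u l,
 [/\ T<=re (- uc2 u), iter l (horner q) u=w1 & u != w2].
Proof.
move=> RT; have [r r0 hr] := near_parabolic RT.
have [u [l [h1 h2]]] := preimages_near d2 w12 r0.
have un: u != w2.
 apply/eqP => e; move: h2; rewrite e (iter_fix d2) => e2; by move: w12; rewrite e2 eqxx.
exists u, l; split=> //; have [bu|] := hr u un h1; last by rewrite (reN (uc2 u)); lra.
by have := basin_fix_neq l bu; rewrite h2 eqxx.
Qed.

(** Near a preimage u0 of w1, of multiplicity e, the coordinate of w1 after l steps behaves like a
    constant over (w - u0)^e, while [pd_Chi] stays bounded; hence large values are attained. Writing
    w = u0 + eta/t, with eta fitted to j, turns the equation into t^e + E(t) = 1 with small E.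
    Taking j real and positive places the image in the attracting petal. *)
Lemma solve_near (A B : R) (ka : Cplx R) : 0<A -> 0<=B -> exists2 J : R, 0<J &
 forall j : R, J<=j -> exists w, [/\ basin d1 w, w != w2, Td d2<=re (- uc2 w) &
 rc A * phi d1 w-rc B * pd_Chi d2 (- uc2 w)=ka+rc j].
Proof.
move=> A0 B0; have M20 := pd_M0 d2; have m10 := nmmu d1; have mu10 := pd_mu d1.
have D0 := pd_D0 d1; have R0 := Rd_gt0 d1.
have TdR: pd_R d2<=Td d2+1 by rewrite /Td; lra.
have [u0 [l [hu0 hl u0n]]] := connection_preimage TdR.
have TdR1: pd_R d2+1<=Td d2+1 by rewrite /Td; lra.
have [r2 [L2 [B2 [r20 L20 B20 hchi]]]] := Chi_near (le_trans TdR1 hu0).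
pose Q := iterp q l-w1%:P.
have QE x: Q.[x] = iter l (horner q) x-w1 by rewrite /Q !hornerE iterpE.
have [e [k hk eQ]] := multiplicity_XsubC Q u0.
have Qn0: Q!=0.
 have [c m1 _] := critical_in_basin d2.
 apply/eqP => Q0; have := basin_fix_neq l m1; rewrite -subr_eq0 -QE Q0 horner0 eqxx //.
rewrite Qn0 /= rootE in hk; set k0 := k.[u0] in hk.
have e0: (0<e)%N.
 rewrite lt0n; apply/eqP => e0; move: hk; rewrite /k0; have := QE u0.
 by rewrite hl subrr eQ e0 expr0 mulr1 => ->; rewrite eqxx.
have k00: 0<nm k0 by rewrite nm_gt0.
have QEk x: Q.[x]=k.[x]*(x-u0)^+e by rewrite eQ hornerM horner_exp hornerXsubC.
have [M [tau [[M0 tau0 tau2 ht4] [htl hsolve]]]] := @solve_root R e e0.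
have [Lk Lk0 hLk] := poly_lip k (nm u0+1).
have T10: 0<64 * pd_D d1/tau+1 by rewrite ltr_wpDl // divr_ge0 ?mulr_ge0 // ltW.
(* Beyond T1 the function [ps] has a Lipschitz constant so small that it stays small after
   multiplication by M+1, the stretching of X in terms of t. *)
pose T1 := pd_R d1+16 * pd_D d1*(M+1)+64 * pd_D d1/tau.
have x1: 0<=16 * pd_D d1*(M+1) by rewrite !mulr_ge0 //; lr M0.
have x2: 0<=64 * pd_D d1/tau by rewrite divr_ge0 ?mulr_ge0 // ltW.
have T1p: 0<T1 by rewrite /T1; lr x2 x1 R0.
have DT1: pd_D d1/T1*(M+1)<=1/16.
 by rewrite mulrAC ler_pdivrMr // /T1; lr x2 R0.
have DT2: 2*(pd_D d1/T1)<=tau/32.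
 rewrite mulrA ler_pdivrMr //; have : tau/32*(64 * pd_D d1/tau)<=tau/32*T1.
 by rewrite ler_wpM2l ?divr_ge0 ?(ltW tau0) // /T1; lr x1 R0.
 by have ->: tau/32*(64 * pd_D d1/tau) = 2 * pd_D d1 by field; rewrite gt_eqF.
have RT1: pd_R d1<=T1 by rewrite /T1; lr x2 x1.
have DT0: 0<=pd_D d1/T1 by rewrite divr_ge0 // ltW.
pose Ck := 16*Lk/nm k0; have Ck0: 0<=Ck by rewrite divr_ge0 ?mulr_ge0 // ltW.
pose ps X := pd_Phi d1 X-X.
pose Bp := nm (ps (rc T1))+pd_D d1; have Bp0: 0<=Bp by rewrite addr_ge0 ?nm_ge0.
pose Bc := B*B2+nm (ka+rc A * l%:R); have Bc0: 0<=Bc by rewrite addr_ge0 ?nm_ge0 // mulr_ge0.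
pose Se := (2+M)*Ck*16/tau+2/r2+2+2*Lk/nm k0*2.
have Sa: 0<=(2+M)*Ck*16/tau.
 by apply: divr_ge0; [apply: mulr_ge0 => //; apply: mulr_ge0 => //; exact: addr_ge0|exact: ltW].
have Sb: 0<=2/r2 by rewrite divr_ge0 // ltW.
have Sc: 0<=2*Lk/nm k0*2 by rewrite mulr_ge0 // divr_ge0 ?mulr_ge0 // ltW.
have Se0: 0<Se by rewrite /Se; lr Sa Sb Sc.
pose c0 := nm mu1*nm k0; have c00: 0<c0 by rewrite mulr_gt0.
pose J := A*Se^+e/c0+2*A*T1+(64*(A*Bp+Bc)/tau+64*(B*L2)+1).
have Ja: 0<=A*Se^+e/c0 by rewrite divr_ge0 ?mulr_ge0 ?exprn_ge0 // ltW.
have Jb: 0<=2*A*T1 by rewrite !mulr_ge0 // ltW.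
have Jc: 0<=64*(A*Bp+Bc)/tau.
 apply: divr_ge0; last exact: ltW.
 by apply: mulr_ge0 => //; apply: addr_ge0 => //; apply: mulr_ge0 => //; exact: ltW.
have Jd: 0<=64*(B*L2) by rewrite !mulr_ge0.
exists J; first by rewrite /J; lr Ja Jb Jc Jd.
move=> j Jj; have jp: 0<j by move: Jj Ja Jb Jc Jd; rewrite /J; lr.
have j1: A*Se^+e/c0<=j by move: Jj Jb Jc Jd; rewrite /J; lr.
have j2: 2*A*T1<=j by move: Jj Ja Jc Jd; rewrite /J; lr.
have j3: 64*(A*Bp+Bc)/tau<=j by move: Jj Ja Jb Jd; rewrite /J; lr.
have j4: 64*(B*L2)<=j by move: Jj Ja Jb Jc; rewrite /J; lr.
have jn: rc j!=0 by rewrite rc_eq0 gt_eqF.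
have An: rc A!=0 by rewrite rc_eq0 gt_eqF.
pose eta := e.-root (- rc A/(mu1*k0*rc j)).
have heta: eta^+e = - rc A/(mu1*k0*rc j) by rewrite rootCK.
have eta0: eta!=0.
 have : eta^+e!=0.
 rewrite heta; apply: mulf_neq0; rewrite ?oppr_eq0 // invr_eq0.
 by apply: mulf_neq0 => //; exact: mulf_neq0.
 by rewrite expf_eq0 e0.
have neta: nm eta<=Se^-1.
 rewrite -(@ler_pXn2r _ e) ?nnegrE ?nm_ge0 ?invr_ge0 ?(ltW Se0) // -nmX heta nmf nmN !nmM !nm_rc.
 rewrite !gtr0_norm // -/c0 exprVn ler_pdivrMr ?mulr_gt0 // mulrC -ler_pdivrMr ?invr_gt0 ?exprn_gt0 // invrK.
 by move: j1; rewrite ler_pdivrMr // mulrC [j*_]mulrC.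
have neta0 := nm_ge0 eta.
have Seta: Se*nm eta<=1 by rewrite mulrC -ler_pdivlMr // div1r.
have Sea := mulr_ge0 Sa neta0; have Seb := mulr_ge0 Sb neta0; have Sec := mulr_ge0 Sc neta0.
move: Seta; rewrite /Se !mulrDl => Seta.
have E1: (2+M)*Ck*16/tau*nm eta<=1 by lr Seta Sea Seb Sec neta0.
have E2: 2*nm eta<=r2.
 have : 2/r2*nm eta<=1 by lr Seta Sea Seb Sec neta0.
 by rewrite mulrAC ler_pdivrMr // mul1r.
have E3: 2*nm eta<=1 by lr Seta Sea Seb Sec.
have E4: 2*Lk*(2*nm eta)<=nm k0.
 have : 2*Lk/nm k0*2*nm eta<=1 by lr Seta Sea Seb Sec neta0.
 by rewrite -mulrA mulrAC ler_pdivrMr // mul1r.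
have E5: (2+M)*(Ck*nm eta)<=tau/16.
 by move: E1; rewrite mulrAC ler_pdivrMr // mul1r; lr.
pose W t := u0+eta/t.
have tn t: nm (t - 1)<=tau -> 1/2<=nm t.
 move=> ht; have := nmD_ge 1 (t - 1); have ->: 1+(t - 1)=t by ring.
 by rewrite nm1; lr ht tau2.
have tn0 t: nm (t - 1)<=tau -> t!=0 by move=> /tn h; rewrite -nm_gt0; lr h.
have ti t: nm (t - 1)<=tau -> nm t^-1<=2.
 by move=> ht; rewrite nmV -[leRHS]invrK lef_pV2 ?posrE ?invr_gt0 // ?nm_gt0 ?tn0 // -div1r tn.
have Wd t: nm (t - 1)<=tau -> nm (W t-u0)<=2*nm eta.
 by move=> ht; rewrite /W addrC addKr nmM mulrC ler_wpM2r // ti.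
have Wl t t': nm (t - 1)<=tau -> nm (t' - 1)<=tau -> nm (W t-W t')<=4*nm eta*nm (t-t').
 move=> ht ht'; have ->: W t-W t' = - (eta*(t-t')*(t^-1*t'^-1)).
 by rewrite /W; field; rewrite !tn0.
 rewrite nmN !nmM; have : nm t^-1*nm t'^-1<=2*2 by rewrite ler_pM ?nm_ge0 ?ti.
 move=> h; apply: le_trans (ler_wpM2l (mulr_ge0 neta0 (nm_ge0 _)) h) _; lr.
have Wb t: nm (t - 1)<=tau -> nm (W t)<=nm u0+1.
 by move=> /Wd h; have := nmD (W t-u0) u0; rewrite subrK; lr h E3.
have u0b: nm u0<=nm u0+1 by lr.
have kl t: nm (t - 1)<=tau -> nm (k.[W t]-k0)<=Lk*(2*nm eta).
 by move=> ht; apply: le_trans (hLk _ _ (Wb t ht) u0b) _; rewrite ler_wpM2l // Wd.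
have kb t: nm (t - 1)<=tau -> nm k0/2<=nm k.[W t].
 move=> /kl h; have := nmD_ge k0 (k.[W t]-k0); have ->: k0+(k.[W t]-k0)=k.[W t] by ring.
 by lr h E4.
have kn t: nm (t - 1)<=tau -> k.[W t]!=0 by move=> /kb h; rewrite -nm_gt0; lr h k00.
have ki t: nm (t - 1)<=tau -> nm k.[W t]^-1<=2/nm k0.
 move=> ht; rewrite nmV -[leRHS]invrK lef_pV2 ?posrE ?invr_gt0 ?divr_gt0 // ?nm_gt0 ?kn //.
 by rewrite invf_div kb.
pose K t := k0/k.[W t].
have K1 t: nm (t - 1)<=tau -> nm (K t - 1)<=Ck*nm eta.
 move=> ht; have ->: K t - 1 = - (k.[W t]-k0)*k.[W t]^-1 by rewrite /K; field; exact: kn.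
 rewrite nmM nmN; via (Lk*(2*nm eta)*(2/nm k0)).
 by rewrite ler_pM ?nm_ge0 ?kl ?ki.
 have ->: Lk*(2*nm eta)*(2/nm k0) = 4*(Lk/nm k0*nm eta) by ring.
 have ->: Ck*nm eta = 16*(Lk/nm k0*nm eta) by rewrite /Ck; ring.
 by have := mulr_ge0 (divr_ge0 Lk0 (ltW k00)) neta0; lr.
have K2 t t': nm (t - 1)<=tau -> nm (t' - 1)<=tau -> nm (K t-K t')<=Ck*nm eta*nm (t-t').
 move=> ht ht'; have ->: K t-K t' = - k0*(k.[W t]-k.[W t'])*(k.[W t]^-1*k.[W t']^-1).
 by rewrite /K; field; rewrite !kn.
 rewrite !nmM nmN; via (nm k0*(Lk*(4*nm eta*nm (t-t')))*(2/nm k0*(2/nm k0))).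
 apply: ler_pM; rewrite ?mulr_ge0 ?nm_ge0 //; last by rewrite ler_pM ?nm_ge0 ?ki.
 rewrite ler_wpM2l ?nm_ge0 //; apply: le_trans (hLk _ _ (Wb t ht) (Wb t' ht')) _.
 by rewrite ler_wpM2l // Wl.
 by apply: eq_ler; rewrite /Ck; field; rewrite gt_eqF.
have CkE: Ck*nm eta<=tau/32.
 by have := mulr_ge0 M0 (mulr_ge0 Ck0 neta0); lr E5.
have t4 t: nm (t - 1)<=tau -> nm (t^+e)<=5/4.
 by move=> /ht4 h; have := nmD (t^+e - 1) 1; rewrite subrK nm1; lr h.
pose Y t := t^+e*K t.
have Y1 t: nm (t - 1)<=tau -> nm (Y t-t^+e)<=5/4*(Ck*nm eta).
 move=> ht; have ->: Y t-t^+e=t^+e*(K t - 1) by rewrite /Y; ring.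
 by rewrite nmM ler_pM ?nm_ge0 ?K1 ?t4.
have Y2 t t': nm (t - 1)<=tau -> nm (t' - 1)<=tau ->
 nm ((Y t-t^+e)-(Y t'-t'^+e))<=tau/16*nm (t-t').
 move=> ht ht'; have ->: (Y t-t^+e)-(Y t'-t'^+e)=t^+e*(K t-K t')+(t^+e-t'^+e)*(K t' - 1).
 by rewrite /Y; ring.
 apply: nmD_le; rewrite !nmM.
 have a1: nm (t^+e)*nm (K t-K t')<=2*(Ck*nm eta*nm (t-t')).
 by rewrite ler_pM ?nm_ge0 ?K2 //; have := t4 t ht; lr.
 have a2: nm (t^+e-t'^+e)*nm (K t' - 1)<=M*nm (t-t')*(Ck*nm eta).
 by rewrite ler_pM ?nm_ge0 ?K1 ?htl.
 have := ler_wpM2r (nm_ge0 (t-t')) E5; lr a1 a2.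
pose X t := uc1 (iter l (horner q) (W t)).
have XE t: nm (t - 1)<=tau -> X t=rc (j/A)*Y t.
 move=> ht; rewrite /X /uc -QE QEk; have ->: W t-u0=eta/t by rewrite /W addrC addKr.
 rewrite expr_div_n heta /Y /K rc_f.
 have := kn t ht; have : t^+e!=0 by rewrite expf_neq0 // tn0.
 by move: (t^+e) (k.[_]) => te kk te0 kk0; field; rewrite te0 kk0 hk mu10 jn An.
have jA: 0<j/A by rewrite divr_gt0.
have Yre t: nm (t - 1)<=tau -> 1/2<=re (Y t).
 move=> ht; have := Y1 t ht; have := ht4 t ht; have := re_geN ((Y t-t^+e)+(t^+e - 1)).
 have := nmD (Y t-t^+e) (t^+e - 1); rewrite addrA subrK reB re1; lr CkE tau2.
have Xre t: nm (t - 1)<=tau -> T1<=re (X t).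
 move=> ht; rewrite XE // re_rcM; via (j/A*(1/2)).
 by rewrite mulrAC ler_pdivlMr //; lr j2.
 by rewrite ler_wpM2l ?Yre // ltW.
have Xl t t': nm (t - 1)<=tau -> nm (t' - 1)<=tau -> nm (X t-X t')<=j/A*((M+1)*nm (t-t')).
 move=> ht ht'; rewrite !XE // -mulrBr nmM nm_rc gtr0_norm // ler_wpM2l ?(ltW jA) //.
 have ->: Y t-Y t'=((Y t-t^+e)-(Y t'-t'^+e))+(t^+e-t'^+e) by ring.
 apply: nmD_le; have := Y2 t t' ht ht'; have := htl t t' ht ht'.
 have : tau/16*nm (t-t')<=1*nm (t-t') by rewrite ler_wpM2r ?nm_ge0 //; lr tau2.
 by lr.
have [_ _ Phi3 _] := pd_attr d1.
have psl x y: T1<=re x -> T1<=re y -> nm (ps x-ps y)<=pd_D d1/T1*nm (x-y).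
 move=> hx hy; have := Phi3 T1 x y RT1 hx hy; rewrite /ps.
 by have ->: pd_Phi d1 x-x-(pd_Phi d1 y-y) = pd_Phi d1 x-pd_Phi d1 y-(x-y) by ring.
pose E t := (Y t-t^+e)+rc (A/j) * ps (X t)-rc j^-1*(rc B * pd_Chi d2 (- uc2 (W t))+(ka+rc A * l%:R)).
have Aj: 0<A/j by rewrite divr_gt0.
have ji: 0<j^-1 by rewrite invr_gt0.
have Wr t: nm (t - 1)<=tau -> nm (W t-u0)<=r2 by move=> ht; apply: le_trans (Wd t ht) E2.
have E1l t t': nm (t - 1)<=tau -> nm (t' - 1)<=tau -> nm (E t-E t')<=1/4*nm (t-t').
 move=> ht ht'; have ->: E t-E t'=((Y t-t^+e)-(Y t'-t'^+e))+rc (A/j)*(ps (X t)-ps (X t'))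
 - rc j^-1*(rc B*(pd_Chi d2 (- uc2 (W t))-pd_Chi d2 (- uc2 (W t')))) by rewrite /E; ring.
 apply: nmB_le; have a0 := nmD ((Y t-t^+e)-(Y t'-t'^+e)) (rc (A/j)*(ps (X t)-ps (X t'))).
 have a1 := Y2 t t' ht ht'.
 have a2: nm (rc (A/j)*(ps (X t)-ps (X t')))<=1/16*nm (t-t').
 rewrite nmM nm_rc gtr0_norm //; via (A/j*(pd_D d1/T1*(j/A*((M+1)*nm (t-t'))))).
 rewrite ler_wpM2l ?(ltW Aj) //; apply: le_trans (psl _ _ (Xre t ht) (Xre t' ht')) _.
 by rewrite ler_wpM2l // Xl.
 have ->: A/j*(pd_D d1/T1*(j/A*((M+1)*nm (t-t')))) = pd_D d1/T1*(M+1)*nm (t-t').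
 by field; rewrite !gt_eqF.
 by rewrite ler_wpM2r ?nm_ge0.
 have a3: nm (rc j^-1*(rc B*(pd_Chi d2 (- uc2 (W t))-pd_Chi d2 (- uc2 (W t')))))<=1/16*nm (t-t').
 rewrite !nmM !nm_rc gtr0_norm // ger0_norm //.
 have [_ _ _ hl2] := hchi _ (Wr t ht).
 via (j^-1*(B*(L2*(4*nm eta*nm (t-t'))))).
 rewrite ler_wpM2l ?(ltW ji) // ler_wpM2l //; apply: le_trans (hl2 _ (Wr t' ht')) _.
 by rewrite ler_wpM2l // Wl.
 have ->: j^-1*(B*(L2*(4*nm eta*nm (t-t'))))=(B*L2*(4*nm eta))/j*nm (t-t') by ring.
 rewrite ler_wpM2r ?nm_ge0 // ler_pdivrMr //.
 have : B*L2*(4*nm eta)<=B*L2*2 by rewrite ler_wpM2l ?mulr_ge0 //; lr E3.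
 by lr j4 jp.
 have := nm_ge0 (t-t'); have : tau/16*nm (t-t')<=1/16*nm (t-t').
 by rewrite ler_wpM2r ?nm_ge0 //; lr tau2.
 by lr a0 a1 a2 a3.
have t11: nm (1 - 1 : Cplx R)<=tau by rewrite subrr nm0 ltW.
have E1s: nm (E 1)<=tau/4.
 rewrite /E; apply: nmB_le; have a0 := nmD (Y 1 - 1^+e) (rc (A/j) * ps (X 1)).
 have a1 := Y1 1 t11.
 have nX: A/j*nm (X 1)<=2.
 rewrite XE // nmM nm_rc gtr0_norm // mulrA.
 have ->: A/j*(j/A) = 1 by field; rewrite !gt_eqF.
 rewrite mul1r; have := nmD (Y 1 - 1^+e) (1^+e); rewrite subrK; have := t4 1 t11.
 by lr a1 CkE tau2.
 have a2: nm (rc (A/j) * ps (X 1))<=A*Bp/j+tau/32.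
 rewrite nmM nm_rc gtr0_norm //.
 have rT: T1<=re (rc T1) by rewrite -[rc T1]mulr1 re_rcM re1 mulr1.
 have b1 := psl _ _ (Xre 1 t11) rT; have b2 := nmD (ps (X 1)-ps (rc T1)) (ps (rc T1)); rewrite subrK in b2.
 have b3 := nmB (X 1) (rc T1); rewrite nm_rc gtr0_norm // in b3.
 have b4: pd_D d1/T1*nm (X 1-rc T1)<=pd_D d1/T1*nm (X 1)+pd_D d1.
 apply: le_trans (ler_wpM2l DT0 b3) _; rewrite mulrDr lerD2l divfK ?gt_eqF //.
 have b5: nm (ps (X 1))<=Bp+pd_D d1/T1*nm (X 1) by rewrite /Bp; lr b1 b2 b4.
 apply: le_trans (ler_wpM2l (ltW Aj) b5) _; rewrite mulrDr; apply: lerD; first by rewrite mulrAC.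
 have := ler_wpM2l DT0 nX; move: DT2; set x := pd_D d1/T1; set y := A/j; move: (nm (X 1)) => z; lr.
 have a3: nm (rc j^-1*(rc B * pd_Chi d2 (- uc2 (W 1))+(ka+rc A * l%:R)))<=Bc/j.
 rewrite nmM nm_rc gtr0_norm // mulrC ler_wpM2r ?(ltW ji) //; apply: nmD_le.
 rewrite lerD2r nmM nm_rc ger0_norm // ler_wpM2l //.
 by have [_ _ -> _] := hchi _ (Wr 1 t11).
 have a4: A*Bp/j+Bc/j<=tau/64.
 rewrite -mulrDl ler_pdivrMr //; move: j3; rewrite ler_pdivrMr //; lr.
 by lr a0 a1 a2 a3 a4 CkE tau0.
have [t ht te] := hsolve E E1l E1s.
have [Wn Wre _ _] := hchi _ (Wr t ht).
have hX: pd_R d1<=re (uc1 (iter l (horner q) (W t))) := le_trans RT1 (Xre t ht).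
exists (W t); split=> //.
- by exists l.
- by lr Wre hu0.
rewrite (phiE hX) -/(X t).
have e1: rc j*(t^+e+E t)=rc j by rewrite te mulr1.
have e2: rc j*(t^+e+E t)=rc A*(X t+ps (X t))-(rc B * pd_Chi d2 (- uc2 (W t))+(ka+rc A * l%:R)).
 rewrite /E (XE t ht) !rc_f rcV; move: (Y t) (ps _) (pd_Chi _ _) => y1 y2 y3.
 by field; rewrite jn An.
rewrite /ps in e2; move: e1; rewrite e2 => <-; ring.
Qed.

(** The surplus j is removed afterwards: pulling w back n = D2 i times along the inverse branch
    lowers [phi] by n and raises [pd_Chi] by n, so the left side drops by (al1 D2 + D1) i. For this
    reason j is taken of that form. *)
Theorem solve_connection (al1 D1 D2 : nat) (ka : Cplx R) : (0<al1)%N -> (0<D2)%N -> exists w v,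
 [/\ basin d1 w, w=wc w2 mu2 (- v), Td d2<=re v &
 al1%:R * phi d1 w-D1%:R/D2%:R * pd_Chi d2 v=ka].
Proof.
move=> a0 D20; have M20 := pd_M0 d2; have R0 := Rd_gt0 d2.
have A0: 0<(al1%:R : R) by rewrite ltr0n.
have B0: 0<=(D1%:R/D2%:R : R) by rewrite divr_ge0.
have [J J0 hJ] := solve_near ka A0 B0.
have [i hi] := ex_natge J.
have hj: J<=((al1*D2+D1) * i)%:R.
 apply: (le_trans hi); rewrite ler_nat leq_pmull // addn_gt0 muln_gt0 a0 D20 //.
have [x [bx xn hx e]] := hJ _ hj.
have hxR: pd_R d2<=re (- uc2 x) by apply: le_trans hx; rewrite /Td; lra.
pose n := (D2 * i)%N; pose v := iter n (pd_G d2) (- uc2 x).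
have [g1 _ _ g4] := pd_rep d2.
have gre k: re (- uc2 x)<=re (iter k (pd_G d2) (- uc2 x)).
 by have := g1 _ hxR k; have : 0<=(k%:R : R)/2 by [rewrite divr_ge0]; lr.
have back k: iter k (horner q) (wc w2 mu2 (- iter k (pd_G d2) (- uc2 x)))=x.
 elim: k => [|k IH]; first by rewrite /= opprK (ucK d2 xn).
 have hk: pd_R d2<=re (iter k (pd_G d2) (- uc2 x)) by apply: le_trans (gre k).
 have hk1: pd_R d2<=nm (- iter k.+1 (pd_G d2) (- uc2 x)).
 by rewrite nmN; apply: le_trans (re_le _); apply: le_trans (gre k.+1).
 rewrite iterSr (q_wc (d := d2) hk1) iterS; have [hF _] := pd_inv hk.
 by rewrite /pF hF IH.
have chis k: pd_Chi d2 (iter k (pd_G d2) (- uc2 x)) = pd_Chi d2 (- uc2 x)+k%:R.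
 elim: k => [|k IH]; first by rewrite addr0.
 by rewrite iterS g4 ?IH -?addrA ?natr1 //; apply: le_trans (gre k).
exists (wc w2 mu2 (- v)), v; split=> //.
- by apply/(basin_iter d1 _ n); rewrite back.
- by apply: le_trans (gre n).
have bw: basin d1 (wc w2 mu2 (- v)) by apply/(basin_iter d1 _ n); rewrite back.
have := phi_iter n bw; rewrite back => ep.
rewrite /v chis; have ->: phi d1 (wc w2 mu2 (- v)) = phi d1 x-n%:R by rewrite ep addrK.
have D2n: (D2%:R : Cplx R)!=0 by rewrite pnatr_eq0 -lt0n.
move: e; rewrite rc_f !rc_nat natrM natrD natrM => e.
have : al1%:R * phi d1 x-D1%:R/D2%:R * pd_Chi d2 (- uc2 x)-(al1%:R*D2%:R+D1%:R) * i%:R=ka by rewrite e addrK.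
by move=> <-; rewrite /n natrM; field.
Qed.

End Connection.

(** * Orbits of the base map with prescribed phase *)

Section ZFamily.
Context {R : realType}.
Implicit Types (u v w x y z s : Cplx R).
Variables (p pt : {poly Cplx R}) (a : Cplx R) (dz : pdata pt 0 1 a).
(** The change of sign turns z - z^2 + a z^3 into the normal form x + x^2 + a x^3 with the same a;
    the coordinate -1/x is then 1/z. *)
Hypothesis hpt : forall x, pt.[x] = - p.[- x].
Local Notation Rd := (pd_R dz).
Local Notation F := (pF dz).
Local Notation Phi := (pd_Phi dz).
Local Notation g := (a - 1).

Lemma iter_inv z k : Rd<=re z^-1 -> (iter k (horner p) z)^-1 = iter k F z^-1.
Proof.
have uE x: uc 0 1 (- x)=x^-1 by rewrite /uc subr0 mul1r invrN opprK.
have itE j: iter j (horner pt) (- z) = - iter j (horner p) z.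
 by elim: j => //= j ->; rewrite hpt opprK.
by move=> h; rewrite -uE -itE (uc_iter (d := dz)) uE.
Qed.

Lemma p_taylor : exists Q r : R, [/\ 0<=Q, 0<r &
 forall z, nm z<=r -> nm (p.[z]-(z-z^+2+a*z^+3))<=Q*nm z^+4].
Proof.
have [Q Q0 hQ] := poly_bounded (pd_h dz) 1.
exists Q, 1; split=> // z hz.
have e: - p.[z]=(parab a (pd_h dz)).[- z].
 by have := pd_conj dz (- z); rewrite !subr0 mul1r divr1 add0r hpt opprK.
have e2: (parab a (pd_h dz)).[- z] = - z+(- z)^+2+a*(- z)^+3+(pd_h dz).[- z]*(- z)^+4.
 by rewrite /parab !(hornerD, hornerM, hornerZ, hornerX, hornerXn).
have ->: p.[z]-(z-z^+2+a*z^+3) = - ((pd_h dz).[- z]*z^+4).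
 have ->: p.[z] = - - p.[z] by rewrite opprK.
 by rewrite e e2; ring.
by rewrite nmN nmM nmX ler_wpM2r ?exprn_ge0 ?nm_ge0 // hQ // nmN.
Qed.

Definition Tz := Rd+4 * pd_D dz.

Lemma Tz_ge : Rd<=Tz.
Proof. by rewrite /Tz; have := pd_D0 dz; lra. Qed.

Lemma Phi_iso u v : Tz<=re u -> Tz<=re v -> nm (Phi u-Phi v-(u-v))<=1/4*nm (u-v).
Proof.
have D0 := pd_D0 dz; have R0 := Rd_gt0 dz; move=> hu hv; have [_ _ h _] := pd_attr dz.
apply: (le_trans (h Tz u v Tz_ge hu hv)); rewrite ler_wpM2r ?nm_ge0 //.
by rewrite ler_pdivrMr /Tz; lra.
Qed.

Lemma Phi_inj u v : Tz<=re u -> Tz<=re v -> Phi u = Phi v -> u=v.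
Proof.
move=> hu hv e; have := Phi_iso hu hv; rewrite e subrr sub0r nmN => h.
by apply/eqP; rewrite -subr_eq0 -nm_eq0 eq_le nm_ge0 andbT; lra.
Qed.

(** [Phi] minus the identity has Lipschitz constant 1/4, so u is a fixed point in a disc around k +
    s; for large k this disc lies in the half-plane where the estimate holds. *)
Lemma Phi_surj S : exists X : R, forall k : nat, X<=k%:R -> exists B, forall s, nm s<=S ->
 exists u, [/\ Tz<=re u, nm u<=B & Phi u=k%:R+s].
Proof.
have T0: 0<Tz by apply: lt_le_trans (Rd_gt0 dz) Tz_ge.
pose c0 := nm (Phi (rc Tz)-rc Tz); have c00: 0<=c0 := nm_ge0 _.
exists (4*(c0+Tz + `|S|)) => k hk; exists (2*k%:R+4*(c0+Tz + `|S|)) => s sS.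
have S0 := normr_ge0 S; have SS := ler_norm S.
set v := k%:R+s.
have nv: nm v<=k%:R + `|S| by apply: nmD_le; rewrite nm_nat; lra.
have rv: k%:R - `|S| <= re v by rewrite /v reD re_nat; have := re_geN s; lra.
pose r := 2*(c0+1/4*nm (v-rc Tz)).
have nT: nm (v-rc Tz)<=k%:R + `|S|+Tz.
 by apply: nmB_le; rewrite nm_rc gtr0_norm //; lra.
have rr: r<=k%:R/2+2*c0 + `|S| / 2+Tz/2 by rewrite /r; lr nT.
have reb x: nm (x-v)<=r -> Tz<=re x.
 by move=> hx; have := re_geN (x-v); rewrite reB; lr hx rr rv S0 hk T0.
have reT: Tz<=re (rc Tz) by rewrite -[rc Tz]mulr1 re_rcM re1 mulr1.
have rvT: Tz<=re v by lr rv S0 hk c00 T0.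
have [|| u hu fu] := @cbanach R (fun u => v-(Phi u-u)) v r.
- move=> x y hx hy; have ->: v-(Phi x-x)-(v-(Phi y-y)) = - (Phi x-Phi y-(x-y)) by ring.
 rewrite nmN; have := Phi_iso (reb x hx) (reb y hy); have := nm_ge0 (x-y); lr.
- have ->: v-(Phi v-v)-v = - ((Phi v-Phi (rc Tz)-(v-rc Tz))+(Phi (rc Tz)-rc Tz)) by ring.
 rewrite nmN; apply: nmD_le; rewrite -/c0; have := Phi_iso rvT reT; rewrite /r; lr.
exists u; split; first exact: reb.
 have := nmD (u-v) v; rewrite subrK; lr hu rr nv S0 hk c00 T0.
have : Phi u=v-(v-(Phi u-u))+u by ring.
by rewrite fu => ->; ring.
Qed.

(** All orbits start at one time k0, at the point with [Phi] equal to k0 + s, so that the index is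
    the time to which the phase s refers. The last clause provides an open set of initial values:
    every z near [zs] is the N-th term of such an orbit with s near s0. *)
Lemma z_family s0 : exists (kb : nat) (Cz Q : R) (zz : Cplx R -> nat -> Cplx R),
 [/\ (0<kb)%N, 0<=Cz, 0<=Q,
 forall s, nm (s-s0)<=1 -> zdata a Q Cz s (zz s) kb /\ (forall k, (kb<=k)%N -> zz s k.+1 = p.[zz s k]) &
 forall eta N, 0<eta -> (kb<=N)%N -> exists zs de, 0<de /\
 forall z, nm (z-zs)<=de -> exists2 s, nm (s-s0)<=Num.min eta 1 & z=zz s N].
Proof.
have D0 := pd_D0 dz; have R0 := Rd_gt0 dz; have R10 := pd_R1 dz.
have [Q [rQ [Q0 rQ0 hQ]]] := p_taylor; have TR := Tz_ge; have g0 := nm_ge0 g.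
pose S := nm s0+1; have [X hX] := Phi_surj S.
have [k0' hk0'] := ex_natge X; pose k0 := k0'.+1.
have k0X: X<=k0%:R by apply: (le_trans hk0'); rewrite ler_nat.
have [B hB] := hX k0 k0X.
have sS s: nm (s-s0)<=1 -> nm s<=S by move=> h; have := nmD (s-s0) s0; rewrite subrK /S; lra.
have hex s: exists u, nm s<=S -> [/\ Tz<=re u, nm u<=B & Phi u=k0%:R+s].
 have [h|h] := leP (nm s) S; last by exists 0.
 by have [u hu] := hB s h; exists u.
have [ub hub] := choice hex.
have B0: 0<=B by have [|_ h _] := hub 0; [rewrite nm0 addr_ge0 ?nm_ge0|apply: le_trans (nm_ge0 _) h].
pose zz s k := iter (k-k0) (horner p) (ub s)^-1.
pose Cz := pd_D dz*(1+B)*2+2*k0%:R*nm g.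
have Cz0: 0<=Cz.
 apply: addr_ge0; apply: mulr_ge0 => //.
 by apply: mulr_ge0 => //; exact: addr_ge0.
have zi s k: nm s<=S -> (zz s k)^-1 = iter (k-k0) F (ub s).
 by move=> h; have [h1 _ _] := hub s h; rewrite iter_inv invrK //; lr h1 TR.
have zest s k: nm s<=S -> (2*k0<=k)%N -> nm ((zz s k)^-1-(k%:R-g*rc (ln k%:R)+s))<=Cz * isq k.
 move=> h hk; have [h1 h2 h3] := hub s h; rewrite zi //.
 have kk: (k0<=k)%N by move: hk; clear; lia.
 have kp: (0<k)%N by apply: leq_trans kk.
 have kk0: (0<k-k0)%N by rewrite subn_gt0; move: hk; rewrite /k0; clear; lia.
 have [_ hf _ _] := pd_attr dz; have := hf (ub s) _ ltac:(lr h1 TR) kk0; rewrite h3 -/F => h4.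
 have ->: iter (k-k0) F (ub s)-(k%:R-g*rc (ln k%:R)+s) =
 (iter (k-k0) F (ub s)-(k-k0)%:R+g*rc (ln (k-k0)%:R)-(k0%:R+s))-g*rc (ln (k-k0)%:R-ln k%:R).
 by rewrite natrB // rcB; ring.
 apply: nmB_le; rewrite /Cz [leRHS]mulrDl; apply: lerD.
 apply: (le_trans h4); rewrite -[leRHS]mulrA; apply: ler_pM.
 - by rewrite mulr_ge0 // addr_ge0 ?nm_ge0.
 - exact: isq_ge0.
 - by rewrite ler_wpM2l // lerD2l.
 - rewrite -(@ler_pXn2r _ 2) ?nnegrE ?mulr_ge0 ?isq_ge0 // exprMn !expr2 !isq_sq //.
 rewrite ler_pdivlMr ?ltr0n // mulrC ler_pdivrMr ?ltr0n //.
 by rewrite -!natrM ler_nat; move: hk; clear; lia.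
 rewrite nmM nm_rc mulrC [leRHS]mulrAC; apply: ler_wpM2r => //.
 apply: le_trans (ln_sub_est hk kp) _; rewrite -mulrA -[leRHS]mulrA ler_wpM2l // ler_wpM2l //.
 exact: invn_le_isq.
have zre s k: nm s<=S -> Tz+(k-k0)%:R/2<=re (zz s k)^-1.
 move=> h; have [h1 _ _] := hub s h; rewrite zi //; have [hf _ _ _] := pd_attr dz.
 by have := hf (ub s) ltac:(lr h1 TR) (k-k0)%N; rewrite -/F; lr h1.
have [k2 hk2] := ex_natge (2*rQ^-1).
exists (2*k0+k2+2)%N, Cz, Q, zz; split=> //.
 move=> s hs; have h := sS s hs; have nxt k: (k0<=k)%N -> zz s k.+1 = p.[zz s k].
 by move=> kk; rewrite /zz subSn.
 split; last by move=> k kk; apply: nxt; move: kk; clear; lia.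
 move=> k kk; split; first by apply: zest => //; move: kk; clear; lia.
 rewrite nxt; last by move: kk; clear; lia.
 apply: hQ; have h1 := zre s k h; have h2 := re_le (zz s k)^-1.
 have h3: (k2%:R : R)<=(k-k0)%:R by rewrite ler_nat; move: kk; clear; lia.
 have h4: rQ^-1<=nm (zz s k)^-1 by lr h1 h2 h3 hk2 TR R0.
 have ri: 0<rQ^-1 by rewrite invr_gt0.
 by rewrite -[nm _]invrK -nmV -[leRHS]invrK lef_pV2 ?posrE // (lt_le_trans ri).
move=> eta N eta0 hN; have s00: nm s0<=S by rewrite /S; lr.
set zs := zz s0 N; have h1 := zre s0 N s00; rewrite -/zs in h1.
have N2: 1<=(N-k0)%:R/2 :> R.
 have : (2%:R : R)<=(N-k0)%:R by rewrite ler_nat; move: hN; clear; lia.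
 by lr.
set U := nm zs^-1; have U0: 0<U by have := re_le zs^-1; rewrite -/U; lr N2 h1 TR R0.
have zs0: zs!=0 by rewrite -invr_eq0 -nm_gt0.
pose e1 := Num.min 1 (Num.min eta 1/(2+pd_D dz)).
have em: 0<Num.min eta 1 by rewrite lt_min eta0 ltr01.
have D20: 0<2+pd_D dz by lr D0.
have e10: 0<e1 by rewrite lt_min ltr01 divr_gt0.
pose de := Num.min ((2*U)^-1) (e1/(2*U^+2)).
have U20: 0<2*U^+2 by rewrite mulr_gt0 // exprn_gt0.
exists zs, de; split; first by rewrite lt_min invr_gt0 mulr_gt0 // divr_gt0.
move=> z hz.
have hz1: nm (z-zs)*U<=1/2.
 have : nm (z-zs)<=(2*U)^-1 by apply: (le_trans hz); rewrite ge_min lexx.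
 rewrite -[_^-1]div1r ler_pdivlMr ?mulr_gt0 //; lr.
have hz2: 2*U^+2*nm (z-zs)<=e1.
 have : nm (z-zs)<=e1/(2*U^+2) by apply: (le_trans hz); rewrite ge_min lexx orbT.
 by rewrite ler_pdivlMr // mulrC.
have [z0 h2] := inv_close zs0 (lexx _) hz1.
have h3: nm (z^-1-zs^-1)<=e1 := le_trans h2 hz2.
have e1le: e1<=1 by rewrite ge_min lexx.
have e1le2: (2+pd_D dz)*e1<=Num.min eta 1 by rewrite mulrC -ler_pdivlMr // ge_min lexx orbT.
have rez: Tz<=re z^-1 by have := re_geN (z^-1-zs^-1); rewrite reB; lr e1le h3 N2 h1.
have kN: (k0<=N)%N by move: hN; clear; lia.
have PhiN s: nm s<=S -> Phi (zz s N)^-1=N%:R+s.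
 move=> h; have [b1 _ b3] := hub s h.
 by rewrite zi // (Phi_shift _ (le_trans TR b1)) b3 natrB //; ring.
have rezs: Tz<=re zs^-1 by lr h1 N2.
have := Phi_iso rez rezs; rewrite (PhiN s0 s00) => h4.
pose s := Phi z^-1-N%:R.
have hs: nm (s-s0)<=Num.min eta 1.
 have ->: s-s0=(Phi z^-1-(N%:R+s0)-(z^-1-zs^-1))+(z^-1-zs^-1) by rewrite /s; ring.
 apply: nmD_le; apply: le_trans e1le2; have := mulr_ge0 D0 (ltW e10).
 by lr h3 h4 e10.
exists s => //; have s1: nm s<=S by apply: sS; apply: (le_trans hs); rewrite ge_min lexx orbT.
apply: invr_inj; apply: Phi_inj => //.
 by apply: le_trans (zre s N s1); rewrite lerDl divr_ge0.
by rewrite PhiN // /s; ring.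
Qed.

End ZFamily.

(** * The limit return map and its critical fixed point *)

Section ReturnMap.
Context {R : realType}.
Implicit Types (u v w x y z s : Cplx R).
Variables (p pt : {poly Cplx R}) (f : Cplx R -> Cplx R -> Cplx R) (q : {poly Cplx R}) (w1 w2 a : Cplx R) (al1 al2 : nat).
Variables (dz : pdata pt 0 1 a) (T1 : transit (horner p) f q w1 a al1) (T2 : transit (horner p) f q w2 a al2).
Hypothesis hpt : forall x, pt.[x] = - p.[- x].
Hypothesis w12 : w1 != w2.
Local Notation d1 := (t_d T1).
Local Notation d2 := (t_d T2).

Lemma basin_disjoint x : basin d1 x -> basin d2 x -> False.
Proof.
move=> b1 b2; have n12: 0<nm (w1-w2) by rewrite nm_gt0 subr_eq0.
have h: 0<nm (w1-w2)/3 by rewrite divr_gt0.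
have [N1 hN1] := basin_cvg b1 h; have [N2 hN2] := basin_cvg b2 h.
have := hN1 (N1+N2)%N (leq_addr _ _); have := hN2 (N1+N2)%N (leq_addl _ _).
have := nm_tri (iter (N1+N2) (horner q) x) w1 w2; rewrite (nmC w1 (iter _ _ _)); lra.
Qed.

(** The exit from w1 must be at a preimage of c on the repelling side of w1, which fixes v1. The
    unknowns are v2 and s0, and both exit equations are affine in s0. Eliminating s0 leaves the
    equation of [solve_connection]; s0 is then read off from the equation at w2. *)
Lemma matching (C1 C2 : Cplx R) : exists c m v1 v2 s0,
 [/\ basin d2 c, q^`().[c] = 0, iter m (horner q) (wc w1 (t_mu T1) (- v1))=c & basin d1 (wc w2 (t_mu T2) (- v2))] /\
 [/\ Td d1<=re v1, Td d2<=re v2,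
 - pd_Chi d2 v2=al2%:R * phi d2 c+(1-al2%:R)*s0+C2 &
 - pd_Chi d1 v1=al1%:R * phi d1 (wc w2 (t_mu T2) (- v2))+(1-al1%:R)*s0+C1].
Proof.
have [c bc qc] := critical_in_basin d2; have M10 := pd_M0 d1.
have cw1: c != w1 by have := basin_fix_neq d1 w12 0 bc.
have RT: pd_R d1<=Td d1 by rewrite /Td; lra.
have [r r0 hr] := near_parabolic RT.
have [y [m [hy1 hy2]]] := preimages_near d1 cw1 r0.
have yn: y != w1.
 by apply: contraNneq cw1 => e; rewrite -hy2 e (iter_fix d1).
have hy: re (uc w1 (t_mu T1) y) <= - Td d1.
 have [b|//] := hr y yn hy1; exfalso; apply: (@basin_disjoint c) => //.
 by rewrite -hy2; apply/basin_iter.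
pose v1 := - uc w1 (t_mu T1) y.
have a1: (1<al1)%N := t_al T1; have a2: (1<al2)%N := t_al T2.
have D20: (0<al2 - 1)%N by rewrite subn_gt0.
pose D1 : Cplx R := (al1 - 1)%:R; pose D2 : Cplx R := (al2 - 1)%:R.
have [w [v2 [bw ew hv2 e]]] := @solve_connection R q w1 w2 _ _ a d1 d2 w12 al1 (al1 - 1) (al2 - 1)
 (- pd_Chi d1 v1-C1+D1/D2*(al2%:R * phi d2 c+C2)) (ltnW a1) D20.
have D2n: D2!=0 by rewrite pnatr_eq0 -lt0n.
have eD1: D1=al1%:R - 1 by rewrite /D1 natrB // ltnW.
have eD2: D2=al2%:R - 1 by rewrite /D2 natrB // ltnW.
pose s0 := (al2%:R * phi d2 c+C2+pd_Chi d2 v2)/D2.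
exists c, m, v1, v2, s0; split; split=> //.
- by rewrite /v1 opprK (ucK d1).
- by rewrite -ew.
- by rewrite (reN (uc w1 _ y)); lr hy.
- have ->: 1-al2%:R = - D2 by rewrite eD2; ring.
 by rewrite /s0; field.
- have ->: 1-al1%:R = - D1 by rewrite eD1; ring.
 rewrite -ew -/D1 -/D2 in e *.
 have ->: al1%:R * phi d1 w = - pd_Chi d1 v1-C1+D1/D2*(al2%:R * phi d2 c+C2)+D1/D2 * pd_Chi d2 v2.
 by rewrite -e; ring.
 by rewrite /s0; field.
Qed.

(** All contributions are kept at order r^2: the variation of [phi] at the critical point, the
    variation of s, and the error allowed in each passage. The constant G gathers the Lipschitz
    factors on the way back to c, and r G <= 1 closes the loop. r is chosen before the precision
    [eps] of the last clause. *)
Theorem return_map : exists (c s0 : Cplx R) (m : nat), forall Q Cz, 0<=Q -> 0<=Cz ->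
 exists r : R, 0<r /\ (exists n0 B, (0<n0)%N /\ forall n s (z w : nat -> Cplx R),
 (n0<=n)%N -> nm (s-s0)<=r^+2 -> zdata a Q Cz s z n ->
 (forall k, (n<=k)%N -> z k.+1 = p.[z k]) -> (forall k, (n<=k)%N -> w k.+1=f (z k) (w k)) ->
 nm (w n-c)<=r ->
 nm (w (al1*(al2*n)+m)%N-c)<=r /\
 (forall k, (n<=k<=al1*(al2*n)+m)%N -> nm (w k)<=B)) /\
 (forall eps, 0<eps -> exists K n0, forall n s (z w : nat -> Cplx R),
 (n0<=n)%N -> nm (s-s0)<=r^+2 -> zdata a Q Cz s z n ->
 (forall k, (n<=k)%N -> z k.+1 = p.[z k]) -> (forall k, (n<=k)%N -> w k.+1=f (z k) (w k)) ->
 nm (w n-c)<=r ->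
 (forall k, (n+K<=k)%N -> (k+K<=al2*n)%N -> nm (w k-w2)<=eps) /\
 (forall k, (al2*n+K<=k)%N -> (k+K<=al1*(al2*n))%N -> nm (w k-w1)<=eps)).
Proof.
have [C1 h1] := passage_near T1; have [C2 h2] := passage_near T2.
have [c [m [v1 [v2 [s0 [[bc qc ey1 by2] [hv1 hv2 e2 e1]]]]]]] := matching C1 C2.
set y1 := wc w1 (t_mu T1) (- v1) in ey1 e1; set y2 := wc w2 (t_mu T2) (- v2) in by2 e1.
exists c, s0, m => Q Cz Q0 Cz0.
have [r1 [L1 [r10 L10 p1]]] := h1 y2 v1 s0 Q Cz by2 hv1 Q0 Cz0 e1.
have [r2 [L2 [r20 L20 p2]]] := h2 c v2 s0 Q Cz bc hv2 Q0 Cz0 e2.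
have [rf [Lf [Df [Kf [rf0 Lf0 _ _ hf]]]]] := basin_coord by2.
have [rc' [Lc [rc0 Lc0 hc]]] := phi_crit bc qc.
have [By hBy] := orbit_bounded q m (nm y1).
have [M M1 hM] := shadow T1 (By+1) m.
have M0: 0<=M by lr M1.
pose G := M*(L1*Lf*(L2*(Lc+1)+1)+L1+1)+1.
pose H := L2*(Lc+1)+1.
have H0: 0<=H by rewrite addr_ge0 // mulr_ge0 // addr_ge0.
have H1: 0<=L1*Lf*H+L1+1 by rewrite addr_ge0 // addr_ge0 // !mulr_ge0.
have eG: G=M*(L1*Lf*H+L1+1)+1 by [].
have G0: 0<G by rewrite eG ltr_wpDl // mulr_ge0.
pose rm := Num.min r1 rf; have rm0: 0<rm by rewrite lt_min r10.
pose r := Num.min (Num.min (Num.min r2 rc') (G^-1)) (Num.min (Num.min 1 rm) (rm/(H+1))).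
have H20: 0<H+1 by lr H0.
have r0: 0<r by rewrite !lt_min r20 rc0 invr_gt0 G0 ltr01 r10 rf0 divr_gt0.
have rr2: r<=r2 by rewrite !ge_min lexx.
have rrc: r<=rc' by rewrite !ge_min lexx orbT.
have rG: r*G<=1.
 by rewrite -ler_pdivlMr // div1r !ge_min lexx !orbT.
have r11: r<=1 by rewrite !ge_min lexx !orbT.
have rrm: r<=rm by rewrite ge_min; apply/orP; right; rewrite ge_min; apply/orP; left; rewrite ge_min lexx orbT.
have rH: r*(H+1)<=rm.
 by rewrite -ler_pdivlMr // ge_min; apply/orP; right; rewrite ge_min lexx orbT.
have rsq: r^+2<=r by rewrite expr2 ler_piMl // ltW.
have rsq0: 0<r^+2 by rewrite exprn_gt0.
have rmr1: rm<=r1 by rewrite ge_min lexx.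
have rmrf: rm<=rf by rewrite ge_min lexx orbT.
have [K1 [n1 [B1 [n10 q1]]]] := p1 (r^+2) rsq0.
have [K2 [n2 [B2 [n20 q2]]]] := p2 (r^+2) rsq0.
have a1: (1<al1)%N := t_al T1; have a2: (1<al2)%N := t_al T2.
(* First passage: the quadratic behaviour of [phi d2] at [c] gives an error of order [r ^+ 2]. *)
have first n s (z w: nat -> Cplx R) : (n2<=n)%N -> nm (s-s0)<=r^+2 -> zdata a Q Cz s z n ->
 (forall k, (n<=k)%N -> z k.+1 = p.[z k]) -> (forall k, (n<=k)%N -> w k.+1=f (z k) (w k)) ->
 nm (w n-c)<=r -> nm (w (al2*n)%N-y2)<=H*r^+2 /\ nm (w (al2*n)%N-y2)<=rm.
 move=> nn hs hz hp hw hwc.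
 have [l _ _] := q2 n s z w nn (le_trans hs (le_trans rsq rr2)) hz hp hw (le_trans hwc rr2).
 have E: nm (w (al2*n)%N-y2)<=H*r^+2.
 apply: (le_trans l); rewrite /H mulrDl mul1r lerD2r -mulrA ler_wpM2l // mulrDl mul1r lerD //.
 by apply: (le_trans (hc _ (le_trans hwc rrc))); rewrite ler_wpM2l // ler_pXn2r ?nnegrE ?nm_ge0 // ltW.
 split=> //; apply: (le_trans E); apply: le_trans rH; rewrite mulrC.
 by apply: ler_pM => //; [exact: ltW|rewrite lerDl].
exists r; split=> //; split.
 have [CZ [k1 [CZ0 k10 hZ]]] := Z_est (a - 1) (addr_ge0 (nm_ge0 s0) ler01) Cz0.
 pose e := r/M; have Mp: 0<M by apply: lt_le_trans M1.
 have e0: 0<e by rewrite divr_gt0.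
 have [n3 n30 hn3] := nat_ge (2/e).
 exists (maxn (maxn n1 n2) (maxn k1 n3)), (B1+B2+(By+1)); split; first by rewrite !leq_max n10.
 move=> n s z w nn hs hz hp hw hwc.
 have [n1n n2n k1n n3n]: [/\ (n1<=n)%N, (n2<=n)%N, (k1<=n)%N & (n3<=n)%N].
 by move: nn; rewrite !geq_max => /andP[/andP[-> ->] /andP[-> ->]].
 have n0: (0<n)%N by apply: leq_trans n1n.
 have nn2: (n<=al2*n)%N by rewrite leq_pmull // ltnW.
 have nn1: (al2*n<=al1*(al2*n))%N by rewrite leq_pmull // ltnW.
 have [E2 E2m] := first n s z w n2n hs hz hp hw hwc.
 set n' := (al2*n)%N in nn2 nn1 E2 E2m *.
 have hz': zdata a Q Cz s z n' by move=> k kk; apply: hz; apply: leq_trans kk.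
 have hp' k: (n'<=k)%N -> z k.+1 = p.[z k] by move=> kk; apply: hp; apply: leq_trans kk.
 have hw' k: (n'<=k)%N -> w k.+1=f (z k) (w k) by move=> kk; apply: hw; apply: leq_trans kk.
 have hs1: nm (s-s0)<=r1 by apply: (le_trans hs); apply: (le_trans rsq); apply: (le_trans rrm).
 have [l2 b2 _] := q1 n' s z w (leq_trans n1n nn2) hs1 hz' hp' hw' (le_trans E2m rmr1).
 set N := (al1*n')%N in nn1 l2 b2 *.
 have [_ _ lf _] := hf _ (le_trans E2m rmrf).
 have E3: nm (w N-y1)<=(L1*Lf*H+L1+1)*r^+2.
 apply: (le_trans l2); rewrite mulrDl mul1r lerD2r mulrDl mulrDr; apply: lerD; last by rewrite ler_wpM2l.
 rewrite -!mulrA ler_wpM2l //; via (Lf*nm (w n'-y2)); last by rewrite ler_wpM2l.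
 by apply: lf; rewrite subrr nm0 ltW.
 have E3': nm (w N-y1)<=e.
 apply: (le_trans E3); rewrite ler_pdivlMr //.
 have : (M*(L1*Lf*H+L1+1))*r<=1.
 by move: rG; rewrite eG mulrDr mulr1 mulrC; lr r0.
 move=> h; have := ler_wpM2r (ltW r0) h; rewrite mul1r expr2; move: (L1*Lf*H+L1+1) => y; lr.
 have Me: M*e=r by rewrite /e mulrCA mulfV ?mulr1 // gt_eqF.
 have zk k: (n<=k)%N -> nm (z k)<=e.
 move=> nk; have sS: nm s<=nm s0+1.
 by have := nmD (s-s0) s0; rewrite subrK; lr hs rsq r11.
 have [_ _ _ h _] := hZ k s (z k) (leq_trans k1n nk) sS (hz k nk).1.
 apply: (le_trans h); have kp: 0<(k%:R : R) by rewrite ltr0n (leq_trans n0).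
 rewrite ler_pdivrMr // mulrC -ler_pdivrMr //; apply: (le_trans (hn3 n n3n)); by rewrite ler_nat.
 have sh := hM z w y1 e N (ltW e0) ltac:(by rewrite Me).
 have {}sh j: (j<=m)%N -> nm (w (N+j)%N-iter j (horner q) y1)<=r.
 rewrite -Me; apply: sh.
 - by move=> i _; apply: zk; apply: leq_trans nn2 (leq_trans nn1 (leq_addr _ _)).
 - by move=> i _; apply: hw; apply: leq_trans nn2 (leq_trans nn1 (leq_addr _ _)).
 - exact: E3'.
 - by move=> i im; rewrite lerD2r; exact: hBy.
 split; first by rewrite -ey1; exact: sh.
 have pos2: 0<=B2.
 have [_ b _] := q2 n s z w n2n (le_trans hs (le_trans rsq rr2)) hz hp hw (le_trans hwc rr2).
 by apply: le_trans (nm_ge0 _) (b n _); rewrite leqnn.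
 have pos1: 0<=B1 by apply: le_trans (nm_ge0 _) (b2 n' _); rewrite leqnn.
 have posy: 0<=By by apply: le_trans (nm_ge0 _) (hBy y1 0%N (lexx _) _).
 move=> k /andP[nk kN]; have [k2|k2] := leqP k n'.
 have [_ b _] := q2 n s z w n2n (le_trans hs (le_trans rsq rr2)) hz hp hw (le_trans hwc rr2).
 apply: le_trans (b k _) _; first by rewrite nk.
 by lr pos1 posy.
 have [k3|k3] := leqP k N.
 apply: le_trans (b2 k _) _; first by rewrite (ltnW k2).
 by lr pos2 posy.
 have jm: (k-N<=m)%N by rewrite leq_subLR.
 have := sh _ jm; have := hBy y1 _ (lexx _) jm; rewrite subnKC ?(ltnW k3) //.
 have := nmD (w k-iter (k-N) (horner q) y1) (iter (k-N) (horner q) y1); rewrite subrK.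
 by lr pos1 pos2 r11.
move=> eps eps0.
have [K3 [n3 [B3 [n30 q3]]]] := p1 eps eps0.
have [K4 [n4 [B4 [n40 q4]]]] := p2 eps eps0.
exists (maxn K3 K4), (maxn n2 (maxn n3 n4)) => n s z w nn hs hz hp hw hwc.
have [n2n n3n n4n]: [/\ (n2<=n)%N, (n3<=n)%N & (n4<=n)%N].
 by move: nn; rewrite !geq_max => /and3P[-> -> ->].
have nn2: (n<=al2*n)%N by rewrite leq_pmull // ltnW.
have [E2 E2m] := first n s z w n2n hs hz hp hw hwc.
split.
 have [_ _ h] := q4 n s z w n4n (le_trans hs (le_trans rsq rr2)) hz hp hw (le_trans hwc rr2).
 move=> k h1' h2'; apply: h; [apply: leq_trans h1'|apply: leq_trans h2']; by rewrite leq_add2l leq_maxr.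
set n' := (al2*n)%N in nn2 E2 E2m *.
have hz': zdata a Q Cz s z n' by move=> k kk; apply: hz; apply: leq_trans kk.
have hp' k: (n'<=k)%N -> z k.+1 = p.[z k] by move=> kk; apply: hp; apply: leq_trans kk.
have hw' k: (n'<=k)%N -> w k.+1=f (z k) (w k) by move=> kk; apply: hw; apply: leq_trans kk.
have hs1: nm (s-s0)<=r1 by apply: (le_trans hs); apply: (le_trans rsq); apply: (le_trans rrm).
have [_ _ h] := q3 n' s z w (leq_trans n3n nn2) hs1 hz' hp' hw' (le_trans E2m rmr1).
move=> k h1' h2'; apply: h; [apply: leq_trans h1'|apply: leq_trans h2']; by rewrite leq_add2l leq_maxl.
Qed.

End ReturnMap.

(** * A box with prescribed visiting times *)

Section WanderingBox.
Context {R : realType}.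
Implicit Types (u v w x y z s : Cplx R).
Variables (p pt : {poly Cplx R}) (f : Cplx R -> Cplx R -> Cplx R) (q : {poly Cplx R}) (w1 w2 a : Cplx R) (al1 al2 : nat).
Variables (dz : pdata pt 0 1 a) (T1 : transit (horner p) f q w1 a al1) (T2 : transit (horner p) f q w2 a al2).
Hypothesis hpt : forall x, pt.[x] = - p.[- x].
Hypothesis w12 : w1 != w2.

Definition skewf (x : C2 R) : C2 R := (p.[x.1], f x.1 x.2).

(* The times [N_j] at which the orbit returns close to the critical point of the limit map. *)
Fixpoint rtime (m N0 j : nat) : nat := if j is i.+1 then (al1*(al2*rtime m N0 i)+m)%N else N0.

Lemma rtime_step m N0 j : (rtime m N0 j.+1=al1*(al2*rtime m N0 j)+m)%N.
Proof. by []. Qed.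

Lemma rtime_double m N0 j : (2*rtime m N0 j<=rtime m N0 j.+1)%N.
Proof.
have a1: (1<al1)%N := t_al T1; have a2: (1<al2)%N := t_al T2.
by rewrite rtime_step (leq_trans _ (leq_addr _ _)) // leq_mul // leq_pmull // ltnW.
Qed.

Lemma rtime_ge m N0 j : (0<N0)%N -> (N0+j<=rtime m N0 j)%N.
Proof.
move=> N00; elim: j => [|j IH]; first by rewrite addn0.
by apply: leq_trans (rtime_double m N0 j); move: IH N00; clear; lia.
Qed.

(** An orbit starts at time N0, so the iterate of order k belongs to time k + N0. K bounds the index
    j from below and is also the margin at both ends of the stay, so the condition becomes stronger
    as K grows. *)
Definition block2 m N0 (K k : nat) := exists2 j, (K<=j)%N &
 ((rtime m N0 j+K<=k+N0)%N /\ (k+N0+K<=al2*rtime m N0 j)%N).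
Definition block1 m N0 (K k : nat) := exists2 j, (K<=j)%N &
 ((al2*rtime m N0 j+K<=k+N0)%N /\ (k+N0+K<=al1*(al2*rtime m N0 j))%N).

(** No images of boxes are followed: each orbit is written as a member of [z_family], with one s for
    all times, and closeness to c passes from each N_j to the next by [return_map]. *)
Theorem wandering_box : exists (m N0 : nat) (zs c : Cplx R) (r B : R), [/\ (0<N0)%N, 0<r,
 forall x : C2 R, nm (x.1-zs)<=r -> nm (x.2-c)<=r ->
 forall k, nm (iter k skewf x).1<=B /\ nm (iter k skewf x).2<=B,
 forall e, 0<e -> exists K, forall k, block2 m N0 K k -> forall x : C2 R, nm (x.1-zs)<=r -> nm (x.2-c)<=r ->
 nm (iter k skewf x).1<=e /\ nm ((iter k skewf x).2-w2)<=e &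
 forall e, 0<e -> exists K, forall k, block1 m N0 K k -> forall x : C2 R, nm (x.1-zs)<=r -> nm (x.2-c)<=r ->
 nm (iter k skewf x).1<=e /\ nm ((iter k skewf x).2-w1)<=e].
Proof.
have [c [s0 [m hret]]] := return_map T1 T2 w12.
have [kb [Cz [Q [zz [kb0 Cz0 Q0 hzz hnear]]]]] := z_family dz hpt s0.
have [r [r0 [[n0 [B [n00 hret1]]] hret2]]] := hret Q Cz Q0 Cz0.
have [CZ [k1 [CZ0 k10 hZ]]] := Z_est (a - 1) (addr_ge0 (nm_ge0 s0) ler01) Cz0.
pose N0 := maxn (maxn kb n0) k1.
have [N0b N0n N0k]: [/\ (kb<=N0)%N, (n0<=N0)%N & (k1<=N0)%N] by rewrite /N0 !leq_max !leqnn !orbT.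
have N00: (0<N0)%N by apply: leq_trans N0n.
have rsq0: 0<r^+2 by nneg.
have [zs [de [de0 hde]]] := hnear (r^+2) N0 rsq0 N0b.
pose r' := Num.min r de; have r'0: 0<r' by rewrite lt_min r0.
pose N := rtime m N0.
have NN j: (N0<=N j)%N by apply: leq_trans (rtime_ge m j N00); rewrite leq_addr.
have orb (x: C2 R) : nm (x.1-zs)<=r' -> nm (x.2-c)<=r' -> exists s (z w : nat -> Cplx R),
 [/\ nm (s-s0)<=r^+2 /\ nm (s-s0)<=1, zdata a Q Cz s z N0, (forall k, (N0<=k)%N -> z k.+1 = p.[z k]),
 (forall k, (N0<=k)%N -> w k.+1=f (z k) (w k)) & nm (w N0-c)<=r /\ 
 forall k, iter k skewf x=(z (N0+k)%N, w (N0+k)%N)].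
 move=> h1 h2; have [|s hs ez] := hde x.1; first by apply: (le_trans h1); rewrite ge_min lexx orbT.
 have hs1: nm (s-s0)<=1 by apply: (le_trans hs); rewrite ge_min lexx orbT.
 have [zd zp] := hzz s hs1.
 have e k: (iter k skewf x).1=zz s (N0+k)%N.
 elim: k => [|k IH]; first by rewrite addn0.
 by rewrite iterS /skewf /= IH addnS zp // (leq_trans N0b) ?leq_addr.
 exists s, (zz s), (fun k => (iter (k-N0) skewf x).2); split.
 - by split=> //; apply: (le_trans hs); rewrite ge_min lexx.
 - by move=> k kk; apply: zd; apply: leq_trans kk.
 - by move=> k kk; apply: zp; apply: leq_trans kk.
 - by move=> k kk; rewrite subSn // iterS /skewf /= e subnKC.
 split; first by rewrite subnn /=; apply: (le_trans h2); rewrite ge_min lexx.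
 by move=> k; rewrite addKn -e -surjective_pairing.
have sub s (z w: nat -> Cplx R) n : (N0<=n)%N -> zdata a Q Cz s z N0 -> (forall k, (N0<=k)%N -> z k.+1 = p.[z k]) ->
 (forall k, (N0<=k)%N -> w k.+1=f (z k) (w k)) ->
 [/\ zdata a Q Cz s z n, forall k, (n<=k)%N -> z k.+1 = p.[z k] & forall k, (n<=k)%N -> w k.+1=f (z k) (w k)].
 move=> nn h1 h2 h3; split=> k kk; [apply: h1|apply: h2|apply: h3]; exact: leq_trans kk.
have rec s (z w: nat -> Cplx R) : nm (s-s0)<=r^+2 -> zdata a Q Cz s z N0 ->
 (forall k, (N0<=k)%N -> z k.+1 = p.[z k]) -> (forall k, (N0<=k)%N -> w k.+1=f (z k) (w k)) ->
 nm (w N0-c)<=r -> forall j, nm (w (N j)-c)<=r.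
 move=> hs h1 h2 h3 h4; elim=> [|j IH] //.
 have [s1 s2 s3] := sub s z w _ (NN j) h1 h2 h3.
 by have [] := hret1 (N j) s z w (leq_trans N0n (NN j)) hs s1 s2 s3 IH.
have loc k: (N0<=k)%N -> exists j, (N j<=k<=N j.+1)%N.
 move=> kk; have [j hj]: exists j, (k<N j)%N.
 by exists k; apply: leq_trans (rtime_ge m k N00); move: N00; clear; lia.
 elim: j hj => [|j IH] hj; first by exists 0%N; move: hj kk; rewrite /N /=; clear; lia.
 by have [kj|kj] := leqP (N j) k; [exists j; rewrite kj ltnW|exact: IH].
have zk s (z: nat -> Cplx R) k : nm (s-s0)<=1 -> zdata a Q Cz s z N0 -> (N0<=k)%N -> nm (z k)<=2/k%:R.
 move=> hs hz kk; have sS: nm s<=nm s0+1 by have := nmD (s-s0) s0; rewrite subrK; lr hs.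
 by have [] := hZ k s (z k) (leq_trans N0k kk) sS (hz k kk).1.
have zsmall e: 0<e -> exists2 k2, (0<k2)%N & forall s (z : nat -> Cplx R) k, nm (s-s0)<=1 -> zdata a Q Cz s z N0 ->
 (N0<=k)%N -> (k2<=k)%N -> nm (z k)<=e.
 move=> e0; have [k2 k20 hk2] := nat_ge (2/e); exists k2 => // s z k hs hz kk k2k.
 have kp: 0<(k%:R : R) by rewrite ltr0n (leq_trans k20).
 by apply: (le_trans (zk s z k hs hz kk)); rewrite ler_pdivrMr // mulrC -ler_pdivrMr // hk2.
exists m, N0, zs, c, r', (`|B|+2); split=> //.
- move=> x hx1 hx2 k; have [s [z [w [[hs hs1] hz hp hw [hwc he]]]]] := orb x hx1 hx2.
 rewrite he; have kk: (N0<=N0+k)%N by rewrite leq_addr.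
 split=> /=.
 apply: le_trans (zk s z _ hs1 hz kk) _; have kp: 1<=((N0+k)%:R : R) by rewrite ler1n (leq_trans N00).
 rewrite ler_pdivrMr; [have := normr_ge0 B; nr kp|exact: lt_le_trans kp].
 have [j /andP[j1 j2]] := loc _ kk; have wj := rec s z w hs hz hp hw hwc j.
 have [s1 s2 s3] := sub s z w _ (NN j) hz hp hw.
 have [_ h] := hret1 (N j) s z w (leq_trans N0n (NN j)) hs s1 s2 s3 wj.
 apply: le_trans (h (N0+k)%N _) _; first by rewrite j1.
 by have := ler_norm B; lr.
- move=> e e0; have [K [n1 hK]] := hret2 e e0; have [k2 k20 hk2] := zsmall e e0.
 exists (maxn K (maxn n1 k2)) => k [j hj [b1 b2]] x hx1 hx2.
 have [s [z [w [[hs hs1] hz hp hw [hwc he]]]]] := orb x hx1 hx2.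
 move: hj; rewrite !geq_max => /and3P[Kj n1j k2j].
 have Nj: (j<=N j)%N by apply: leq_trans (rtime_ge m j N00); rewrite leq_addl.
 have [s1 s2 s3] := sub s z w _ (NN j) hz hp hw.
 have [h _] := hK (N j) s z w (leq_trans n1j Nj) hs s1 s2 s3 (rec s z w hs hz hp hw hwc j).
 rewrite he addnC /=; split.
 apply: (hk2 s z) => //; first by rewrite leq_addl.
 by apply: leq_trans k2j (leq_trans Nj (leq_trans (leq_addr _ _) b1)).
 by apply: h; [apply: leq_trans b1|apply: leq_trans b2]; rewrite leq_add2l leq_maxl.
- move=> e e0; have [K [n1 hK]] := hret2 e e0; have [k2 k20 hk2] := zsmall e e0.
 exists (maxn K (maxn n1 k2)) => k [j hj [b1 b2]] x hx1 hx2.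
 have [s [z [w [[hs hs1] hz hp hw [hwc he]]]]] := orb x hx1 hx2.
 move: hj; rewrite !geq_max => /and3P[Kj n1j k2j].
 have Nj: (j<=N j)%N by apply: leq_trans (rtime_ge m j N00); rewrite leq_addl.
 have [s1 s2 s3] := sub s z w _ (NN j) hz hp hw.
 have [_ h] := hK (N j) s z w (leq_trans n1j Nj) hs s1 s2 s3 (rec s z w hs hz hp hw hwc j).
 have a2: (1<al2)%N := t_al T2.
 have Nj2: (N j<=al2*N j)%N by rewrite leq_pmull // ltnW.
 rewrite he addnC /=; split.
 apply: (hk2 s z) => //; first by rewrite leq_addl.
 by apply: leq_trans k2j (leq_trans Nj (leq_trans Nj2 (leq_trans (leq_addr _ _) b1))).
 by apply: h; [apply: leq_trans b1|apply: leq_trans b2]; rewrite leq_add2l leq_maxl.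
Qed.

End WanderingBox.

(** * Propagation along Fatou components *)

Section PolyIdentity.
Context {R : realType}.
Implicit Types (x y t : Cplx R).

(** Divides K times by the variable. For T = 4 the tail is at most B 2^-K, since the radius beats
    the factor 2 lost at each division; this explains the 4 in [poly_ident]. *)
Lemma poly_tail (p : {poly Cplx R}) (T B : R) K : 0<T -> (forall t, nm t<=T -> nm p.[t]<=B) ->
 exists2 h : {poly Cplx R}, p.[1] = \sum_(k<K) p`_k+h.[1] &
 forall t, nm t<=T -> nm h.[t]<=B*(2/T)^+K.
Proof.
move=> T0; elim: K p B => [|K IH] p B hB.
 by exists p; [rewrite big_ord0 add0r|move=> t ht; rewrite expr0 mulr1 hB].
have [h e] := poly_divX p.
have [h' e' hh] := IH h (2*B/T) (poly_divX_bound T0 e hB).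
exists h'; last first.
 move=> t /hh h1; apply: (le_trans h1); rewrite exprS.
 by apply: eq_ler; ring.
rewrite {1}e !hornerE e' big_ord_recl /= -horner_coef0 -addrA; congr (_+(_+_)).
by apply: eq_bigr => i _; rewrite [in RHS]e coefD coefC coefMX add0r.
Qed.

(* Identity principle: a bounded sequence of polynomials converging to a constant
 near the origin converges to that constant at [1]. *)
Lemma poly_ident (X : nat -> {poly Cplx R}) (l : Cplx R) (B de : R) : 0<de ->
 (forall n t, nm t<=4 -> nm (X n).[t]<=B) ->
 (forall e, 0<e -> exists N, forall n t, (N<=n)%N -> nm t<=de -> nm ((X n).[t]-l)<=e) ->
 forall e, 0<e -> exists N, forall n, (N<=n)%N -> nm ((X n).[1]-l)<=e.
Proof.
move=> de0 hB hl e e0; pose Z n := X n-l%:P; pose B' := `|B|+nm l+1.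
have B'0: 0<B' by rewrite ltr_wpDl // addr_ge0 ?nm_ge0.
have ZE n t: (Z n).[t]=(X n).[t]-l by rewrite /Z !hornerE.
have hZ n t: nm t<=4 -> nm (Z n).[t]<=B'.
 move=> ht; rewrite ZE; apply: nmB_le; have := hB n t ht; have := ler_norm B; rewrite /B'; lra.
have [K hK] := @pow2_small R (e/2/B') ltac:(by rewrite !divr_gt0).
pose Sg := \sum_(k<K) (2/de)^+k.
have Sg0: 0<=Sg by apply: sumr_ge0 => k _; rewrite exprn_ge0 // divr_ge0 // ltW.
have e10 := div1_gt0 Sg0 (divr_gt0 e0 (ltr0n R 2)).
have [N hN] := hl _ e10; exists N => n Nn.
have [h eh hh] := @poly_tail (Z n) 4 B' K ltac:(lra) (hZ n).
rewrite -ZE eh; apply: nmD_le; have ->: e=e/2+e/2 by field.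
apply: lerD.
 apply: le_trans (nm_sum _ _ _) _.
 via (Sg*(e/2/(Sg+1))); last exact: mul_le_div1 Sg0 (ltW e10) (lexx _).
 rewrite mulr_suml; apply: ler_sum => k _; rewrite mulrC.
 by apply: (poly_coef_bound _ de0) => t ht; rewrite ZE hN.
have := hh 1; rewrite nm1 => h1; apply: (le_trans (h1 _)); first by lra.
have ->: (2/4 : R) = 2^-1 by field.
by rewrite mulrC -ler_pdivlMr.
Qed.

End PolyIdentity.

(** * The real-valued sup distance on C^2 *)

Section BoxDistance.
Context {R : realType}.
Implicit Types (x y z : C2 R).

Definition bd x y : R := Num.max (nm (x.1-y.1)) (nm (x.2-y.2)).

Lemma bd_ge0 x y : 0<=bd x y. Proof. by rewrite le_max nm_ge0. Qed.
Lemma bdxx x : bd x x = 0. Proof. by rewrite /bd !subrr nm0 maxxx. Qed.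
Lemma bdC x y : bd x y=bd y x. Proof. by rewrite /bd nmC (nmC x.2). Qed.

Lemma bd_le x y e : (bd x y<=e)=(nm (x.1-y.1)<=e) && (nm (x.2-y.2)<=e).
Proof. by rewrite /bd ge_max. Qed.

Lemma bd_lt x y e : (bd x y<e)=(nm (x.1-y.1)<e) && (nm (x.2-y.2)<e).
Proof. by rewrite /bd gt_max. Qed.

Lemma bd1 x y : nm (x.1-y.1)<=bd x y. Proof. by rewrite le_max lexx. Qed.
Lemma bd2 x y : nm (x.2-y.2)<=bd x y. Proof. by rewrite le_max lexx orbT. Qed.

Lemma bd_tri y x z : bd x z<=bd x y+bd y z.
Proof.
rewrite bd_le; apply/andP; split.
 by apply: le_trans (nm_tri y.1 _ _) _; apply: lerD; exact: bd1.
by apply: le_trans (nm_tri y.2 _ _) _; apply: lerD; exact: bd2.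
Qed.

Lemma bd_eq0 x y : bd x y = 0 -> x=y.
Proof.
move=> h; have := bd1 x y; have := bd2 x y; rewrite h.
case: x y {h} => x1 x2 [y1 y2] /= h2 h1; congr pair; apply/eqP; rewrite -subr_eq0 -nm_eq0 eq_le nm_ge0 andbT //.
Qed.

Lemma ball_bd x e y : ball x (rc e : Cplx R) y <-> bd y x<e.
Proof.
split=> [[/ballC h1 /ballC h2]|]; first by rewrite bd_lt h1.
by rewrite bd_lt => /andP[h1 h2]; split; apply/ballC.
Qed.

Lemma nbhs_bd x A : nbhs x A <-> exists2 e : R, 0<e & forall y, bd y x<e -> A y.
Proof.
split=> [/nbhs_ballP[e /ltC_rc[e0 ee] hA]|[e e0 hA]].
 by exists (re e) => // y hy; apply: hA; rewrite ee; apply/ball_bd.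
apply/nbhs_ballP; exists (rc e); first by rewrite /= -rc0 ltC_rcE.
by move=> y /ball_bd; exact: hA.
Qed.

Lemma open_bd A : (forall x, A x -> exists2 e : R, 0<e & forall y, bd y x<e -> A y) -> open A.
Proof. by move=> h; rewrite openE => x /h hx; apply/nbhs_bd. Qed.

Lemma open_box x r : open [set y | bd y x<r].
Proof.
apply: open_bd => y /= hy; exists (r-bd y x); first by lra.
by move=> z hz /=; have := bd_tri y z x; lra.
Qed.

Lemma compact_box x r : compact [set y | bd y x<=r].
Proof.
have ->: [set y | bd y x<=r]=[set u | nm (u-x.1)<=r] `*` [set u | nm (u-x.2)<=r].
 by apply/seteqP; split=> y /=; rewrite bd_le => /andP.
exact: compact_setX (@compact_disc _ _ _) (@compact_disc _ _ _).
Qed.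

Lemma unif_bd (K : set (C2 R)) (f : nat -> C2 R -> C2 R) g : {uniform K, f @ \oo --> g} <->
 forall e, 0<e -> exists N, forall n, (N<=n)%N -> forall x, K x -> bd (f n x) (g x)<e.
Proof.
split=> [h e e0|h P /uniform_nbhs[E [entE subP]]].
 pose V := [set h : C2 R -> C2 R | forall y, K y -> bd (h y) (g y)<e].
 have hV: nbhs (g : {uniform` K -> C2 R}) V.
 apply/uniform_nbhs; exists [set xy | ball xy.1 (rc e : Cplx R) xy.2]; split.
 rewrite -entourage_from_ballE; exists (rc e) => //=.
 by rewrite -rc0 ltC_rcE.
 by move=> u hu y Ky; apply/ball_bd; exact: hu.
 by have [N _ hN] := h V hV; exists N => n Nn x Kx; exact: hN.
move: entE; rewrite -entourage_from_ballE => -[e /= /ltC_rc[e0 ee] hE].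
have [N hN] := h (re e) e0; exists N => // n /= Nn; apply: subP => y Ky; apply: hE => /=.
by rewrite ee; apply/ball_bd; exact: hN.
Qed.

End BoxDistance.

(** * Normality and propagation of limits *)

Section Normality.
Context {R : realType}.
Implicit Types (x y z : C2 R).
Variable P : C2 R -> C2 R.

Definition line x (b : C2 R) (t : Cplx R) : C2 R := (x.1+t*b.1, x.2+t*b.2).

(** Holomorphy enters only in this form: along every complex line each iterate is a pair of
    polynomials in one variable. *)
Hypothesis plines : forall m x b, exists X Y : {poly Cplx R}, forall t, iter m P (line x b t)=(X.[t], Y.[t]).

Lemma line_bd x b t : bd (line x b t) x<=nm t*Num.max (nm b.1) (nm b.2).
Proof.
rewrite bd_le /line /= !(addrC _ (t*_)) !addrK !nmM.
by apply/andP; split; rewrite ler_wpM2l ?nm_ge0 // le_max lexx ?orbT.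
Qed.

Lemma line0 x b : line x b 0=x.
Proof. by rewrite /line !mul0r !addr0 -surjective_pairing. Qed.

(** Equicontinuity by Schwarz's lemma on the complex line through the two points; for distances of
    at least rho/2 the bound B alone suffices. *)
Lemma iter_lip x0 (rho B : R) : 0<rho -> 0<=B -> (forall m y, bd y x0<=2*rho -> bd (iter m P y) 0<=B) ->
 forall m y y', bd y x0<=rho -> bd y' x0<=rho -> bd (iter m P y) (iter m P y')<=4*B/rho*bd y y'.
Proof.
move=> rho0 B0 hB m y y' hy hy'; set t := bd y y'.
have nb0 z: bd z x0<=rho -> bd (iter m P z) 0<=B by move=> h; apply: hB; lra.
have c0: 0<=4*B/rho by rewrite divr_ge0 ?mulr_ge0 // ltW.
have [tr|tr] := leP (rho/2) t.
 have h1 := bd_tri 0 (iter m P y) (iter m P y'); rewrite (bdC 0) in h1.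
 have h2: 4*B/rho*(rho/2)<=4*B/rho*t by rewrite ler_wpM2l.
 have e: 4*B/rho*(rho/2) = 2*B by field; rewrite gt_eqF.
 by have := nb0 y hy; have := nb0 y' hy'; lra.
have [t0|t0] := eqVneq t 0; first by rewrite t0 (bd_eq0 t0) bdxx mulr0.
have tp: 0<t by rewrite lt_neqAle eq_sym t0 bd_ge0.
pose b : C2 R := ((y.1-y'.1)/rc t, (y.2-y'.2)/rc t).
have nb: Num.max (nm b.1) (nm b.2)<=1.
 rewrite ge_max /b /= !nmf !nm_rc gtr0_norm // !ler_pdivrMr // !mul1r.
 by rewrite -bd_le.
have [X [Y hXY]] := plines m y' b.
have bd u: nm u<=rho/2 -> bd (iter m P (line y' b u)) 0<=B.
 move=> hu; apply: hB; have := bd_tri y' (line y' b u) x0; have := line_bd y' b u.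
 have : nm u*Num.max (nm b.1) (nm b.2)<=rho/2*1 by rewrite ler_pM ?nm_ge0 // le_max nm_ge0.
 lra.
have et: line y' b (rc t)=y.
 have tn: rc t!=0 by rewrite rc_eq0.
 by rewrite /line /b /= !(mulrC (rc t)) !divfK // !(addrC y'.1) !(addrC y'.2) !subrK -surjective_pairing.
have e1: iter m P y=(X.[rc t], Y.[rc t]) by rewrite -hXY et.
have e2: iter m P y'=(X.[0], Y.[0]) by rewrite -hXY line0.
have r2: 0<rho/2 by rewrite divr_gt0.
have bX u: nm u<=rho/2 -> nm X.[u]<=B.
 by move=> /bd; rewrite hXY bd_le /= !subr0 => /andP[].
have bY u: nm u<=rho/2 -> nm Y.[u]<=B.
 by move=> /bd; rewrite hXY bd_le /= !subr0 => /andP[].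
have nt: nm (rc t)<=rho/2 by rewrite nm_rc gtr0_norm // ltW.
have ec: 2*B/(rho/2)*nm (rc t) = 4*B/rho*t.
 by rewrite nm_rc gtr0_norm //; field; rewrite gt_eqF.
by rewrite e1 e2 bd_le /= -ec !(@poly_schwarz R _ _ _ r2) //.
Qed.

Lemma ultra_cvg (G : set_system nat) (f : nat -> C2 R) (B : R) : UltraFilter G -> (forall n, bd (f n) 0<=B) ->
 exists l, forall e, 0<e -> G [set n | bd (f n) l<e].
Proof.
move=> UG hB; have := @compact_box R 0 B.
have FF: ProperFilter (f @ G) by exact: fmap_proper_filter.
move=> /(_ _ FF) [|l [_ hl]]; first by apply: (@filterS _ G _ setT); [move=> n _ /=; exact: hB|exact: filterT].
exists l => e e0; have [//|h] := in_ultra_setVsetC [set n | bd (f n) l<e] UG.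
have h1: (f @ G) (~` [set y | bd y l<e]) by exact: h.
have h2: nbhs l [set y | bd y l<e] by apply/nbhs_bd; exists e.
by have [z [/= z1 z2]] := hl _ _ h1 h2.
Qed.

(** Arzela-Ascoli with an ultrafilter instead of a diagonal extraction: limits along it exist
    pointwise by compactness, the common Lipschitz bound makes them uniform on the box, and a
    subsequence is picked only at the end. *)
Theorem normal_of_bounded x0 (rho B : R) : 0<rho -> 0<=B ->
 (forall m y, bd y x0<=2*rho -> bd (iter m P y) 0<=B) ->
 normal_iterates P [set y | bd y x0<rho].
Proof.
move=> rho0 B0 hB m; have lip := iter_lip rho0 B0 hB; set L := 4*B/rho in lip.
have L0: 0<=L by rewrite divr_ge0 ?mulr_ge0 // ltW.
pose F n := iter (m n) P.
have FI: ProperFilter (\oo : set_system nat) by exact: eventually_filter.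
have [G [UG sG]] := ultraFilterLemma FI.
have hg x: exists l, bd x x0<=rho -> forall e, 0<e -> G [set n | bd (F n x) l<e].
 have [h|h] := leP (bd x x0) rho; last by exists 0.
 by have [|l hl] := @ultra_cvg G (F ^~ x) B UG; [move=> n; apply: hB; lra|exists l].
have [g hgg] := choice hg.
have GF: Filter G by typeclasses eauto.
have Gne A: G A -> exists n, A n.
 by move=> GA; apply: contrapT => h; apply: (@filter_not_empty _ G); apply: filterS GA => n An; apply: h; exists n.
have glip x y: bd x x0<=rho -> bd y x0<=rho -> bd (g x) (g y)<=L*bd x y.
 move=> hx hy; apply/ler_addgt0Pr => e e0; have e2: 0<e/2 by rewrite divr_gt0.
 have [n [/= h1 h2]] := Gne _ (filterI (hgg x hx _ e2) (hgg y hy _ e2)).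
 have := lip (m n) x y hx hy; rewrite -/(F n).
 have := bd_tri (F n x) (g x) (g y); have := bd_tri (F n y) (F n x) (g y); rewrite (bdC (g x) (F n x)); lra.
have unif e: 0<e -> G [set n | forall x, bd x x0<=rho -> bd (F n x) (g x)<e].
 move=> e0; have /compact_near_coveringP hcov := @compact_box R x0 rho.
 have := hcov nat G (fun n x => bd x x0<=rho -> bd (F n x) (g x)<e) GF.
 move=> h; apply: filterS (h _) => [n hn x hx|x hx]; first exact: hn.
 have e3: 0<e/3 by rewrite divr_gt0.
 have Lp: 0<L+1 by lra.
 pose de := e/3/(L+1); have de0: 0<de by rewrite divr_gt0.
 exists ([set y | bd y x<de], [set n | bd (F n x) (g x)<e/3]) => /=.
 by split; [apply/nbhs_bd; exists de|exact: hgg].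
 move=> [y n] /= [hy hn] hyr.
 have Ld: L*bd y x<=e/3.
 by apply: (mul_le_div1 L0 (bd_ge0 _ _)); rewrite ltW.
 have := lip (m n) y x hyr hx; have := glip x y hx hyr; rewrite -/(F n) (bdC x y).
 have := bd_tri (F n x) (F n y) (g y); have := bd_tri (g x) (F n x) (g y); rewrite (bdC (F n y) (F n x)); lr Ld hn.
have pick (j N: nat) : exists n, (N<=n)%N /\ forall x, bd x x0<=rho -> bd (F n x) (g x)<j.+1%:R^-1.
 have j0: 0<(j.+1%:R^-1 : R) by rewrite invr_gt0.
 have GN: G [set n | (N<=n)%N] by apply: sG; exists N.
 by have [n [h1 h2]] := Gne _ (filterI GN (unif _ j0)); exists n.
have [pk hpk]: exists pk : nat -> nat -> nat, forall j N, (N<=pk j N)%N /\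
 forall x, bd x x0<=rho -> bd (F (pk j N) x) (g x)<j.+1%:R^-1.
 have [pk hpk] := choice (fun jN : nat*nat => pick jN.1 jN.2).
 by exists (fun j N => pk (j, N)) => j N; exact: (hpk (j, N)).
pose s := fix s j := if j is i.+1 then pk i.+1 (s i).+1 else pk 0%N 0%N.
exists s; first by apply: homo_ltn => [? ? ?|i]; [exact: ltn_trans|exact: (hpk i.+1 (s i).+1).1].
left; exists g => K cK KV; apply/unif_bd => e e0.
have [N [N0 hN]] := invn_small e0; exists N => n Nn x /KV /= hx.
have hx': bd x x0<=rho by rewrite ltW.
have : bd (F (s n) x) (g x)<n.+1%:R^-1 by case: n {Nn} => [|i]; apply: (hpk _ _).2.
by move=> h; apply: (lt_le_trans h); apply: hN; exact: leqW.
Qed.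

(* [tends S l x]: near [x], the iterates at the times of [S K] are uniformly close to [l] as [K] grows. *)
Definition tends (S : nat -> nat -> Prop) (l x : C2 R) := exists W : set (C2 R), [/\ open W, W x &
 forall e, 0<e -> exists K, forall k, S K k -> forall y, W y -> bd (iter k P y) l<e].

(** Vitali's argument. From a sequence of bad times normality extracts a limit g; the iterates tend
    to l near some y close to x, and along complex lines through y the identity principle carries g
    = l to a whole neighbourhood of x. *)
Lemma tends_closed S l x : (forall K K' k, (K<=K')%N -> S K' k -> S K k) -> fatou_set P x ->
 closure [set y | tends S l y] x -> tends S l x.
Proof.
move=> Santi [U [oU nU] Ux] clx.
have [rho rho0 hU]: exists2 rho : R, 0<rho & forall y, bd y x<rho -> U y.
 by apply/nbhs_bd; exact: open_nbhs_nbhs.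
have r16: 0<rho/16 by rewrite divr_gt0.
have [y [[W [oW Wy hW]] /= yx]]: exists y, tends S l y /\ bd y x<rho/16.
 have [y [h1 h2]] := clx [set y | bd y x<rho/16] ltac:(by apply/nbhs_bd; exists (rho/16)).
 by exists y.
have [de de0 hde]: exists2 de : R, 0<de & forall z, bd z y<de -> W z.
 by apply/nbhs_bd; exact: open_nbhs_nbhs.
pose V := [set z | bd z x<rho/16].
exists V; split; [exact: open_box|by rewrite /V /= bdxx|].
move=> e e0; apply: contrapT => hcon.
have bad K: exists kz : nat*C2 R, S K kz.1 /\ V kz.2 /\ e<=bd (iter kz.1 P kz.2) l.
 apply: contrapT => h; apply: hcon; exists K => k Sk z Vz; rewrite ltNge; apply/negP => hz.
 by apply: h; exists (k, z).
have [kz hkz] := choice bad; have [s hs hcv] := nU (fun K => (kz K).1).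
have sn n: (n<=s n)%N by elim: n => // n IH; apply: leq_ltn_trans IH (hs _ _ (ltnSn n)).
have Ws e': 0<e' -> exists N, forall n, (N<=n)%N -> forall z, W z -> bd (iter (kz (s n)).1 P z) l<e'.
 move=> /hW[K hK]; exists K => n Kn z Wz; apply: hK => //.
 by apply: (Santi K (s n)); [apply: leq_trans Kn (sn n)|exact: (hkz (s n)).1].
case: hcv => [[g hg]|hdiv]; last first.
 (* Compact divergence is impossible, because the iterates of y at these times tend to l. *)
 have cy: compact [set y] by exact: compact_set1.
 have [N1 _ hN1] := hdiv [set y] _ cy ltac:(by move=> _ ->; apply: hU; lra) (@compact_box R l 1).
 have [N2 hN2] := Ws 1 ltr01.
 apply: (hN1 (N1+N2)%N (leq_addr _ _) y erefl); rewrite /= ltW //.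
 by apply: hN2 Wy; rewrite leq_addl.
pose K := [set z | bd z x<=3/4*rho].
have KU: K `<=` U by move=> z; rewrite /K /= => hz; apply: hU; lra.
have /unif_bd hgK := hg K (@compact_box R x _) KU.
have gl z: V z -> g z=l.
 rewrite /V /= => Vz; apply: bd_eq0; apply/eqP; rewrite eq_le bd_ge0 andbT.
 pose b : C2 R := (z.1-y.1, z.2-y.2).
 have ebn: Num.max (nm b.1) (nm b.2)=bd z y by [].
 (* The parametrized line through y and z then stays, for |t| <= 4, within 9 rho/16 of x and hence
    in K, as [poly_ident] requires. *)
 have bn: bd z y<=rho/8 by have := bd_tri x z y; rewrite (bdC x y); lr Vz yx.
 have l1: line y b 1=z by rewrite /line /b /= !mul1r !(addrC y.1) !(addrC y.2) !subrK -surjective_pairing.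
 have lK t: nm t<=4 -> K (line y b t).
 move=> ht; rewrite /K /=; have := bd_tri y (line y b t) x; have := line_bd y b t.
 have : nm t*Num.max (nm b.1) (nm b.2)<=4*(rho/8) by rewrite ebn ler_pM ?nm_ge0 ?bd_ge0.
 lr yx rho0.
 have [XY hXY] := choice (fun n => plines (kz (s n)).1 y b).
 have [XY2 hXY2] := choice hXY.
 have [N1 hN1] := hgK 1 ltr01.
 have [M1 M10 hM1] := poly_bounded (XY N1) 4; have [M2 M20 hM2] := poly_bounded (XY2 N1) 4.
 pose B := M1+M2+2.
 have bdd n t: (N1<=n)%N -> nm t<=4 -> nm (XY n).[t]<=B /\ nm (XY2 n).[t]<=B.
 move=> nn ht; have := hN1 n nn _ (lK t ht); have := hN1 N1 (leqnn _) _ (lK t ht).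
 rewrite !hXY2 => h1 h2; have := bd_tri (g (line y b t)) ((XY n).[t], (XY2 n).[t]) ((XY N1).[t], (XY2 N1).[t]).
 rewrite (bdC (g _)) => h3; have h4 := hM1 t ht; have h5 := hM2 t ht.
 have := bd1 ((XY n).[t], (XY2 n).[t]) ((XY N1).[t], (XY2 N1).[t]).
 have := bd2 ((XY n).[t], (XY2 n).[t]) ((XY N1).[t], (XY2 N1).[t]) => /= h6 h7.
 have := nmD ((XY n).[t]-(XY N1).[t]) (XY N1).[t]; have := nmD ((XY2 n).[t]-(XY2 N1).[t]) (XY2 N1).[t].
 by rewrite !subrK /B; lr h1 h2 h3 h4 h5 h6 h7 M10 M20.
 pose d1 := de/(2*(bd z y+1)).
 have zy1: 0<bd z y+1 by have := bd_ge0 z y; lr.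
 have d10: 0<d1 by rewrite divr_gt0 // mulr_gt0.
 have lW t: nm t<=d1 -> W (line y b t).
 move=> ht; apply: hde; apply: (le_lt_trans (line_bd _ _ _)); rewrite ebn.
 apply: (@le_lt_trans _ _ (d1*(bd z y+1))).
 by rewrite ler_pM ?nm_ge0 ?bd_ge0 // lerDl.
 have ->: d1*(bd z y+1)=de/2 by rewrite /d1; field; rewrite gt_eqF.
 by lr de0.
 have c1 e': 0<e' -> exists N, forall n t, (N<=n)%N -> nm t<=d1 ->
 nm ((XY (n+N1)%N).[t]-l.1)<=e' /\ nm ((XY2 (n+N1)%N).[t]-l.2)<=e'.
 move=> /Ws[N hN]; exists N => n t Nn ht; have := hN (n+N1)%N (leq_trans Nn (leq_addr _ _)) _ (lW t ht).
 by rewrite hXY2 bd_lt /= => /andP[/ltW h1 /ltW h2].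
 apply/ler_addgt0Pr => e' e'0; rewrite add0r; have e2: 0<e'/2 by rewrite divr_gt0.
 have [Na hNa] := @poly_ident R (fun n => XY (n+N1)%N) l.1 B d1 d10
 (fun n t ht => (bdd _ t (leq_addl _ _) ht).1)
 (fun e h => let: ex_intro N hN := c1 e h in ex_intro _ N (fun n t nn ht => (hN n t nn ht).1)) _ e2.
 have [Nb hNb] := @poly_ident R (fun n => XY2 (n+N1)%N) l.2 B d1 d10
 (fun n t ht => (bdd _ t (leq_addl _ _) ht).2)
 (fun e h => let: ex_intro N hN := c1 e h in ex_intro _ N (fun n t nn ht => (hN n t nn ht).2)) _ e2.
 have [Nc hNc] := hgK _ e2; pose n := (Na+Nb+Nc)%N.
 have zK: K z by rewrite -l1; apply: lK; rewrite nm1; lr.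
 have nc: (Nc<=n+N1)%N by rewrite /n; clear; lia.
 have := hNc _ nc z zK.
 have ha := hNa n ltac:(by rewrite /n; clear; lia).
 have hb := hNb n ltac:(by rewrite /n; clear; lia).
 have : bd (iter (kz (s (n+N1)%N)).1 P z) l<=e'/2 by rewrite -l1 hXY2 bd_le /= ha.
 by have := bd_tri (iter (kz (s (n+N1)%N)).1 P z) (g z) l; rewrite (bdC (g z) (iter _ P z)); lr.
have [N hN] := hgK e e0; have [_ [Vz hz]] := hkz (s N).
have zK: K (kz (s N)).2 by move: Vz; rewrite /V /K /=; lra.
by have := hN N (leqnn N) _ zK; rewrite (gl _ Vz); lr hz.
Qed.

Theorem tends_component S l x0 : (forall K K' k, (K<=K')%N -> S K' k -> S K k) ->
 fatou_set P x0 -> tends S l x0 -> forall x, connected_component (fatou_set P) x0 x -> tends S l x.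
Proof.
move=> Santi fx0 t0 x hx; set Om := connected_component _ _ in hx.
have OmF y: Om y -> fatou_set P y by exact: connected_component_sub.
pose T := [set y | tends S l y].
have oT: open T.
 by rewrite openE => y [W [oW Wy h]]; apply: filterS (open_nbhs_nbhs (conj oW Wy)) => z Wz; exists W.
have : Om `&` T = Om.
 apply: (@component_connected _ (fatou_set P) x0).
 - by exists x0; split=> //; exact: connected_component_refl.
 - by exists T.
 - exists (closure T); first exact: closed_closure.
 apply/seteqP; split=> y [h1 h2]; split=> //; first exact: subset_closure.
 by apply: tends_closed Santi _ h2; exact: OmF.
by move=> e; have : (Om `&` T) x by [rewrite e]; case.
Qed.

End Normality.

(** * Empirical measures *)

Section Averages.
Context {R : realType}.
Variables (al1 al2 m N0 : nat).
Hypotheses (a1 : (1<al1)%N) (a2 : (1<al2)%N) (N00 : (0<N0)%N).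
Local Notation N := (rtime al1 al2 m N0).

Lemma sum_dist_le (x : nat -> R) (v c : R) l u : (forall k, (l<=k<u)%N -> `|x k-v| <= c) ->
 `|\sum_(l<=k<u) x k-(u-l)%:R*v| <= c*(u-l)%:R.
Proof.
move=> h; rewrite mulrC [v*_]mulrC mulr_natl -sumr_const_nat -sumrB.
apply: le_trans (ler_norm_sum _ _ _) _.
rewrite mulr_natr -(sumr_const_nat u l c) big_nat_cond [leRHS]big_nat_cond.
by apply: ler_sum => k /andP[hk _]; exact: h.
Qed.

Lemma block_sum_est (x : nat -> R) (v M e : R) l u K : (l<=u)%N -> 0<=e -> 0<=M ->
 (forall k, `|x k| <= M) -> `|v| <= M ->
 (forall k, (l+K<=k)%N -> (k+K<=u)%N -> `|x k-v| <= e) ->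
 `|\sum_(l<=k<u) x k-(u-l)%:R*v| <= e*(u-l)%:R+4*K%:R*M.
Proof.
move=> lu e0 M0 xM vM h; have xv k: `|x k-v| <= 2*M.
 by apply: le_trans (ler_normB _ _) _; have := xM k; lra.
have [hK|hK] := leqP (l+K+K) u; last first.
 apply: le_trans (@sum_dist_le x v (2*M) l u _) _; first by move=> k _; exact: xv.
 have : ((u-l)%:R : R)<=2*K%:R by rewrite -natrM ler_nat; move: hK; clear; lia.
 have : 0<=e*(u-l)%:R by rewrite mulr_ge0.
 by move=> ? ?; have : 2*M*(u-l)%:R<=2*M*(2*K%:R); [rewrite ler_wpM2l ?mulr_ge0|lra].
have h1: (l<=l+K)%N by rewrite leq_addr.
have h2: (l+K<=u-K)%N by move: hK; clear; lia.
have h3: (u-K<=u)%N by rewrite leq_subr.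
rewrite (big_cat_nat h1 (leq_trans h2 h3)) (big_cat_nat h2 h3) /=.
have s1 := @sum_dist_le x v (2*M) l (l+K) ltac:(by move=> k _; exact: xv).
have s3 := @sum_dist_le x v (2*M) (u-K) u ltac:(by move=> k _; exact: xv).
have s2: `|\sum_(l+K<=k<u-K) x k-(u-K-(l+K))%:R*v| <= e*(u-K-(l+K))%:R.
 by apply: sum_dist_le => k /andP[k1 k2]; apply: h => //; move: k2; clear; lia.
have ->: ((u-l)%:R : R)=(l+K-l)%:R+((u-K-(l+K))%:R+(u-(u-K))%:R).
 by rewrite -!natrD; congr (_%:R); move: hK; clear; lia.
move: s1 s2 s3; rewrite addKn subKn; last by move: hK; clear; lia.
set S1 := \sum_(l<=k<_) _; set S2 := \sum_(_<=k<u-K) _; set S3 := \sum_(u-K<=k<u) _.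
set y := (u-K-(l+K))%:R => s1 s2 s3.
have ->: S1+(S2+S3)-(K%:R+(y+K%:R))*v=(S1-K%:R*v)+(S2-y*v)+(S3-K%:R*v) by ring.
apply: le_trans (ler_normD _ _) _; have := ler_normD (S1-K%:R*v) (S2-y*v).
have : 0<=e*K%:R by rewrite mulr_ge0.
by lr s1 s2 s3.
Qed.

Lemma rt_double j : (2*N j<=N j.+1)%N.
Proof.
by rewrite rtime_step (leq_trans _ (leq_addr _ _)) // leq_mul // leq_pmull // ltnW.
Qed.

Lemma rt_pos j : (0<N j)%N.
Proof. by elim: j => // j IH; apply: leq_trans (rt_double j); rewrite muln_gt0. Qed.

(** Quadratic growth is all that is needed: every cycle adds a bounded error besides the
    proportional one, so j cycles add O(j), which is negligible against N j. *)
Lemma rt_sq j : (j*j<=4*N j)%N.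
Proof.
have h i: (i<2 ^ i)%N by exact: ltn_expl.
have h2 i: (i * i<=4*2 ^ i)%N by elim: i => // i IH; have := h i; rewrite expnS; nia.
apply: leq_trans (h2 j) _; rewrite leq_mul2l /=.
by elim: j => [|j IH]; [exact: N00|rewrite expnS; apply: leq_trans (rt_double j); rewrite leq_mul2l].
Qed.

Lemma rt_mono : {homo N : i j/(i<j)%N}.
Proof.
apply: homo_ltn => [? ? ?|i]; first exact: ltn_trans.
by apply: leq_trans (rt_double i); have := rt_pos i; clear; lia.
Qed.

Lemma rt_ge j : (N0+j<=N j)%N.
Proof. by elim: j => [|j IH]; [rewrite addn0|rewrite addnS; apply: leq_ltn_trans IH (rt_mono (ltnSn j))]. Qed.

Variables (x : nat -> R) (M v1 v2 : R).
Hypotheses (xM : forall k, `|x k| <= M) (v1M : `|v1| <= M) (v2M : `|v2| <= M).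
Hypothesis x2 : forall e, 0<e -> exists K, forall k, block2 al1 al2 m N0 K k -> `|x k-v2| <= e.
Hypothesis x1 : forall e, 0<e -> exists K, forall k, block1 al1 al2 m N0 K k -> `|x k-v1| <= e.
Local Notation A := (al1%:R*al2%:R : R).

(** The average V at return times is a fixed point: one cycle multiplies the elapsed time by A, so A
    V = V + (al2 - 1) v2 + (A - al2) v1. Similarly [vmid] is the average at the end of the stay with
    value v2, al2 times later than a return. *)
Definition vret : R := ((al2%:R - 1)*v2+(A-al2%:R)*v1)/(A - 1).
Definition vmid : R := (vret+(al2%:R - 1)*v2)/al2%:R.

Let T u : R := \sum_(N0<=k<u) x (k-N0)%N.

Lemma A_gt1 : 1<A.
Proof. by rewrite -natrM ltr1n; move: a1 a2; clear; nia. Qed.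

Lemma half_block e : 0<e -> exists K, forall j, (K<=j)%N ->
 `|T (al2*N j)-T (N j)-(al2%:R - 1)*(N j)%:R*v2| <= e*(al2%:R - 1)*(N j)%:R+4*K%:R*M /\
 `|T (al1*(al2*N j))-T (al2*N j)-(A-al2%:R)*(N j)%:R*v1| <= e*(A-al2%:R)*(N j)%:R+4*K%:R*M.
Proof.
move=> e0; have [K2 h2] := x2 e0; have [K1 h1] := x1 e0; exists (maxn K1 K2) => j.
rewrite geq_max => /andP[K1j K2j]; set K := maxn K1 K2; have M0: 0<=M by apply: le_trans (xM 0).
have NN: (N0<=N j)%N by apply: leq_trans (rt_ge j); rewrite leq_addr.
have l2: (N j<=al2*N j)%N by rewrite leq_pmull // ltnW.
have l1: (al2*N j<=al1*(al2*N j))%N by rewrite leq_pmull // ltnW.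
have cut l u: (N0<=l)%N -> (l<=u)%N -> T u-T l = \sum_(l<=k<u) x (k-N0)%N.
 by move=> h h'; rewrite /T (big_cat_nat h h') /= addrAC subrr add0r.
have K1K: (K1<=K)%N by rewrite leq_maxl.
have K2K: (K2<=K)%N by rewrite leq_maxr.
split.
- rewrite cut //; have := @block_sum_est (fun k => x (k-N0)%N) v2 M e (N j) (al2*N j) K l2 (ltW e0) M0
 (fun k => xM _) v2M; rewrite natrB // natrM => h.
 have ->: (al2%:R - 1)*(N j)%:R=al2%:R*(N j)%:R-(N j)%:R :> R by ring.
 rewrite -[e*_*_]mulrA; have ->: (al2%:R - 1)*(N j)%:R=al2%:R*(N j)%:R-(N j)%:R :> R by ring.
 apply: h => k k1 k2; apply: h2; exists j => //; rewrite subnK; last by apply: leq_trans (leq_trans NN (leq_addr K _)) k1.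
 by split; [apply: leq_trans k1; rewrite leq_add2l|apply: leq_trans k2; rewrite leq_add2l].
rewrite cut //; last exact: leq_trans l2.
have := @block_sum_est (fun k => x (k-N0)%N) v1 M e (al2*N j) (al1*(al2*N j)) K l1 (ltW e0) M0
 (fun k => xM _) v1M; rewrite natrB // !natrM => h.
rewrite -[e*_*_]mulrA; have ->: (A-al2%:R)*(N j)%:R=al1%:R*(al2%:R*(N j)%:R)-al2%:R*(N j)%:R :> R by ring.
apply: h => k k1 k2; apply: h1; exists j => //; rewrite subnK.
 by split; [apply: leq_trans k1; rewrite leq_add2l|apply: leq_trans k2; rewrite leq_add2l].
by apply: leq_trans (leq_trans NN (leq_trans l2 (leq_addr K _))) k1.
Qed.

Lemma return_avg e : 0<e -> exists J, forall j, (J<=j)%N -> `|T (N j)-vret*(N j)%:R| <= e*(N j)%:R.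
Proof.
move=> e0; have A1 := A_gt1; have Ap: 0<2*A by lra.
have e10: 0<e/(2*A) by rewrite divr_gt0.
have [K hK] := half_block e10; set e1 := e/(2*A) in e10 hK.
have M0: 0<=M by apply: le_trans (xM 0).
pose Cc : R := 8*K%:R*M+m%:R*M + `|vret| * m%:R.
have C0: 0<=Cc by rewrite !addr_ge0 ?mulr_ge0.
have al2R: 1<=(al2%:R : R) by rewrite ler1n ltnW.
have al1R: 1<=(al1%:R : R) by rewrite ler1n ltnW.
have step j: (K<=j)%N -> `|T (N j.+1)-vret*(N j.+1)%:R| <= `|T (N j)-vret*(N j)%:R|+e1*A*(N j)%:R+Cc.
 move=> Kj; have [h2 h1] := hK j Kj.
 have eN: ((N j.+1)%:R : R)=A*(N j)%:R+m%:R by rewrite rtime_step natrD !natrM; ring.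
 have rest: `|T (N j.+1)-T (al1*(al2*N j))| <= m%:R*M.
 have h0: (N0<=al1*(al2*N j))%N.
 apply: leq_trans (leq_addr j _) (leq_trans (rt_ge j) _).
 by rewrite mulnA leq_pmull // muln_gt0 (ltnW a1) (ltnW a2).
 have h3: (al1*(al2*N j)<=N j.+1)%N by rewrite rtime_step leq_addr.
 rewrite /T (big_cat_nat h0 h3) /= addrAC subrr add0r.
 have := @sum_dist_le (fun k => x (k-N0)%N) 0 M (al1*(al2*N j)) (N j.+1).
 by rewrite mulr0 subr0 rtime_step addKn mulrC; apply => k _; rewrite subr0.
 have ev: vret*(A - 1)=(al2%:R - 1)*v2+(A-al2%:R)*v1.
 by rewrite /vret divfK //; rewrite gt_eqF //; lr A1.
 have eq1: T (N j.+1)-vret*(N j.+1)%:R=(T (N j)-vret*(N j)%:R)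
 + (T (al2*N j)-T (N j)-(al2%:R - 1)*(N j)%:R*v2)
 + (T (al1*(al2*N j))-T (al2*N j)-(A-al2%:R)*(N j)%:R*v1)
 + (T (N j.+1)-T (al1*(al2*N j)))-vret * m%:R.
 have : vret*(A - 1)*(N j)%:R=((al2%:R - 1)*v2+(A-al2%:R)*v1)*(N j)%:R by rewrite ev.
 by rewrite eN; move: (T _) (T _) (T _) (T _) => t1 t2 t3 t4; lr.
 rewrite eq1; apply: le_trans (ler_normB _ _) _; apply: (le_trans (lerD (le_trans (ler_normD _ _) (lerD (le_trans (ler_normD _ _) (lerD (ler_normD _ _) (lexx _))) (lexx _))) (lexx _))).
 rewrite normrM [`|m%:R|]ger0_norm // /Cc.
 have n0: 0<=e1*(N j)%:R by rewrite mulr_ge0 // ltW.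
 have e3: e1*(al2%:R - 1)*(N j)%:R+e1*(A-al2%:R)*(N j)%:R<=e1*A*(N j)%:R by lr n0.
 by lr h1 h2 rest e3.
pose E := `|T (N K)-vret*(N K)%:R|.
(* The proportional error does not accumulate: as N at least doubles, the bound at the next return
   covers both the old bound and the new error. *)
have rec i: `|T (N (K+i)%N)-vret*(N (K+i)%N)%:R| <= E+e1*A*(N (K+i)%N)%:R+i%:R*Cc.
 elim: i => [|i IH].
 rewrite addn0 mul0r addr0 lerDl !mulr_ge0 ?(ltW e10) //; lr e0.
 rewrite addnS; apply: le_trans (step _ (leq_addr _ _)) _.
 have d: 2*(N (K+i)%N)%:R<=(N (K+i).+1)%:R :> R by rewrite -natrM ler_nat rt_double.
 have e1A: 0<=e1*A by rewrite mulr_ge0 ?(ltW e10) //; lra.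
 have := ler_wpM2l e1A d; rewrite -natr1; lr IH.
have e1A: e1*A=e/2 by rewrite /e1; field; rewrite gt_eqF //; lr al1R al2R.
have [J J0 hJ] := nat_ge (16*(E+Cc)/e).
exists (maxn K J).+1 => j hj; have Kj: (K<=j)%N by move: hj (leq_maxl K J); clear; lia.
have Jj: (J<=j)%N by move: hj (leq_maxr K J); clear; lia.
have j0: (0<j)%N by apply: leq_trans J0 Jj.
have := rec (j-K)%N; rewrite subnKC // e1A => h; apply: (le_trans h).
have jp: 1<=(j%:R : R) by rewrite ler1n.
have E0: 0<=E := normr_ge0 _.
have hh: E+(j-K)%:R*Cc<=(E+Cc)*j%:R.
 have : (j-K)%:R*Cc<=j%:R*Cc by rewrite ler_wpM2r // ler_nat leq_subr.
 have : E<=E*j%:R by rewrite ler_peMr.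
 lr.
have sq: (j%:R : R)*j%:R<=4*(N j)%:R by rewrite -!natrM ler_nat rt_sq.
have := hJ j Jj; rewrite ler_pdivrMr // => hJj.
have : 16*(E+Cc)*j%:R<=j%:R*e*j%:R by rewrite ler_wpM2r.
have : e*(j%:R*j%:R)<=e*(4*(N j)%:R) by rewrite ler_wpM2l // ltW.
have : 0<=e*(N j)%:R by rewrite mulr_ge0 // ltW.
by lr hh.
Qed.

Lemma middle_avg e : 0<e -> exists J, forall j, (J<=j)%N ->
 `|T (al2*N j)-vmid*(al2*N j)%:R| <= e*(al2*N j)%:R.
Proof.
move=> e0; have e3: 0<e/3 by rewrite divr_gt0.
have [J1 h1] := return_avg e3; have [K hK] := half_block e3.
have M0: 0<=M by apply: le_trans (xM 0).
have al2R: 1<=(al2%:R : R) by rewrite ler1n ltnW.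
have [J2 J20 h2] := nat_ge (12*K%:R*M/e).
exists (maxn J1 (maxn K J2)) => j; rewrite !geq_max => /and3P[j1 j2 j3].
have [a _] := hK j j2; have b := h1 j j1.
have ev: vmid*al2%:R=vret+(al2%:R - 1)*v2 by rewrite /vmid divfK // gt_eqF // (lt_le_trans ltr01).
rewrite natrM mulrA ev.
have ->: T (al2*N j)-(vret+(al2%:R - 1)*v2)*(N j)%:R =
 (T (al2*N j)-T (N j)-(al2%:R - 1)*(N j)%:R*v2)+(T (N j)-vret*(N j)%:R) by ring.
apply: le_trans (ler_normD _ _) _.
have nj: j%:R<=(N j)%:R :> R by rewrite ler_nat; apply: leq_trans (rt_ge j); rewrite leq_addl.
have := h2 j j3; rewrite ler_pdivrMr // => c.
have : j%:R*e<=(N j)%:R*e by rewrite ler_wpM2r // ltW.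
have : 0<=e*(N j)%:R by rewrite mulr_ge0 // ltW.
have : e*(N j)%:R<=e*(al2%:R*(N j)%:R) by rewrite ler_wpM2l ?(ltW e0) // ler_peMl.
by lr a b c.
Qed.

(** Passes from [T], whose time starts at N0, to empirical averages, which begin with the first
    iterate; the two sums differ by x n - x 0 only. *)
Lemma avg_cvg (u : nat -> nat) (V : R) : (forall j, (N0+j<u j)%N) ->
 (forall e, 0<e -> exists J, forall j, (J<=j)%N -> `|T (u j)-V*(u j)%:R| <= e*(u j)%:R) ->
 (fun j => (u j-N0)%:R^-1 * \sum_(k<(u j-N0)%N) x k.+1) @ \oo --> V.
Proof.
move=> hu hT; have M0: 0<=M by apply: le_trans (xM 0).
apply/cvgrPdist_le => e e0; have e4: 0<e/4 by rewrite divr_gt0.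
have [J1 h1] := hT _ e4; pose Cc := 2*M + `|V|*N0%:R.
have C0: 0<=Cc by rewrite addr_ge0 ?mulr_ge0.
have [J2 J20 h2] := nat_ge (4*Cc/e).
exists (maxn J1 (maxn J2 N0)) => // j /=; rewrite !geq_max => /and3P[j1 j2 j3].
have ju := hu j; have lu: (N0<=u j)%N by move: ju; clear; lia.
set n := (u j-N0)%N; have n0: (0<n)%N by rewrite subn_gt0; move: ju; clear; lia.
have np: 0<(n%:R : R) by rewrite ltr0n.
have un: (u j)%:R=n%:R+N0%:R :> R by rewrite -natrD subnK.
have nN: N0%:R<=n%:R :> R by rewrite ler_nat /n; move: ju j3; clear; lia.
have eT: T (u j) = \sum_(k<n) x k.
 rewrite /T -{1}[N0]add0n big_addn big_mkord; apply: eq_bigr => i _.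
 by rewrite addnK.
have eS: \sum_(k<n) x k.+1=T (u j)+x n-x 0%N.
 have r1: \sum_(k<n.+1) x k = \sum_(k<n) x k+x n by rewrite big_ord_recr.
 have r2: \sum_(k<n.+1) x k=x 0%N + \sum_(k<n) x k.+1.
 by rewrite big_ord_recl; congr (_+_); apply: eq_bigr => i _; rewrite lift0.
 by rewrite eT -r1 r2; ring.
have ->: V-n%:R^-1 * \sum_(k<n) x k.+1 = - ((\sum_(k<n) x k.+1-V*n%:R)/n%:R).
 by field; rewrite gt_eqF.
rewrite normrN normrM [`|n%:R^-1|]ger0_norm ?invr_ge0 // ler_pdivrMr //.
have ->: \sum_(k<n) x k.+1-V*n%:R=(T (u j)-V*(u j)%:R)+(x n-x 0%N)+V*N0%:R.
 by rewrite eS un; ring.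
apply: le_trans (ler_normD _ _) _; have q1 := ler_normD (T (u j)-V*(u j)%:R) (x n-x 0%N).
have q2 := ler_normB (x n) (x 0%N); rewrite normrM [`|N0%:R|]ger0_norm //.
have q3 := h1 j j1; have := h2 j j2; rewrite ler_pdivrMr // => q4.
have jn: j%:R<=n%:R :> R by rewrite ler_nat /n; move: ju; clear; lia.
have q5: j%:R*e<=n%:R*e by rewrite ler_wpM2r // ltW.
have q6: e/4*(u j)%:R<=e/4*(n%:R+n%:R) by rewrite ler_wpM2l ?(ltW e4) // un lerD2l.
have q7: 0<=e*n%:R by rewrite mulr_ge0 // ltW.
have := xM n; have := xM 0%N; move: q7 q1 q2 q3 q4 q5 q6 e0; rewrite /Cc; lr.
Qed.

Lemma return_cvg : (fun j => (N j.+1-N0)%:R^-1 * \sum_(k<(N j.+1-N0)%N) x k.+1) @ \oo --> vret.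
Proof.
apply: avg_cvg => [j|e e0]; first by have := rt_ge j.+1; rewrite addnS.
by have [J hJ] := return_avg e0; exists J => j Jj; apply: hJ; exact: leqW.
Qed.

Lemma middle_cvg : (fun j => (al2*N j.+1-N0)%:R^-1 * \sum_(k<(al2*N j.+1-N0)%N) x k.+1) @ \oo --> vmid.
Proof.
apply: avg_cvg => [j|e e0].
 have := rt_ge j.+1; have : (N j.+1<=al2*N j.+1)%N by rewrite leq_pmull // ltnW.
 by rewrite addnS; clear; lia.
by have [J hJ] := middle_avg e0; exists J => j Jj; apply: hJ; exact: leqW.
Qed.

End Averages.

(** * Integrals against empirical and limit measures *)

Section Integrals.
Context {R : realType}.
Implicit Types (f g : C2 R -> R).
Local Notation borel := (borelC2 R).
Local Notation TT := [set: borel].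

Lemma continuous_borel f : continuous f -> measurable_fun TT (EFin \o (f : borel -> R)).
Proof.
move=> cf; apply/measurable_EFinP.
apply: (measurability _ (RGenOInfty.measurableE R)) => _ [_ [x ->] <-].
rewrite setTI; apply: sub_sigma_algebra; apply: open_comp => //; exact: open_gt.
Qed.

Lemma integral_dirac_fin (a : borel) g : measurable_fun TT (EFin \o (g : borel -> R)) ->
 (\int[\d_a]_(x in TT) (g x)%:E)%E=(g a)%:E.
Proof. by move=> mg; rewrite integral_dirac // diracT mul1e. Qed.

(** Reduces signed integrands to nonnegative ones; L is the candidate value of the integral,
    required to respect the splitting into positive and negative parts. *)
Lemma integral_split (mu : {measure set borel -> \bar R}) (L : (C2 R -> R) -> R) f :
 (forall g, (forall x, 0<=g x) -> measurable_fun TT (EFin \o (g : borel -> R)) ->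
 (\int[mu]_(x in TT) (g x)%:E)%E=(L g)%:E) ->
 measurable_fun TT (EFin \o (f : borel -> R)) -> L f=L (fun x => Num.max (f x) 0)-L (fun x => Num.max (- f x) 0) ->
 (\int[mu]_(x in TT) (f x)%:E)%E=(L f)%:E.
Proof.
move=> hL mf eL; have mr: measurable_fun TT (f : borel -> R) by apply/measurable_EFinP.
have m1: measurable_fun TT (EFin \o ((fun x => Num.max (f x) 0) : borel -> R)).
 by apply/measurable_EFinP; apply: measurable_maxr => //; exact: measurable_cst.
have m2: measurable_fun TT (EFin \o ((fun x => Num.max (- f x) 0) : borel -> R)).
 apply/measurable_EFinP; apply: measurable_maxr; last exact: measurable_cst.
 exact: measurableT_comp.
rewrite integralE eL EFinB -(hL _ _ m1) -?(hL _ _ m2); try by move=> x; rewrite le_max lexx orbT.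
by congr (_-_)%E; apply: eq_integral => x _; rewrite ?funeposE ?funenegE -EFin_max.
Qed.

Lemma max_split (r : R) : Num.max r 0-Num.max (- r) 0=r.
Proof. by rewrite !maxEle; have [|] := leP r 0; have [|] := leP (- r) 0; lra. Qed.

Lemma integral_empirical (P : C2 R -> C2 R) x n f : continuous f ->
 (\int[empirical P x n]_(y in TT) (f y)%:E)%E=(n%:R^-1 * \sum_(k<n) f (iter k.+1 P x))%:E.
Proof.
move=> /continuous_borel mf.
apply: (@integral_split _ (fun g => n%:R^-1 * \sum_(k<n) g (iter k.+1 P x))) => // [g g0 mg|].
 have g0' y: TT y -> (0%R<=(g y)%:E)%E by rewrite lee_fin.
 rewrite /empirical ge0_integral_mscale //=; rewrite ge0_integral_measure_sum // EFinM; congr (_*_)%E.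
 rewrite -sumEFin; apply: eq_bigr => k _; exact: integral_dirac_fin.
by rewrite -mulrBr -sumrB; congr (_*_); apply: eq_bigr => k _; rewrite max_split.
Qed.

Lemma integral_limit (w1 w2 : Cplx R) (b1 b2 : R) f : continuous f ->
 (\int[limit_measure w1 w2 b1 b2]_(y in TT) (f y)%:E)%E =
 ((alpha b1*alpha b2-alpha b2)/(alpha b1*alpha b2 - 1)*f (0, w1) +
 (alpha b2 - 1)/(alpha b1*alpha b2 - 1)*f (0, w2))%:E.
Proof.
move=> /continuous_borel mf.
apply: (@integral_split _ (fun g => (alpha b1*alpha b2-alpha b2)/(alpha b1*alpha b2 - 1)*g (0, w1) +
 (alpha b2 - 1)/(alpha b1*alpha b2 - 1)*g (0, w2))) => // [g g0 mg|].
 have g0' y: TT y -> (0%R<=(g y)%:E)%E by rewrite lee_fin.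
 by rewrite /limit_measure ge0_integral_measure_add // !ge0_integral_mscale //= !integral_dirac_fin.
rewrite -{1}(max_split (f (0, w1))) -{1}(max_split (f (0, w2))); ring.
Qed.

Lemma weak_cvg_empirical (P : C2 R -> C2 R) x (s : nat -> nat) (w1 w2 : Cplx R) (b1 b2 : R) :
 (forall f, continuous f -> (exists M, forall y, `|f y| <= M) ->
 (fun j => (s j)%:R^-1 * \sum_(k<s j) f (iter k.+1 P x)) @ \oo -->
 (alpha b1*alpha b2-alpha b2)/(alpha b1*alpha b2 - 1)*f (0, w1) +
 (alpha b2 - 1)/(alpha b1*alpha b2 - 1)*f (0, w2)) ->
 weak_cvg (empirical P x \o s) (limit_measure w1 w2 b1 b2).
Proof.
move=> h f cf bf; rewrite integral_limit //.
apply: cvg_EFin; first by apply: nearW => j; rewrite /= integral_empirical.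
by apply: cvg_trans (h f cf bf); apply: near_eq_cvg; apply: nearW => j; rewrite /= integral_empirical.
Qed.

Definition test_fun (w1 : Cplx R) (x : C2 R) : R := Num.min (nm (x.2-w1)) 1.

Lemma test_fun_continuous w1 : continuous (test_fun w1).
Proof.
move=> x; apply/(@cvgrPdist_lt R R (C2 R) (nbhs x) (nbhs_filter x) (test_fun w1) (test_fun w1 x)) => e e0.
apply/nbhs_bd; exists e => // y hy; apply: le_lt_trans hy.
have h: `|nm (x.2-w1)-nm (y.2-w1)| <= bd y x.
 apply: le_trans (nm_dist _ _) _; have ->: x.2-w1-(y.2-w1) = - (y.2-x.2) by ring.
 by rewrite nmN bd2.
move: h; rewrite /test_fun !minEle !ler_norml => /andP[h1 h2].
by have [|] := leP (nm (x.2-w1)) 1; have [|] := leP (nm (y.2-w1)) 1; lra.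
Qed.

(** [test_fun] vanishes at (0, w1) but not at (0, w2), so it compares the weights at (0, w2). These
    are proportional to alpha b2 - 1 and alpha b1 (alpha b2 - 1), and equality would force one of
    the alphas to be 1. *)
Lemma historic_of_limits (P : C2 R -> C2 R) x (w1 w2 : Cplx R) (b1 b2 : R) : w1 != w2 ->
 2<=alpha b1 -> 2<=alpha b2 ->
 has_weak_limit_point (empirical P x) (limit_measure w1 w2 b1 b2) ->
 has_weak_limit_point (empirical P x) (limit_measure w2 w1 b2 b1) ->
 ~ exists mu, weak_cvg (empirical P x) mu.
Proof.
move=> w12 a1 a2 [s1 hs1 c1] [s2 hs2 c2] [mu hmu]; pose f := test_fun w1.
have cf := @test_fun_continuous w1.
have bf: exists M : R, forall y, `|f y| <= M.
 exists 1 => y; rewrite ger0_norm /f /test_fun; first by rewrite ge_min lexx orbT.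
 by rewrite le_min nm_ge0 ler01.
have incr (s: nat -> nat) : {homo s : i j/(i<j)%N} -> s j @[j --> \oo] --> \oo.
 move=> hs; have sn n: (n<=s n)%N by elim: n => // n IH; apply: leq_ltn_trans IH (hs _ _ (ltnSn n)).
 by move=> A [N _ hN]; exists N => // n /= Nn; apply: hN => /=; apply: leq_trans Nn (sn n).
have d := hmu f cf bf.
have e1: (\int[mu]_(y in TT) (f y)%:E = \int[limit_measure w1 w2 b1 b2]_(y in TT) (f y)%:E)%E.
 exact: (cvg_unique (@ereal_hausdorff R) (cvg_comp _ _ (incr s1 hs1) d) (c1 f cf bf)).
have e2: (\int[mu]_(y in TT) (f y)%:E = \int[limit_measure w2 w1 b2 b1]_(y in TT) (f y)%:E)%E.
 exact: (cvg_unique (@ereal_hausdorff R) (cvg_comp _ _ (incr s2 hs2) d) (c2 f cf bf)).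
have := etrans (esym e1) e2; rewrite !integral_limit // => -[].
have ->: f (0, w1) = 0 by rewrite /f /test_fun /= subrr nm0 minEle ler01.
have f2: 0<f (0, w2) by rewrite /f /test_fun /= lt_min ltr01 andbT nm_gt0 subr_eq0 eq_sym.
rewrite !mulr0 addr0 add0r; set y := f (0, w2) in f2 *; move: (alpha b1) (alpha b2) a1 a2 => u v hu hv.
rewrite [v*u]mulrC; have uv: 0<u*v - 1 by nra.
move/(mulIf (lt0r_neq0 f2)) => /(congr1 (fun t => t*(u*v - 1))); rewrite !divfK ?gt_eqF //.
by nra.
Qed.

End Integrals.

Transparent Cplx nm re im rc cx.

(** * Estimates for the normalizing charts *)

Section Charts.
Context {R : realType}.
Implicit Types (u v w x y z : Cplx R).

Lemma expR_B1 (x : R) : `|expR x - 1| <= expR `|x| * `|x|.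
Proof.
have h1 := @expR_ge1Dx R x; have h2 := @expR_ge1Dx R (- x); have e0 := expR_gt0 x.
have e1: expR x*expR (- x) = 1 by rewrite expRN mulfV // gt_eqF.
have [x0|x0] := leP 0 x.
 rewrite (ger0_norm x0) ger0_norm; last by lra.
 nra.
rewrite (ltr0_norm x0); have em0 := expR_gt0 (- x); have em1: 1<=expR (- x) by lra.
rewrite ler_norml; apply/andP; split; nra.
Qed.

Lemma cexp_cis u : cexp u=rc (expR (re u))*cis (im u).
Proof.
apply/eqP; rewrite eq_complex; apply/andP; split; apply/eqP.
all: by case: u => a b; rewrite /cexp /cis /rc /re /im /=; simpc; rewrite /= ?mul0r ?subr0 ?addr0 ?add0r.
Qed.

Lemma nm_cexp u : nm (cexp u)<=expR (nm u).
Proof.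
by rewrite cexp_cis nmM nm_cis mulr1 nm_rc gtr0_norm ?expR_gt0 // ler_expR re_le.
Qed.

Lemma cexpB1_le u : nm (cexp u - 1)<=3*expR (nm u)*nm u.
Proof.
rewrite cexp_cis; have ->: rc (expR (re u))*cis (im u) - 1=rc (expR (re u))*(cis (im u) - 1)+rc (expR (re u) - 1).
 by rewrite rcB rc1; ring.
apply: nmD_le; rewrite nmM !nm_rc gtr0_norm ?expR_gt0 //.
have n0 := nm_ge0 u; have E0 := expR_gt0 (nm u).
have h1: expR (re u)*nm (cis (im u) - 1)<=expR (nm u)*(2*nm u).
 apply: ler_pM; rewrite ?nm_ge0 ?(ltW (expR_gt0 _)) // ?ler_expR ?re_le //.
 by apply: le_trans (cisB1_le _) _; rewrite ler_wpM2l // normr_im.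
have h2: `|expR (re u) - 1| <= expR (nm u)*nm u.
 apply: le_trans (expR_B1 _) _; apply: ler_pM; rewrite ?(ltW (expR_gt0 _)) //; last exact: normr_re.
 by rewrite ler_expR normr_re.
by move: h1 h2; lra.
Qed.

Definition psi_chart (w0 mu la A B z w : Cplx R) := (chart w0 mu la A B (z, w)).2.

Lemma psi_chartE (w0 mu la A B z w : Cplx R) :
 psi_chart w0 mu la A B z w=cexp (A*z)*(mu*(w-w0)+la*z)+B*z^+2.
Proof. by []. Qed.

Lemma psi_chart_near (w0 mu la A B : Cplx R) (b : R) : exists2 M, 0<=M & forall z w, nm z<=1 -> nm w<=b ->
 nm (psi_chart w0 mu la A B z w-mu*(w-w0))<=M*nm z.
Proof.
pose E := expR (nm A); have E0: 0<E := expR_gt0 _.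
pose M := 3*E*nm A*(nm mu*(`|b|+nm w0))+E*nm la+nm B.
have [a0 m0 l0 B0]: [/\ 0<=nm A, 0<=nm mu, 0<=nm la & 0<=nm B] by rewrite !nm_ge0.
have w00 := nm_ge0 w0; have b0 := normr_ge0 b; have E0' := ltW E0.
have m1: 0<=nm mu*(`|b|+nm w0) by rewrite mulr_ge0 ?addr_ge0.
have M0: 0<=M.
 by apply: addr_ge0 => //; apply: addr_ge0; rewrite mulr_ge0 // mulr_ge0 // mulr_ge0.
exists M => // z w hz hw; have z0 := nm_ge0 z.
have hA: nm (A*z)<=nm A by rewrite nmM ler_piMr.
have hE: expR (nm (A*z))<=E by rewrite ler_expR.
have ->: psi_chart w0 mu la A B z w-mu*(w-w0)=(cexp (A*z) - 1)*(mu*(w-w0))+cexp (A*z) * la*z+B*z^+2.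
 by rewrite psi_chartE; ring.
have h1: nm ((cexp (A*z) - 1)*(mu*(w-w0)))<=3*E*nm A*(nm mu*(`|b|+nm w0))*nm z.
 rewrite nmM; have c1: nm (cexp (A*z) - 1)<=3*E*(nm A*nm z).
 apply: le_trans (cexpB1_le _) _; rewrite nmM in hE *; rewrite -!mulrA; apply: ler_wpM2l => //.
 by apply: ler_wpM2r => //; rewrite mulr_ge0.
 have c2: nm (mu*(w-w0))<=nm mu*(`|b|+nm w0).
 rewrite nmM ler_wpM2l //; apply: nmB_le; rewrite lerD2r.
 by apply: le_trans hw _; exact: ler_norm.
 have ->: 3*E*nm A*(nm mu*(`|b|+nm w0))*nm z = 3*E*(nm A*nm z)*(nm mu*(`|b|+nm w0)) by ring.
 by apply: ler_pM; rewrite ?nm_ge0.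
have h2: nm (cexp (A*z) * la*z)<=E*nm la*nm z.
 rewrite 2!nmM ler_wpM2r // ler_wpM2r //; exact: le_trans (nm_cexp _) hE.
have h3: nm (B*z^+2)<=nm B*nm z.
 by rewrite nmM nmX ler_wpM2l // expr2 ler_piMr.
apply: nmD_le; have := nmD ((cexp (A*z) - 1)*(mu*(w-w0))) (cexp (A*z) * la*z).
rewrite /M; move: h1 h2 h3; set X := 3*_*_*_; lra.
Qed.

Lemma psi_chart_inv (w0 mu la A B : Cplx R) : mu!=0 -> exists2 C, 0<=C & forall z w, nm z<=1 ->
 nm (w-w0)<=C*(nm z+nm (psi_chart w0 mu la A B z w)).
Proof.
move=> mu0; pose E := expR (nm A); have E0: 0<E := expR_gt0 _; have E0' := ltW E0.
have [a0 l0 B0]: [/\ 0<=nm A, 0<=nm la & 0<=nm B] by rewrite !nm_ge0.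
have m0: 0<nm mu by rewrite nm_gt0.
pose C := (E*(1+nm B)+nm la)/nm mu.
have C0: 0<=C by rewrite divr_ge0 ?(ltW m0) // addr_ge0 // mulr_ge0 // addr_ge0.
exists C => // z w hz; have z0 := nm_ge0 z; set ps := psi_chart _ _ _ _ _ _ _.
have p0 := nm_ge0 ps.
have ew: w-w0=(cexp (- (A*z))*(ps-B*z^+2)-la*z)/mu.
 by have := chartK w0 la A B mu0 (z, w); rewrite /chart_inv => /(congr1 snd) /= <-; rewrite addrK.
rewrite ew nmf ler_pdivrMr //.
have ->: C*(nm z+nm ps)*nm mu=(E*(1+nm B)+nm la)*(nm z+nm ps) by rewrite /C; field; rewrite gt_eqF.
have hA: nm (- (A*z))<=nm A by rewrite nmN nmM ler_piMr.
have h1: nm (cexp (- (A*z))*(ps-B*z^+2))<=E*(nm ps+nm B*nm z).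
 rewrite nmM; apply: ler_pM; rewrite ?nm_ge0 //.
 by apply: le_trans (nm_cexp _) _; rewrite ler_expR.
 apply: nmB_le; rewrite lerD2l nmM nmX ler_wpM2l // expr2 ler_piMr //.
apply: nmB_le; rewrite (nmM la).
have : 0<=E*nm z by rewrite mulr_ge0.
have : 0<=E*nm B*nm ps by rewrite !mulr_ge0.
have : 0<=nm la*nm ps by rewrite mulr_ge0.
by move: h1; lra.
Qed.

End Charts.

(** * Slices and lines for polynomials in two variables *)

Section TwoVariable.
Context {R : realType}.
Implicit Types (u v w x y z : Cplx R) (q : {poly {poly Cplx R}}).

Lemma slice0 q : exists q0 : {poly Cplx R}, forall w, q0.[w]=q.[w%:P].[0].
Proof.
elim/poly_ind: q => [|q c [q0 h]]; first by exists 0 => w; rewrite !horner0.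
by exists (q0 * 'X+c.[0]%:P) => w; rewrite !hornerMXaddC hornerD hornerM hornerC h.
Qed.

Lemma slice_diff q : exists g : {poly {poly Cplx R}}, forall z w,
 q.[w%:P].[z]-q.[w%:P].[0]=z*g.[w%:P].[z].
Proof.
elim/poly_ind: q => [|q c [g h]]; first by exists 0 => z w; rewrite !horner0 subrr mulr0.
have [c' ec] := poly_divX c.
exists (g * 'X+c'%:P) => z w; rewrite !hornerMXaddC !hornerD !hornerM !hornerC.
have e: c.[z]-c.[0]=z*c'.[z] by rewrite {1}ec !hornerE addrAC subrr add0r mulrC.
have ->: q.[w%:P].[z]*w+c.[z]-(q.[w%:P].[0]*w+c.[0]) =
 (q.[w%:P].[z]-q.[w%:P].[0])*w+(c.[z]-c.[0]) by ring.
by rewrite h e; ring.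
Qed.

Lemma slice_lip q (q0 : {poly Cplx R}) : (forall w, q0.[w]=q.[w%:P].[0]) ->
 forall B : R, exists2 M, 0<=M & forall z w w', nm z<=1 -> nm w<=B -> nm w'<=B ->
 nm (q.[w%:P].[z]-q0.[w'])<=M*(nm z+nm (w-w')).
Proof.
move=> h0 B; have [g hg] := slice_diff q.
have [M1 M10 hM1] := poly2_bounded g (Num.max B 1); have [M2 M20 hM2] := poly_lip q0 B.
exists (M1+M2) => [|z w w' hz hw hw']; first exact: addr_ge0.
have ->: q.[w%:P].[z]-q0.[w']=(q.[w%:P].[z]-q.[w%:P].[0])+(q0.[w]-q0.[w']) by rewrite !h0; ring.
apply: nmD_le; rewrite hg nmM.
have b1: nm g.[w%:P].[z]<=M1 by apply: hM1; rewrite le_max ?hw ?hz ?orbT.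
have b2 := hM2 w w' hw hw'; have z0 := nm_ge0 z; have w0 := nm_ge0 (w-w').
have b3: nm z*nm g.[w%:P].[z]<=nm z*M1 by rewrite ler_wpM2l.
have : 0<=M2*nm z by rewrite mulr_ge0.
have : 0<=M1*nm (w-w') by rewrite mulr_ge0.
by move: b2 b3; lra.
Qed.

Lemma skew_lines (p : {poly Cplx R}) q m (x b : C2 R) : exists X Y : {poly Cplx R}, forall t,
 iter m (skew_product p q) (line x b t)=(X.[t], Y.[t]).
Proof.
elim: m => [|m [X [Y h]]].
 by exists (x.1%:P + 'X*b.1%:P), (x.2%:P + 'X*b.2%:P) => t; rewrite /line !hornerE.
have [Z hZ]: exists Z : {poly Cplx R}, forall t, Z.[t]=q.[Y.[t]%:P].[X.[t]].
 elim/poly_ind: q {h} => [|q c [Z hZ]]; first by exists 0 => t; rewrite !horner0.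
 exists (Z*Y+(c \Po X)) => t.
 by rewrite hornerMXaddC !hornerD !hornerM hornerC horner_comp hZ.
by exists (p \Po X), Z => t; rewrite iterS h /skew_product /= horner_comp hZ.
Qed.

Lemma normC2 (x : C2 R) : `|x| = rc (bd x 0).
Proof.
rewrite prod_normE /bd !subr0 !normE /Num.max ltC_rcE; by case: ltP.
Qed.

(** Turns an O-relation, whose constants are elements of [Cplx R], into a real constant and a real
    radius. *)
Lemma bigO_C2 (f g h : C2 R -> Cplx R) (k : C2 R -> R) : (forall x : C2 R, nm (h x)=k x) ->
 f=g +O_ (0 : C2 R) h -> exists Q r : R, [/\ 0<=Q, 0<r & forall x : C2 R, bd x 0<r -> nm (f x-g x)<=Q*k x].
Proof.
move=> hk /eqaddOP/bigO_exP[Q Q0 hQ]; have [Q1 eQ] := ltC_rc Q0.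
have [r r0 hr]: exists2 r : R, 0<r & forall x : C2 R, bd x 0<r -> `|(f-g) x| <= Q * `|h x|.
 by apply/nbhs_bd.
exists (re Q), r; split=> //; first exact: ltW.
move=> x hx; have := hr x hx; rewrite !normE eQ hk -rcM.
by rewrite lecE /= => /andP[_].
Qed.

End TwoVariable.

(** * From the local forms to parabolic data and transits *)

Section Unpack.
Context {R : realType}.
Implicit Types (u v w x y z : Cplx R).
Variables (p : {poly Cplx R}) (q : {poly {poly Cplx R}}).
Local Notation P := (skew_product p q).

Lemma local_form_p (w0 a : Cplx R) (b : R) (b03 b30 : Cplx R) : local_form P w0 a b b03 b30 ->
 exists Q r : R, [/\ 0<=Q, 0<r & forall z, nm z<r -> nm (p.[z]-(z-z^+2+a*z^+3))<=Q*nm z^+4].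
Proof.
move=> [mu [la [A [B [mu0 [h _]]]]]].
have [Q [r [Q0 r0 hQ]]] := bigO_C2 (k := fun x : C2 R => nm x.1^+4) (fun x : C2 R => nmX _ _) h.
exists Q, r; split=> // z hz; have := hQ (z, 0); apply.
have h0: nm (0 : Cplx R)<r by rewrite nm0.
by rewrite bd_lt /=; apply/andP; split; [rewrite subr0|rewrite subrr].
Qed.

Lemma reflected_pdata (a : Cplx R) (Q r : R) : 0<r ->
 (forall z, nm z<r -> nm (p.[z]-(z-z^+2+a*z^+3))<=Q*nm z^+4) ->
 let pt := - (p \Po - 'X) in (forall x, pt.[x] = - p.[- x]) /\ inhabited (pdata pt 0 1 a).
Proof.
move=> r0 hp pt; have ept x: pt.[x] = - p.[- x] by rewrite /pt !hornerE horner_comp !hornerE.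
split=> //; have [h eh]: exists h, pt-('X + 'X^2+a *: 'X^3)=h * 'X^4.
 apply: (poly_dvdXn (M := Q) r0) => x hx.
 rewrite -(nmN x) in hx *; apply: le_trans (hp _ hx); rewrite le_eqVlt; apply/orP; left; apply/eqP.
 by rewrite -nmN; congr nm; rewrite hornerD ept !(hornerD, hornerN, hornerZ, hornerX, hornerXn); ring.
apply: (@pdata_exists _ pt 0 1 a h (oner_neq0 _)) => x.
by rewrite subr0 mul1r divr1 add0r /parab -eh addrC subrK.
Qed.

(** c = sqrt (b - 1/4) turns the definition of alpha into c ln al = pi. As alpha > 1, beta = 0 gives
    b03 = a, the only form of the expansion that [transit] stores. The slice z = 0 receives its
    exact normal form from the O-estimate through [poly_dvdXn]. *)
Lemma local_form_transit (q0 : {poly Cplx R}) (w0 a : Cplx R) (b : R) (b03 b30 : Cplx R) :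
 (forall w, q0.[w]=q.[w%:P].[0]) -> local_form P w0 a b b03 b30 -> 1/4<b ->
 (exists2 n : nat, (0<n)%N & alpha b=n%:R) -> beta a b03 b = 0 ->
 exists al : nat, [/\ (2<=al)%N, alpha b=al%:R &
 inhabited (transit (horner p) (fun z w => q.[w%:P].[z]) q0 w0 a al)].
Proof.
move=> h0 hl b4 [al al0 ea] hb.
have p00: p.[0] = 0.
 have [Qp [rp [Qp0 rp0 hp]]] := local_form_p hl; have := hp 0; rewrite nm0 => /(_ rp0); rewrite [0^+4]expr0n mulr0.
 by rewrite !expr0n /= mulr0 !subr0 addr0 subr0 => h; apply/eqP; rewrite -nm_eq0 eq_le h nm_ge0.
have s0: 0<4*b - 1 by lra.
have al1: 1<alpha b by rewrite /alpha expR_gt1 divr_gt0 ?mulr_gt0 ?pi_gt0 // sqrtr_gt0.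
have al2: (2<=al)%N by rewrite ea ltr1n in al1.
have eb: b03=a.
 move/eqP: hb; rewrite /beta mulf_eq0 subr_eq0 => /orP[/eqP //|].
 rewrite -[real_Cplx _]/(rc (alpha b)) -rc1 -rcB rc_eq0 subr_eq0 => /eqP e.
 by rewrite e ltxx in al1.
pose c := Num.sqrt (b - 1/4); have c0: 0<c by rewrite sqrtr_gt0; lra.
have ebq: bq c=b by rewrite /bq sqr_sqrtr; lra.
have hc: c * ln al%:R = pi.
 rewrite -ea /alpha expRK; have ->: Num.sqrt (4*b - 1) = 2*c.
 have ->: 4*b - 1 = 2^+2*(b - 1/4) by field.
 by rewrite sqrtrM ?exprn_ge0 // sqrtr_sqr ger0_norm.
 by field; rewrite gt_eqF.
move: hl => [mu [la [A [B [mu0 [_ h]]]]]].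
have nd (x: C2 R) : nm (`|x| ^+ 4)=bd x 0^+4 by rewrite normC2 nmX nm_rc ger0_norm ?bd_ge0.
have [Q [r [Q0 r0 hQ]]] := bigO_C2 (k := fun x : C2 R => bd x 0^+4) nd h.
pose psi := psi_chart w0 mu la A B.
have est z w: nm z<r -> nm (psi z w)<r -> let o := psi z w in
 nm (psi p.[z] q.[w%:P].[z]-(o+o^+2+rc (bq c)*z^+2+a * o^+3+b30*z^+3))<=Q*(nm z+nm o)^+4.
 move=> hz ho /=; set o := psi z w in ho *.
 have ho': bd (z, o) 0<r by rewrite bd_lt /= !subr0 hz.
 have eF: (chart w0 mu la A B \o P \o chart_inv w0 mu la A B) (z, o)=chart w0 mu la A B (P (z, w)).
 have eC: chart_inv w0 mu la A B (z, o)=(z, w) by exact: (chartK w0 la A B mu0 (z, w)).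
 by rewrite /comp eC.
 have := hQ (z, o) ho'; rewrite eF eb ebq => h1; apply: (le_trans h1); rewrite ler_wpM2l //.
 have z0 := nm_ge0 z; have o0 := nm_ge0 o.
 rewrite lerXn2r ?nnegrE ?bd_ge0 ?addr_ge0 //.
 by rewrite bd_le /= !subr0 lerDl lerDr z0 o0.
have psi00 w: psi 0 w=mu*(w-w0).
 rewrite /psi psi_chartE !mulr0 addr0 expr0n /= mulr0 addr0.
 by rewrite cexp_cis re0 expR0 rc1 mul1r -[im 0]/0 cis0 mul1r.
have [hh eh]: exists hh, (mu *: (q0 \Po (w0%:P+mu^-1 *: 'X))-(mu*w0)%:P)-('X + 'X^2+a *: 'X^3)=hh * 'X^4.
 apply: (poly_dvdXn (M := Q) r0) => x hx.
 have eo: psi 0 (w0+mu^-1*x)=x by rewrite psi00 addrC addKr mulVKf.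
 have := est 0 (w0+mu^-1*x); rewrite nm0 eo => /(_ r0 hx) /=; rewrite add0r.
 rewrite p00 -h0 psi00 => h1; apply: le_trans h1; apply: eq_ler; congr nm.
 rewrite !(hornerD, hornerN, hornerZ, hornerX, hornerXn, hornerC, horner_comp) !expr0n /=; ring.
have [d]: inhabited (pdata q0 w0 mu a).
 apply: (@pdata_exists _ q0 w0 mu a hh mu0) => x.
 rewrite /parab -eh !(hornerD, hornerN, hornerZ, hornerX, hornerXn, hornerC, horner_comp).
 rewrite [x/mu]mulrC; ring.
have [C C0 hC] := psi_chart_inv w0 la A B mu0.
pose r' := Num.min (r/2) 1; have r'0: 0<r' by rewrite lt_min divr_gt0 //= ltr01.
have r'r x: nm x<=r' -> nm x<r.
 by rewrite le_min => /andP[h1 _]; apply: (le_lt_trans h1); lra.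
exists al; split=> //; constructor; apply: (@Transit R (horner p) _ q0 w0 a al mu b30 c psi Q r' C d al2 c0 hc Q0 r'0 C0).
- exact: slice_lip.
- by move=> b'; exact: psi_chart_near.
- by move=> z w; rewrite le_min => /andP[_]; exact: hC.
- by move=> z w hz ho; apply: est; exact: r'r.
Qed.

End Unpack.

(** * Limit points of the empirical measures *)

Section Limits.
Context {R : realType}.
Variables (P : C2 R -> C2 R) (w1 w2 : Cplx R) (b1 b2 : R) (al1 al2 m N0 : nat) (x : C2 R).
Hypotheses (e1 : alpha b1=al1%:R) (e2 : alpha b2=al2%:R) (a1 : (1<al1)%N) (a2 : (1<al2)%N) (N00 : (0<N0)%N).
Hypothesis t2 : tends P (block2 al1 al2 m N0) (0, w2) x.
Hypothesis t1 : tends P (block1 al1 al2 m N0) (0, w1) x.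
Local Notation N := (rtime al1 al2 m N0).

Lemma tends_test S (l : C2 R) (f : C2 R -> R) : tends P S l x -> continuous f ->
 forall e, 0<e -> exists K, forall k, S K k -> `|f (iter k P x)-f l| <= e.
Proof.
move=> [W [_ Wx hW]] cf e e0.
have [r r0 hr]: exists2 r : R, 0<r & forall y, bd y l<r -> `|f l-f y| < e.
 apply/nbhs_bd.
 have := cf l; move/(@cvgrPdist_lt R R (C2 R) (nbhs l) (nbhs_filter l) f (f l)); exact.
have [K hK] := hW r r0; exists K => k Sk; rewrite distrC ltW //; apply: hr; exact: hK.
Qed.

(** Averages up to the return times give the first measure, averages up to the ends of the stays
    near (0, w2) the second. Subtracting N0 converts to the time of the orbit of x, and the index
    j+1 keeps the lengths positive. *)
Lemma limit_points :
 has_weak_limit_point (empirical P x) (limit_measure w1 w2 b1 b2) /\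
 has_weak_limit_point (empirical P x) (limit_measure w2 w1 b2 b1).
Proof.
have A1: 1<al1%:R*al2%:R :> R by rewrite -natrM ltr1n; move: a1 a2; clear; nia.
have An: (al1%:R*al2%:R - 1 : R)!=0 by rewrite gt_eqF // subr_gt0.
have a2n: (al2%:R : R)!=0 by rewrite pnatr_eq0; move: a2; clear; case: al2.
split.
- exists (fun j => N j.+1-N0)%N.
 move=> i j ij; have := rt_mono m a1 a2 N00 (ltn_trans ij (ltnSn j) : (i<j.+1)%N).
 have := rt_mono m a1 a2 N00 (ij : (i.+1<j.+1)%N); have := rt_ge m a1 a2 N00 i.+1; clear; lia.
 apply: weak_cvg_empirical => f cf [M hM].
 have := return_cvg a1 a2 N00 (fun k => hM (iter k P x)) (hM (0, w1)) (hM (0, w2)) (tends_test t2 cf) (tends_test t1 cf).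
 rewrite /vret e1 e2 => h; apply: cvg_trans h _.
 by have ->: ((al2%:R - 1)*f (0, w2)+(al1%:R*al2%:R-al2%:R)*f (0, w1))/(al1%:R*al2%:R - 1) =
 (al1%:R*al2%:R-al2%:R)/(al1%:R*al2%:R - 1)*f (0, w1)+(al2%:R - 1)/(al1%:R*al2%:R - 1)*f (0, w2) by field.
exists (fun j => al2*N j.+1-N0)%N.
 move=> i j ij; have h := rt_mono m a1 a2 N00 (ij : (i.+1<j.+1)%N).
 have h2: (al2*N i.+1<al2*N j.+1)%N by rewrite ltn_pmul2l // ltnW.
 have := rt_ge m a1 a2 N00 i.+1; have : (N i.+1<=al2*N i.+1)%N by rewrite leq_pmull // ltnW.
 by move: h2; clear; lia.
apply: weak_cvg_empirical => f cf [M hM].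
have := middle_cvg a1 a2 N00 (fun k => hM (iter k P x)) (hM (0, w1)) (hM (0, w2)) (tends_test t2 cf) (tends_test t1 cf).
rewrite /vmid /vret e1 e2 => h; apply: cvg_trans h _; rewrite [al2%:R*al1%:R]mulrC.
have ->: (((al2%:R - 1)*f (0, w2)+(al1%:R*al2%:R-al2%:R)*f (0, w1))/(al1%:R*al2%:R - 1) +
 (al2%:R - 1)*f (0, w2))/al2%:R =
 (al1%:R*al2%:R-al1%:R)/(al1%:R*al2%:R - 1)*f (0, w2)+(al1%:R - 1)/(al1%:R*al2%:R - 1)*f (0, w1).
 by field; rewrite An a2n.
by [].
Qed.

End Limits.

Theorem corollary1p17 (R : realType)
    (p : {poly Cplx R}) (q : {poly {poly Cplx R}})
    (w1 w2 a b03_1 b03_2 b30_1 b30_2 : Cplx R) (b1 b2 : R) :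
  let P := skew_product p q in
  (fun z : Cplx R => p.[z]) = (fun z => z - z ^+ 2)
    +O_ (0 : Cplx R) (fun z => z ^+ 3) ->
  w1 != w2 ->
  fixed_tangent_to_id P (0, w1) ->
  fixed_tangent_to_id P (0, w2) ->
  local_form P w1 a b1 b03_1 b30_1 ->
  local_form P w2 a b2 b03_2 b30_2 ->
  1 / 4 < b1 ->
  1 / 4 < b2 ->
  (exists2 n : nat, (0 < n)%N & alpha b1 = n%:R) ->
  (exists2 n : nat, (0 < n)%N & alpha b2 = n%:R) ->
  beta a b03_1 b1 = 0 ->
  beta a b03_2 b2 = 0 ->
  exists Omega : set (C2 R),
    [/\ fatou_component P Omega,
        historic_behaviour P Omega &
        forall x, Omega x ->
          has_weak_limit_point (empirical P x) (limit_measure w1 w2 b1 b2) /\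
          has_weak_limit_point (empirical P x) (limit_measure w2 w1 b2 b1)].
Proof.
move=> P _ w12 _ _ l1 l2 hb1 hb2 n1 n2 be1 be2.
have [q0 h0] := slice0 q.
have [al1 [a1 e1 [T1]]] := local_form_transit h0 l1 hb1 n1 be1.
have [al2 [a2 e2 [T2]]] := local_form_transit h0 l2 hb2 n2 be2.
have [Qp [rp [Qp0 rp0 hp]]] := local_form_p l1.
have [hpt [dz]] := reflected_pdata rp0 hp.
have [m [N0 [zs [c [r [B [N00 r0 hB h2 h1]]]]]]] := wandering_box dz T1 T2 hpt w12.
pose x0 : C2 R := (zs, c).
have r20: 0<r/2 by rewrite divr_gt0.
have bx (y: C2 R) : bd y x0<=r -> nm (y.1-zs)<=r /\ nm (y.2-c)<=r by rewrite bd_le => /andP.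
have lines := skew_lines p q.
(* [normal_of_bounded] needs bounded iterates on twice the radius, hence r/2. *)
have fx0: fatou_set P x0.
 exists [set y | bd y x0<r/2]; last by rewrite /= bdxx.
 split; first exact: open_box.
 apply: (@normal_of_bounded R P lines x0 (r/2) `|B|) => // k y hy.
 have [|y1 y2] := bx y; first by move: hy; lra.
 have [b1' b2'] := hB y y1 y2 k; rewrite bd_le !subr0.
 by rewrite !(le_trans _ (ler_norm B)).
have near S (l: C2 R) : (forall e : R, 0<e -> exists K, forall k, S K k -> forall y : C2 R, nm (y.1-zs)<=r -> nm (y.2-c)<=r ->
 nm (iter k P y).1<=e /\ nm ((iter k P y).2-l.2)<=e) -> l.1 = 0 -> tends P S l x0.
 move=> h l10; exists [set y | bd y x0<r]; split; [exact: open_box|by rewrite /= bdxx|].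
 move=> e e0; have [K hK] := h (e/2) ltac:(by rewrite divr_gt0); exists K => k Sk y /= /ltW/bx[y1 y2].
 have [k1 k2] := hK k Sk y y1 y2; apply: (@le_lt_trans _ _ (e/2)); last by lra.
 by rewrite bd_le l10 subr0 k1.
have anti2 K K' k: (K<=K')%N -> block2 al1 al2 m N0 K' k -> block2 al1 al2 m N0 K k.
 by move=> KK [j Kj [i1 i2]]; exists j; [exact: leq_trans Kj|split; move: KK i1 i2; clear; lia].
have anti1 K K' k: (K<=K')%N -> block1 al1 al2 m N0 K' k -> block1 al1 al2 m N0 K k.
 by move=> KK [j Kj [i1 i2]]; exists j; [exact: leq_trans Kj|split; move: KK i1 i2; clear; lia].
have s2 := tends_component lines anti2 fx0 (near _ (0, w2) h2 erefl).
have s1 := tends_component lines anti1 fx0 (near _ (0, w1) h1 erefl).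
have lim x: connected_component (fatou_set P) x0 x ->
 has_weak_limit_point (empirical P x) (limit_measure w1 w2 b1 b2) /\
 has_weak_limit_point (empirical P x) (limit_measure w2 w1 b2 b1).
 by move=> hx; exact: limit_points e1 e2 a1 a2 N00 (s2 x hx) (s1 x hx).
exists (connected_component (fatou_set P) x0); split=> //; first by exists x0.
move=> x hx; have [c1 c2] := lim x hx.
by apply: historic_of_limits w12 _ _ c1 c2; rewrite ?e1 ?e2 ler_nat.
Qed.
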